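(* Let $r\ge2$ and let $D$ be any parabolic connection on $\mathrm{Sym}^{r-1}(E_* )$. For each $1\le j\le r-1$, the second fundamental form $$\psi(D,j)\in H^0\bigl(X,\ \mathrm{Hom}(\mathcal F^j_*/\mathcal F^{j-1}_*,\ \mathcal F^{j+1}_*/\mathcal F^j_* )\otimes K_X(S)\bigr)=H^0(X,\mathcal O_X)$$ is a nonzero constant.
   Context: SETTING. $X$ is a compact connected Riemann surface with canonical bundle $K_X$; $S=\{x_1,\dots,x_n\}\subset X$ is a set of $n\ge 1$ distinct points, and $n\ge 3$ if $X$ has genus $0$. $S$ also denotes the reduced divisor $\sum x_i$, and $F(kS):=F\otimes\mathcal O_X(kS)$. For each $i$ fix a real number $c_i>1$. PARABOLIC BUNDLES. A parabolic bundle $E_*$ is a holomorphic vector bundle $E$ with, at each $x_i$, a filtration $E_{x_i}=E_{i,1}\supset\cdots\supset E_{i,l_i}\supset E_{i,l_i+1}=0$ and weights $0\le\alpha_{i,1}<\cdots<\alpha_{i,l_i}<1$. Equivalently it is the decreasing filtered sheaf $(E_t)_{t\in\mathbb R}$: for $0\le t<1$, $E_t\subset E$ consists of sections $s$ with $s(x_i)\in E_{i,j}$, $j$ the smallest index with $\alpha_{i,j}\ge t$ ($s(x_i)=0$ if there is none), and $E_{t+1}=E_t(-S)$. Tensor product: $(V_*\otimes W_* )_t=\sum_{a+b=t}V_a\otimes W_b$; $\mathrm{Sym}^m(E_* )_t$ is the image of $(E_*^{\otimes m})_t$ in the symmetric power (on $X\setminus S$, meromorphic along $S$); $\mathrm{Sym}^0(E_*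 )=\mathcal O_X$ with trivial parabolic structure. A logarithmic connection on $E$ singular over $S$ is $D:E\to E\otimes K_X(S)$ satisfying the Leibniz rule, with residue $\mathrm{Res}(D,x_i)\in\mathrm{End}(E_{x_i})$. A parabolic connection on $E_*$ is such a $D$ with $\mathrm{Res}(D,x_i)(E_{i,j})\subset E_{i,j}$ and with $\mathrm{Res}(D,x_i)$ acting on $E_{i,j}/E_{i,j+1}$ as multiplication by $\alpha_{i,j}$. THE PARABOLIC GUNNING BUNDLE. Fix a holomorphic line bundle $\mathcal L$ with an isomorphism $\mathcal L^{\otimes2}\cong K_X$. Let $0\to\mathcal L\to\widetilde E\xrightarrow{p_0}\mathcal L^*\to0$ be the extension with class $1\in H^1(X,\mathrm{Hom}(\mathcal L^*,\mathcal L))=H^1(X,K_X)=\mathbb C$, and $E:=p_0^{-1}(\mathcal L^*(-S))$, so $0\to\mathcal L\to E\xrightarrow{p}\mathcal L^*(-S)\to0$. For $x\in S$, the image of $\widetilde E(-S)_x\to E_x$ (induced by the inclusion $\widetilde E(-S)\subset E$) is a line mapped isomorphically by $p$ to $\mathcal L^*(-S)_x$; it is denoted $\mathcal L^*(-S)_x\subset E_x$. $E_*$ is $E$ with filtration $0\subset\mathcal L^*(-S)_{x_i}\subset E_{x_i}$, the weight of the line being $\frac{c_i+1}{2c_i+1}$ and that of $E_{x_i}$ being $\frac{c_i}{2c_i+1}$. $\mathcal L_*$ is $\mathcal L\subset E$ with the induced parabolic structure (weight $\frac{c_i}{2c_i+1}$ at $x_i$), and $E_*/\mathcal L_*$ is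 $\mathcal L^*(-S)$ with weight $\frac{c_i+1}{2c_i+1}$ at $x_i$, which is the parabolic dual of $\mathcal L_*$. THE FILTRATION AND SECOND FUNDAMENTAL FORMS. For $1\le j\le r$, $\mathcal F^j_*$ is the image of the natural injective homomorphism $\mathrm{Sym}^{j-1}(E_* )\otimes(\mathcal L_* )^{\otimes(r-j)}\to\mathrm{Sym}^{r-1}(E_* )$; it is a parabolic subbundle of rank $j$ with underlying bundle $\mathcal F^j_0$, and $\mathcal F^0_*=0$. One has $\mathcal F^j_*/\mathcal F^{j-1}_*=(\mathcal L_* )^{r-j}\otimes(E_*/\mathcal L_* )^{j-1}$, so $(\mathcal F^j_*/\mathcal F^{j-1}_* )^*\otimes(\mathcal F^{j+1}_*/\mathcal F^j_* )=(E_*/\mathcal L_* )^{\otimes2}$ is $TX(-S)=K_X(S)^*$ with parabolic weight $\frac1{2c_i+1}$ at $x_i$; hence the bundle underlying its tensor product with $K_X(S)$ is $\mathcal O_X$. Every parabolic connection $D$ on $\mathrm{Sym}^{r-1}(E_* )$ satisfies $D(\mathcal F^j_0)\subset\mathcal F^{j+1}_0\otimes K_X(S)$ for $1\le j\le r-1$; $\psi(D,j)$ is the resulting $\mathcal O_X$-linear homomorphism $\mathcal F^j_*/\mathcal F^{j-1}_*\to(\mathcal F^{j+1}_*/\mathcal F^j_* )\otimes K_X(S)$. *)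

(* Defs.v *)
From HB Require Import structures.
From mathcomp Require Import all_boot all_order all_algebra.
From mathcomp Require Import boolp classical_sets functions reals topology.
From mathcomp Require Import normedtype derive.
From mathcomp Require Import complex.
(* the notations of mpoly clash with those of MathComp-Analysis *)
From mathcomp Require Import -(notations) mpoly.

Set Implicit Arguments.
Unset Strict Implicit.
Unset Printing Implicit Defensive.

Import Order.TTheory GRing.Theory Num.Theory numFieldNormedType.Exports.

Local Open Scope classical_set_scope.
Local Open Scope complex_scope.
Local Open Scope ring_scope.

(* [R[i]^o] is the field of complex numbers seen as a normed module over itself, so that
   [derivable _ z 1] and [derive1] are complex differentiability and the
   complex derivative. *)
Notation Cplx R := ((R[i])^o).

(** * Riemann surfaces *)

Record riemannSurface (R : realType) := RiemannSurface {
  carrier :> topologicalType;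
  carrier_hausdorff : hausdorff_space carrier;
  cidx : Type;
  cdom : cidx -> set carrier;
  crd : cidx -> carrier -> Cplx R;
  crdV : cidx -> Cplx R -> carrier;
  cdom_open : forall k, open (cdom k);
  cdom_cover : forall y, exists k, cdom k y;
  crdK : forall k y, cdom k y -> crdV k (crd k y) = y;
  crd_open : forall k, open (crd k @` cdom k);
  crd_continuous : forall k y, cdom k y -> {for y, continuous (crd k)};
  crdV_continuous : forall k y, cdom k y -> {for crd k y, continuous (crdV k)};
  crd_holomorphic : forall k l y, cdom k y -> cdom l y ->
    derivable (crd l \o crdV k) (crd k y) 1
}.

Section Functions.
Context {R : realType} {X : riemannSurface R}.
Implicit Types (W N : set X) (k l : cidx X) (y : X).

(* [f] is holomorphic on the open set [W]; values outside [W] are irrelevant. *)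
Definition hol W (f : X -> Cplx R) :=
  forall k y, W y -> cdom k y -> derivable (f \o crdV k) (crd k y) 1.

(* [df / dz_k] *)
Definition dfun k (f : X -> Cplx R) y : Cplx R :=
  derive1 (f \o crdV k) (crd k y).

(* [dz_l / dz_k] *)
Definition dcrd k l y : Cplx R := dfun k (crd l) y.

Definition coord_nbhd k (x : X) N := [/\ open N, N x & N `<=` cdom k].

(* The local coordinate [z_k] centred at [x]. *)
Definition ccrd k (x : X) : X -> Cplx R := fun y => crd k y - crd k x.

(* A 1-form is given by its components: [w k] is the coefficient of [dz_k]. *)
Definition is_form W (w : cidx X -> X -> Cplx R) :=
  (forall k, hol (W `&` cdom k) (w k)) /\
  (forall k l y, W y -> cdom k y -> cdom l y -> w k y = w l y * dcrd k l y).

(* [dim H^0(X, K_X) = g] *)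
Definition has_genus (g : nat) :=
  exists w : 'I_g -> cidx X -> X -> Cplx R,
    (forall j, is_form setT (w j)) /\
    (forall v, is_form setT v ->
       exists! u : {ffun 'I_g -> Cplx R}, forall k y, cdom k y ->
         v k y = \sum_(j < g) u j * w j k y).

(* The 1-form [w], holomorphic near [x] except at [x], is meromorphic at [x]
   with residue [rho]: [w = h / (z - z(x))^(m+1) dz] with [h] holomorphic, and
   [rho] is the Taylor coefficient of [h] of order [m] at [x]. *)
Definition has_residue (x : X) (w : cidx X -> X -> Cplx R) (rho : Cplx R) :=
  exists k N (m : nat) (h : X -> Cplx R),
    [/\ coord_nbhd k x N, hol N h,
        forall y, N y -> y <> x -> w k y = h y / ccrd k x y ^+ m.+1
      & rho = derive1n m (h \o crdV k) (crd k x) / m`!%:R].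

End Functions.
Arguments has_genus {R} X g.

(** * The line bundle and the extension *)

(* Transition functions with respect to local frames [e_a] on [bdom a]:
   [e_b = ltr a b * e_a]. *)
Record lineBundle (R : realType) (X : riemannSurface R) := LineBundle {
  bidx : Type;
  bdom : bidx -> set X;
  ltr : bidx -> bidx -> X -> Cplx R;
  bdom_open : forall a, open (bdom a);
  bdom_cover : forall y, exists a, bdom a y;
  ltr_hol : forall a b, hol (bdom a `&` bdom b) (ltr a b);
  ltr_neq0 : forall a b y, bdom a y -> bdom b y -> ltr a b y != 0;
  ltr_cocycle : forall a b c y, bdom a y -> bdom b y -> bdom c y ->
    ltr a b y * ltr b c y = ltr a c y
}.

Section Extension.
Context {R : realType} {X : riemannSurface R} (L : lineBundle X).
Implicit Types (a b : bidx L) (k : cidx X) (y : X).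

(* An isomorphism from the square of [L] to the canonical bundle, given by
   [e_a^2 |-> kappa a k dz_k]. *)
Definition is_theta_iso (kappa : bidx L -> cidx X -> X -> Cplx R) :=
  [/\ forall a, is_form (bdom a) (kappa a),
      forall a k y, bdom a y -> cdom k y -> kappa a k y != 0
    & forall a b k y, bdom a y -> bdom b y -> cdom k y ->
        kappa b k y = ltr a b y ^+ 2 * kappa a k y].

(* [L^-1] is the dual of [L], with frames [e_a^-1] dual to [e_a].  Cech
   1-cocycles [xi a b * e_a^2] of [Hom(L^-1, L) = L^2].  The extension
   [0 -> L -> Et -> L^-1 -> 0] that it defines has local frames [(e_a, f_a)],
   where [f_a] lifts the frame [e_a^-1] of [L^-1], glued by
   [f_b = (ltr a b)^-1 * (f_a + xi a b * e_a)]: [xi] is the difference of the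
   local splittings [e_b^-1 |-> f_b] and [e_a^-1 |-> f_a].  Every extension is of
   this form after a refinement of the cover [bdom]. *)
Definition is_cocycle (xi : bidx L -> bidx L -> X -> Cplx R) :=
  (forall a b, hol (bdom a `&` bdom b) (xi a b)) /\
  (forall a b c y, bdom a y -> bdom b y -> bdom c y ->
     xi a c y = xi a b y + ltr a b y ^+ 2 * xi b c y).

(* The image of the class of [xi] under [H^1(X, L^2) = H^1(X, K_X) = C] is [v].
   The last map is the residue map: if the cocycle of 1-forms is the coboundary
   [mu b - mu a] of a Mittag-Leffler distribution of meromorphic 1-forms, its
   value is the sum of the residues of [mu]. *)
Definition has_ext_class (kappa : bidx L -> cidx X -> X -> Cplx R)
    (xi : bidx L -> bidx L -> X -> Cplx R) (v : Cplx R) :=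
  exists (m : nat) (p : 'I_m -> X) (rho : 'I_m -> Cplx R)
         (mu : bidx L -> cidx X -> X -> Cplx R),
    [/\ injective p,
        forall a, is_form (bdom a `\` range p) (mu a),
        forall a j, bdom a (p j) -> has_residue (p j) (mu a) (rho j),
        forall a b k y, bdom a y -> bdom b y -> cdom k y -> ~ range p y ->
          mu b k y - mu a k y = xi a b y * kappa a k y
      & \sum_(j < m) rho j = v].

End Extension.

(** * Filtered sheaves in the symmetric algebra of the extension *)

Section Parabolic.
Context {R : realType} {X : riemannSurface R} (L : lineBundle X).
Context (xi : bidx L -> bidx L -> X -> Cplx R).
Context (n : nat) (x : 'I_n -> X) (c : 'I_n -> R).
Implicit Types (a b : bidx L) (k l : cidx X) (y : X) (W N : set X) (t : R).

Local Notation S := (range x).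

(* The symmetric algebra of a fibre of [Et], in the frame [(e_a, f_a)]: the
   variables are [e_a] and [f_a]. *)
Local Notation Sym := (mpoly 2 (Cplx R)).
Definition var_e : Sym := mpolyX _ (mnm1 (0 : 'I_2)).
Definition var_f : Sym := mpolyX _ (mnm1 (1 : 'I_2)).

(* From the frame [(e_b, f_b)] to the frame [(e_a, f_a)]. *)
Definition glue a b y (p : Sym) : Sym :=
  comp_mpoly [tuple ltr a b y *: var_e;
                    (ltr a b y)^-1 *: (var_f + xi a b y *: var_e)] p.

(* [s a y] is the value at [y] in the frame of index [a]; it is only relevant
   for [y] in [bdom a] and in the open set where the section lives. *)
Definition sec := bidx L -> X -> Sym.

(* Sections over [W] of [Sym^m Et]. *)
Definition is_sec (m : nat) W (s : sec) :=
  [/\ forall a y, W y -> bdom a y -> s a y \is ishomog1 m mdeg,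
      forall a mon, hol (W `&` bdom a) (fun y => mcoeff mon (s a y))
    & forall a b y, W y -> bdom a y -> bdom b y -> s a y = glue a b y (s b y)].

(* The quotient map [p_0 : Et -> L^-1], in the frame [e_a^-1]. *)
Definition p0 (p : Sym) : Cplx R := mcoeff (mnm1 (1 : 'I_2)) p.

Definition seq_on W (s s' : sec) :=
  forall a y, W y -> bdom a y -> s a y = s' a y.
Definition addsec (s s' : sec) : sec := fun a y => s a y + s' a y.
Definition scalesec (f : X -> Cplx R) (s : sec) : sec := fun a y => f y *: s a y.
Definition zerosec : sec := fun _ _ => 0.

(* Subsheaves of the sheaf of sections over [X \ S]. *)
Definition shf := set X -> sec -> Prop.
Definition fshf := R -> shf.

(* [E], the inverse image of [L^-1(-S)] under [p_0]. *)
Definition Eshf : shf := fun W s =>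
  is_sec 1 W s /\ (forall a y, W y -> bdom a y -> S y -> p0 (s a y) = 0).

(* [e] and [e'] have the same image in the fibre at [q] of [G]. *)
Definition fib_eq (G : shf) (q : X) (e e' : sec) :=
  exists k N v, [/\ coord_nbhd k q N, G N v
    & seq_on (N `\` S) e (addsec e' (scalesec (ccrd k q) v))].

(* [e(q)] lies in the image of the fibre of [Et(-S)] in the fibre of [E]. *)
Definition in_line (q : X) (e : sec) :=
  exists N u, [/\ open N, N q, is_sec 1 N u,
    forall a y, N y -> bdom a y -> S y -> u a y = 0
    & fib_eq Eshf q e u].

(* The filtered sheaf with [G_t = {s in G | cond i t s at every x_i}] for
   [0 <= t < 1] and [G_(t+1) = G_t(-S)]. *)
Definition filtered (m : nat) (G : shf) (cond : 'I_n -> R -> sec -> Prop)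
  : fshf := fun t W s =>
  is_sec m (W `\` S) s /\
  forall i, W (x i) -> exists k N e,
    [/\ coord_nbhd k (x i) N, N `<=` W, G N e,
        cond i (t - (Num.floor t)%:~R) e
      & seq_on (N `\` S) s
          (scalesec (fun y => ccrd k (x i) y ^ Num.floor t) e)].

Definition weight_total i : R := c i / (2 * c i + 1).
Definition weight_line i : R := (c i + 1) / (2 * c i + 1).

Definition E_par : fshf := filtered 1 Eshf (fun i t e =>
  if t <= weight_total i then True
  else if t <= weight_line i then in_line (x i) e
  else fib_eq Eshf (x i) e zerosec).

Definition L_par : fshf := fun t W s =>
  E_par t W s /\
  (forall a y, (W `\` S) y -> bdom a y -> p0 (s a y) = 0).

(* [O_X] with the trivial parabolic structure (weight 0). *)
Definition O_par : fshf := filtered 0 (is_sec 0) (fun i t e =>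
  if t <= 0 then True else fib_eq (is_sec 0) (x i) e zerosec).

(* Image in the symmetric algebra of the parabolic tensor product. *)
Definition par_mul (P Q : fshf) : fshf := fun t W s =>
  forall y, W y -> exists N, [/\ open N, N y, N `<=` W &
    exists (m : nat) (u v : 'I_m -> R) (p q : 'I_m -> sec),
      (forall j, [/\ u j + v j = t, P (u j) N (p j) & Q (v j) N (q j)]) /\
      seq_on (N `\` S) s (fun a y' => \sum_(j < m) p j a y' * q j a y')].

Definition SymE_par (m : nat) : fshf := iter m (par_mul E_par) O_par.
Definition L_par_pow (m : nat) : fshf := iter m (par_mul L_par) O_par.

(* [F^j], for [1 <= j <= r]. *)
Definition F_par (r j : nat) : fshf :=
  par_mul (SymE_par j.-1) (L_par_pow (r - j)).

(** * Parabolic connections *)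

(* Sections over [W] of [G (x) K_X(S)]: [w k] is the coefficient of [dz_k]. *)
Definition is_logform (G : shf) W (w : cidx X -> sec) :=
  (forall k l, seq_on (W `&` cdom k `&` cdom l `\` S)
     (w k) (scalesec (dcrd k l) (w l))) /\
  (forall k y, W y -> cdom k y -> exists N,
     [/\ coord_nbhd k y N, N `<=` W, ~ S y -> G N (w k)
       & S y -> G N (scalesec (ccrd k y) (w k))]).

Definition is_log_connection (G : shf) (D : set X -> sec -> cidx X -> sec) :=
  [/\ forall W s, open W -> G W s -> is_logform G W (D W s),
      (* restriction, and independence of irrelevant values *)
      forall W W' s s', open W -> open W' -> W' `<=` W -> G W s -> G W' s' ->
        seq_on (W' `\` S) s s' ->
        forall k, seq_on (W' `&` cdom k `\` S) (D W s k) (D W' s' k),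
      forall W s s', open W -> G W s -> G W s' ->
        forall k, seq_on (W `&` cdom k `\` S)
          (D W (addsec s s') k) (addsec (D W s k) (D W s' k))
    & forall W f s, open W -> hol W f -> G W s ->
        forall k, seq_on (W `&` cdom k `\` S)
          (D W (scalesec f s) k)
          (addsec (scalesec f (D W s k)) (scalesec (dfun k f) s))].

(* The value of [v] in the fibre of [G_0] at [q] lies in the image of [G_t];
   for [0 <= t < 1] this image is the step of the filtration whose weight is
   the smallest one that is at least [t], and for [t = 1] it is zero. *)
Definition in_fib (G : fshf) (q : X) t (v : sec) :=
  exists N u, [/\ open N, N q, G t N u & fib_eq (G 0) q v u].

Definition is_weight (G : fshf) (q : X) (alpha : R) :=
  0 <= alpha < 1 /\
  exists N v, [/\ open N, N q, G 0 N v, in_fib G q alpha v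
    & forall t, alpha < t <= 1 -> ~ in_fib G q t v].

(* The residue of [D] at [q] maps the class of [v] to the class of
   [(z_k - z_k(q)) * D_k v]. *)
Definition residue (D : set X -> sec -> cidx X -> sec) W k (q : X) (v : sec)
  : sec := scalesec (ccrd k q) (D W v k).

Definition is_par_connection (G : fshf) (D : set X -> sec -> cidx X -> sec) :=
  is_log_connection (G 0) D /\
  forall i alpha, is_weight G (x i) alpha ->
  forall W k v, open W -> W (x i) -> cdom k (x i) ->
    G 0 W v -> in_fib G (x i) alpha v ->
    in_fib G (x i) alpha (residue D W k (x i) v) /\
    exists t, alpha < t <= 1 /\
      in_fib G (x i) t
        (addsec (residue D W k (x i) v) (scalesec (fun=> - alpha%:C) v)).

(** * Second fundamental forms *)

(* The projection [F^j -> F^j / F^(j-1) = L^(r-j) (x) (E/L)^(j-1)], in the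
   frame [e_a^(r-j) (x) (e_a^-1)^(j-1)]. *)
Definition gr (r j : nat) (s : sec) a y : Cplx R :=
  mcoeff (Multinom [tuple (r - j)%N; j.-1]) (s a y).

(* [h] is the function [psi(D, j)].  The trivialization of
   [Hom(F^j / F^(j-1), F^(j+1) / F^j) (x) K_X(S)] is its section
   [e_a |-> e_a^-1 (x) e_a^2] of [Hom(L, L^-1) (x) L^2], followed by
   [e_a^2 = kappa a k dz_k]. *)
Definition is_second_fundamental_form
    (kappa : bidx L -> cidx X -> X -> Cplx R) (r : nat)
    (D : set X -> sec -> cidx X -> sec) (j : nat) (h : X -> Cplx R) :=
  hol setT h /\
  forall W s, open W -> F_par r j 0 W s ->
    is_logform (F_par r j.+1 0) W (D W s) /\
    forall k a y, (W `\` S) y -> cdom k y -> bdom a y ->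
      gr r j.+1 (D W s k) a y = h y * kappa a k y * gr r j s a y.

End Parabolic.

(* Main.v *)
From HB Require Import structures.
Require Import Defs.
From mathcomp Require Import all_boot all_order all_algebra.
From mathcomp Require Import ring lra zify.
From mathcomp Require Import boolp classical_sets functions cardinality reals topology.
From mathcomp Require Import normedtype derive realfun sequences measure.
From mathcomp Require Import lebesgue_measure lebesgue_integral ftc trigo.
From mathcomp Require Import complex.
From mathcomp Require Import -(notations) mpoly.
Set Implicit Arguments.
Unset Strict Implicit.
Unset Printing Implicit Defensive.
Import Order.TTheory GRing.Theory Num.Theory numFieldNormedType.Exports.
Import Normc.
Local Open Scope classical_set_scope.
Local Open Scope complex_scope.
Local Open Scope ring_scope.

(* Let A be the matrix of D in the local frames e^(r-1-b) f^b of the symmetric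
   power.  If A vanishes further than K above the diagonal, then the entries
   A_(b+K,b) divided by kappa^K glue to sections of K_X^(1-K), and a change of
   frame adds to A_(b+K-1,b) the product of the cocycle xi with
   B_b = b A_(b+K-1,b-1) - (b+K) A_(b+K,b).  The residue condition bounds the
   orders of these entries at the points of S.  Let K >= 2 and compare with a
   reference form: a holomorphic one or, if there is none, one with a single
   double pole (the Dirichlet problem and Schwarz's alternating method).  By
   degree, B_b either vanishes, whence A_(b+K,b) = 0, or has no zero off S and
   the least possible orders on S; then kappa A_(b+K-1,b) / B_b is a holomorphic
   splitting of xi, although the sum of residues of xi is 1.  So A vanishes
   further than 1 above the diagonal and u_b = A_(b+1,b) / kappa is constant.
   The residue theorem for the global form
     2 A_(b,b) + (r-1-2b) dlog(ref / kappa) - 2 (b u_(b-1) - (b+1) u_b) mu,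
   where mu represents the class of xi, gives u_b = - (r-1-b) Delta / 2 with
   Delta = sum_i 2 c_i / (2 c_i + 1) + deg ref > 0, and psi(D, j) = u_(j-1). *)

(** * Complex analysis in the plane *)

(** Degrees, orders and the pairing with the extension class all go back to one fact, the residue
    theorem on a compact surface. It is proved without Stokes: the total residue of [w / (f - c)] is
    an entire function of [c] that tends to 0. This needs a nonconstant meromorphic [f], obtained as
    a quotient of two forms with double poles, and that is why potential theory comes in.

    The number 2/3 governs the estimates. Since [c_i > 1], the entries at distance K from the
    diagonal have order at least [K - ceil (K / (2 c_i + 1)) >= 2 (K - 1) / 3] at [x_i]. Multiplied
    by the power [K - 1] of a reference form, a section of [K_X^(1-K)] becomes a function, whose
    degree is at least [(K - 1) (deg ref + 2 n / 3)]. This is nonnegative for a holomorphic form,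
    and for one double pole once [n >= 3]: here the assumption in genus 0 enters. A strict form of
    the same bound makes Delta positive.

    The filtered sheaves are given by sums of local products, on which nothing can be computed
    directly; they are translated into orders of the coefficients at the points of [S]. *)

Notation re := (@complex.Re _).
Notation im := (@complex.Im _).

Section ComplexBasics.
Context {R : realType}.
Local Notation C := (Cplx R).
Implicit Types (z w : C) (f g : C -> C).

Lemma normc_normE z : `|z| = (normc z)%:C.
Proof. by []. Qed.

Lemma normc_ge0 z : 0 <= normc z :> R.
Proof. by case: z => a b; exact: sqrtr_ge0. Qed.

Lemma normc_gt0 z : (0 < normc z) = (z != 0).
Proof. by rewrite -ltcR -normc_normE normr_gt0. Qed.

Lemma normc_eq0 z : (normc z == 0) = (z == 0).
Proof. by apply/eqP/eqP => [/eq0_normc//|->]; rewrite normc0. Qed.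

Lemma normcB z w : normc (z - w) = normc (w - z).
Proof. by rewrite -normcN opprB. Qed.

Lemma normcX z n : normc (z ^+ n) = normc z ^+ n.
Proof. by elim: n => [|n IH]; rewrite ?expr0 ?normc1 // !exprS normcM IH. Qed.

Lemma normcR (a : R) : normc a%:C = `|a|.
Proof. by rewrite /normc /= expr0n addr0 sqrtr_sqr. Qed.

Lemma normc_ge_normRe z : `|re z| <= normc z.
Proof. by rewrite -lecR; exact: normc_ge_Re. Qed.

Lemma normc_ge_normIm z : `|im z| <= normc z.
Proof.
case: z => a b /=; rewrite -sqrtr_sqr ler_wsqrtr // lerDr; exact: sqr_ge0.
Qed.

Lemma normc_leD z w : normc z <= `|re z| + `|im z|.
Proof.
rewrite {1}(complexE z); apply: le_trans (le_normcD _ _) _.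
by rewrite normcM !normcR /= expr0n expr1n add0r sqrtr1 mul1r.
Qed.

Lemma le_normcB z w : normc (z - w) <= normc z + normc w.
Proof. by rewrite (le_trans (le_normcD _ _)) // normcN. Qed.

Lemma le_normc_dist z w : normc z - normc w <= normc (z - w).
Proof. by rewrite lerBlDr (le_trans _ (le_normcD _ _)) // subrK. Qed.

Lemma sqr_normcE z : normc z ^+ 2 = re z ^+ 2 + im z ^+ 2.
Proof. by case: z => a b /=; rewrite sqr_sqrtr // addr_ge0 ?sqr_ge0. Qed.

Lemma normcJ z : normc (conjc z) = normc z.
Proof. by case: z => a b /=; rewrite sqrrN. Qed.

Lemma mulcJ z : z * conjc z = (normc z ^+ 2)%:C :> R[i].
Proof.
rewrite sqr_normcE; case: z => a b; apply/eqP; rewrite eq_complex /=.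
by rewrite !expr2; apply/andP; split; apply/eqP; ring.
Qed.

Lemma ReD z w : re (z + w) = re z + re w. Proof. by case: z w => ? ? []. Qed.
Lemma ImD z w : im (z + w) = im z + im w. Proof. by case: z w => ? ? []. Qed.
Lemma ReN z : re (- z) = - re z. Proof. by case: z. Qed.
Lemma ImN z : im (- z) = - im z. Proof. by case: z. Qed.
Lemma ReB z w : re (z - w) = re z - re w. Proof. by rewrite ReD ReN. Qed.
Lemma ImB z w : im (z - w) = im z - im w. Proof. by rewrite ImD ImN. Qed.
Lemma ReM z w : re (z * w) = re z * re w - im z * im w.
Proof. by case: z w => ? ? []. Qed.
Lemma ImM z w : im (z * w) = re z * im w + im z * re w.
Proof. by case: z w => ? ? []. Qed.
Lemma ReMr (a : R) z : re (a%:C * z) = a * re z.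
Proof. by rewrite ReM /= mul0r subr0. Qed.
Lemma ImMr (a : R) z : im (a%:C * z) = a * im z.
Proof. by rewrite ImM /= mul0r addr0. Qed.

Lemma Re_Im_eq z w : re z = re w -> im z = im w -> z = w.
Proof. by case: z w => a b [c d] /= -> ->. Qed.

Lemma nbhs_cplx z (A : set C) :
  nbhs z A <-> exists2 d : R, 0 < d & forall w, normc (w - z) < d -> A w.
Proof.
split => [/nbhs_ballP [e /= e0 he]|[d d0 hd]].
  have eE : e = (re e)%:C by move/gtr0_real : e0 => /RRe_real.
  exists (re e); first by rewrite -ltcR -eE.
  move=> w hw; apply: he; rewrite -ball_normE /ball_ /= eE normc_normE ltcR.
  by rewrite normcB.
apply/nbhs_ballP; exists d%:C; first by rewrite /= ltcR.
move=> w; rewrite -ball_normE /ball_ /= normc_normE ltcR normcB; exact: hd.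
Qed.

Lemma open_cplx (A : set C) : open A <->
  forall z, A z -> exists2 d : R, 0 < d & forall w, normc (w - z) < d -> A w.
Proof.
rewrite openE; split => h z Az; first by apply/nbhs_cplx; exact: h.
by apply/nbhs_cplx; exact: h.
Qed.

Lemma open_disc z (r : R) : open [set w : C | normc (w - z) < r].
Proof.
apply/open_cplx => w /= hw; exists (r - normc (w - z)); first by rewrite subr_gt0.
move=> v hv; have -> : v - z = (v - w) + (w - z) by ring.
by rewrite (le_lt_trans (le_normcD _ _)) // -ltrBrDr.
Qed.

Lemma cvg_to_cplxP {T} (F : set_system T) {FF : Filter F} (f : T -> C) (l : C) :
  f @ F --> l <-> forall e : R, 0 < e -> \forall x \near F, normc (f x - l) < e.
Proof.
split=> [h e e0|h].
  have /= := h [set w | normc (w - l) < e]; apply.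
  by apply/nbhs_cplx; exists e.
by move=> A /nbhs_cplx[d d0 hd]; apply: filterS (h d d0) => x; exact: hd.
Qed.

Lemma near_cplxW (P : C -> Prop) z : (forall w, P w) -> \forall w \near z, P w.
Proof. by move=> h; apply/nbhs_cplx; exists 1. Qed.

Definition ccont {T : topologicalType} (f : T -> C) (x : T) :=
  forall e : R, 0 < e -> \forall y \near x, normc (f y - f x) < e.

Lemma ccontE {T : topologicalType} (f : T -> C) (x : T) :
  {for x, continuous f} <-> ccont f x.
Proof. exact: cvg_to_cplxP. Qed.

Lemma ccontP f z : ccont f z <->
  forall e : R, 0 < e -> exists2 d : R, 0 < d &
    forall w, normc (w - z) < d -> normc (f w - f z) < e.
Proof.
split=> h e e0; first by have /nbhs_cplx := h e e0.
by apply/nbhs_cplx; exact: h.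
Qed.

Lemma rcontP {T : topologicalType} (f : T -> R) (x : T) :
  {for x, continuous f} <->
  forall e : R, 0 < e -> \forall y \near x, `|f y - f x| < e.
Proof.
split=> [/cvgrPdist_lt h e e0|h]; last apply/cvgrPdist_lt => e e0.
  by apply: filterS (h e e0) => y; rewrite distrC.
by apply: filterS (h e e0) => y; rewrite distrC.
Qed.

Lemma rcont_cplx (f : C -> R) (z : C) : {for z, continuous f} <->
  forall e : R, 0 < e -> exists2 d : R, 0 < d &
    forall w, normc (w - z) < d -> `|f w - f z| < e.
Proof.
rewrite rcontP; split=> h e e0; first by have /nbhs_cplx := h e e0.
by apply/nbhs_cplx; exact: h.
Qed.

Section ContAlgebra.
Context {T : topologicalType}.
Implicit Types (p q : T -> C) (x : T).

Lemma ccont_near p q x : (\forall y \near x, p y = q y) -> ccont p x -> ccont q x.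
Proof.
move=> e h d d0; have e0 := nbhs_singleton e; rewrite -e0.
by apply: filterS2 e (h d d0) => y ->.
Qed.

Lemma ccont_cst (c : C) x : ccont (fun _ => c) x.
Proof. by move=> e e0; apply: nearW => y; rewrite subrr normc0. Qed.

Lemma ccontD p q x : ccont p x -> ccont q x -> ccont (fun y => p y + q y) x.
Proof.
move=> hp hq e e0; have e2 : 0 < e / 2 by rewrite divr_gt0.
apply: filterS2 (hp _ e2) (hq _ e2) => y h1 h2.
have -> : p y + q y - (p x + q x) = (p y - p x) + (q y - q x) by ring.
by rewrite (le_lt_trans (le_normcD _ _)) // [e]splitr ltrD.
Qed.

Lemma ccontN p x : ccont p x -> ccont (fun y => - p y) x.
Proof.
by move=> hp e e0; apply: filterS (hp e e0) => y; rewrite -opprD normcN.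
Qed.

Lemma ccontB p q x : ccont p x -> ccont q x -> ccont (fun y => p y - q y) x.
Proof. by move=> hp /ccontN; exact: ccontD. Qed.

Lemma ccontM p q x : ccont p x -> ccont q x -> ccont (fun y => p y * q y) x.
Proof.
move=> hp hq e e0.
pose M := normc (p x) + 1 + normc (q x) + 1.
have p0 := normc_ge0 (p x); have q0 := normc_ge0 (q x).
have M0 : 0 < M by rewrite /M; lra.
have e2 : 0 < Num.min 1 (e / (2 * M)).
  by rewrite lt_min ltr01 divr_gt0 // mulr_gt0.
apply: filterS2 (hp _ e2) (hq _ e2) => y; rewrite !lt_min => /andP[h1 h2] /andP[_ h4].
have -> : p y * q y - p x * q x = p y * (q y - q x) + (p y - p x) * q x by ring.
rewrite (le_lt_trans (le_normcD _ _)) // !normcM.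
have h5 : normc (p y) <= M.
  have -> : p y = p y - p x + p x by ring.
  rewrite (le_trans (le_normcD _ _)) // /M; lra.
have h6 : normc (q x) <= M by rewrite /M; lra.
have eE : e = M * (e / (2 * M)) + (e / (2 * M)) * M by field; rewrite gt_eqF.
rewrite eE ltr_leD //.
  apply: le_lt_trans (_ : M * normc (q y - q x) < _).
    by rewrite ler_wpM2r // normc_ge0.
  by rewrite ltr_pM2l.
by rewrite ler_pM // ?normc_ge0 // ltW.
Qed.

Lemma ccontV p x : p x != 0 -> ccont p x -> ccont (fun y => (p y)^-1) x.
Proof.
move=> p0 hp e e0; have n0 : 0 < normc (p x) by rewrite normc_gt0.
have d0 : 0 < Num.min (normc (p x) / 2) (e * normc (p x) ^+ 2 / 2).
  by rewrite lt_min !divr_gt0 // mulr_gt0 // exprn_gt0.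
apply: filterS (hp _ d0) => y; rewrite lt_min => /andP[h1 h2].
have h3 : normc (p x) / 2 < normc (p y).
  have := le_normc_dist (p x) (p y); rewrite normcB; lra.
have py0 : p y != 0 by rewrite -normc_gt0; apply: lt_trans h3; rewrite divr_gt0.
have -> : (p y)^-1 - (p x)^-1 = (p x - p y) / (p x * p y).
  by field; rewrite p0 py0.
rewrite normcM normcV normcM normcB ltr_pdivrMr ?mulr_gt0 // ?normc_gt0 //.
apply: lt_trans h2 _; rewrite expr2 mulrA -mulrA -mulrA ltr_pM2l // ltr_pM2l //.
Qed.

Lemma ccontX p x n : ccont p x -> ccont (fun y => p y ^+ n) x.
Proof.
move=> h; elim: n => [|n IH]; first exact: ccont_cst.
by apply: ccont_near (ccontM h IH); apply: nearW => y; rewrite exprS.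
Qed.

Lemma ccont_Complex (f g : T -> R) x :
  {for x, continuous f} -> {for x, continuous g} -> ccont (fun y => Complex (f y) (g y)) x.
Proof.
move=> /rcontP hf /rcontP hg e e0; have e2 : 0 < e / 2 by rewrite divr_gt0.
apply: filterS2 (hf _ e2) (hg _ e2) => y h1 h2.
by rewrite (le_lt_trans (normc_leD _ 0)) //= [ltRHS]splitr ltrD.
Qed.

Lemma ccont_Re p x : ccont p x -> {for x, continuous (fun y => re (p y))}.
Proof.
move=> h; apply/rcontP => e e0; apply: filterS (h e e0) => y.
by rewrite -ReB; apply: le_lt_trans; exact: normc_ge_normRe.
Qed.

Lemma ccont_Im p x : ccont p x -> {for x, continuous (fun y => im (p y))}.
Proof.
move=> h; apply/rcontP => e e0; apply: filterS (h e e0) => y.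
by rewrite -ImB; apply: le_lt_trans; exact: normc_ge_normIm.
Qed.

Lemma ccont_normc p x : ccont p x -> {for x, continuous (fun y => normc (p y))}.
Proof.
move=> h; apply/rcontP => e e0; apply: filterS (h e e0) => y hy.
rewrite ltr_norml; apply/andP; split.
  by rewrite ltrNl opprB (le_lt_trans (le_normc_dist _ _)) // normcB.
by rewrite (le_lt_trans (le_normc_dist _ _)).
Qed.

Lemma ccont_comp (f : C -> C) p x : ccont f (p x) -> ccont p x -> ccont (fun y => f (p y)) x.
Proof.
move=> /ccontP hf hp e e0; have [d d0 hd] := hf e e0.
by apply: filterS (hp d d0) => y; exact: hd.
Qed.

Lemma rcont_ccomp (f : C -> R) p x : {for p x, continuous f} -> ccont p x ->
  {for x, continuous (fun y => f (p y))}.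
Proof.
move=> /rcont_cplx hf hp; apply/rcontP => e e0; have [d d0 hd] := hf e e0.
by apply: filterS (hp d d0) => y; exact: hd.
Qed.

End ContAlgebra.

Lemma ccont_id z : ccont id z.
Proof. by apply/ccontP => e e0; exists e. Qed.

Lemma ccont_real (t : R) : ccont (fun t : R => t%:C) t.
Proof.
have : {for t, continuous (@id R)} by [].
move=> /rcontP h e e0; apply: filterS (h e e0) => s hs.
by rewrite -rmorphB normcR.
Qed.

Lemma rcomp_ccont {T : topologicalType} (f : T -> R) (p : R -> C) x :
  {for x, continuous f} -> ccont p (f x) -> ccont (fun y => p (f y)) x.
Proof.
move=> hf /ccontE hp; apply/ccontE; exact: (@continuous_comp _ _ _ f p).
Qed.

(* Caratheodory's form of complex differentiability. *)
Definition dC f z (l : C) :=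
  exists q : C -> C, [/\ ccont q z, q z = l & forall w, f w - f z = (w - z) * q w].

Lemma dC_derive f z l : dC f z l -> is_derive (z : C) (1 : C) f l.
Proof.
move=> [q [cq qz hq]].
have h : h^-1 *: (f (h *: (1 : C) + z) - f z) @[h --> (0:C)^'] --> l.
  apply/cvg_to_cplxP => e e0; have [d d0 hd] := (ccontP q z).1 cq e e0.
  rewrite /dnbhs /within; apply/nbhs_cplx; exists d => // h hh h0.
  have -> : h *: (1 : C) + z = h + z by rewrite /GRing.scale /= mulr1.
  rewrite hq addrK -[_ *: _]/(h^-1 * (h * q (h + z))) mulKf // -qz.
  by apply: hd; rewrite addrK -[h]subr0.
have dv : derivable (f : C -> C) (z : C) (1 : C) by apply/cvg_ex; exists l.
apply: DeriveDef => //; apply: cvg_lim; [exact: norm_hausdorff|exact: h].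
Qed.

Lemma derive_dC f z : derivable (f : C -> C) (z : C) (1 : C) ->
  dC f z (derive1 (f : C -> C) (z : C)).
Proof.
move=> dv; set l := derive1 _ _.
have hl : h^-1 *: (f (h *: (1 : C) + z) - f z) @[h --> (0:C)^'] --> l.
  rewrite /l derive1E; exact: dv.
exists (fun w => if w == z then l else (w - z)^-1 * (f w - f z)); split.
- apply/ccontP => e e0; rewrite eqxx.
  have := (@cvg_to_cplxP _ _ (dnbhs_filter _) _ _).1 hl e e0.
  rewrite /prop_near1 /dnbhs /within => /nbhs_cplx[d d0 hd]; exists d => // w hw.
  have [_|wz] := eqVneq w z; first by rewrite subrr normc0.
  have /= := hd (w - z); rewrite subr0 subr_eq0 => /(_ hw wz).
  by have -> : (w - z) *: (1 : C) + z = w by rewrite /GRing.scale /= mulr1 subrK.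
- by rewrite eqxx.
move=> w; have [->|wz] := eqVneq w z; first by rewrite !subrr mul0r.
by rewrite mulVKf // subr_eq0.
Qed.

Lemma dC_derivable f z l : dC f z l -> derivable (f : C -> C) (z : C) (1 : C).
Proof. by move/dC_derive => []. Qed.

Lemma dC_derive1 f z l : dC f z l -> derive1 (f : C -> C) (z : C) = l.
Proof. by move/dC_derive => [] _ <-; rewrite derive1E. Qed.

Lemma dC_cont f z l : dC f z l -> ccont f z.
Proof.
move=> [q [cq qz hq]].
apply: (@ccont_near _ (fun w => (w - z) * q w + f z)).
  by apply: near_cplxW => w; rewrite -hq subrK.
apply: ccontD; last exact: ccont_cst.
apply: ccontM => //; apply: ccontB; [exact: ccont_id|exact: ccont_cst].
Qed.

Lemma dC_cst c z : dC (fun _ => c) z 0.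
Proof. by exists (fun _ => 0); split; [exact: ccont_cst| |move=> w; rewrite subrr mulr0]. Qed.

Lemma dC_id z : dC id z 1.
Proof. by exists (fun _ => 1); split; [exact: ccont_cst| |move=> w; rewrite mulr1]. Qed.

Lemma dCD f g z l m : dC f z l -> dC g z m -> dC (fun w => f w + g w) z (l + m).
Proof.
move=> [q [cq qz hq]] [p [cp pz hp]]; exists (fun w => q w + p w); split.
- exact: ccontD.
- by rewrite qz pz.
- by move=> w; rewrite mulrDr -hq -hp opprD addrACA.
Qed.

Lemma dCM f g z l m : dC f z l -> dC g z m ->
  dC (fun w => f w * g w) z (l * g z + f z * m).
Proof.
move=> hf [p [cp pz hp]]; have cf := dC_cont hf; move: hf => [q [cq qz hq]].
exists (fun w => q w * g z + f w * p w); split.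
- by apply: ccontD; apply: ccontM => //; exact: ccont_cst.
- by rewrite qz pz.
- by move=> w; rewrite mulrDr mulrA -hq mulrCA -hp; ring.
Qed.

Lemma dCN f z l : dC f z l -> dC (fun w => - f w) z (- l).
Proof.
move=> [q [cq qz hq]]; exists (fun w => - q w); split; first exact: ccontN.
- by rewrite qz.
- by move=> w; rewrite mulrN -hq opprB opprK addrC.
Qed.

Lemma dCB f g z l m : dC f z l -> dC g z m -> dC (fun w => f w - g w) z (l - m).
Proof. by move=> hf /dCN; exact: dCD. Qed.

Lemma dCZ c f z l : dC f z l -> dC (fun w => c * f w) z (c * l).
Proof. by move=> h; have := dCM (dC_cst c z) h; rewrite mul0r add0r. Qed.

Lemma dC_near f g z l : (\forall w \near z, f w = g w) -> dC f z l -> dC g z l.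
Proof.
move=> e [q [cq qz hq]]; have e0 := nbhs_singleton e.
have /nbhs_cplx[d d0 hd] := e.
(* [dC] asks for a factorization at every [w]; outside the neighbourhood the factor has to be the
   difference quotient of [g] itself. *)
exists (fun w => if normc (w - z) < d then q w else (w - z)^-1 * (g w - g z)); split.
- apply: ccont_near cq; apply/nbhs_cplx; exists d => // w ->//.
- by rewrite subrr normc0 d0.
- move=> w; case: ifPn => [/hd <-|]; first by rewrite -e0 -hq.
  move=> wz; rewrite mulVKf //; apply: contra wz => /eqP ->; by rewrite normc0.
Qed.

Lemma dC_eq f z l l' : dC f z l -> l = l' -> dC f z l'.
Proof. by move=> h <-. Qed.

Lemma dCV f z l : f z != 0 -> dC f z l -> dC (fun w => (f w)^-1) z (- l / f z ^+ 2).
Proof.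
move=> f0 hf; have cf := dC_cont hf; move: hf => [q [cq qz hq]].
have [d d0 hd] : exists2 d : R, 0 < d & forall w, normc (w - z) < d -> f w != 0.
  have n0 : 0 < normc (f z) by rewrite normc_gt0.
  have [d d0 hd] := (ccontP f z).1 cf _ n0; exists d => // w /hd.
  by apply: contraTneq => ->; rewrite sub0r normcN ltxx.
exists (fun w => if normc (w - z) < d then - q w * (f w)^-1 * (f z)^-1
  else (w - z)^-1 * ((f w)^-1 - (f z)^-1)); split.
- apply: (@ccont_near _ (fun w => - q w * (f w)^-1 * (f z)^-1)).
    by apply/nbhs_cplx; exists d => // w ->.
  apply: ccontM; last exact: ccont_cst.
  by apply: ccontM; [exact: ccontN|exact: ccontV].
- by rewrite subrr normc0 d0 qz expr2 invfM mulrA.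
- move=> w; case: ifPn => [/hd fw|].
    rewrite mulrA mulrA mulrN -hq; field; by rewrite f0 fw.
  move=> wz; rewrite mulVKf //; apply: contra wz => /eqP ->; by rewrite normc0.
Qed.

Lemma dC_comp f g z l m : dC g z m -> dC f (g z) l -> dC (fun w => f (g w)) z (l * m).
Proof.
move=> hg [q [cq qz hq]]; have cg := dC_cont hg; move: hg => [p [cp pz hp]].
exists (fun w => q (g w) * p w); split.
- by apply: ccontM => //; exact: ccont_comp.
- by rewrite qz pz.
- by move=> w; rewrite hq hp mulrAC mulrA.
Qed.

Lemma dCX n f z l : dC f z l -> dC (fun w => f w ^+ n) z (n%:R * f z ^+ n.-1 * l).
Proof.
move=> h; elim: n => [|n IH]; first by rewrite !mul0r; exact: dC_cst.
apply: dC_near (dC_eq (dCM h IH) _); first by apply: near_cplxW => w; rewrite exprS.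
case: n {IH} => [|n]; first by rewrite !expr0 !mul0r mulr0 addr0 mulr1 !mul1r.
by rewrite /= -[n.+2%:R]natr1 exprS; ring.
Qed.

End ComplexBasics.

(** * Integrals of continuous complex functions over the unit interval and over segments *)

Section Integral.
Context {R : realType}.
Local Notation C := (Cplx R).
Implicit Types (z w a b c : C) (f F : C -> C) (g G : R -> C) (t s : R).

Definition dR g t (l : C) :=
  exists q : R -> C, [/\ ccont q t, q t = l & forall s, g s - g t = (s - t)%:C * q s].

Lemma dR_eq g t l l' : dR g t l -> l = l' -> dR g t l'.
Proof. by move=> h <-. Qed.

Lemma dR_ext g G t l : g =1 G -> dR g t l -> dR G t l.
Proof. by move=> /funext ->. Qed.

Lemma dR_cont g t l : dR g t l -> ccont g t.
Proof.
move=> [q [cq qt hq]]; apply: (@ccont_near _ _ (fun s => (s - t)%:C * q s + g t)).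
  by apply: filterE => s; rewrite -hq subrK.
apply: ccontD; last exact: ccont_cst.
apply: ccontM => //; apply: (@ccont_near _ _ (fun s => s%:C - t%:C)).
  by apply: filterE => s; rewrite rmorphB.
by apply: ccontB; [exact: ccont_real|exact: ccont_cst].
Qed.

Lemma dR_cst c t : dR (fun _ => c) t 0.
Proof. by exists (fun _ => 0); split; [exact: ccont_cst| |move=> s; rewrite subrr mulr0]. Qed.

Lemma dR_id t : dR (fun s => s%:C) t 1.
Proof.
by exists (fun _ => 1); split; [exact: ccont_cst| |move=> s; rewrite mulr1 rmorphB].
Qed.

Lemma dRD g G t l m : dR g t l -> dR G t m -> dR (fun s => g s + G s) t (l + m).
Proof.
move=> [q [cq qz hq]] [p [cp pz hp]]; exists (fun w : R => q w + p w); split.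
- exact: ccontD.
- by rewrite qz pz.
- by move=> w; rewrite mulrDr -hq -hp opprD addrACA.
Qed.

Lemma dRM g G t l m : dR g t l -> dR G t m ->
  dR (fun s => g s * G s) t (l * G t + g t * m).
Proof.
move=> hf [p [cp pz hp]]; have cf := dR_cont hf; move: hf => [q [cq qz hq]].
exists (fun w : R => q w * G t + g w * p w); split.
- by apply: ccontD; apply: ccontM => //; exact: ccont_cst.
- by rewrite qz pz.
- by move=> w; rewrite mulrDr mulrA -hq mulrCA -hp; ring.
Qed.

Lemma dRZ c g t l : dR g t l -> dR (fun s => c * g s) t (c * l).
Proof. by move=> h; have := dRM (dR_cst c t) h; rewrite mul0r add0r. Qed.

Lemma dRB g G t l m : dR g t l -> dR G t m -> dR (fun s => g s - G s) t (l - m).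
Proof.
move=> h /(dRZ (-1)) H; rewrite mulN1r in H.
by apply: dR_ext (dRD h H) => s; rewrite mulN1r.
Qed.

Lemma dR_comp F g t l m : dR g t m -> dC F (g t) l -> dR (fun s => F (g s)) t (l * m).
Proof.
move=> hg [q [cq qz hq]]; have cg := dR_cont hg; move: hg => [p [cp pz hp]].
exists (fun w : R => q (g w) * p w); split.
- by apply: ccontM => //; exact: ccont_comp.
- by rewrite qz pz.
- by move=> w; rewrite hq hp; ring.
Qed.

Lemma dR_aff g t l (u v : R) : dR g (u + v * t) l -> dR (fun s => g (u + v * s)) t (v%:C * l).
Proof.
move=> [q [cq qz hq]]; exists (fun s => v%:C * q (u + v * s)); split.
- apply: ccontM; first exact: ccont_cst.
  apply: (@rcomp_ccont _ _ (fun s => u + v * s) q) => //.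
  by apply: cvgD; [exact: cvg_cst|apply: cvgM; [exact: cvg_cst|exact: cvg_id]].
- by rewrite qz.
- move=> s; rewrite hq mulrCA mulrA; congr (_ * _).
  by rewrite -rmorphM; congr (_%:C); ring.
Qed.

Lemma dR_Re g t l : dR g t l -> is_derive t (1:R) (fun s => re (g s)) (re l).
Proof.
move=> [q [cq qz hq]]; apply/is_derive1_caratheodory.
exists (fun s => re (q s)); split; [|exact: ccont_Re|by rewrite qz].
by move=> s; rewrite -ReB hq ReMr mulrC.
Qed.

Lemma dR_Complex (u v : R -> R) t (a b : R) :
  is_derive t (1:R) u a -> is_derive t (1:R) v b ->
  dR (fun s => Complex (u s) (v s)) t (Complex a b).
Proof.
move=> /is_derive1_caratheodory[p [hp cp pt]] /is_derive1_caratheodory[q [hq cq qt]].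
exists (fun s => Complex (p s) (q s)); split; first exact: ccont_Complex.
  by rewrite pt qt.
move=> s; apply: Re_Im_eq; first by rewrite ReMr ReB /= hp mulrC.
by rewrite ImMr ImB /= hq mulrC.
Qed.

Definition in01 t := 0 <= t <= 1.
Definition cont01 g := forall t, in01 t -> ccont g t.

(** The mean value theorem fails for complex values, but it applies to the real function
    [re (conjc d * G)], whose increment is the square of [normc d]. *)
Lemma dR_bound G g (M : R) : (forall t, in01 t -> dR G t (g t)) ->
  (forall t, in01 t -> normc (g t) <= M) -> normc (G 1 - G 0) <= M.
Proof.
move=> dG bg; set d := G 1 - G 0.
have [->|d0] := eqVneq d 0.
  rewrite normc0; apply: le_trans (bg 0 _); first exact: normc_ge0.
  by rewrite /in01 lexx ler01.
have hd t : in01 t -> is_derive t (1:R) (fun s => re (conjc d * G s)) (re (conjc d * g t)).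
  by move=> /dG /(dRZ (conjc d)); exact: dR_Re.
have [|||c cin] := @MVT_segment R (fun s => re (conjc d * G s)) (fun t => re (conjc d * g t)) 0 1.
- exact: ler01.
- by move=> x /[!in_itv] /= /andP[h1 h2]; apply: hd; rewrite /in01 !ltW.
- apply: derivable_within_continuous => x /[!in_itv] /= /hd h.
  by apply: ex_derive; exact: h.
rewrite subr0 mulr1 -ReB -mulrBr -/d [conjc d * d]mulrC mulcJ /= => hh.
rewrite -(ler_pM2l (_ : 0 < normc d)) ?normc_gt0 // -expr2 hh.
apply: le_trans (ler_norm _) _; apply: le_trans (normc_ge_normRe _) _.
by rewrite normcM normcJ ler_wpM2l ?normc_ge0 // bg; rewrite in_itv in cin.
Qed.

Lemma dR_uniq G G' g : (forall t, in01 t -> dR G t (g t)) ->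
  (forall t, in01 t -> dR G' t (g t)) -> G 1 - G 0 = G' 1 - G' 0.
Proof.
move=> h h'; apply/eqP; rewrite -subr_eq0 -normc_eq0.
have := @dR_bound (fun s => G s - G' s) (fun t => g t - g t) 0.
have -> : G 1 - G' 1 - (G 0 - G' 0) = G 1 - G 0 - (G' 1 - G' 0) by ring.
move=> /(_ (fun t ht => dRB (h t ht) (h' t ht))) H.
by rewrite eq_le normc_ge0 andbT; apply: H => t _; rewrite subrr normc0.
Qed.

(** The integral is the increment of any antiderivative, well defined by [dR_uniq]. Linearity and
    reparametrization thus become rules of differentiation; measure theory serves only for the
    existence of antiderivatives. *)
Definition I01 g : C :=
  xget 0 [set v | exists G, (forall t, in01 t -> dR G t (g t)) /\ v = G 1 - G 0].

Lemma I01E G g : (forall t, in01 t -> dR G t (g t)) -> I01 g = G 1 - G 0.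
Proof.
move=> h; rewrite /I01; case: xgetP => [v _ [G' [h' ->]]|/(_ (G 1 - G 0))[]].
  exact: dR_uniq h' h.
by exists G.
Qed.

Lemma real_antiderivative (h : R -> R) : (forall t, in01 t -> {for t, continuous h}) ->
  exists H : R -> R, forall t, in01 t -> is_derive t (1:R) H (h t).
Proof.
move=> ch.
(* Clamping extends [h] continuously to the whole line, so that 0 and 1 become interior points of
   [[-1, 2]], where the fundamental theorem of calculus applies. *)
pose k (t : R) : R := Num.min 1 (Num.max 0 t).
have kin t : in01 (k t).
  by rewrite /in01 /k le_min ler01 le_max lexx /= ge_min lexx.
have ck : continuous k.
  move=> t; apply: continuous_min; first exact: cvg_cst.
  by apply: continuous_max; [exact: cvg_cst|exact: cvg_id].
have chk : continuous (h \o k) by move=> t; apply: continuous_comp; [exact: ck|exact: ch].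
pose H (x : R) := (\int[lebesgue_measure]_(t in [set` `[(-1)%R, x]]) (h \o k) t)%R.
exists H => t /andP[t0 t1].
have [||||d1 d2] := @continuous_FTC1_closed R (h \o k) (-1) t 2.
- lra.
- apply: continuous_compact_integrable; first exact: segment_compact.
  exact: continuous_subspaceT.
- lra.
- exact: chk.
apply: DeriveDef; first exact: d1.
rewrite -derive1E d2 /= /k max_r //; congr h; exact: min_r.
Qed.

Lemma antiderivative g : cont01 g -> exists G, forall t, in01 t -> dR G t (g t).
Proof.
move=> cg; have [|U hU] := @real_antiderivative (fun t => re (g t)).
  by move=> t /cg /ccont_Re.
have [|V hV] := @real_antiderivative (fun t => im (g t)); first by move=> t /cg /ccont_Im.
exists (fun s => Complex (U s) (V s)) => t ht.
by apply: (dR_eq (dR_Complex (hU _ ht) (hV _ ht))); case: (g t).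
Qed.

Lemma cont01D g G : cont01 g -> cont01 G -> cont01 (fun t => g t + G t).
Proof. by move=> h h' t ht; apply: ccontD; [exact: h|exact: h']. Qed.
Lemma cont01M g G : cont01 g -> cont01 G -> cont01 (fun t => g t * G t).
Proof. by move=> h h' t ht; apply: ccontM; [exact: h|exact: h']. Qed.
Lemma cont01B g G : cont01 g -> cont01 G -> cont01 (fun t => g t - G t).
Proof. by move=> h h' t ht; apply: ccontB; [exact: h|exact: h']. Qed.
Lemma cont01_cst c : cont01 (fun _ => c).
Proof. by move=> t _; exact: ccont_cst. Qed.

Lemma I01_ext g G : (forall t, in01 t -> g t = G t) -> I01 g = I01 G.
Proof.
move=> e; rewrite /I01; congr (xget 0 _); apply/funext => v; apply/propext; split=> -[H [h1 h2]].
  by exists H; split => // t ht; rewrite -e //; exact: h1.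
by exists H; split => // t ht; rewrite e //; exact: h1.
Qed.

Lemma I01D g G : cont01 g -> cont01 G -> I01 (fun t => g t + G t) = I01 g + I01 G.
Proof.
move=> /antiderivative[U hU] /antiderivative[V hV].
rewrite (I01E hU) (I01E hV) (@I01E (fun s => U s + V s)); first by ring.
by move=> t ht; exact: dRD (hU _ ht) (hV _ ht).
Qed.

Lemma I01Z c g : cont01 g -> I01 (fun t => c * g t) = c * I01 g.
Proof.
move=> /antiderivative[U hU]; rewrite (I01E hU) (@I01E (fun s => c * U s)) ?mulrBr //.
by move=> t ht; exact: dRZ (hU _ ht).
Qed.

Lemma I01B g G : cont01 g -> cont01 G -> I01 (fun t => g t - G t) = I01 g - I01 G.
Proof.
move=> /antiderivative[U hU] /antiderivative[V hV].
rewrite (I01E hU) (I01E hV) (@I01E (fun s => U s - V s)); first by ring.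
by move=> t ht; exact: dRB (hU _ ht) (hV _ ht).
Qed.

Lemma I01_cst c : I01 (fun _ => c) = c.
Proof.
rewrite (@I01E (fun s => c * s%:C)); first by rewrite mulr1 mulr0 subr0.
by move=> t _; have := dRZ c (dR_id t); rewrite mulr1.
Qed.

Lemma I01_norm g (M : R) : cont01 g -> (forall t, in01 t -> normc (g t) <= M) ->
  normc (I01 g) <= M.
Proof. by move=> /antiderivative[U hU] b; rewrite (I01E hU); exact: dR_bound hU b. Qed.

Lemma I01_re_ge0 g : cont01 g -> (forall t, in01 t -> 0 <= re (g t)) -> 0 <= re (I01 g).
Proof.
move=> /antiderivative[U hU] b; rewrite (I01E hU) ReB.
have hd t : in01 t -> is_derive t (1:R) (fun s => re (U s)) (re (g t)).
  by move=> /hU; exact: dR_Re.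
have [|||c cin] := @MVT_segment R (fun s => re (U s)) (fun t => re (g t)) 0 1.
- exact: ler01.
- by move=> x /[!in_itv] /= /andP[h1 h2]; apply: hd; rewrite /in01 !ltW.
- apply: derivable_within_continuous => x /[!in_itv] /= /hd h.
  by apply: ex_derive; exact: h.
by move=> ->; rewrite subr0 mulr1 b //; rewrite in_itv in cin.
Qed.

Definition seg a b t : C := a + t%:C * (b - a).
Definition SI f a b : C := (b - a) * I01 (fun t => f (seg a b t)).

Lemma seg0 a b : seg a b 0 = a. Proof. by rewrite /seg mul0r addr0. Qed.
Lemma seg1 a b : seg a b 1 = b. Proof. by rewrite /seg mul1r addrC subrK. Qed.

Lemma dR_seg a b t : dR (seg a b) t (b - a).
Proof.
apply: dR_eq (dRD (dR_cst a t) (dRM (dR_id t) (dR_cst (b - a) t))) _.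
by rewrite mulr0 addr0 mul1r add0r.
Qed.

Lemma cont01_seg f a b : (forall t, in01 t -> ccont f (seg a b t)) ->
  cont01 (fun t => f (seg a b t)).
Proof. by move=> h t ht; apply: ccont_comp; [exact: h|exact: dR_cont (dR_seg a b t)]. Qed.

Lemma SI_prim F f a b : (forall t, in01 t -> dC F (seg a b t) (f (seg a b t))) ->
  cont01 (fun t => f (seg a b t)) -> SI f a b = F b - F a.
Proof.
move=> h cf; rewrite /SI -I01Z // (@I01E (fun t => F (seg a b t))) ?seg0 ?seg1 // => t ht.
by rewrite mulrC; exact: dR_comp (dR_seg a b t) (h t ht).
Qed.

(** If [G] is an antiderivative on the whole segment, [G (s t) / s] is one on its initial piece, and
    similarly at the other end; hence the separate cases [s = 0] and [s = 1]. *)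
Lemma SI_split f a b s : 0 <= s <= 1 -> cont01 (fun t => f (seg a b t)) ->
  SI f a b = SI f a (seg a b s) + SI f (seg a b s) b.
Proof.
move=> /andP[s0 s1] /antiderivative[G hG]; rewrite /SI.
have e1 : (seg a b s - a) * I01 (fun t => f (seg a (seg a b s) t)) = (b - a) * (G s - G 0).
  have -> : seg a b s - a = (b - a) * s%:C by rewrite /seg addrAC subrr add0r mulrC.
  rewrite -mulrA; congr (_ * _); case: (eqVneq s 0) => [->|sn0].
    by rewrite mul0r subrr.
  have sp : s%:C != 0 :> C by rewrite eq_complex /= eqxx andbT.
  rewrite (@I01E (fun t => (s%:C)^-1 * G (0 + s * t))).
    by rewrite mulr0 mulr1 !add0r -mulrBr mulVKf.
  move=> t /andP[t0 t1]; have ht : in01 (0 + s * t).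
    by rewrite /in01 add0r mulr_ge0 //= mulr_ile1.
  apply: dR_eq (dRZ _ (dR_aff (hG _ ht))) _.
  rewrite mulKf //; congr f; rewrite /seg add0r rmorphM; ring.
have e2 : (b - seg a b s) * I01 (fun t => f (seg (seg a b s) b t)) = (b - a) * (G 1 - G s).
  have -> : b - seg a b s = (b - a) * (1 - s)%:C by rewrite /seg rmorphB rmorph1; ring.
  rewrite -mulrA; congr (_ * _); case: (eqVneq s 1) => [->|sn0].
    by rewrite subrr mul0r subrr.
  have sp : (1 - s)%:C != 0 :> C.
    by rewrite eq_complex /= eqxx andbT subr_eq0 eq_sym.
  rewrite (@I01E (fun t => ((1 - s)%:C)^-1 * G (s + (1 - s) * t))).
    by rewrite mulr0 mulr1 addr0 [s + _]addrC subrK -mulrBr mulVKf.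
  move=> t /andP[t0 t1]; have ht : in01 (s + (1 - s) * t).
    rewrite /in01; have : 0 <= (1 - s) * t by rewrite mulr_ge0 // subr_ge0.
    have : (1 - s) * t <= (1 - s) by rewrite ler_piMr // subr_ge0.
    lra.
  apply: dR_eq (dRZ _ (dR_aff (hG _ ht))) _.
  rewrite mulKf //; congr f; rewrite /seg rmorphD rmorphM rmorphB rmorph1; ring.
rewrite e1 e2 (I01E hG); ring.
Qed.

Lemma SI_rev f a b : cont01 (fun t => f (seg a b t)) -> SI f b a = - SI f a b.
Proof.
move=> /antiderivative[G hG]; rewrite /SI (I01E hG).
rewrite (@I01E (fun t => - G (1 + (-1) * t))).
  by rewrite mulr0 mulr1 addr0 subrr; ring.
move=> t /andP[t0 t1]; have ht : in01 (1 + -1 * t) by rewrite /in01; lra.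
apply: dR_eq (dR_ext _ (dRZ (-1) (dR_aff (hG _ ht)))) _.
  by move=> s; exact: mulN1r.
rewrite rmorphN1 mulrA mulrNN !mul1r; congr f.
by rewrite /seg rmorphD rmorphM rmorphN1 rmorph1; ring.
Qed.

Lemma SI_norm f a b (M : R) : cont01 (fun t => f (seg a b t)) ->
  (forall t, in01 t -> normc (f (seg a b t)) <= M) -> normc (SI f a b) <= normc (b - a) * M.
Proof. by move=> cf bf; rewrite normcM ler_wpM2l ?normc_ge0 //; exact: I01_norm. Qed.

End Integral.

(** * Goursat's theorem for triangles in a closed convex set *)

Section Goursat.
Context {R : realType}.
Local Notation C := (Cplx R).
Implicit Types (z w a b c : C) (f F : C -> C) (U : set C).

(** The sequences [u n - K q^n] and [u n + K q^n] are monotone in opposite directions, so the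
    supremum of the former is the limit, with an explicit rate. *)
Lemma geometric_limit (u : nat -> R) (L q : R) : 0 <= q < 1 ->
  (forall n, `|u n.+1 - u n| <= L * q ^+ n) ->
  exists l, forall n, `|l - u n| <= L / (1 - q) * q ^+ n.
Proof.
move=> /andP[q0 q1] h; set K := L / (1 - q).
have q10 : 1 - q != 0 by rewrite subr_eq0 gt_eqF.
have KE : K * (1 - q) = L by rewrite /K divfK.
have L0 : 0 <= L.
  by have := le_trans (normr_ge0 _) (h 0%N); rewrite expr0 mulr1.
have K0 : 0 <= K by rewrite divr_ge0 // subr_ge0 ltW.
have qn n : 0 <= q ^+ n by rewrite exprn_ge0.
pose v n := u n - K * q ^+ n; pose w n := u n + K * q ^+ n.
have vi : {homo v : m n / (m <= n)%N >-> m <= n}.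
  apply: homo_leq => //; first by move=> ? ? ?; exact: le_trans.
  move=> n; rewrite /v exprS; have := h n; rewrite -KE ler_norml => /andP[h1 h2].
  have -> : u n.+1 - K * (q * q ^+ n) = u n.+1 - u n + K * (1 - q) * q ^+ n + (u n - K * q ^+ n) by ring.
  by rewrite lerDr -(lerBlDr) sub0r.
have wi : {homo w : m n / (m <= n)%N >-> n <= m}.
  apply: homo_leq => //; first by move=> ? ? ? h1 h2; exact: le_trans h2 h1.
  move=> n; rewrite /w exprS; have := h n; rewrite -KE ler_norml => /andP[h1 h2].
  have -> : u n.+1 + K * (q * q ^+ n) = u n.+1 - u n - K * (1 - q) * q ^+ n + (u n + K * q ^+ n) by ring.
  by rewrite gerDr subr_le0.
have vw n : v n <= w n by rewrite /v /w lerD2l ge0_cp // mulr_ge0.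
have vwmn m n : v m <= w n.
  apply: (le_trans (vi m (maxn m n) (leq_maxl _ _))); apply: le_trans (vw _) _.
  exact: wi (leq_maxr _ _).
have S0 : has_sup [set v n | n in setT].
  split; first by exists (v 0%N); exists 0%N.
  by exists (w 0%N) => _ [n _ <-].
exists (sup [set v n | n in setT]) => n; rewrite ler_norml; apply/andP; split.
  rewrite lerBrDr addrC; apply: ub_le_sup; first by case: S0.
  by exists n.
rewrite lerBlDr addrC; apply: ge_sup; first by case: S0.
by move=> _ [m _ <-]; exact: vwmn.
Qed.

Definition convexC U := forall a b t, U a -> U b -> in01 t -> U (seg a b t).
Definition limclosed U :=
  forall z, (forall e : R, 0 < e -> exists2 w, U w & normc (w - z) < e) -> U z.

Definition TI f a b c := SI f a b + SI f b c + SI f c a.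
Definition mid a b : C := seg a b (2^-1).

Lemma in01_half : in01 (2^-1 : R).
Proof. by rewrite /in01; lra. Qed.

Lemma midE a b : mid a b = (a + b) / 2.
Proof.
rewrite /mid /seg; have -> : (2^-1 : R)%:C = 2^-1 :> C by rewrite fmorphV rmorph_nat.
by field.
Qed.

Lemma normc2V : normc (2^-1 : C) = 2^-1 :> R.
Proof. by rewrite normcV -[2]/(2%:R) -(rmorph_nat (real_complex R)) normcR ger0_norm. Qed.

Lemma SIB f F a b : cont01 (fun t => f (seg a b t)) -> cont01 (fun t => F (seg a b t)) ->
  SI (fun z => f z - F z) a b = SI f a b - SI F a b.
Proof. by move=> h h'; rewrite /SI I01B // mulrBr. Qed.

Lemma TI_affine (u v z a b c : C) : TI (fun w => u + v * (w - z)) a b c = 0.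
Proof.
pose F (w : C) := u * w + v * ((w - z) ^+ 2 / 2).
have dF (w : C) : dC F w (u + v * (w - z)).
  apply: dC_eq (dCD (dCZ u (dC_id w)) (dCZ v (dCM (dCX 2 (dCB (dC_id w) (dC_cst z w))) (dC_cst 2^-1 w)))) _.
  by rewrite /=; field.
have cF p q : cont01 (fun t => u + v * (seg p q t - z)).
  move=> t _; apply: ccontD; first exact: ccont_cst.
  apply: ccontM; first exact: ccont_cst.
  by apply: ccontB; [exact: dR_cont (dR_seg _ _ _)|exact: ccont_cst].
by rewrite /TI !(@SI_prim R F) //; ring.
Qed.

Section Bisection.
Variables (f : C -> C) (U : set C).
Hypotheses (Uc : convexC U) (Ul : limclosed U)
  (df : forall z, U z -> exists l, dC f z l).

Lemma goursat_cont a b : U a -> U b -> cont01 (fun t => f (seg a b t)).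
Proof.
move=> Ua Ub; apply: cont01_seg => t ht.
by have [l] := df (Uc Ua Ub ht); exact: dC_cont.
Qed.

Let inU (T : C * C * C) := [/\ U T.1.1, U T.1.2 & U T.2].
Let tri (T : C * C * C) := TI f T.1.1 T.1.2 T.2.
Let len (T : C * C * C) := normc (T.1.2 - T.1.1) + normc (T.2 - T.1.2) + normc (T.1.1 - T.2).

Lemma goursat_split (a b c : C) : U a -> U b -> U c ->
  TI f a b c = TI f a (mid a b) (mid c a) + TI f (mid a b) b (mid b c)
    + TI f (mid c a) (mid b c) c + TI f (mid a b) (mid b c) (mid c a).
Proof.
move=> Ua Ub Uc'; have Um p q : U p -> U q -> U (mid p q).
  by move=> Up Uq; apply: Uc => //; exact: in01_half.
have h01 : 0 <= (2^-1 : R) <= 1 by exact: in01_half.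
rewrite {1}/TI (SI_split h01 (goursat_cont Ua Ub)) (SI_split h01 (goursat_cont Ub Uc')).
rewrite (SI_split h01 (goursat_cont Uc' Ua)) -!/(mid _ _) /TI.
have rev p q : U p -> U q -> SI f q p = - SI f p q.
  by move=> Up Uq; rewrite SI_rev //; exact: goursat_cont.
rewrite (rev (mid a b) (mid c a)) ?(rev (mid b c) (mid a b)) ?(rev (mid c a) (mid b c)); try exact: Um.
rewrite (rev (mid a b) (mid b c)) ?(rev (mid b c) (mid c a)); try exact: Um.
by rewrite (rev (mid c a) (mid a b)); try exact: Um; ring.
Qed.

Lemma len_half a b p q : p - q = (a - b) / 2 -> normc (p - q) = normc (a - b) / 2.
Proof. by move=> ->; rewrite normcM normc2V. Qed.

(** Of the four triangles cut out by the midpoints, one carries at least a quarter of the integral.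
    The hypothesis [inU T] sits under the existential so that [choice] yields a total successor
    function. *)
Lemma goursat_step (T : C * C * C) : exists T' : C * C * C, inU T ->
  [/\ inU T', len T' = len T / 2, normc (T'.1.1 - T.1.1) <= len T / 2
    & normc (tri T) <= 4 * normc (tri T')].
Proof.
have [iT|] := pselect (inU T); last by exists T.
case: T iT => [[a b] c] [/= Ua Ub Uc'].
have Um p q : U p -> U q -> U (mid p q).
  by move=> Up Uq; apply: Uc => //; exact: in01_half.
have h := goursat_split Ua Ub Uc'.
have n4 : normc (TI f a b c) <= normc (TI f a (mid a b) (mid c a)) +
    normc (TI f (mid a b) b (mid b c)) + normc (TI f (mid c a) (mid b c) c)
    + normc (TI f (mid a b) (mid b c) (mid c a)).
  rewrite h; apply: le_trans (le_normcD _ _) _; rewrite lerD2r.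
  by apply: le_trans (le_normcD _ _) _; rewrite lerD2r; exact: le_normcD.
set A1 := TI f a (mid a b) (mid c a) in n4; set A2 := TI f (mid a b) b (mid b c) in n4.
set A3 := TI f (mid c a) (mid b c) c in n4; set A4 := TI f (mid a b) (mid b c) (mid c a) in n4.
have g0 := @normc_ge0 R.
have nab := g0 (b - a); have nbc := g0 (c - b); have nca := g0 (a - c).
have E1 : normc (mid a b - a) = normc (b - a) / 2 by apply: len_half; rewrite midE; field.
have E2 : normc (mid c a - a) = normc (a - c) / 2.
  by rewrite normcB; apply: len_half; rewrite midE; field.
have [h1|h1] := leP (normc (TI f a b c)) (4 * normc A1).
  exists (a, mid a b, mid c a); split => //; rewrite /inU /len /=.
  - by split => //; exact: Um.
  - have e1 : normc (mid c a - mid a b) = normc (c - b) / 2.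
      by apply: len_half; rewrite !midE; field.
    have e2 : normc (a - mid c a) = normc (a - c) / 2.
      by apply: len_half; rewrite !midE; field.
    rewrite E1 e1 e2.
    by lra.
  - by rewrite subrr normc0; lra.
have [h2|h2] := leP (normc (TI f a b c)) (4 * normc A2).
  exists (mid a b, b, mid b c); split => //; rewrite /inU /len /=.
  - by split => //; exact: Um.
  - have e1 : normc (b - mid a b) = normc (b - a) / 2.
      by apply: len_half; rewrite !midE; field.
    have e2 : normc (mid b c - b) = normc (c - b) / 2.
      by apply: len_half; rewrite !midE; field.
    have e3 : normc (mid a b - mid b c) = normc (a - c) / 2.
      by apply: len_half; rewrite !midE; field.
    rewrite e1 e2 e3.
    by lra.
  - by rewrite E1; lra.
have [h3|h3] := leP (normc (TI f a b c)) (4 * normc A3).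
  exists (mid c a, mid b c, c); split => //; rewrite /inU /len /=.
  - by split => //; exact: Um.
  - have e1 : normc (mid b c - mid c a) = normc (b - a) / 2.
      by apply: len_half; rewrite !midE; field.
    have e2 : normc (c - mid b c) = normc (c - b) / 2.
      by apply: len_half; rewrite !midE; field.
    have e3 : normc (mid c a - c) = normc (a - c) / 2.
      by apply: len_half; rewrite !midE; field.
    rewrite e1 e2 e3.
    by lra.
  - by rewrite E2; lra.
exists (mid a b, mid b c, mid c a); split => //; rewrite /inU /len /tri /=.
- by split => //; exact: Um.
- have e1 : normc (mid b c - mid a b) = normc (a - c) / 2.
    by rewrite normcB; apply: len_half; rewrite !midE; field.
  have e2 : normc (mid c a - mid b c) = normc (b - a) / 2.
    by rewrite normcB; apply: len_half; rewrite !midE; field.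
  have e3 : normc (mid a b - mid c a) = normc (c - b) / 2.
    by rewrite normcB; apply: len_half; rewrite !midE; field.
  by rewrite e1 e2 e3; lra.
- by rewrite E1; lra.
- by rewrite -/A4; lra.
Qed.

Lemma goursat a b c : U a -> U b -> U c -> TI f a b c = 0.
Proof.
move=> Ua Ub Uc'; have [nx hnx] := choice goursat_step.
pose T n := iter n nx (a, b, c); set L := len (a, b, c).
have iT n : inU (T n) by elim: n => [|n IH] //=; case: (hnx _ IH).
have lT n : len (T n) = L * 2^-1 ^+ n.
  elim: n => [|n IH]; first by rewrite expr0 mulr1.
  by rewrite /T iterS; case: (hnx _ (iT n)) => _ -> _ _; rewrite IH exprSr mulrA.
have tT n : normc (TI f a b c) <= 4 ^+ n * normc (tri (T n)).
  elim: n => [|n IH]; first by rewrite expr0 mul1r.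
  apply: le_trans IH _; rewrite exprSr -mulrA ler_pM2l ?exprn_gt0 //.
  by rewrite /T iterS; case: (hnx _ (iT n)).
have dT n : normc ((T n.+1).1.1 - (T n).1.1) <= L * 2^-1 ^+ n.
  rewrite /T iterS; case: (hnx _ (iT n)) => _ _ h _; apply: le_trans h _.
  have := normc_ge0 ((T n).1.2 - (T n).1.1); have := normc_ge0 ((T n).2 - (T n).1.2).
  have := normc_ge0 ((T n).1.1 - (T n).2); rewrite -lT /len; lra.
have q01 : 0 <= (2^-1 : R) < 1 by lra.
have [|x hx] := @geometric_limit (fun n => re (T n).1.1) L _ q01.
  by move=> n; rewrite -ReB; exact: le_trans (normc_ge_normRe _) (dT n).
have [|y hy] := @geometric_limit (fun n => im (T n).1.1) L _ q01.
  by move=> n; rewrite -ImB; exact: le_trans (normc_ge_normIm _) (dT n).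
have K2 : L / (1 - 2^-1) = 2 * L.
  have -> : 1 - 2^-1 = 2^-1 :> R by lra.
  by rewrite invrK mulrC.
have {}hx n : `|x - re (T n).1.1| <= 2 * len (T n).
  by apply: le_trans (hx n) _; rewrite lT K2; lra.
have {}hy n : `|y - im (T n).1.1| <= 2 * len (T n).
  by apply: le_trans (hy n) _; rewrite lT K2; lra.
pose z : C := Complex x y.
have hz n : normc ((T n).1.1 - z) <= 4 * len (T n).
  rewrite normcB; apply: le_trans (normc_leD _ 0) _; rewrite /= ReB ImB /=.
  by have := hx n; have := hy n; lra.
have L0 : 0 <= L by rewrite /L /len; do !apply: addr_ge0; exact: normc_ge0.
have small e : 0 < e -> exists n, len (T n) < e.
  move=> e0.
  have : (fun n => L * 2^-1 ^+ n) @ \oo --> (0 : R).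
    by apply: cvg_geometric; rewrite ger0_norm; lra.
  move=> /cvgrPdist_lt /(_ e e0) [N _ /(_ N (leqnn N)) /=].
  by rewrite sub0r normrN -lT => h; exists N; apply: le_lt_trans (ler_norm _) h.
have Uz : U z.
  apply: Ul => e e0; have [|n hn] := small (e / 4); first by rewrite divr_gt0.
  exists (T n).1.1; first by case: (iT n).
  by apply: le_lt_trans (hz n) _; lra.
have [l [q [cq qz hq]]] := df Uz.
apply/eqP; rewrite -normc_eq0 eq_le normc_ge0 andbT.
apply/ler_addgt0Pl => e e0; rewrite addr0.
(* The point [z] is within [4 len] of the first vertex of the n-th triangle, so each point of that
   triangle is within [5 len] of [z]. The remainder contributes at most [5 len^2 e'], and the factor
   [4^n] cancels the square of [2^-n]. *)
pose e' := e / (5 * (L ^+ 2 + 1)).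
have L2 : 0 < 5 * (L ^+ 2 + 1) by rewrite mulr_gt0 // ltr_wpDl // sqr_ge0.
have e'0 : 0 < e' by rewrite divr_gt0.
have [d d0 hd] := (ccontP q z).1 cq e' e'0.
have [|n hn] := small (d / 6); first by rewrite divr_gt0.
case E : (T n) => [[p1 p2] p3]; have := iT n; rewrite E => -[/= U1 U2 U3].
have dist (u v : C) t : in01 t -> normc (u - p1) <= len (T n) -> normc (v - p1) <= len (T n) ->
   normc (seg u v t - z) <= 5 * len (T n).
  move=> /andP[t0 t1] hu hv.
  have -> : seg u v t - z = ((1 - t)%:C * (u - p1) + t%:C * (v - p1)) + (p1 - z).
    by rewrite /seg rmorphB rmorph1; ring.
  apply: le_trans (le_normcD _ _) _.
  have := hz n; rewrite E /= => hz1.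
  have : normc ((1 - t)%:C * (u - p1) + t%:C * (v - p1)) <= len (T n).
    apply: le_trans (le_normcD _ _) _; rewrite !normcM !normcR !ger0_norm ?subr_ge0 //.
    have -> : len (T n) = (1 - t) * len (T n) + t * len (T n) by ring.
    by apply: lerD; apply: ler_wpM2l => //; rewrite subr_ge0.
  by move: hz1; rewrite -E; lra.
have ll : len (T n) = normc (p2 - p1) + normc (p3 - p2) + normc (p1 - p3) by rewrite E.
have n1 := normc_ge0 (p2 - p1); have n2 := normc_ge0 (p3 - p2); have n3 := normc_ge0 (p1 - p3).
(* The affine part has a primitive, so its integral over a triangle is zero and only this remainder
   counts. *)
pose rem w := f w - (f z + l * (w - z)).
have remE w : normc (w - z) <= 5 * len (T n) -> normc (rem w) <= 5 * len (T n) * e'.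
  move=> hw; have -> : rem w = (w - z) * (q w - q z).
    by rewrite /rem qz (mulrBr (w - z)) -hq; ring.
  rewrite normcM; apply: ler_pM; rewrite ?normc_ge0 //; apply/ltW/hd.
  by apply: le_lt_trans hw _; lra.
have crem u v : U u -> U v -> cont01 (fun t => rem (seg u v t)).
  move=> Uu Uv; apply: cont01B; first exact: goursat_cont.
  apply: cont01D; first exact: cont01_cst.
  apply: cont01M; first exact: cont01_cst.
  apply: cont01B; [by move=> t _; exact: dR_cont (dR_seg _ _ _)|exact: cont01_cst].
have caff u v : cont01 (fun t => f z + l * (seg u v t - z)).
  apply: cont01D; first exact: cont01_cst.
  apply: cont01M; first exact: cont01_cst.
  apply: cont01B; [by move=> t _; exact: dR_cont (dR_seg _ _ _)|exact: cont01_cst].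
have trirem : tri (T n) = TI rem p1 p2 p3.
  rewrite /tri E /=; rewrite -[LHS]subr0 -{1}(TI_affine (f z) l z p1 p2 p3) /TI /rem.
  rewrite !(@SIB f (fun w => f z + l * (w - z))) //; try exact: goursat_cont.
  by ring.
have sidebd u v : U u -> U v -> normc (u - p1) <= len (T n) -> normc (v - p1) <= len (T n) ->
    normc (SI rem u v) <= normc (v - u) * (5 * len (T n) * e').
  move=> Uu Uv hu hv; apply: SI_norm; first exact: crem.
  by move=> t ht; apply: remE; exact: dist.
have tb : normc (tri (T n)) <= len (T n) * (5 * len (T n) * e').
  rewrite trirem /TI {1}ll; move: sidebd; set Q := 5 * len (T n) * e' => sidebd.
  rewrite (mulrDl _ _ Q) (mulrDl _ _ Q).
  have m1 : normc (p1 - p1) <= len (T n) by rewrite subrr normc0 ll; lra.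
  have m2 : normc (p2 - p1) <= len (T n) by rewrite ll; lra.
  have m3 : normc (p3 - p1) <= len (T n) by rewrite normcB ll; lra.
  apply: le_trans (le_normcD _ _) _; apply: lerD; last exact: (sidebd p3 p1).
  by apply: le_trans (le_normcD _ _) _; apply: lerD; [exact: (sidebd p1 p2)|exact: (sidebd p2 p3)].
apply: le_trans (tT n) _; apply: le_trans (_ : 4 ^+ n * (len (T n) * (5 * len (T n) * e')) <= _).
  by rewrite ler_pM2l ?exprn_gt0.
rewrite lT; have p40 : (4 : R) ^+ n = (2 ^+ n) ^+ 2 by rewrite -exprM mulnC exprM; congr (_ ^+ _); ring.
have -> : 4 ^+ n * (L * 2^-1 ^+ n * (5 * (L * 2^-1 ^+ n) * e')) = (2 ^+ n * 2^-1 ^+ n) ^+ 2 * (5 * L ^+ 2 * e').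
  by rewrite p40; ring.
have -> : (2 : R) ^+ n * 2^-1 ^+ n = 1 by rewrite -exprMn mulfV ?expr1n ?pnatr_eq0.
rewrite expr1n mul1r /e'.
by rewrite mulrA ler_pdivrMr // mulrC ler_pM2l // ler_pM2l // lerDl.
Qed.

End Bisection.
End Goursat.

(** * Primitives on discs, with one exceptional point *)

Section Cauchy.
Context {R : realType}.
Local Notation C := (Cplx R).
Implicit Types (z w a b c : C) (f F : C -> C) (U : set C) (r : R).

Definition disc c r : set C := [set z | normc (z - c) < r].

Lemma disc_center c r : 0 < r -> disc c r c.
Proof. by rewrite /disc /= subrr normc0. Qed.

Lemma disc_sub c r z : disc c r z -> exists2 d : R, 0 < d & disc z d `<=` disc c r.
Proof.
rewrite /disc /= => h; exists (r - normc (z - c)); first by rewrite subr_gt0.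
move=> w /= hw; have -> : w - c = (w - z) + (z - c) by ring.
by rewrite (le_lt_trans (le_normcD _ _)) // -ltrBrDr.
Qed.

Lemma near_disc z (P : C -> Prop) : (\forall w \near z, P w) <->
  exists2 d : R, 0 < d & forall w, disc z d w -> P w.
Proof. exact: nbhs_cplx. Qed.

Lemma seg_sub a b t c : seg a b t - c = (1 - t)%:C * (a - c) + t%:C * (b - c).
Proof. by rewrite /seg rmorphB rmorph1; ring. Qed.

Lemma normc_seg a b t c r : in01 t -> normc (a - c) <= r -> normc (b - c) <= r ->
  normc (seg a b t - c) <= r.
Proof.
move=> /andP[t0 t1] ha hb; rewrite seg_sub; apply: le_trans (le_normcD _ _) _.
rewrite !normcM !normcR !ger0_norm ?subr_ge0 //.
have -> : r = (1 - t) * r + t * r by ring.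
by apply: lerD; apply: ler_wpM2l => //; rewrite subr_ge0.
Qed.

Lemma convexC_disc c r : convexC [set z : C | normc (z - c) <= r].
Proof. by move=> a b t /= ha hb ht; exact: normc_seg. Qed.

Lemma limclosed_disc c r : limclosed [set z : C | normc (z - c) <= r].
Proof.
move=> z h /=; apply/ler_addgt0Pl => e e0; have [w /= hw he] := h e e0.
have -> : z - c = (z - w) + (w - c) by ring.
by apply: le_trans (le_normcD _ _) _; apply: lerD => //; rewrite normcB ltW.
Qed.

Lemma convexC_half u a s : convexC [set z : C | s <= re (u * (z - a))].
Proof.
move=> p q t /= hp hq /andP[t0 t1]; rewrite seg_sub mulrDr ReD.
rewrite (mulrCA u) (mulrCA u) (ReMr (1 - t)) (ReMr t).
have -> : s = (1 - t) * s + t * s by ring.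
by apply: lerD; apply: ler_wpM2l => //; rewrite subr_ge0.
Qed.

Lemma limclosed_half u a s : limclosed [set z : C | s <= re (u * (z - a))].
Proof.
move=> z h /=; apply/ler_addgt0Pr => e e0.
have u0 : 0 < normc u + 1 by rewrite ltr_wpDl ?normc_ge0.
have [|w /= hw he] := h (e / (normc u + 1)); first by rewrite divr_gt0.
apply: le_trans hw _.
have -> : u * (w - a) = u * (z - a) + u * (w - z) by ring.
rewrite ReD lerD2l; apply: le_trans (ler_norm _) _.
apply: le_trans (normc_ge_normRe _) _; rewrite normcM.
apply: le_trans (_ : (normc u + 1) * (e / (normc u + 1)) <= _).
  by apply: ler_pM; rewrite ?normc_ge0 // ?lerDl // ltW.
by rewrite mulrCA divff ?mulr1 // gt_eqF.
Qed.

Lemma convexC_setI U V : convexC U -> convexC V -> convexC (U `&` V).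
Proof. by move=> h h' a b t [? ?] [? ?] ht; split; [exact: h|exact: h']. Qed.

Lemma limclosed_setI U V : limclosed U -> limclosed V -> limclosed (U `&` V).
Proof.
move=> h h' z hz; split.
  by apply: h => e /hz [w []]; exists w.
by apply: h' => e /hz [w []]; exists w.
Qed.

Lemma dC_local f z l (q : C -> C) : ccont q z -> q z = l ->
  (exists2 d : R, 0 < d & forall w, disc z d w -> f w - f z = (w - z) * q w) -> dC f z l.
Proof.
move=> cq qz [d d0 h]; apply: (@dC_near _ (fun w => f z + (w - z) * q w)).
  by apply/near_disc; exists d => // w /h <-; rewrite addrC subrK.
exists q; split => // w; rewrite subrr mul0r addr0; ring.
Qed.

Lemma ccont_segavg f z r : 0 < r -> (forall w, disc z r w -> ccont f w) ->
  ccont (fun w => I01 (fun t => f (seg z w t))) z.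
Proof.
move=> r0 cf; apply/ccontP => e e0; have e2 : 0 < e / 2 by rewrite divr_gt0.
have [d d0 hd] := (ccontP f z).1 (cf z (disc_center z r0)) _ e2.
exists (Num.min d r); first by rewrite lt_min d0.
move=> w; rewrite lt_min => /andP[h1 h2].
have hin t : in01 t -> normc (seg z w t - z) <= normc (w - z).
  by move=> ht; apply: normc_seg => //; rewrite subrr normc0 normc_ge0.
have cc : cont01 (fun t => f (seg z w t)).
  by apply: cont01_seg => t /hin ht; apply: cf; exact: le_lt_trans ht h2.
have -> : I01 (fun t => f (seg z z t)) = I01 (fun _ => f z).
  by apply: I01_ext => t _; rewrite /seg subrr mulr0 addr0.
rewrite -I01B //; last exact: cont01_cst.
apply: le_lt_trans (_ : e / 2 < e); last by rewrite ltr_pdivrMr // ltr_pMr //; lra.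
apply: I01_norm; first by apply: cont01B => //; exact: cont01_cst.
by move=> t /hin ht; apply/ltW/hd; exact: le_lt_trans ht h1.
Qed.

Lemma normc_re_ge (u v : C) : - (normc u * normc v) <= re (conjc u * v).
Proof.
have := normc_ge_normRe (conjc u * v); rewrite normcM normcJ ler_norml => /andP[h _].
by apply: le_trans h; rewrite lerN2.
Qed.

Section Primitive.
Variables (f : C -> C) (c : C) (r : R) (a : C).
Hypotheses (Da : disc c r a) (cf : forall z, disc c r z -> ccont f z)
  (df : forall z, disc c r z -> z != a -> exists l, dC f z l).

Lemma disc_seg u v t : disc c r u -> disc c r v -> in01 t -> disc c r (seg u v t).
Proof.
move=> hu hv ht; rewrite /disc /=.
apply: le_lt_trans (_ : Num.max (normc (u - c)) (normc (v - c)) < r).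
  by apply: normc_seg => //; rewrite le_max lexx ?orbT.
by rewrite gt_max; apply/andP.
Qed.

Lemma disc_cont01 u v : disc c r u -> disc c r v -> cont01 (fun t => f (seg u v t)).
Proof. by move=> hu hv; apply: cont01_seg => t ht; apply: cf; exact: disc_seg. Qed.

Lemma SI_disc_rev u v : disc c r u -> disc c r v -> SI f v u = - SI f u v.
Proof. by move=> hu hv; rewrite SI_rev //; exact: disc_cont01. Qed.

(** Here [f] is merely continuous at the vertex [a], so Goursat's theorem does not apply to the
    whole triangle. Its tip at [a] is cut off at scale [s]; the rest splits into two triangles in a
    half-plane that misses [a], and the tip contributes [O(s)]. *)
Lemma TI_vertex z w : disc c r z -> disc c r w -> normc (w - z) < normc (z - a) ->
  TI f a z w = 0.
Proof.
move=> Dz Dw hwz; apply/eqP; rewrite -normc_eq0 eq_le normc_ge0 andbT.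
apply/ler_addgt0Pl => e e0; rewrite addr0.
have [d d0 hd] := (ccontP f a).1 (cf Da) 1 ltr01.
pose M := normc (f a) + 1.
have M0 : 0 < M by rewrite /M; have := normc_ge0 (f a); lra.
have za0 : 0 < normc (z - a) by exact: le_lt_trans (normc_ge0 _) hwz.
pose K := normc (z - a) + normc (w - a) + normc (w - z).
have K0 : 0 < K.
  by rewrite /K; have := normc_ge0 (w - a); have := normc_ge0 (w - z); lra.
(* The tip stays in the disc where [f] is bounded by [M], and [M] times its perimeter is at most
   [e]. *)
pose s := Num.min 1 (Num.min (d / (2 * K)) (e / (M * K))).
have s0 : 0 < s by rewrite !lt_min ltr01 !divr_gt0 ?mulr_gt0.
have s1 : s <= 1 by rewrite ge_min lexx.
have sd : s * K < d.
  have : s <= d / (2 * K) by rewrite !ge_min lexx !orbT.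
  rewrite -(ler_pM2r K0) => /le_lt_trans; apply.
  have -> : d / (2 * K) * K = d / 2 by field; rewrite gt_eqF.
  by rewrite ltr_pdivrMr // ltr_pMr //; lra.
have se : M * (s * K) <= e.
  have : s <= e / (M * K) by rewrite !ge_min lexx !orbT.
  rewrite -(ler_pM2r (mulr_gt0 M0 K0)) divfK ?gt_eqF ?mulr_gt0 //.
  by rewrite mulrCA.
have s01 : 0 <= s <= 1 by rewrite s1 ltW.
pose z' := seg a z s; pose w' := seg a w s.
have Dz' : disc c r z' by exact: disc_seg.
have Dw' : disc c r w' by exact: disc_seg.
pose u := conjc (z - a).
pose m := s * (normc (z - a) * (normc (z - a) - normc (w - z))).
have m0 : 0 < m by rewrite mulr_gt0 // mulr_gt0 // subr_gt0.
pose r1 := Num.max (normc (a - c)) (Num.max (normc (z - c)) (normc (w - c))).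
have r1r : r1 < r by rewrite !gt_max; apply/and3P; split.
(* The condition [normc (w - z) < normc (z - a)] places [z] and [w] strictly on one side of a line
   through [a]; shifting this line by [m] still leaves [z'] and [w'] on the good side. *)
pose U := [set v : C | normc (v - c) <= r1] `&` [set v : C | m <= re (u * (v - a))].
have hz : normc (z - a) * (normc (z - a) - normc (w - z)) <= re (u * (z - a)).
  by rewrite [u * _]mulrC /u mulcJ /= expr2 ler_wpM2l ?normc_ge0 // gerBl normc_ge0.
have hw : normc (z - a) * (normc (z - a) - normc (w - z)) <= re (u * (w - a)).
  have -> : u * (w - a) = u * (z - a) + u * (w - z) by ring.
  rewrite ReD {1}/u [conjc (z - a) * (z - a)]mulrC mulcJ /= expr2 mulrBr lerD2l.
  exact: normc_re_ge.
have hpos : 0 < normc (z - a) * (normc (z - a) - normc (w - z)) by rewrite mulr_gt0 // subr_gt0.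
have hs v : re (u * (seg a v s - a)) = s * re (u * (v - a)).
  by rewrite /seg addrAC subrr add0r mulrCA ReMr.
have in1 v : normc (z - a) * (normc (z - a) - normc (w - z)) <= re (u * (v - a)) ->
   m <= re (u * (v - a)).
  by move=> h; apply: le_trans h; rewrite ler_piMl // ltW.
have Ua : normc (a - c) <= r1 by rewrite le_max lexx.
have Uz : U z by split; [rewrite /= !le_max lexx !orbT|exact: in1].
have Uw : U w by split; [rewrite /= !le_max lexx !orbT|exact: in1].
have Uz' : U z'.
  by split; [apply: normc_seg => //; case: Uz|rewrite /= hs /m ler_pM2l].
have Uw' : U w'.
  by split; [apply: normc_seg => //; case: Uw|rewrite /= hs /m ler_pM2l].
have gU p q v : U p -> U q -> U v -> TI f p q v = 0.
  apply: goursat.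
  - by apply: convexC_setI; [exact: convexC_disc|exact: convexC_half].
  - by apply: limclosed_setI; [exact: limclosed_disc|exact: limclosed_half].
  move=> y [hy1 hy2]; apply: df; first exact: le_lt_trans hy1 r1r.
  apply: contraTneq hy2 => ->; rewrite /= subrr mulr0 /= -ltNge //.
have t1 := gU _ _ _ Uz' Uz Uw; have t2 := gU _ _ _ Uz' Uw Uw'.
have ez := SI_split s01 (disc_cont01 Da Dz); have ew := SI_split s01 (disc_cont01 Da Dw).
have key : TI f a z w = SI f a z' - SI f a w' - SI f w' z'.
  rewrite /TI (SI_disc_rev Da Dw) ez ew -/z' -/w'.
  move: t1 t2; rewrite /TI (SI_disc_rev Dz' Dw) (SI_disc_rev Dw' Dw) => t1 t2.
  have t3 := t1; move/eqP : t3; rewrite subr_eq0 => /eqP t3.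
  move: t2; rewrite -t3 => t2.
  have -> : SI f z' z = - SI f z w + SI f w' w - SI f w' z'.
    by apply/eqP; rewrite -subr_eq0 -t2; apply/eqP; ring.
  ring.
have small v p : normc (v - a) <= s * K -> normc (p - a) <= s * K ->
    disc c r v -> disc c r p -> normc (SI f v p) <= normc (p - v) * M.
  move=> hv hp Dv Dp; apply: SI_norm; first exact: disc_cont01.
  move=> t ht; have h : normc (seg v p t - a) < d.
    by apply: le_lt_trans sd; exact: normc_seg.
  have -> : f (seg v p t) = f a + (f (seg v p t) - f a) by ring.
  apply: le_trans (le_normcD _ _) _; rewrite /M lerD2l; exact/ltW/hd.
have na : normc (a - a) <= s * K by rewrite subrr normc0 mulr_ge0 // ltW.
have nz' : normc (z' - a) = s * normc (z - a).
  by rewrite /z' /seg addrAC subrr add0r normcM normcR ger0_norm // ltW.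
have nw' : normc (w' - a) = s * normc (w - a).
  by rewrite /w' /seg addrAC subrr add0r normcM normcR ger0_norm // ltW.
have nzw' : normc (z' - w') = s * normc (w - z).
  have -> : z' - w' = s%:C * (z - w) by rewrite /z' /w' /seg; ring.
  by rewrite normcM normcR ger0_norm ?(ltW s0) // normcB.
have hz' : normc (z' - a) <= s * K.
  rewrite nz' ler_pM2l // /K; have := normc_ge0 (w - a); have := normc_ge0 (w - z); lra.
have hw' : normc (w' - a) <= s * K.
  rewrite nw' ler_pM2l // /K; have := normc_ge0 (z - a); have := normc_ge0 (w - z); lra.
rewrite key; apply: le_trans (le_normcB _ _) _.
apply: le_trans (lerD (le_normcB _ _) (lexx _)) _.
apply: le_trans (lerD (lerD (small _ _ na hz' Da Dz') (small _ _ na hw' Da Dw')) (small _ _ hw' hz' Dw' Dz')) _.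
rewrite nz' nw' nzw'; apply: le_trans se; rewrite /K.
by rewrite le_eqVlt; apply/orP; left; apply/eqP; ring.
Qed.

(** The primitive is the integral from [a], so all triangles that occur have their vertex at the
    exceptional point. Its difference quotient at [z] is the mean of [f] over a segment, which tends
    to [f z]. *)
Lemma disc_primitive : exists F, forall z, disc c r z -> dC F z (f z).
Proof.
exists (fun z => SI f a z) => z Dz.
have [d d0 hd] := disc_sub Dz.
have cq : ccont (fun w => I01 (fun t => f (seg z w t))) z.
  by apply: ccont_segavg d0 _ => w /hd; exact: cf.
have qz : I01 (fun t => f (seg z z t)) = f z.
  rewrite -[RHS]I01_cst; apply: I01_ext => t _.
  by rewrite /seg subrr mulr0 addr0.
apply: (dC_local cq qz); have [za|za] := eqVneq z a.
  exists 1 => // w _; rewrite -za.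
  have -> : SI f z z = 0 by rewrite /SI subrr mul0r.
  by rewrite subr0.
exists (Num.min d (normc (z - a))); first by rewrite lt_min d0 normc_gt0 subr_eq0.
move=> w; rewrite /disc /= lt_min => /andP[h1 h2].
have Dw : disc c r w by exact: hd.
have := TI_vertex Dz Dw h2; rewrite /TI (SI_disc_rev Da Dw) => /eqP.
by rewrite subr_eq0 => /eqP <-; rewrite /SI; ring.
Qed.

End Primitive.
End Cauchy.

(** * Cauchy's formula and the local structure of holomorphic functions *)

Section CauchyFormula.
Context {R : realType}.
Local Notation C := (Cplx R).
Implicit Types (z w a b c : C) (f F g : C -> C) (U : set C) (r rho : R).

Definition zeta (t : R) : C := Complex (cos (2 * pi * t)) (sin (2 * pi * t)).
Definition circ c rho (t : R) : C := c + rho%:C * zeta t.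
Definition tpi : C := Complex 0 (2 * pi).

Lemma normc_zeta t : normc (zeta t) = 1.
Proof. by rewrite /zeta /= cos2Dsin2 sqrtr1. Qed.

Lemma zeta_neq0 t : zeta t != 0.
Proof. by rewrite -normc_gt0 normc_zeta. Qed.

Lemma zeta0 : zeta 0 = 1. Proof. by rewrite /zeta mulr0 cos0 sin0. Qed.
Lemma zeta1 : zeta 1 = 1.
Proof. by rewrite /zeta mulr1 mulr_natl cos2pi sin2pi. Qed.

Lemma tpi_neq0 : tpi != 0.
Proof.
by rewrite /tpi eq_complex /= eqxx /= mulf_neq0 // gt_eqF // pi_gt0.
Qed.

Lemma dR_zeta t : dR zeta t (tpi * zeta t).
Proof.
have hs : is_derive t (1:R) (fun s : R => 2 * pi * s) (2 * pi).
  apply: is_derive_eq; by rewrite /GRing.scale /= mulr1.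
have h1 : is_derive t (1:R) (fun s => cos (2 * pi * s)) (- sin (2 * pi * t) * (2 * pi)).
  have h := @is_derive1_comp R cos (fun s => 2 * pi * s) t _ _ (is_derive_cos (2 * pi * t)) hs.
  exact: h.
have h2 : is_derive t (1:R) (fun s => sin (2 * pi * s)) (cos (2 * pi * t) * (2 * pi)).
  have h := @is_derive1_comp R sin (fun s => 2 * pi * s) t _ _ (is_derive_sin (2 * pi * t)) hs.
  exact: h.
apply: dR_eq (dR_Complex h1 h2) _; apply: Re_Im_eq; rewrite ?ReM ?ImM /=; ring.
Qed.

Lemma dR_circ c rho t : dR (circ c rho) t (tpi * (rho%:C * zeta t)).
Proof.
apply: dR_eq (dRD (dR_cst c t) (dRZ rho%:C (dR_zeta t))) _.
by rewrite add0r mulrCA.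
Qed.

Lemma ccont_zeta t : ccont zeta t. Proof. exact: dR_cont (dR_zeta t). Qed.
Lemma ccont_circ c rho t : ccont (circ c rho) t. Proof. exact: dR_cont (dR_circ c rho t). Qed.

Lemma circ_sub c rho t : 0 <= rho -> normc (circ c rho t - c) = rho.
Proof.
by move=> h; rewrite /circ addrAC subrr add0r normcM normc_zeta mulr1 normcR ger0_norm.
Qed.

Lemma cont01_circ f c rho : (forall t, ccont f (circ c rho t)) -> cont01 (fun t => f (circ c rho t)).
Proof. by move=> h t _; apply: ccont_comp; [exact: h|exact: ccont_circ]. Qed.

Lemma cont01_rz rho : cont01 (fun t => rho%:C * zeta t).
Proof. by move=> t _; apply: ccontM; [exact: ccont_cst|exact: ccont_zeta]. Qed.

Lemma circ_prim F f c rho : (forall t, dC F (circ c rho t) (f (circ c rho t))) ->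
  (forall t, ccont f (circ c rho t)) ->
  I01 (fun t => f (circ c rho t) * (rho%:C * zeta t)) = 0.
Proof.
move=> h cf; have cc := cont01_circ cf.
have e : I01 (fun t => tpi * (f (circ c rho t) * (rho%:C * zeta t))) = 0.
  rewrite (@I01E _ (fun t => F (circ c rho t))).
    by rewrite /circ zeta0 zeta1 subrr.
  by move=> t _; apply: dR_eq (dR_comp (dR_circ c rho t) (h t)) _; ring.
apply: (mulfI tpi_neq0); rewrite -I01Z ?e ?mulr0 //.
by apply: cont01M cc _; exact: cont01_rz.
Qed.

Section CauchyTransform.
Variables (g gam : R -> C) (z : C) (d : R).
Hypotheses (cg : cont01 g) (cgam : cont01 gam) (d0 : 0 < d)
  (far : forall t, in01 t -> d <= normc (gam t - z)).

Lemma far_near w t : normc (w - z) < d / 2 -> in01 t -> d / 2 <= normc (gam t - w).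
Proof.
move=> hw /far h; have e : gam t - z = (gam t - w) + (w - z) by ring.
by move: h; rewrite e => /le_trans /(_ (le_normcD _ _)); lra.
Qed.

Lemma far_neq0 w t : normc (w - z) < d / 2 -> in01 t -> gam t - w != 0.
Proof.
move=> hw ht; rewrite -normc_gt0; apply: lt_le_trans (far_near hw ht); have := d0; lra.
Qed.

Lemma far_inv w t : normc (w - z) < d / 2 -> in01 t -> normc (gam t - w)^-1 <= 2 / d.
Proof.
move=> hw ht; have h := far_near hw ht; rewrite normcV -[2 / d]invrK invfM invrK mulrC.
have d20 : 0 < d / 2 by rewrite divr_gt0.
by rewrite lef_pV2 // posrE ?(lt_le_trans d20 h).
Qed.

Lemma cont01_cauchy w : normc (w - z) < d / 2 -> cont01 (fun t => (gam t - w)^-1).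
Proof.
move=> hw t ht; apply: ccontV; first exact: far_neq0.
by apply: ccontB; [exact: cgam|exact: ccont_cst].
Qed.

Lemma far_refl : normc (z - z) < d / 2.
Proof. by rewrite subrr normc0 divr_gt0. Qed.
Local Notation zz := far_refl.

Lemma cont01_normc_bound (h : R -> C) : cont01 h -> exists2 M, 0 < M & forall t, in01 t -> normc (h t) <= M.
Proof.
move=> ch; have [|c _ hc] := @EVT_max R (fun t => normc (h t)) 0 1 ler01.
  apply: continuous_in_subspaceT => t; rewrite inE /= in_itv /= => ht.
  exact: ccont_normc (ch t ht).
exists (normc (h c) + 1); first by rewrite ltr_wpDl ?normc_ge0.
by move=> t ht; have := hc t; rewrite in_itv /= => /(_ ht) h1; lra.
Qed.

Lemma ccont_param (Q : R -> C -> C) : cont01 (Q^~ z) ->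
  (forall w, normc (w - z) < d / 2 -> cont01 (Q^~ w)) ->
  (exists2 K, 0 < K & forall w t, normc (w - z) < d / 2 -> in01 t ->
      normc (Q t w - Q t z) <= K * normc (w - z)) ->
  ccont (fun w => I01 (fun t => Q t w)) z.
Proof.
move=> cz cw [K K0 hK]; apply/ccontP => e e0.
exists (Num.min (d / 2) (e / (2 * K))); first by rewrite lt_min !divr_gt0 // mulr_gt0.
move=> w; rewrite lt_min => /andP[h1 h2]; rewrite -I01B //; last exact: cw.
apply: le_lt_trans (_ : e / 2 < e); last by lra.
apply: I01_norm; first by apply: cont01B => //; exact: cw.
move=> t ht; apply: le_trans (hK _ _ h1 ht) _.
have -> : e / 2 = K * (e / (2 * K)) by field; rewrite gt_eqF.
by rewrite ler_pM2l // ltW.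
Qed.

(** The difference quotient of the kernel is again an explicit kernel, Lipschitz in [w] uniformly in
    [t] because the curve stays at distance [d] from [z]. The curve and the density are arbitrary:
    the same lemma serves the Poisson integral and the residue theorem. *)
Lemma cauchy_transform_dC :
  dC (fun w => I01 (fun t => g t / (gam t - w))) z (I01 (fun t => g t / (gam t - z) ^+ 2)).
Proof.
have [M M0 hM] := cont01_normc_bound cg.
pose q w := I01 (fun t => g t * ((gam t - w)^-1 * (gam t - z)^-1)).
have cQ w : normc (w - z) < d / 2 -> cont01 (fun t => g t * ((gam t - w)^-1 * (gam t - z)^-1)).
  by move=> hw; apply: cont01M => //; apply: cont01M; apply: cont01_cauchy => //; exact: zz.
apply: (@dC_local _ _ _ _ q).
- apply: (ccont_param (Q := fun t w => g t * ((gam t - w)^-1 * (gam t - z)^-1))) => //.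
    exact: cQ zz.
  exists (M * (2 / d) ^+ 3); first by rewrite mulr_gt0 // exprn_gt0 // divr_gt0.
  move=> w t hw ht; have n1 := far_neq0 hw ht; have n2 := far_neq0 zz ht.
  have -> : g t * ((gam t - w)^-1 * (gam t - z)^-1) - g t * ((gam t - z)^-1 * (gam t - z)^-1)
     = g t * ((gam t - w)^-1 * (gam t - z)^-1 * (gam t - z)^-1) * (w - z).
    by field; rewrite n1 n2.
  rewrite normcM; apply: ler_pM; rewrite ?normc_ge0 // normcM.
  apply: ler_pM; rewrite ?normc_ge0 ?hM // !exprS expr0 mulr1 !normcM mulrA.
  have i1 := far_inv hw ht; have i2 := far_inv zz ht.
  by apply: ler_pM => //; rewrite ?mulr_ge0 ?normc_ge0 //; apply: ler_pM; rewrite ?normc_ge0.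
- by apply: I01_ext => t _; rewrite expr2 invfM.
- exists (d / 2); first by rewrite divr_gt0.
  move=> w hw; rewrite -I01B; first last.
  + by apply: cont01M => //; exact: cont01_cauchy zz.
  + by apply: cont01M => //; exact: cont01_cauchy.
  rewrite -I01Z; last exact: cQ.
  apply: I01_ext => t ht; have n1 := far_neq0 hw ht; have n2 := far_neq0 zz ht.
  by field; rewrite n1 n2.
Qed.

Lemma cauchy_transform2_dC :
  dC (fun w => I01 (fun t => g t / (gam t - w) ^+ 2)) z (2 * I01 (fun t => g t / (gam t - z) ^+ 3)).
Proof.
have [M M0 hM] := cont01_normc_bound cg.
pose Q t w := g t * (((gam t - w)^-1 + (gam t - z)^-1) * ((gam t - w)^-1 * (gam t - z)^-1)).
have cQ w : normc (w - z) < d / 2 -> cont01 (Q^~ w).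
  move=> hw; apply: cont01M => //; apply: cont01M; first by apply: cont01D; apply: cont01_cauchy => //; exact: zz.
  by apply: cont01M; apply: cont01_cauchy => //; exact: zz.
apply: (@dC_local _ _ _ _ (fun w => I01 (Q^~ w))).
- apply: ccont_param => //; first exact: cQ zz.
  exists (M * (3 * (2 / d) ^+ 4)); first by rewrite mulr_gt0 // mulr_gt0 // exprn_gt0 // divr_gt0.
  move=> w t hw ht; have n1 := far_neq0 hw ht; have n2 := far_neq0 zz ht.
  have i1 := far_inv hw ht; have i2 := far_inv zz ht.
  set A := (gam t - w)^-1 in i1; set B := (gam t - z)^-1 in i2.
  have -> : Q t w - Q t z = g t * ((A * (A * (B * B))) + B * (A * (B * B)) + (B * (A * (B * B)))) * (w - z).
    by rewrite /Q /A /B; field; rewrite n1 n2.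
  rewrite normcM; apply: ler_pM; rewrite ?normc_ge0 // normcM.
  apply: ler_pM; rewrite ?normc_ge0 ?hM //.
  have k0 : 0 <= 2 / d by rewrite divr_ge0 // ltW.
  have i3 : normc (A * (B * B)) <= (2 / d) ^+ 3.
    rewrite !exprS expr0 mulr1 !normcM; apply: ler_pM; rewrite ?mulr_ge0 ?normc_ge0 //.
    by apply: ler_pM; rewrite ?normc_ge0.
  have i4 D : normc D <= 2 / d -> normc (D * (A * (B * B))) <= (2 / d) ^+ 4.
    by move=> hD; rewrite exprS normcM; apply: ler_pM; rewrite ?normc_ge0.
  have := i4 _ i1; have := i4 _ i2.
  have := le_normcD (A * (A * (B * B)) + B * (A * (B * B))) (B * (A * (B * B))).
  have := le_normcD (A * (A * (B * B))) (B * (A * (B * B))).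
  move: (_ ^+ 4) => k; lra.
- rewrite -I01Z; last first.
    apply: cont01M => // t ht; apply: ccontV; first by rewrite expf_neq0 //; exact: far_neq0 zz ht.
    by apply: ccontX; apply: ccontB; [exact: cgam|exact: ccont_cst].
  apply: I01_ext => t ht; rewrite /Q; have n2 := far_neq0 zz ht; by field.
- exists (d / 2); first by rewrite divr_gt0.
  have c2 w : normc (w - z) < d / 2 -> cont01 (fun t => g t / (gam t - w) ^+ 2).
    move=> hw; apply: cont01M => // t ht; apply: ccontV; first by rewrite expf_neq0 //; exact: far_neq0.
    by apply: ccontX; apply: ccontB; [exact: cgam|exact: ccont_cst].
  move=> w hw; rewrite -I01B; first last.
  + exact: c2 zz.
  + exact: c2.
  rewrite -I01Z; last exact: cQ.
  apply: I01_ext => t ht; have n1 := far_neq0 hw ht; have n2 := far_neq0 zz ht.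
  by rewrite /Q; field; rewrite n1 n2.
Qed.

End CauchyTransform.

Lemma circ_far c rho z t : 0 < rho -> rho - normc (z - c) <= normc (circ c rho t - z).
Proof.
move=> r0; have e : circ c rho t - c = (circ c rho t - z) + (z - c) by ring.
rewrite lerBlDr -{1}(circ_sub c t (ltW r0)) e; exact: le_normcD.
Qed.

Lemma circ_neq c rho z t : 0 < rho -> normc (z - c) < rho -> circ c rho t - z != 0.
Proof.
move=> r0 hz; rewrite -normc_gt0; apply: lt_le_trans (circ_far c z t r0).
by rewrite subr_gt0.
Qed.

(** As a function of [z] the integral has derivative 0, since the derivative of its kernel has a
    primitive along the circle; at the centre the integrand is 1. *)
Lemma cauchy_kernel c rho z : 0 < rho -> normc (z - c) < rho ->
  I01 (fun t => rho%:C * zeta t / (circ c rho t - z)) = 1.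
Proof.
move=> r0 hz; pose W w := I01 (fun t => rho%:C * zeta t / (circ c rho t - w)).
have cr : cont01 (fun t => rho%:C * zeta t) := cont01_rz rho.
have cc : cont01 (circ c rho) by move=> t _; exact: ccont_circ.
have dW w : normc (w - c) < rho -> dC W w 0.
  move=> hw; have d0 : 0 < rho - normc (w - c) by rewrite subr_gt0.
  apply: dC_eq (cauchy_transform_dC cr cc d0 (fun t _ => circ_far c w t r0)) _.
  have h := @circ_prim (fun v => - (v - w)^-1) (fun v => (v - w) ^- 2) c rho.
  rewrite -[RHS]h.
  - by apply: I01_ext => t _; rewrite mulrC.
  - move=> t; have n0 := circ_neq t r0 hw.
    apply: dC_eq (dCN (@dCV _ (fun v => v - w) _ _ n0 (dCB (dC_id _) (dC_cst w _)))) _.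
    by rewrite /=; field; exact: n0.
  - move=> t; apply: ccontV; first by rewrite expf_neq0 //; exact: circ_neq.
    by apply: ccontX; apply: ccontB; [exact: ccont_id|exact: ccont_cst].
have Wc : W c = 1.
  rewrite -[RHS]I01_cst; apply: I01_ext => t _.
  rewrite /circ addrAC subrr add0r divff // mulf_neq0 ?zeta_neq0 //.
  by rewrite eq_complex /= eqxx andbT gt_eqF.
rewrite -/(W z) -Wc; apply/eqP; rewrite -subr_eq0 -normc_eq0 eq_le normc_ge0 andbT.
have := @dR_bound _ (fun t => W (seg c z t)) (fun _ => 0) 0.
rewrite seg0 seg1; apply.
  move=> t ht; apply: dR_eq (dR_comp (dR_seg c z t) (dW _ _)) _; last by rewrite mul0r.
  apply: le_lt_trans hz; apply: normc_seg => //; by rewrite subrr normc0 normc_ge0.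
by move=> t _; rewrite normc0.
Qed.

Lemma disc_open (c : C) (r : R) : open (disc c r).
Proof. exact: open_disc. Qed.

Definition holC U f := forall z, U z -> exists l, dC f z l.

Lemma holC_cont U f z : holC U f -> U z -> ccont f z.
Proof. by move=> h /h [l]; exact: dC_cont. Qed.

Lemma holC_sub U V f : U `<=` V -> holC V f -> holC U f.
Proof. by move=> s h z /s; exact: h. Qed.

Lemma circ_disc c rho r t : 0 <= rho -> rho < r -> disc c r (circ c rho t).
Proof. by move=> h0 h; rewrite /disc /= circ_sub. Qed.

(** The difference quotient of [f] at [z] is continuous, and holomorphic away from [z]. It has a
    primitive by [disc_primitive] with exceptional point [z], hence integral 0 over the circle. *)
Lemma cauchy_formula c r f rho z : holC (disc c r) f -> 0 < rho < r -> normc (z - c) < rho ->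
  I01 (fun t => f (circ c rho t) * (rho%:C * zeta t) / (circ c rho t - z)) = f z.
Proof.
move=> hf /andP[r0 rr] hz.
have Dz : disc c r z by exact: lt_trans hz rr.
have [l [q [cq qz hq]]] := hf z Dz.
have qE w : w != z -> q w = (f w - f z) / (w - z).
  by move=> wz; rewrite hq mulrC mulKf // subr_eq0.
have qdC w : disc c r w -> w != z -> exists l, dC q w l.
  move=> Dw wz; have [m dm] := hf w Dw; eexists.
  have n0 : w - z != 0 by rewrite subr_eq0.
  apply: dC_near (dCM (dCB dm (dC_cst (f z) w)) (@dCV _ (fun v => v - z) _ _ n0 (dCB (dC_id w) (dC_cst z w)))).
  apply/near_disc; exists (normc (w - z)); first by rewrite normc_gt0.
  move=> v hv; rewrite qE //; apply: contraTneq hv => ->.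
  by rewrite /disc /= normcB ltxx.
have qc w : disc c r w -> ccont q w.
  move=> Dw; have [->//|wz] := eqVneq w z.
  by have [m] := qdC _ Dw wz; exact: dC_cont.
have [Q hQ] := disc_primitive Dz qc qdC.
have cin t : disc c r (circ c rho t) by apply: circ_disc => //; exact: ltW.
have h0 := circ_prim (fun t => hQ _ (cin t)) (fun t => qc _ (cin t)).
have k1 := cauchy_kernel r0 hz.
have crz := cont01_rz rho.
have cinv : cont01 (fun t => (circ c rho t - z)^-1).
  move=> t _; apply: ccontV; first exact: circ_neq.
  by apply: ccontB; [exact: ccont_circ|exact: ccont_cst].
have cf : cont01 (fun t => f (circ c rho t)).
  by apply: cont01_circ => t; exact: holC_cont hf (cin t).
have h1 : I01 (fun t => f (circ c rho t) * (rho%:C * zeta t) / (circ c rho t - z)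
     - f z * (rho%:C * zeta t / (circ c rho t - z))) = 0.
  rewrite -[RHS]h0; apply: I01_ext => t _; rewrite qE ?(circ_neq t r0 hz) //; last first.
    by rewrite -subr_eq0; exact: circ_neq.
  by field; exact: circ_neq.
move: h1; rewrite I01B; last first.
- by apply: cont01M; [exact: cont01_cst|exact: cont01M].
- by apply: cont01M => //; exact: cont01M.
move=> /eqP; rewrite subr_eq0 => /eqP ->.
by rewrite I01Z ?k1 ?mulr1 //; exact: cont01M.
Qed.

Lemma holC_derive1 U f : open U -> holC U f -> holC U (derive1 f).
Proof.
move=> oU hf a Ua; have [r r0 hr] := (open_cplx U).1 oU a Ua.
have hD : holC (disc a r) f by apply: holC_sub hf.
pose rho := r / 2; have rr : 0 < rho < r by rewrite /rho; lra.
have rho0 : 0 < rho by case/andP: rr.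
pose g t := f (circ a rho t) * (rho%:C * zeta t).
have cg : cont01 g.
  apply: cont01M; last exact: cont01_rz.
  apply: cont01_circ => t; apply: holC_cont hD _.
  by apply: circ_disc; [exact: ltW|case/andP: rr].
have cc : cont01 (circ a rho) by move=> t _; exact: ccont_circ.
have d1 w : normc (w - a) < rho -> derive1 f w = I01 (fun t => g t / (circ a rho t - w) ^+ 2).
  move=> hw; apply: dC_derive1.
  have d0 : 0 < rho - normc (w - a) by rewrite subr_gt0.
  apply: dC_near (cauchy_transform_dC cg cc d0 (fun t _ => circ_far a w t rho0)).
  apply/near_disc; exists (rho - normc (w - a)) => // v hv.
  rewrite /g (cauchy_formula hD rr) //.
  have -> : v - a = (v - w) + (w - a) by ring.
  by apply: le_lt_trans (le_normcD _ _) _; rewrite -ltrBrDr.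
have d0 : 0 < rho - normc (a - a) by rewrite subrr normc0 subr0.
eexists; apply: dC_near (cauchy_transform2_dC cg cc d0 (fun t _ => circ_far a a t rho0)).
by apply/near_disc; exists rho => // v hv; rewrite d1.
Qed.

Lemma holC_dC U f z : holC U f -> U z -> dC f z (derive1 f z).
Proof. by move=> h /h [l dl]; rewrite (dC_derive1 dl). Qed.

Definition dquot f a z := if z == a then derive1 f a else (f z - f a) / (z - a).

Lemma dquotE f a z : f z = f a + (z - a) * dquot f a z.
Proof.
rewrite /dquot; case: eqP => [->|/eqP za]; first by rewrite subrr mul0r addr0.
by rewrite mulrC divfK ?subr_eq0 // addrC subrK.
Qed.

Lemma holC_near_eq U f g z : open U -> U z -> (forall w, U w -> f w = g w) ->
  (exists l, dC f z l) -> exists l, dC g z l.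
Proof.
move=> oU Uz e [l dl]; exists l; apply: dC_near dl; apply: filterS e _.
exact: open_nbhs_nbhs.
Qed.

(** A removable singularity: the quotient is continuous at [a], so it has a primitive on a disc, and
    the derivative of that primitive is holomorphic. *)
Lemma holC_dquot U f a : open U -> U a -> holC U f -> holC U (dquot f a).
Proof.
move=> oU Ua hf; have off w : U w -> w != a -> exists l, dC (dquot f a) w l.
  move=> Uw wa; have [m dm] := hf w Uw; eexists.
  have n0 : w - a != 0 by rewrite subr_eq0.
  apply: dC_near (dCM (dCB dm (dC_cst (f a) w)) (@dCV _ (fun v => v - a) _ _ n0 (dCB (dC_id w) (dC_cst a w)))).
  apply/near_disc; exists (normc (w - a)); first by rewrite normc_gt0.
  move=> v hv; rewrite /dquot ifN //; apply: contraTneq hv => ->.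
  by rewrite /disc /= normcB ltxx.
have ca : ccont (dquot f a) a.
  have [q [cq qa hq]] := holC_dC hf Ua.
  apply: ccont_near cq; apply: near_cplxW => w; rewrite /dquot; case: eqP => [->//|/eqP wa].
  by rewrite hq mulrC mulKf // subr_eq0.
have [r r0 hr] := (open_cplx U).1 oU a Ua.
have cD w : disc a r w -> ccont (dquot f a) w.
  move=> /hr Uw; have [->//|wa] := eqVneq w a.
  by have [m] := off _ Uw wa; exact: dC_cont.
have [F hF] := disc_primitive (disc_center a r0) cD (fun w Dw => off w (hr w Dw)).
move=> w Uw; have [->|wa] := eqVneq w a; last exact: off.
have hF1 : holC (disc a r) F by move=> v /hF; exists (dquot f a v).
have [l dl] := holC_derive1 (@disc_open a r) hF1 (disc_center a r0).
exists l; apply: dC_near dl; apply/near_disc; exists r => // v Dv.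
exact: dC_derive1 (hF _ Dv).
Qed.

Lemma holC_cst U c : holC U (fun _ => c). Proof. by move=> z _; exists 0; exact: dC_cst. Qed.
Lemma holC_id U : holC U id. Proof. by move=> z _; exists 1; exact: dC_id. Qed.
Lemma holCD U f g : holC U f -> holC U g -> holC U (fun z => f z + g z).
Proof. by move=> h k z Uz; have [l hl] := h z Uz; have [m hm] := k z Uz; exists (l + m); exact: dCD. Qed.
Lemma holCN U f : holC U f -> holC U (fun z => - f z).
Proof. by move=> h z Uz; have [l hl] := h z Uz; exists (- l); exact: dCN. Qed.
Lemma holCB U f g : holC U f -> holC U g -> holC U (fun z => f z - g z).
Proof. by move=> h k; apply: holCD => //; exact: holCN. Qed.
Lemma holCM U f g : holC U f -> holC U g -> holC U (fun z => f z * g z).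
Proof.
move=> h k z Uz; have [l hl] := h z Uz; have [m hm] := k z Uz.
by exists (l * g z + f z * m); exact: dCM.
Qed.
Lemma holCV U f : holC U f -> (forall z, U z -> f z != 0) -> holC U (fun z => (f z)^-1).
Proof. by move=> h k z Uz; have [l hl] := h z Uz; exists (- l / f z ^+ 2); apply: dCV hl; exact: k. Qed.

Lemma circ_bounded c r f rho : holC (disc c r) f -> 0 < rho < r ->
  exists2 M, 0 < M & forall t, in01 t -> normc (f (circ c rho t)) <= M.
Proof.
move=> hf /andP[r0 rr]; apply: cont01_normc_bound; apply: cont01_circ => t.
by apply: holC_cont hf _; apply: circ_disc => //; exact: ltW.
Qed.

Lemma cauchy_estimate c r f rho z (M : R) : holC (disc c r) f -> 0 < rho < r ->
  normc (z - c) < rho -> (forall t, in01 t -> normc (f (circ c rho t)) <= M) ->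
  normc (f z) <= M * (rho / (rho - normc (z - c))).
Proof.
move=> hf rr hz hM; rewrite -(cauchy_formula hf rr hz).
have rho0 : 0 < rho by case/andP: rr.
have cf : cont01 (fun t => f (circ c rho t)).
  apply: cont01_circ => t; apply: holC_cont hf _.
  by apply: circ_disc; [exact: ltW|case/andP: rr].
have d0 : 0 < rho - normc (z - c) by rewrite subr_gt0.
apply: I01_norm.
  apply: cont01M; first by apply: cont01M => //; exact: cont01_rz.
  move=> t _; apply: ccontV; first exact: circ_neq.
  by apply: ccontB; [exact: ccont_circ|exact: ccont_cst].
move=> t ht; rewrite !normcM normc_zeta mulr1 normcR ger0_norm ?(ltW rho0) // -mulrA.
apply: ler_pM; rewrite ?normc_ge0 ?hM ?mulr_ge0 ?normc_ge0 ?(ltW rho0) //.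
rewrite normcV ler_pM2l // lef_pV2 ?posrE ?normc_gt0 ?circ_neq //.
exact: circ_far.
Qed.

(** If every power of [z - c] can be split off, Cauchy's estimate for the cofactors bounds [f z] by
    a constant times [(normc (z - c) / rho)^n] for all [n], so [f z = 0]. *)
Lemma holC_factor c r f : 0 < r -> holC (disc c r) f ->
  (forall z, disc c r z -> f z = 0) \/
  exists n g, [/\ holC (disc c r) g, g c != 0 & forall z, f z = (z - c) ^+ n * g z].
Proof.
move=> r0 hf.
have [h|h] := pselect (exists n g, [/\ holC (disc c r) g, g c != 0 &
   forall z, f z = (z - c) ^+ n * g z]); [by right|left].
have all n : exists g, holC (disc c r) g /\ forall z, f z = (z - c) ^+ n * g z.
  elim: n => [|n [g [hg fg]]].
    by exists f; split => // z; rewrite expr0 mul1r.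
  have gc : g c = 0 by apply/eqP; apply: contrapT => /negP gc; apply: h; exists n, g.
  exists (dquot g c); split.
    exact: holC_dquot (@disc_open c r) (disc_center c r0) hg.
  by move=> z; rewrite fg (dquotE g c z) gc add0r exprSr mulrA.
move=> z Dz; pose rho := (normc (z - c) + r) / 2.
have hz : normc (z - c) < rho by move: Dz; rewrite /disc /rho /=; lra.
have rr : 0 < rho < r.
  by move: Dz; rewrite /disc /rho /=; have := normc_ge0 (z - c); lra.
have rho0 : 0 < rho by case/andP: rr.
have [M M0 hM] := circ_bounded hf rr.
set K := rho / (rho - normc (z - c)).
have K0 : 0 < K by rewrite divr_gt0 // subr_gt0.
have bound n : normc (f z) <= (M * K) * (normc (z - c) / rho) ^+ n.
  have [g [hg fg]] := all n.
  have hMg t : in01 t -> normc (g (circ c rho t)) <= M / rho ^+ n.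
    move=> ht; rewrite ler_pdivlMr ?exprn_gt0 // mulrC -{1}(circ_sub c t (ltW rho0)).
    by rewrite -normcX -normcM -fg hM.
  have := cauchy_estimate hg rr hz hMg; rewrite -/K => hh.
  rewrite fg normcM normcX expr_div_n.
  have -> : M * K * (normc (z - c) ^+ n / rho ^+ n) = normc (z - c) ^+ n * (M / rho ^+ n * K).
    by ring.
  by apply: ler_wpM2l => //; rewrite exprn_ge0 ?normc_ge0.
have q01 : `|normc (z - c) / rho| < 1.
  have h0 : 0 <= normc (z - c) / rho by apply: divr_ge0; [exact: normc_ge0|exact: ltW].
  by rewrite (ger0_norm h0) ltr_pdivrMr // mul1r.
apply/eqP; rewrite -normc_eq0 eq_le normc_ge0 andbT.
apply/ler_addgt0Pl => e e0; rewrite addr0.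
have : (fun n => (M * K) * (normc (z - c) / rho) ^+ n) @ \oo --> (0 : R) by exact: cvg_geometric.
move=> /cvgrPdist_lt /(_ e e0) [N _ /(_ N (leqnn N)) /=].
rewrite sub0r normrN => hN; apply: le_trans (bound N) _; apply/ltW.
exact: le_lt_trans (ler_norm _) hN.
Qed.

Lemma root_exists (n : nat) (b : C) : (0 < n)%N -> exists u : C, u ^+ n = b.
Proof. by move=> n0; exists (n.-root b : R[i]); exact: (@rootCK R[i] n n0 b). Qed.

(** Near [c] a nonconstant [f] behaves as [f c + g c * (z - c)^n], and some direction makes the
    second term positive. *)
Lemma max_principle_local c r f : 0 < r -> holC (disc c r) f ->
  (forall z, disc c r z -> re (f z) <= re (f c)) -> forall z, disc c r z -> f z = f c.
Proof.
move=> r0 hf hmax.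
have hg : holC (disc c r) (fun z => f z - f c) by apply: holCB => //; exact: holC_cst.
have [h z /h /eqP|] := holC_factor r0 hg; first by rewrite subr_eq0 => /eqP.
move=> [n [g [hg' gc fg]]]; exfalso.
have n0 : (0 < n)%N.
  rewrite lt0n; apply: contra gc => /eqP n0; have := fg c.
  by rewrite subrr n0 expr0 mul1r => <-.
(* In the direction [u] the leading term is a positive multiple of [g c * conjc (g c)]. *)
have [u hu] := root_exists (conjc (g c)) n0.
have gc0 : 0 < normc (g c) by rewrite normc_gt0.
have u0 : 0 < normc u.
  rewrite normc_gt0; apply/eqP => u0; move: hu; rewrite u0 expr0n gtn_eqF //= => /esym/eqP.
  by rewrite conjc_eq0 (negbTE gc).
have un0 : 0 < normc (u ^+ n) by rewrite normcX exprn_gt0.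
have [d d0 hd] := (ccontP g c).1 (holC_cont hg' (disc_center c r0)) _
   (divr_gt0 (exprn_gt0 2 gc0) un0).
(* The step length keeps [z] in the disc and the error [u^n (g z - g c)] below the square of
   [normc (g c)]. *)
pose s := Num.min d r / (2 * normc u).
have md : 0 < Num.min d r by rewrite lt_min d0.
have s0 : 0 < s by rewrite divr_gt0 // mulr_gt0.
pose z := c + s%:C * u.
have zc : normc (z - c) = Num.min d r / 2.
  rewrite /z addrAC subrr add0r normcM normcR ger0_norm ?(ltW s0) // /s.
  by field; rewrite gt_eqF.
have m1 : Num.min d r <= d by rewrite ge_min lexx.
have m2 : Num.min d r <= r by rewrite ge_min lexx orbT.
have Dz : disc c r z by rewrite /disc /= zc; lra.
have gz : normc (g z - g c) < normc (g c) ^+ 2 / normc (u ^+ n) by apply: hd; rewrite zc; lra.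
have := hmax _ Dz; rewrite -subr_le0 -ReB fg.
have -> : z - c = s%:C * u by rewrite /z addrAC subrr add0r.
rewrite exprMn -mulrA -rmorphXn ReMr pmulr_rle0 ?exprn_gt0 //.
have -> : u ^+ n * g z = g c * conjc (g c) + u ^+ n * (g z - g c) by rewrite hu; ring.
rewrite mulcJ ReD /=; apply/negP; rewrite -ltNge.
have h1 : `|re (u ^+ n * (g z - g c))| < normc (g c) ^+ 2.
  apply: le_lt_trans (normc_ge_normRe _) _; rewrite normcM.
  by rewrite -ltr_pdivlMl // mulrC.
by move: h1; rewrite ltr_norml => /andP[h1 _]; lra.
Qed.

End CauchyFormula.

(** * Poisson integrals and inequalities for harmonic functions *)

Section Poisson.
Context {R : realType}.
Local Notation C := (Cplx R).
Implicit Types (z w a b c : C) (f F g : C -> C) (U : set C) (r rho : R) (phi psi : C -> R).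

Lemma rcont_cst {T : topologicalType} (k : R) (x : T) : {for x, continuous (fun _ : T => k)}.
Proof. by apply/rcontP => e e0; apply: filterE => y; rewrite subrr normr0. Qed.

Lemma I01_re_le (g h : R -> C) : cont01 g -> cont01 h ->
  (forall t, in01 t -> re (g t) <= re (h t)) -> re (I01 g) <= re (I01 h).
Proof.
move=> cg ch e; rewrite -subr_ge0 -ReB -I01B //; apply: I01_re_ge0; first exact: cont01B.
by move=> t ht; rewrite ReB subr_ge0 e.
Qed.

Lemma I01_re_ext (g h : R -> C) : cont01 g -> cont01 h ->
  (forall t, in01 t -> re (g t) = re (h t)) -> re (I01 g) = re (I01 h).
Proof.
move=> cg ch e; apply: le_anti; apply/andP.
by split; apply: I01_re_le => // t /e ->.
Qed.

Lemma normc_sub_sqr (a b : C) :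
  normc (a - b) ^+ 2 = normc a ^+ 2 + normc b ^+ 2 - 2 * re (conjc b * a).
Proof. by rewrite !sqr_normcE ReB ImB; case: a b => x y [x' y'] /=; ring. Qed.

Section Disc.
Variables (c : C) (rho : R).
Hypothesis rho0 : 0 < rho.
Local Notation gam := (circ c rho).

(** This is [((gam t - c) + (z - c)) / (gam t - z)], whose real part is the Poisson kernel
    ([re_kernel]). A Poisson integral is therefore the real part of a holomorphic function by
    construction. *)
Definition schwarz_kernel z (t : R) : C := 2 * (rho%:C * zeta t / (gam t - z)) - 1.
Definition poisF phi z : C := I01 (fun t => (phi (gam t))%:C * schwarz_kernel z t).
Definition pois phi z : R := re (poisF phi z).

Definition circ_cont phi := forall z, normc (z - c) = rho -> {for z, continuous phi}.

Lemma cont01_phi phi : circ_cont phi -> cont01 (fun t => (phi (gam t))%:C).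
Proof.
move=> h t _; apply: (@rcomp_ccont _ _ (fun t => phi (gam t)) (fun x : R => x%:C)).
  apply: rcont_ccomp; last exact: ccont_circ.
  by apply: h; rewrite circ_sub // ltW.
exact: ccont_real.
Qed.

Lemma cont01_cauchyk z : normc (z - c) < rho -> cont01 (fun t => rho%:C * zeta t / (gam t - z)).
Proof.
move=> hz; apply: cont01M; first exact: cont01_rz.
move=> t _; apply: ccontV; first exact: circ_neq.
by apply: ccontB; [exact: ccont_circ|exact: ccont_cst].
Qed.

Lemma cont01_kernel z : normc (z - c) < rho -> cont01 (schwarz_kernel z).
Proof.
move=> hz; apply: cont01B; last exact: cont01_cst.
by apply: cont01M; [exact: cont01_cst|exact: cont01_cauchyk].
Qed.

Lemma holC_poisF phi : circ_cont phi -> holC (disc c rho) (poisF phi).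
Proof.
move=> hp z Dz; have hz : normc (z - c) < rho by [].
have d0 : 0 < rho - normc (z - c) by rewrite subr_gt0.
have cp := cont01_phi hp.
have cc : cont01 gam by move=> t _; exact: ccont_circ.
pose g t : C := (phi (gam t))%:C * (2 * (rho%:C * zeta t)).
have cg : cont01 g.
  by apply: cont01M => //; apply: cont01M; [exact: cont01_cst|exact: cont01_rz].
have h := cauchy_transform_dC cg cc d0 (fun t _ => circ_far c z t rho0).
eexists; apply: dC_near (dCB h (dC_cst (I01 (fun t => (phi (gam t))%:C)) z)).
apply/near_disc; exists (rho - normc (z - c)) => // w hw.
have hw' : normc (w - c) < rho.
  have -> : w - c = (w - z) + (z - c) by ring.
  by apply: le_lt_trans (le_normcD _ _) _; rewrite -ltrBrDr.
rewrite -I01B //.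
  by apply: I01_ext => t _; rewrite /g /schwarz_kernel; ring.
apply: cont01M => // t _; apply: ccontV; first exact: circ_neq.
by apply: ccontB; [exact: ccont_circ|exact: ccont_cst].
Qed.

Lemma re_kernel z t : normc (z - c) < rho ->
  re (schwarz_kernel z t) = (rho ^+ 2 - normc (z - c) ^+ 2) / normc (gam t - z) ^+ 2.
Proof.
move=> hz; have n0 := circ_neq t rho0 hz; have n1 : normc (gam t - z) != 0 by rewrite normc_eq0.
have e1 : rho%:C * zeta t = (gam t - z) + (z - c) by rewrite /circ; ring.
have e2 : schwarz_kernel z t = 1 + 2 * ((z - c) / (gam t - z)).
  by rewrite /schwarz_kernel e1; field.
have e3 : (z - c) / (gam t - z) = ((normc (gam t - z) ^+ 2)^-1)%:C * ((z - c) * conjc (gam t - z)).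
  apply: (mulIf n0); rewrite divfK // -!mulrA [conjc _ * _]mulrC mulcJ mulrCA -rmorphM.
  by rewrite mulVf ?mulr1 // expf_neq0.
have e4 : rho ^+ 2 = normc (gam t - z) ^+ 2 + normc (z - c) ^+ 2
    + 2 * re ((z - c) * conjc (gam t - z)).
  rewrite -{1}(@circ_sub _ c rho t (ltW rho0)).
  have -> : gam t - c = (gam t - z) + (z - c) by ring.
  rewrite !sqr_normcE; case: (gam t - z) => x y; case: (z - c) => x' y' /=; ring.
rewrite e2 ReD -(rmorph_nat (real_complex R) 2) ReMr e3 ReMr e4 /=.
by field.
Qed.

Lemma re_kernel_ge0 z t : normc (z - c) < rho -> 0 <= re (schwarz_kernel z t).
Proof.
move=> hz; rewrite re_kernel //; apply: divr_ge0; last by rewrite sqr_ge0.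
by rewrite subr_ge0 ler_sqr ?nnegrE ?normc_ge0 ?(ltW rho0) // ltW.
Qed.

Lemma pois_le phi psi z : circ_cont phi -> circ_cont psi -> normc (z - c) < rho ->
  (forall w, normc (w - c) = rho -> phi w <= psi w) -> pois phi z <= pois psi z.
Proof.
move=> hp hq hz h; apply: I01_re_le; first exact: cont01M (cont01_phi hp) (cont01_kernel hz).
  exact: cont01M (cont01_phi hq) (cont01_kernel hz).
move=> t _; rewrite !ReMr; apply: ler_wpM2r; first exact: re_kernel_ge0.
by apply: h; rewrite circ_sub // ltW.
Qed.

(** The Poisson kernel equals the Cauchy kernel plus its conjugate minus 1. The Cauchy part
    reproduces [f z]; the other two contribute [f c - f c]. *)
Lemma pois_hol r f z : rho < r -> holC (disc c r) f -> normc (z - c) < rho ->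
  pois (fun w => re (f w)) z = re (f z).
Proof.
move=> rr hf hz; have r1 : 0 < rho < r by rewrite rho0.
have cf : cont01 (fun t => f (gam t)).
  by apply: cont01_circ => t; apply: holC_cont hf _; apply: circ_disc => //; exact: ltW.
have ck := cont01_kernel hz; have cck := cont01_cauchyk hz.
have cphi : cont01 (fun t => (re (f (gam t)))%:C).
  move=> t ht; apply: ccont_Complex; first exact: ccont_Re (cf t ht).
  exact: rcont_cst.
(* On the circle this agrees with the conjugate of the Cauchy kernel, and it is holomorphic up to
   the mirror image of [z] in the circle. *)
pose h w := rho%:C ^+ 2 / (rho%:C ^+ 2 - conjc (z - c) * (w - c)).
(* A radius slightly above [rho] that leaves the pole of [h] outside. *)
have [r' r'0 hr'] : exists2 r', rho < r' < r & normc (z - c) * r' < rho ^+ 2.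
  pose e := (rho - normc (z - c)) / (2 * (normc (z - c) + 1)) * rho.
  have n0 := normc_ge0 (z - c).
  have e0 : 0 < e by rewrite /e mulr_gt0 // divr_gt0 ?subr_gt0 //; lra.
  exists (Num.min ((rho + r) / 2) (rho + e)).
    by rewrite lt_min gt_min; apply/andP; split; [apply/andP; split; lra|apply/orP; left; lra].
  apply: le_lt_trans (_ : normc (z - c) * (rho + e) < _).
    by apply: ler_wpM2l => //; rewrite ge_min lexx orbT.
  have -> : rho ^+ 2 = normc (z - c) * rho + (rho - normc (z - c)) * rho by ring.
  rewrite mulrDr ltrD2l /e mulrA ltr_pM2r //.
  have -> : normc (z - c) * ((rho - normc (z - c)) / (2 * (normc (z - c) + 1))) =
     (rho - normc (z - c)) * (normc (z - c) / (2 * (normc (z - c) + 1))) by ring.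
  rewrite gtr_pMr ?subr_gt0 // ltr_pdivrMr ?mul1r; lra.
have /andP[r'1 r'2] := r'0.
have hden w : disc c r' w -> rho%:C ^+ 2 - conjc (z - c) * (w - c) != 0.
  move=> hw; rewrite subr_eq0; apply/eqP => e.
  have : normc (rho%:C ^+ 2) <= normc (z - c) * r'.
    rewrite e normcM normcJ; apply: ler_wpM2l; rewrite ?normc_ge0 //; exact: ltW.
  by rewrite normcX normcR real_normK ?num_real //; lra.
have hh : holC (disc c r') h.
  apply: holCM; first exact: holC_cst.
  apply: holCV => //; apply: holCB; first exact: holC_cst.
  by apply: holCM; [exact: holC_cst|apply: holCB; [exact: holC_id|exact: holC_cst]].
have hf' : holC (disc c r') f.
  by apply: holC_sub hf => w; rewrite /disc /= => hw; apply: lt_trans hw r'2.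
have r1' : 0 < rho < r' by rewrite rho0.
have cc0 : normc (c - c) < rho by rewrite subrr normc0.
have gc t : gam t - c = rho%:C * zeta t by rewrite /circ addrAC subrr add0r.
have z0 t : rho%:C * zeta t != 0 by rewrite -gc; exact: circ_neq.
have ctr F : holC (disc c r') F -> I01 (fun t => F (gam t)) = F c.
  move=> hF; rewrite -(cauchy_formula hF r1' cc0); apply: I01_ext => t _.
  by rewrite gc mulfK.
have hE t : h (gam t) = conjc (rho%:C * zeta t / (gam t - z)).
  rewrite /h -(gc t) rmorphM fmorphV /=.
  have hm : (rho%:C) ^+ 2 = (gam t - c) * conjc (gam t - c) :> C.
    by rewrite mulcJ circ_sub ?(ltW rho0) // rmorphXn.
  have e : conjc (gam t - z) = conjc (gam t - c) - conjc (z - c).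
    by rewrite -rmorphB; congr conjc; ring.
  have d1 : gam t - c != 0 by rewrite gc.
  have d2 : conjc (gam t - z) != 0 by rewrite conjc_eq0; exact: circ_neq.
  rewrite hm; have -> : (gam t - c) * conjc (gam t - c) - conjc (z - c) * (gam t - c) =
     (gam t - c) * conjc (gam t - z) by rewrite e; ring.
  by rewrite invfM mulrACA divff // mul1r.
have ch : cont01 (fun t => h (gam t)).
  by apply: cont01_circ => t; apply: holC_cont hh _; apply: circ_disc => //; exact: ltW.
have eK : f z = I01 (fun t => f (gam t) * (rho%:C * zeta t / (gam t - z) + h (gam t) - 1)).
  rewrite (@I01_ext _ _ (fun t => f (gam t) * (rho%:C * zeta t) / (gam t - z)
      + (f (gam t) * h (gam t) - f (gam t)))); last by move=> t _; ring.
  have cA : cont01 (fun t => f (gam t) * (rho%:C * zeta t) / (gam t - z)).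
    move=> t ht; apply: (@ccont_near _ _ (fun t => f (gam t) * (rho%:C * zeta t / (gam t - z)))).
      by apply: filterE => s; rewrite mulrA.
    by apply: ccontM; [exact: cf|exact: cck].
  have cB : cont01 (fun t => f (gam t) * h (gam t)) by exact: cont01M.
  rewrite I01D // ?I01B //; last exact: cont01B.
  rewrite (cauchy_formula hf r1 hz) (ctr (fun w => f w * h w)) ?ctr //; last exact: holCM.
  have -> : h c = 1.
    rewrite /h subrr mulr0 subr0 divff // expf_neq0 //.
    by rewrite eq_complex /= eqxx andbT gt_eqF.
  by rewrite mulr1 subrr addr0.
rewrite [in RHS]eK; apply: I01_re_ext; first exact: cont01M.
  by apply: cont01M => //; apply: cont01B; [exact: cont01D|exact: cont01_cst].
move=> t _; rewrite hE /schwarz_kernel.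
case: (rho%:C * zeta t / (gam t - z)) => x y; case: (f (gam t)) => p q.
rewrite (mulr_natl _ 2) mulr2n ReMr ReM !ReB !ReD ImB ImD /=; ring.
Qed.

Lemma pois_cst k z : normc (z - c) < rho -> pois (fun _ => k) z = k.
Proof.
move=> hz; have r1 : rho < rho + 1 by lra.
exact: (@pois_hol _ (fun _ => k%:C) z r1 (@holC_cst _ _ _) hz).
Qed.

Lemma poisD phi psi z : circ_cont phi -> circ_cont psi -> normc (z - c) < rho ->
  pois (fun w => phi w + psi w) z = pois phi z + pois psi z.
Proof.
move=> hp hq hz; rewrite /pois -ReD /poisF -I01D.
- by congr complex.Re; apply: I01_ext => t _; rewrite rmorphD mulrDl.
- exact: cont01M (cont01_phi hp) (cont01_kernel hz).
- exact: cont01M (cont01_phi hq) (cont01_kernel hz).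
Qed.

Lemma poisZ k phi z : circ_cont phi -> normc (z - c) < rho ->
  pois (fun w => k * phi w) z = k * pois phi z.
Proof.
move=> hp hz; rewrite /pois -ReMr /poisF -I01Z.
  by congr complex.Re; apply: I01_ext => t _; rewrite rmorphM mulrA.
exact: cont01M (cont01_phi hp) (cont01_kernel hz).
Qed.

Lemma circ_cont_dist z0 : circ_cont (fun w => normc (w - z0) ^+ 2).
Proof.
move=> z _; have h : {for z, continuous (fun w : C => normc (w - z0))}.
  by apply: ccont_normc; apply: ccontB; [exact: ccont_id|exact: ccont_cst].
have -> : (fun w : C => normc (w - z0) ^+ 2) = (fun w => normc (w - z0) * normc (w - z0)).
  by apply/funext => w; rewrite expr2.
exact: (continuousM h h).
Qed.

(** On the circle the square of the distance to [z0] is the real part of an affine function, for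
    which [pois_hol] gives the Poisson integral. *)
Lemma pois_dist z0 z : normc (z0 - c) = rho -> normc (z - c) < rho ->
  pois (fun w => normc (w - z0) ^+ 2) z = 2 * (rho * rho - re (conjc (z0 - c) * (z - c))).
Proof.
move=> h0 hz; have r1 : rho < rho + 1 by lra.
pose f w : C := (2 * (rho * rho))%:C - 2%:C * (conjc (z0 - c) * (w - c)).
have hf : holC (disc c (rho + 1)) f.
  apply: holCB; first exact: holC_cst.
  apply: holCM; first exact: holC_cst.
  by apply: holCM; [exact: holC_cst|apply: holCB; [exact: holC_id|exact: holC_cst]].
have -> : 2 * (rho * rho - re (conjc (z0 - c) * (z - c))) = re (f z).
  by rewrite /f ReB ReMr /=; ring.
rewrite -(pois_hol r1 hf hz); apply: I01_re_ext.
- exact: cont01M (cont01_phi (@circ_cont_dist z0)) (cont01_kernel hz).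
- apply: cont01M (cont01_kernel hz); apply: (@cont01_phi (fun w => re (f w))) => w hw.
  apply: ccont_Re; apply: holC_cont hf _; rewrite /disc /= hw; lra.
move=> t _; rewrite !ReMr; congr (_ * _).
have := @circ_sub _ c rho t (ltW rho0); set w := gam t => hw.
have -> : w - z0 = (w - c) - (z0 - c) by ring.
by rewrite normc_sub_sqr hw h0 /f ReB ReMr /=; ring.
Qed.

Lemma pois_le_circ phi psi z : circ_cont phi -> circ_cont psi -> normc (z - c) < rho ->
  (forall t, in01 t -> phi (gam t) <= psi (gam t)) -> pois phi z <= pois psi z.
Proof.
move=> hp hq hz h; apply: I01_re_le; first exact: cont01M (cont01_phi hp) (cont01_kernel hz).
  exact: cont01M (cont01_phi hq) (cont01_kernel hz).
move=> t ht; rewrite !ReMr; apply: ler_wpM2r; first exact: re_kernel_ge0.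
exact: h.
Qed.

Lemma circ_contD phi psi : circ_cont phi -> circ_cont psi -> circ_cont (fun w => phi w + psi w).
Proof. by move=> h k z hz; apply: continuousD; [exact: h|exact: k]. Qed.

Lemma circ_contZ k phi : circ_cont phi -> circ_cont (fun w => k * phi w).
Proof. by move=> h z hz; apply: continuousM; [exact: rcont_cst|exact: h]. Qed.

Lemma circ_cont_cst k : circ_cont (fun _ => k).
Proof. by move=> z _; exact: rcont_cst. Qed.

(* [phi <= phi z0 + e/2 + K |w - z0|^2] on the circle, and the right-hand side
   has an explicit Poisson extension. *)
Lemma pois_boundary_le phi z0 : circ_cont phi -> normc (z0 - c) = rho ->
  forall e, 0 < e -> exists2 d, 0 < d & forall z, normc (z - c) < rho -> normc (z - z0) < d ->
    pois phi z < phi z0 + e.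
Proof.
move=> hp h0 e e0; have e2 : 0 < e / 2 by rewrite divr_gt0.
have [d d0 hd] := (rcont_cplx phi z0).1 (hp _ h0) _ e2.
have [M M0 hM] := cont01_normc_bound (cont01_phi hp).
pose K := (M + `|phi z0|) / d ^+ 2.
have K0 : 0 < K by rewrite divr_gt0 ?exprn_gt0 // ltr_wpDr.
pose psi w := (phi z0 + e / 2) + K * normc (w - z0) ^+ 2.
have cdist := @circ_contZ K _ (@circ_cont_dist z0).
have cpsi : circ_cont psi by apply: circ_contD => //; exact: circ_cont_cst.
have hle t : in01 t -> phi (gam t) <= psi (gam t).
  move=> ht; rewrite /psi; have [h|h] := ltP (normc (gam t - z0)) d.
    have := hd _ h; rewrite ltr_norml => /andP[_ h1].
    have : 0 <= K * normc (gam t - z0) ^+ 2 by rewrite mulr_ge0 ?sqr_ge0 // ltW.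
    by lra.
  have : phi (gam t) <= M.
    by apply: le_trans (hM _ ht); rewrite normcR ler_norm.
  have : M + `|phi z0| <= K * normc (gam t - z0) ^+ 2.
    rewrite /K -{1}(@divfK _ (d ^+ 2) _ (M + `|phi z0|)) ?gt_eqF ?exprn_gt0 //.
    apply: ler_wpM2l; first exact: ltW.
    by rewrite ler_sqr ?nnegrE ?normc_ge0 // ltW.
  have := ler_norm (- phi z0); rewrite normrN; lra.
have rn0 : 0 < 2 * K * rho by rewrite mulr_gt0 // mulr_gt0.
exists (e / (2 * (2 * K * rho))); first by rewrite divr_gt0 // mulr_gt0.
move=> z hz hzz; apply: le_lt_trans (pois_le_circ hp cpsi hz hle) _.
rewrite poisD //; last exact: circ_cont_cst.
rewrite pois_cst // poisZ //; last exact: circ_cont_dist.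
rewrite pois_dist //.
have -> : rho * rho - re (conjc (z0 - c) * (z - c)) = re (conjc (z0 - c) * (z0 - z)).
  have -> : conjc (z0 - c) * (z0 - z) = (z0 - c) * conjc (z0 - c) - conjc (z0 - c) * (z - c) by ring.
  by rewrite mulcJ h0 ReB /= expr2.
have h1 : re (conjc (z0 - c) * (z0 - z)) <= rho * normc (z - z0).
  apply: le_trans (ler_norm _) _; apply: le_trans (normc_ge_normRe _) _.
  by rewrite normcM normcJ h0 (normcB z0 z).
have h2 : 2 * K * rho * normc (z - z0) < e / 2.
  have r4 : 0 < 2 * (2 * K * rho) by rewrite mulr_gt0.
  move: hzz; rewrite (ltr_pdivlMr _ _ r4) => h3; lra.
have h3 : K * (2 * re (conjc (z0 - c) * (z0 - z))) <= 2 * K * rho * normc (z - z0).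
  have -> : 2 * K * rho * normc (z - z0) = K * (2 * (rho * normc (z - z0))) by ring.
  by rewrite ler_pM2l // ler_pM2l.
lra.
Qed.

Lemma poisN phi z : circ_cont phi -> normc (z - c) < rho ->
  pois (fun w => - phi w) z = - pois phi z.
Proof.
move=> hp hz; rewrite -mulN1r -poisZ //; congr pois; apply/funext => w.
by rewrite mulN1r.
Qed.

Lemma pois_boundary phi z0 : circ_cont phi -> normc (z0 - c) = rho ->
  forall e, 0 < e -> exists2 d, 0 < d & forall z, normc (z - c) < rho -> normc (z - z0) < d ->
    `|pois phi z - phi z0| < e.
Proof.
move=> hp h0 e e0; have [d d0 hd] := pois_boundary_le hp h0 e0.
have hn : circ_cont (fun w => - phi w).
  by move=> z hz; apply: continuousN; exact: hp.
have [d' d'0 hd'] := pois_boundary_le hn h0 e0.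
exists (Num.min d d'); first by rewrite lt_min d0.
move=> z hz; rewrite lt_min => /andP[h1 h2].
have := hd z hz h1; have := hd' z hz h2; rewrite poisN // => k1 k2.
by rewrite ltr_norml; apply/andP; split; lra.
Qed.

End Disc.

(** The modulus is linearized by pairing with [conjc (f z)]: the real part of [conjc (f z) * f] is
    bounded on the circle and takes the value [normc (f z) ^+ 2] at [z]. *)
Lemma max_modulus c r rho f z (M : R) : 0 < rho < r -> holC (disc c r) f ->
  (forall w, normc (w - c) = rho -> normc (f w) <= M) -> normc (z - c) < rho -> normc (f z) <= M.
Proof.
move=> /andP[rho0 rr] hf hM hz.
have [->|fz] := eqVneq (f z) 0.
  rewrite normc0; apply: le_trans (hM (circ c rho 0) _); first exact: normc_ge0.
  by rewrite circ_sub // ltW.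
have n0 : 0 < normc (f z) by rewrite normc_gt0.
rewrite -(ler_pM2l n0) -expr2.
have -> : normc (f z) ^+ 2 = re (conjc (f z) * f z) by rewrite mulrC mulcJ.
have hg : holC (disc c r) (fun w => conjc (f z) * f w) by apply: holCM => //; exact: holC_cst.
have cc w : normc (w - c) = rho -> {for w, continuous (fun w => re (conjc (f z) * f w))}.
  move=> hw; apply: ccont_Re; apply: holC_cont hg _; by rewrite /disc /= hw.
rewrite -(pois_hol rho0 rr hg hz) -[X in _ <= X](pois_cst rho0 _ hz).
apply: pois_le => //; first exact: circ_cont_cst.
move=> w hw; apply: le_trans (ler_norm _) _; apply: le_trans (normc_ge_normRe _) _.
by rewrite normcM normcJ ler_pM2l // hM.
Qed.

(* Schwarz's lemma after a Cayley transform *)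
Lemma schwarz_cayley c rho F z : 0 < rho -> holC (disc c rho) F ->
  (forall w, disc c rho w -> 0 <= re (F w)) -> disc c rho z ->
  rho * normc (F z - F c) <= normc (z - c) * normc (F z + conjc (F c)).
Proof.
move=> rho0 hF hpos Dz; have Dc := disc_center c rho0.
have [Fc|Fc] := eqVneq (re (F c)) 0.
  suff -> : F z = F c by rewrite subrr normc0 mulr0 mulr_ge0 ?normc_ge0.
  have hN : holC (disc c rho) (fun w => - F w) by exact: holCN.
  apply: oppr_inj; apply: (max_principle_local rho0 hN _ Dz) => w Dw.
  by rewrite !ReN Fc oppr0 oppr_le0 hpos.
have Fc0 : 0 < re (F c) by rewrite lt_neqAle eq_sym Fc hpos.
have den w : disc c rho w -> F w + conjc (F c) != 0.
  move=> Dw; apply/eqP => /(congr1 (@complex.Re R)); rewrite ReD /=.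
  have -> : re (conjc (F c)) = re (F c) by case: (F c).
  by have := hpos _ Dw; lra.
pose h w := (F w - F c) / (F w + conjc (F c)).
have hh : holC (disc c rho) h.
  apply: holCM; first by apply: holCB => //; exact: holC_cst.
  by apply: holCV => //; apply: holCD => //; exact: holC_cst.
have h1 w : disc c rho w -> normc (h w) <= 1.
  move=> Dw; rewrite /h normcM normcV ler_pdivrMr ?normc_gt0 ?den // mul1r.
  rewrite -ler_sqr ?nnegrE ?normc_ge0 // !sqr_normcE.
  have := hpos _ Dw; move: Fc0; case: (F w) => a b; case: (F c) => a' b' /= h1 h2.
  rewrite -subr_ge0; have -> : (a + a') ^+ 2 + (b - b') ^+ 2 - ((a - a') ^+ 2 + (b - b') ^+ 2) = 4 * (a * a').
    by ring.
  by rewrite !mulr_ge0 // ltW.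
have hc : h c = 0 by rewrite /h subrr mul0r.
pose k := dquot h c; have hk : holC (disc c rho) k by exact: holC_dquot (@disc_open _ c rho) Dc hh.
have hE w : h w = (w - c) * k w by rewrite (dquotE h c w) hc add0r.
have kb : rho * normc (k z) <= 1.
  apply/ler_addgt0Pr => e e0.
  (* On the circle of radius [s] the factor [k] is bounded by [1 / s], and [s] is so close to [rho]
     that [rho / s <= 1 + e]. *)
  pose s := Num.max ((normc (z - c) + rho) / 2) (rho / (1 + e)).
  have Dz' : normc (z - c) < rho by [].
  have e1 : 0 < 1 + e by lra.
  have srho : s < rho.
    rewrite gt_max; apply/andP; split; first lra.
    by rewrite ltr_pdivrMr // ltr_pMr //; lra.
  have s0 : 0 < s by rewrite lt_max; apply/orP; right; rewrite divr_gt0.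
  have sz : normc (z - c) < s by rewrite lt_max; apply/orP; left; lra.
  have kM w : normc (w - c) = s -> normc (k w) <= s^-1.
    move=> hw; have Dw : disc c rho w by rewrite /disc /= hw.
    have := h1 _ Dw; rewrite hE normcM hw => hb.
    by rewrite -(ler_pM2l s0) mulfV ?gt_eqF.
  have s0r : 0 < s < rho by rewrite s0.
  have := max_modulus s0r hk kM sz => kz.
  apply: le_trans (_ : rho * s^-1 <= _); first by rewrite ler_pM2l.
  rewrite ler_pdivrMr //.
  have : rho / (1 + e) <= s by rewrite le_max lexx orbT.
  by rewrite ler_pdivrMr // mulrC.
have := den _ Dz => dz.
have -> : F z - F c = (z - c) * k z * (F z + conjc (F c)) by rewrite -hE /h divfK.
rewrite !normcM; have := normc_ge0 (z - c); have := normc_ge0 (F z + conjc (F c)) => n1 n2.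
have -> : rho * (normc (z - c) * normc (k z) * normc (F z + conjc (F c))) =
  (normc (z - c) * normc (F z + conjc (F c))) * (rho * normc (k z)) by ring.
by rewrite ler_piMr // mulr_ge0.
Qed.

(** At half the radius Schwarz's lemma gives [2 |F z - F c| <= |F z + conjc (F c)|]. The imaginary
    parts occur in the same way on both sides, so [2 |a - a'| <= a + a'] for the real parts. *)
Lemma harnack c rho F z : 0 < rho -> holC (disc c rho) F ->
  (forall w, disc c rho w -> 0 <= re (F w)) -> normc (z - c) <= rho / 2 ->
  re (F c) / 3 <= re (F z).
Proof.
move=> rho0 hF hpos hz; have Dz : disc c rho z by rewrite /disc /=; lra.
have := schwarz_cayley rho0 hF hpos Dz.
set A := normc (F z - F c); set B := normc (F z + _) => hAB.
have AB : 2 * A <= B.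
  have : rho * A <= rho / 2 * B.
    by apply: le_trans hAB _; apply: ler_wpM2r => //; exact: normc_ge0.
  have -> : rho / 2 * B = rho * (B / 2) by ring.
  by rewrite ler_pM2l // => h; lra.
have : (2 * A) ^+ 2 <= B ^+ 2 by rewrite ler_sqr ?nnegrE ?mulr_ge0 ?normc_ge0.
rewrite exprMn /A /B !sqr_normcE.
have := hpos _ Dz; have := hpos _ (disc_center c rho0).
case: (F z) => a b; case: (F c) => a' b' /= h1 h2 h3.
have h4 : (2 * (a - a')) ^+ 2 <= (a + a') ^+ 2.
  have : 0 <= (b - b') ^+ 2 by exact: sqr_ge0.
  move: h3; rewrite exprMn; lra.
have h5 : `|2 * (a - a')| <= `|a + a'|.
  by rewrite -ler_sqr ?nnegrE // !real_normK ?num_real.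
move: h5; rewrite [X in _ <= X]ger0_norm ?addr_ge0 // ler_norml => /andP[h5 h6]; lra.
Qed.

(** Harnack's inequality for [F - m] and for [M - F]. The factor 2/3 is the contraction rate of the
    alternating method. *)
Lemma harmonic_osc c rho F (m M : R) z w : 0 < rho -> holC (disc c rho) F ->
  (forall v, disc c rho v -> m <= re (F v) <= M) ->
  normc (z - c) <= rho / 2 -> normc (w - c) <= rho / 2 ->
  re (F z) - re (F w) <= 2 / 3 * (M - m).
Proof.
move=> rho0 hF hb hz hw.
have hF1 : holC (disc c rho) (fun v => F v - m%:C) by apply: holCB => //; exact: holC_cst.
have hF2 : holC (disc c rho) (fun v => M%:C - F v) by apply: holCB => //; exact: holC_cst.
have p1 v : disc c rho v -> 0 <= re (F v - m%:C).
  by move=> /hb /andP[h _]; rewrite ReB /= subr_ge0.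
have p2 v : disc c rho v -> 0 <= re (M%:C - F v).
  by move=> /hb /andP[_ h]; rewrite ReB /= subr_ge0.
have := harnack rho0 hF1 p1 hw; have := harnack rho0 hF2 p2 hz; rewrite !ReB /=; lra.
Qed.

(** The constant depends only on the bound [M] and the radius, so bounded families of harmonic
    functions are equicontinuous; Perron's method relies on this. Distant points are trivial, close
    ones follow from Schwarz's lemma for [M - F] on a disc about [w]. *)
Lemma harmonic_lipschitz c rho F (M : R) z w : 0 < rho -> holC (disc c rho) F ->
  (forall v, disc c rho v -> `|re (F v)| <= M) ->
  normc (z - c) <= rho / 2 -> normc (w - c) <= rho / 2 ->
  `|re (F z) - re (F w)| <= 16 * M / rho * normc (z - w).
Proof.
move=> rho0 hF hb hz hw.
have Dw : disc c rho w by rewrite /disc /=; lra.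
have Dz : disc c rho z by rewrite /disc /=; lra.
have M0 : 0 <= M by apply: le_trans (hb _ Dw).
have [far|near] := ltP (rho / 4) (normc (z - w)).
  apply: le_trans (_ : 2 * M <= _).
    apply: le_trans (ler_normB _ _) _; have := hb _ Dz; have := hb _ Dw; lra.
  have -> : 2 * M = 16 * M / rho * (rho / 8) by field; rewrite gt_eqF.
  by apply: ler_wpM2l; [rewrite divr_ge0 ?mulr_ge0 // ltW|lra].
have sub v : disc w (rho / 2) v -> disc c rho v.
  rewrite /disc /= => hv; have -> : v - c = (v - w) + (w - c) by ring.
  by apply: le_lt_trans (le_normcD _ _) _; lra.
pose G v := M%:C - F v.
have hG : holC (disc w (rho / 2)) G.
  by apply: holCB; [exact: holC_cst|apply: holC_sub hF].
have pG v : disc w (rho / 2) v -> 0 <= re (G v).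
  by move=> /sub /hb; rewrite ler_norml ReB /= => /andP[_ h]; rewrite subr_ge0.
have r2 : 0 < rho / 2 by rewrite divr_gt0.
have Dzw : disc w (rho / 2) z by rewrite /disc /=; lra.
have := schwarz_cayley r2 hG pG Dzw.
have -> : G z - G w = - (F z - F w) by rewrite /G; ring.
rewrite normcN; set A := normc (F z - F w).
have hB : normc (G z + conjc (G w)) <= 4 * M + A.
  have -> : G z + conjc (G w) = (2 * re (G w))%:C - (F z - F w).
    rewrite /G; case: (F z) => a b; case: (F w) => a' b' /=.
    by apply/eqP; rewrite eq_complex /=; apply/andP; split; apply/eqP; ring.
  apply: le_trans (le_normcB _ _) _; rewrite lerD2r normcR.
  rewrite ger0_norm; last by apply: mulr_ge0 => //; apply: pG; exact: disc_center.
  have -> : re (G w) = M - re (F w) by rewrite /G ReB.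
  by have := hb _ Dw; rewrite ler_norml => /andP[h _]; lra.
move=> h; have A0 : 0 <= A by exact: normc_ge0.
have h2 : rho / 2 * A <= normc (z - w) * (4 * M) + rho / 4 * A.
  apply: le_trans h _; apply: le_trans (_ : normc (z - w) * (4 * M + A) <= _).
    by apply: ler_wpM2l; rewrite ?normc_ge0.
  by rewrite mulrDr lerD2l; apply: ler_wpM2r.
have h3 : A <= 16 * M / rho * normc (z - w).
  have -> : 16 * M / rho * normc (z - w) = (normc (z - w) * (4 * M)) * (4 / rho) by ring.
  rewrite -ler_pdivrMr ?divr_gt0 // invf_div; lra.
by apply: le_trans h3; rewrite -ReB; exact: normc_ge_normRe.
Qed.

End Poisson.

(** * Harmonic and holomorphic functions on a Riemann surface *)

Section PlaneTopology.
Context {R : realType}.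
Local Notation C := (Cplx R).

Lemma closed_cdisc (c : C) (r : R) : closed [set z : C | normc (z - c) <= r].
Proof.
move=> z h; apply: limclosed_disc => e e0.
have [w [/= hw1 hw2]] := h _ ((nbhs_cplx z [set w | normc (w - z) < e]).2 (ex_intro2 _ _ e e0 (fun w hw => hw))).
by exists w.
Qed.

Lemma compact_cdisc (c : C) (r : R) : compact [set z : C | normc (z - c) <= r].
Proof.
pose f (p : R * R) : C := Complex p.1 p.2.
pose A := (`[(re c - r), (re c + r)]%classic `*` `[(im c - r), (im c + r)]%classic) : set (R * R).
have cA : compact A by apply: compact_setX; exact: segment_compact.
have cf : continuous f.
  by move=> p; apply/ccontE; apply: ccont_Complex; [exact: cvg_fst|exact: cvg_snd].
have cfA : compact (f @` A) by apply: continuous_compact => //; exact: continuous_subspaceT.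
apply: (subclosed_compact (@closed_cdisc c r) cfA) => z /= hz.
exists (re z, im z); last by case: (z).
have h1 := le_trans (normc_ge_normRe (z - c)) hz.
have h2 := le_trans (normc_ge_normIm (z - c)) hz.
move: h1 h2; rewrite ReB ImB !ler_norml => /andP[a1 a2] /andP[b1 b2].
by split; rewrite /= in_itv /=; apply/andP; split; lra.
Qed.

End PlaneTopology.

Section Surface.
Context {R : realType} {X : riemannSurface R}.
Local Notation C := (Cplx R).
Implicit Types (W N : set X) (k l : cidx X) (y : X) (c z w : C) (r rho : R).

Definition chart_img k : set C := crd k @` cdom k.

Lemma crdVK k z : chart_img k z -> cdom k (crdV k z) /\ crd k (crdV k z) = z.
Proof. by move=> [y hy <-]; rewrite crdK. Qed.

Lemma crdV_cont k z : chart_img k z -> {for z, continuous (crdV k)}.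
Proof. by move=> [y hy <-]; exact: crdV_continuous. Qed.

Lemma ccont_crd k y : cdom k y -> ccont (crd k : X -> C) y.
Proof. by move=> h; apply/ccontE; exact: crd_continuous. Qed.

Definition odisc k c r : set X := [set y | cdom k y /\ normc (crd k y - c) < r].
Definition cdisc k c r : set X := [set y | cdom k y /\ normc (crd k y - c) <= r].

Lemma sub_odisc_cdisc k c r : odisc k c r `<=` cdisc k c r.
Proof. by move=> y [h1 h2]; split => //; exact: ltW. Qed.

Lemma open_preim k (U : set C) : open U -> open (cdom k `&` crd k @^-1` U).
Proof.
move=> oU; rewrite openE => y [hy hU].
apply: filterI; first exact: open_nbhs_nbhs (conj (cdom_open k) hy).
apply: (crd_continuous hy); exact: open_nbhs_nbhs.
Qed.

Lemma open_odisc k c r : open (odisc k c r).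
Proof. exact: (open_preim k (@disc_open R c r)). Qed.

Definition good k c r := 0 < r /\ forall z, normc (z - c) <= r -> chart_img k z.

Lemma good_le k c r r' : good k c r -> 0 < r' -> r' <= r -> good k c r'.
Proof. by move=> [h1 h2] h0 h; split => // z hz; apply: h2; exact: le_trans hz h. Qed.

(** It is the continuous image of a compact planar disc in a Hausdorff space. This fails for a
    coordinate disc whose closure leaves the chart, whence the notion [good]. *)
Lemma closed_cdiscX k c r : good k c r -> closed (cdisc k c r).
Proof.
move=> [r0 g]; have -> : cdisc k c r = crdV k @` [set z : C | normc (z - c) <= r].
  apply/seteqP; split => [y [h1 h2]|_ [z hz <-]].
    by exists (crd k y) => //; exact: crdK.
  by have [h1 h2] := crdVK (g z hz); split; rewrite ?h2.
apply: compact_closed; first exact: carrier_hausdorff.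
apply: continuous_compact; last exact: compact_cdisc.
apply: continuous_in_subspaceT => z; rewrite inE => hz; exact: crdV_cont (g z hz).
Qed.

Lemma chart_disc k y W : cdom k y -> open W -> W y ->
  exists r, good k (crd k y) r /\ cdisc k (crd k y) r `<=` W.
Proof.
move=> hy oW Wy; have oi : open (chart_img k) := @crd_open R X k.
have iy : chart_img k (crd k y) by exists y.
have [d d0 hd] := (open_cplx _).1 oi _ iy.
have := crdV_continuous hy; rewrite /prop_for /continuous_at crdK // => cv.
have /nbhs_cplx[d' d'0 hd'] := cv W (open_nbhs_nbhs (conj oW Wy)).
have m0 : 0 < Num.min d d' by rewrite lt_min d0.
have m1 : Num.min d d' <= d by rewrite ge_min lexx.
have m2 : Num.min d d' <= d' by rewrite ge_min lexx orbT.
exists (Num.min d d' / 2); split.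
  by split; [rewrite divr_gt0|move=> z hz; apply: hd; lra].
move=> y' [h1 h2]; rewrite -(crdK h1); apply: hd'; lra.
Qed.

Lemma chart_at y W : open W -> W y ->
  exists k r, [/\ cdom k y, good k (crd k y) r & cdisc k (crd k y) r `<=` W].
Proof.
move=> oW Wy; have [k hk] := cdom_cover y.
by have [r [h1 h2]] := chart_disc hk oW Wy; exists k, r.
Qed.

Lemma odisc_center k y r : cdom k y -> 0 < r -> odisc k (crd k y) r y.
Proof. by move=> h r0; split; rewrite // subrr normc0. Qed.

Lemma near_chart k y (P : X -> Prop) : cdom k y ->
  (\forall y' \near y, P y') <->
  exists2 r, 0 < r & forall y', odisc k (crd k y) r y' -> P y'.
Proof.
move=> hy; split.
  move=> hP; have := hP; rewrite -nbhs_nearE nbhsE => -[W [oW Wy] hW]; have [r [[r0 _] h2]] := chart_disc hy oW Wy.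
  by exists r => // y' /sub_odisc_cdisc /h2 /hW.
move=> [r r0 h]; apply: filterS h _; apply: open_nbhs_nbhs; split.
  exact: open_odisc.
exact: odisc_center.
Qed.

Lemma chart_change (f : X -> C) k l y m : cdom k y -> cdom l y ->
  dC (f \o crdV k) (crd k y) m ->
  exists m', dC (f \o crdV l) (crd l y) m'.
Proof.
move=> hk hl df; have dt := derive_dC (crd_holomorphic hl hk).
have e : f \o crdV k \o (crd k \o crdV l) = fun z => (f \o crdV k) ((crd k \o crdV l) z) by [].
have df' : dC (f \o crdV k) ((crd k \o crdV l) (crd l y)) m by rewrite /= crdK.
have h := dC_comp dt df'; eexists; apply: dC_near h.
have il : chart_img l (crd l y) by exists y.
have := crdV_cont il; rewrite /prop_for /continuous_at crdK // => cv.
have cv2 : \forall z \near crd l y, cdom k (crdV l z) := cv _ (open_nbhs_nbhs (conj (cdom_open k) hk)).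
by apply: filterS cv2 => z hz /=; rewrite crdK.
Qed.

Definition hol1 (f : X -> C) y := exists k, cdom k y /\ exists m, dC (f \o crdV k) (crd k y) m.

Lemma hol1P f k y : cdom k y -> hol1 f y <-> exists m, dC (f \o crdV k) (crd k y) m.
Proof.
move=> hk; split; last by exists k.
by move=> [l [hl [m dm]]]; exact: chart_change hl hk dm.
Qed.

Lemma holP W (f : X -> C) : hol W f <-> forall y, W y -> hol1 f y.
Proof.
split=> h y.
  move=> Wy; have [k hk] := cdom_cover y; exists k; split => //.
  by eexists; exact: derive_dC (h k y Wy hk).
by move=> k Wy hk; have [m dm] := (hol1P f hk).1 (h k Wy); exact: dC_derivable dm.
Qed.

Lemma near_crdV k y (P : X -> Prop) : cdom k y -> (\forall y' \near y, P y') ->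
  \forall z \near crd k y, P (crdV k z).
Proof.
move=> hk hP; have ik : chart_img k (crd k y) by exists y.
have := crdV_cont ik; rewrite /prop_for /continuous_at crdK // => cv.
exact: cv hP.
Qed.

Lemma hol1_near f g y : (\forall y' \near y, f y' = g y') -> hol1 f y -> hol1 g y.
Proof.
move=> e [k [hk [m dm]]]; exists k; split => //; exists m.
by apply: dC_near dm; exact: near_crdV hk e.
Qed.

Lemma hol1_of_chart k (G : C -> C) y m : cdom k y -> dC G (crd k y) m ->
  hol1 (fun y' => G (crd k y')) y.
Proof.
move=> hk dG; exists k; split => //; exists m; apply: dC_near dG.
have oi : open (chart_img k) := @crd_open R X k; have ik : chart_img k (crd k y) by exists y.
have := open_nbhs_nbhs (conj oi ik); apply: filterS => z hz /=.
by have [_ ->] := crdVK hz.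
Qed.

Lemma hol1_cont f y : hol1 f y -> ccont f y.
Proof.
move=> [k [hk [m /dC_cont c]]].
apply: (@ccont_near _ _ (fun y' => (f \o crdV k) (crd k y'))).
  have := open_nbhs_nbhs (conj (cdom_open k) hk); apply: filterS => y' h /=.
  by rewrite crdK.
by apply: ccont_comp => //; exact: ccont_crd.
Qed.

Lemma hol1_cst c y : hol1 (fun _ => c) y.
Proof. by have [k hk] := cdom_cover y; exists k; split => //; exists 0; exact: dC_cst. Qed.

Lemma hol1D f g y : hol1 f y -> hol1 g y -> hol1 (fun y => f y + g y) y.
Proof.
move=> [k [hk [m dm]]] /(hol1P _ hk).1[n dn]; exists k; split => //.
by exists (m + n); exact: dCD dm dn.
Qed.

Lemma hol1M f g y : hol1 f y -> hol1 g y -> hol1 (fun y => f y * g y) y.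
Proof.
move=> [k [hk [m dm]]] /(hol1P _ hk).1[n dn]; exists k; split => //.
by eexists; exact: dCM dm dn.
Qed.

Lemma hol1N f y : hol1 f y -> hol1 (fun y => - f y) y.
Proof. by move=> [k [hk [m dm]]]; exists k; split => //; exists (- m); exact: dCN. Qed.

Lemma hol1B f g y : hol1 f y -> hol1 g y -> hol1 (fun y => f y - g y) y.
Proof. by move=> h /hol1N; exact: hol1D. Qed.

Lemma hol1V f y : f y != 0 -> hol1 f y -> hol1 (fun y => (f y)^-1) y.
Proof.
move=> f0 [k [hk [m dm]]]; exists k; split => //.
have f0' : (f \o crdV k) (crd k y) != 0 by rewrite /= crdK.
by eexists; exact: dCV f0' dm.
Qed.

Lemma hol1X f y n : hol1 f y -> hol1 (fun y => f y ^+ n) y.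
Proof. by move=> [k [hk [m dm]]]; exists k; split => //; eexists; exact: dCX dm. Qed.

Lemma hol1_sum (I : Type) (s : seq I) (F : I -> X -> C) y : (forall i, hol1 (F i) y) ->
  hol1 (fun y => \sum_(i <- s) F i y) y.
Proof.
move=> h; elim: s => [|a s IH].
  by apply: hol1_near (hol1_cst 0 y); apply: filterE => y'; rewrite big_nil.
by apply: hol1_near (hol1D (h a) IH); apply: filterE => y'; rewrite big_cons.
Qed.

Lemma hol1_crd k y : cdom k y -> hol1 (crd k) y.
Proof. by move=> hk; exact: hol1_of_chart hk (dC_id _). Qed.

Lemma holC_chart f k c r : (forall y, odisc k c r y -> hol1 f y) ->
  (forall z, disc c r z -> chart_img k z) -> holC (disc c r) (f \o crdV k).
Proof.
move=> hf g z Dz; have [h1 h2] := crdVK (g z Dz).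
have [|m dm] := (hol1P f h1).1 (hf _ _); first by split => //; rewrite h2.
by exists m; rewrite h2 in dm.
Qed.

Lemma clopen_setT (Xc : connected [set: X]) (A : set X) : closed A -> open A ->
  A !=set0 -> A = setT.
Proof.
move=> cA oA A0; apply: Xc => //; [exists A => //|exists A => //]; by rewrite setTI.
Qed.

Lemma hol1_max f y : (\forall y' \near y, hol1 f y') ->
  (\forall y' \near y, re (f y') <= re (f y)) -> \forall y' \near y, f y' = f y.
Proof.
move=> hf hm; have [k hk] := cdom_cover y.
have [r r0 h] := (near_chart _ hk).1 (filterI hf hm).
have oi : open (chart_img k) := @crd_open R X k; have ik : chart_img k (crd k y) by exists y.
have [d d0 hd] := (open_cplx _).1 oi _ ik.
pose s := Num.min r d; have s0 : 0 < s by rewrite lt_min r0.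
have sr : s <= r by rewrite ge_min lexx.
have sd : s <= d by rewrite ge_min lexx orbT.
apply/(near_chart _ hk); exists s => // y' [h1 h2].
have hC : holC (disc (crd k y) s) (f \o crdV k).
  apply: holC_chart => [y'' [g1 g2]|z hz].
    by case: (h y'') => //; split => //; exact: lt_le_trans g2 sr.
  by apply: hd; exact: lt_le_trans hz sd.
have hM z : disc (crd k y) s z -> re ((f \o crdV k) z) <= re ((f \o crdV k) (crd k y)).
  move=> hz; have [g1 g2] := crdVK (hd z (lt_le_trans hz sd)).
  rewrite /= (crdK hk); case: (h (crdV k z)) => //.
  by split; rewrite ?g2 //; exact: lt_le_trans hz sr.
by have := max_principle_local s0 hC hM h2; rewrite /= !crdK.
Qed.

(** Being locally the real part of a holomorphic function does not depend on charts and involves no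
    second derivatives. *)
Definition harm1 (u : X -> R) y :=
  exists g, (\forall y' \near y, hol1 g y') /\ \forall y' \near y, u y' = re (g y').

Lemma harm1_near u v y : (\forall y' \near y, u y' = v y') -> harm1 u y -> harm1 v y.
Proof.
move=> e [g [h1 h2]]; exists g; split => //.
by apply: filterS2 e h2 => y' <-.
Qed.

Lemma harm1_cst (a : R) y : harm1 (fun _ => a) y.
Proof. by exists (fun _ => a%:C); split; apply: filterE => // y'; exact: hol1_cst. Qed.

Lemma harm1D u v y : harm1 u y -> harm1 v y -> harm1 (fun y => u y + v y) y.
Proof.
move=> [g [h1 h2]] [g' [h1' h2']]; exists (fun y => g y + g' y); split.
  by apply: filterS2 h1 h1' => y' a b; exact: hol1D.
by apply: filterS2 h2 h2' => y' -> ->; rewrite ReD.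
Qed.

Lemma harm1Z (a : R) u y : harm1 u y -> harm1 (fun y => a * u y) y.
Proof.
move=> [g [h1 h2]]; exists (fun y => a%:C * g y); split.
  by apply: filterS h1 => y' h; apply: hol1M => //; exact: hol1_cst.
by apply: filterS h2 => y' ->; rewrite ReMr.
Qed.

Lemma harm1N u y : harm1 u y -> harm1 (fun y => - u y) y.
Proof. by move=> /(harm1Z (-1)); apply: harm1_near; apply: filterE => y'; rewrite mulN1r. Qed.

Lemma harm1B u v y : harm1 u y -> harm1 v y -> harm1 (fun y => u y - v y) y.
Proof. by move=> h /harm1N; exact: harm1D. Qed.

Lemma rcont_near {T : topologicalType} (u v : T -> R) x : (\forall y \near x, u y = v y) ->
  {for x, continuous u} -> {for x, continuous v}.
Proof.
move=> e /rcontP h; apply/rcontP => d d0; have e0 := nbhs_singleton e.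
by apply: filterS2 e (h d d0) => y <-; rewrite -e0.
Qed.

Lemma harm1_cont u y : harm1 u y -> {for y, continuous u}.
Proof.
move=> [g [h1 h2]]; apply: (@rcont_near _ (fun y => re (g y))).
  by apply: filterS h2 => y' ->.
by apply: ccont_Re; exact: hol1_cont (nbhs_singleton h1).
Qed.

Lemma harm1_max u y : harm1 u y -> (\forall y' \near y, u y' <= u y) ->
  \forall y' \near y, u y' = u y.
Proof.
move=> [g [h1 h2]] hm; have e0 := nbhs_singleton h2.
have := @hol1_max g y h1; move=> /(_ _) H.
have : \forall y' \near y, g y' = g y.
  by apply: H; apply: filterS2 h2 hm => y' <-; rewrite -e0.
by apply: filterS2 h2 => y' -> ->; rewrite e0.
Qed.

(* subharmonicity at [y], tested by the maximum principle *)
Definition sh1 (v : X -> R) y := forall h, harm1 h y ->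
  (\forall y' \near y, v y' - h y' <= v y - h y) -> \forall y' \near y, v y' - h y' = v y - h y.

Lemma harm_sh1 u y : harm1 u y -> sh1 u y.
Proof. by move=> hu h hh hm; apply: (@harm1_max (fun y => u y - h y)) => //; exact: harm1B. Qed.

Lemma sh1_near u v y : (\forall y' \near y, u y' = v y') -> sh1 u y -> sh1 v y.
Proof.
move=> e hu h hh hm; have e0 := nbhs_singleton e.
have : \forall y' \near y, u y' - h y' = u y - h y.
  by apply: hu => //; apply: filterS2 e hm => y' ->; rewrite e0.
by apply: filterS2 e => y' ->; rewrite e0.
Qed.

(** Whatever touches [v] from above at [y] touches [u] as well. Maxima and Poisson modifications
    inherit the property in this way. *)
Lemma sh1_touch u v y : (\forall y' \near y, u y' <= v y') -> u y = v y -> sh1 u y -> sh1 v y.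
Proof.
move=> le e hu h hh hm.
have H : \forall y' \near y, u y' - h y' = u y - h y.
  apply: hu => //; apply: filterS2 le hm => y' h1 h2; rewrite e.
  by apply: le_trans h2; rewrite lerD2r.
near=> y'; apply/eqP; rewrite eq_le; apply/andP; split; first by near: y'.
rewrite -e; have <- : u y' - h y' = u y - h y by near: y'.
by rewrite lerD2r; near: y'.
Unshelve. all: by end_near. Qed.

Lemma sh1_max u v y : sh1 u y -> sh1 v y -> sh1 (fun y => Num.max (u y) (v y)) y.
Proof.
move=> hu hv; have [h|h] := leP (v y) (u y).
  apply: sh1_touch hu; last by rewrite max_l.
  by apply: filterE => y'; rewrite le_max lexx.
apply: sh1_touch hv; last by rewrite max_r // ltW.
by apply: filterE => y'; rewrite le_max lexx orbT.
Qed.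

Lemma sh1_subharm v h y : sh1 v y -> harm1 h y -> sh1 (fun y => v y - h y) y.
Proof.
move=> hv hh h' hh' hm.
have := hv (fun y => h y + h' y) (harm1D hh hh'); rewrite opprD addrA => H.
have : \forall y' \near y, v y' - (h y' + h' y') = v y - h y - h' y.
  by apply: H; apply: filterS hm => y'; rewrite opprD addrA.
by apply: filterS => y'; rewrite opprD addrA.
Qed.

Section Global.
Hypotheses (Xcompact : compact [set: X]) (Xconn : connected [set: X]).

(** The supremum of [v] need not be attained in [W]. Truncation from below at a level above [M]
    gives a continuous function on the whole compact surface whose maximum set is open, closed and
    contained in [W]. *)
Lemma max_principle W (v : X -> R) (M : R) : open W -> W <> setT ->
  (forall y, W y -> {for y, continuous v}) -> (forall y, W y -> sh1 v y) ->
  (forall y, ~ W y -> forall e, 0 < e -> \forall y' \near y, W y' -> v y' <= M + e) ->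
  forall y, W y -> v y <= M.
Proof.
move=> oW WT cv shv bd y1 Wy1; rewrite leNgt; apply/negP => h1.
pose M' := (M + v y1) / 2; have MM' : M < M' by rewrite /M'; lra.
have M'v : M' < v y1 by rewrite /M'; lra.
pose V y := if `[< W y >] then Num.max (v y) M' else M'.
have VM y : M' <= V y by rewrite /V; case: ifP => // _; rewrite le_max lexx orbT.
have VW y : W y -> V y = Num.max (v y) M' by rewrite /V => /asboolP ->.
have nW y : W y -> \forall y' \near y, V y' = Num.max (v y') M'.
  by move=> Wy; apply: filterS VW _; exact: open_nbhs_nbhs.
have VnW y : ~ W y -> \forall y' \near y, V y' = M'.
  move=> nWy; have e0 : 0 < M' - M by rewrite subr_gt0.
  apply: filterS (bd y nWy _ e0) => y' h; rewrite /V; case: ifPn => // /asboolP /h.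
  by rewrite addrC subrK => /max_r.
have cV : continuous V.
  move=> y; have [Wy|nWy] := pselect (W y); last first.
    apply: (@rcont_near _ (fun _ => M')); last exact: rcont_cst.
    by apply: filterS (VnW _ nWy) => y' ->.
  apply: (@rcont_near _ (fun y => Num.max (v y) M')).
    by apply: filterS (nW _ Wy) => y' ->.
  by apply: continuous_max; [exact: cv|exact: rcont_cst].
have [|y0 _ hy0] := @compact_EVT_max X R V setT (ex_intro _ y1 Logic.I) Xcompact.
  exact: continuous_subspaceT.
have VT y : V y <= V y0 by apply: hy0; rewrite inE.
have big : M' < V y0 by apply: lt_le_trans (VT y1); rewrite VW // lt_max M'v.
pose A := [set y | V y = V y0].
have AW : A `<=` W.
  move=> y hy; apply: contrapT => nWy; have := nbhs_singleton (VnW _ nWy).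
  by rewrite hy => e; rewrite e ltxx in big.
have cA : closed A.
  have -> : A = V @^-1` [set V y0] by [].
  by apply: closed_comp; [move=> y _; exact: cV|exact: closed_eq].
have oA : open A.
  rewrite openE => y Ay; have Wy := AW _ Ay.
  have shV : sh1 V y.
    apply: sh1_near (sh1_max (shv _ Wy) (harm_sh1 (harm1_cst M' y))).
    by apply: filterS (nW _ Wy) => y' ->.
  have := shV (fun _ => 0) (harm1_cst 0 y); rewrite !subr0 => H.
  have : \forall y' \near y, V y' - 0 = V y.
    by apply: H; apply: filterE => y'; rewrite subr0 Ay VT.
  by apply: filterS => y'; rewrite subr0 /A /= => ->.
have AT := clopen_setT Xconn cA oA (ex_intro _ y0 erefl).
by apply: WT; rewrite -subTset -AT.
Qed.

(** At a maximum of the real part [g] is locally constant, so its level set there is open; it is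
    also closed. *)
Lemma hol_constant (f : X -> C) : (forall y, hol1 f y) -> forall y y', f y = f y'.
Proof.
move=> hf; suff H (g : X -> C) : (forall y, hol1 g y) -> forall y y', g y = g y' by exact: H.
move=> hg y1 y2.
have cR : continuous (fun y => re (g y)) by move=> y; apply: ccont_Re; exact: hol1_cont.
have [|y0 _ hy0] := @compact_EVT_max X R (fun y => re (g y)) setT (ex_intro _ y1 Logic.I) Xcompact.
  exact: continuous_subspaceT.
have gT y : re (g y) <= re (g y0) by apply: hy0; rewrite inE.
pose A := [set y | g y = g y0].
have oA : open A.
  rewrite openE => y Ay; have := @hol1_max g y (filterE _ hg).
  by rewrite Ay => H; apply: H; apply: filterE => y'; exact: gT.
have cA : closed A.
  move=> y cl; apply: contrapT => nA.
  have n0 : 0 < normc (g y - g y0) by rewrite normc_gt0 subr_eq0; apply/eqP.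
  have := hol1_cont (hg y) n0 => hn.
  by have [y' [/= e]] := cl _ hn; rewrite /= e normcB ltxx.
have AT := clopen_setT Xconn cA oA (ex_intro _ y0 erefl).
have e y : g y = g y0 by have : A y by rewrite AT.
by rewrite !e.
Qed.

End Global.
End Surface.

(** * Perron solution of the Dirichlet problem *)

Section Perron.
Context {R : realType} {X : riemannSurface R}.
Local Notation C := (Cplx R).
Implicit Types (W N : set X) (k l : cidx X) (y : X) (c z w : C) (r rho : R).
Hypotheses (Xcompact : compact [set: X]) (Xconn : connected [set: X]).

Lemma near_open W y : open W -> W y -> \forall y' \near y, W y'.
Proof. by move=> oW Wy; exact: open_nbhs_nbhs. Qed.

Lemma near_notin_cdisc k c rho y : good k c rho -> ~ cdisc k c rho y ->
  \forall y' \near y, ~ odisc k c rho y'.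
Proof.
move=> g ny; have := near_open (closed_openC (closed_cdiscX g)) ny.
by apply: filterS => y' h /sub_odisc_cdisc.
Qed.

Lemma near_crd_gt k y c a : cdom k y -> a < normc (crd k y - c) ->
  \forall y' \near y, cdom k y' /\ a < normc (crd k y' - c).
Proof.
move=> hy h; have := near_open (open_preim k (_ : open [set z | a < normc (z - c)])) (conj hy h).
apply; apply/open_cplx => z /= hz; exists (normc (z - c) - a); first by rewrite subr_gt0.
move=> w hw; have e : z - c = (z - w) + (w - c) by ring.
have := le_normcD (z - w) (w - c); rewrite -e (normcB z w); lra.
Qed.

Section Modification.
Variables (v : X -> R) (W : set X) (k : cidx X) (c : C) (rho : R).
Hypotheses (oW : open W) (WT : W <> setT) (cv : forall y, W y -> {for y, continuous v})
  (gk : good k c rho) (kW : cdisc k c rho `<=` W).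

Definition pmod y : R :=
  if `[< odisc k c rho y >] then pois c rho (v \o crdV k) (crd k y) else v y.

Lemma pmod_in y : odisc k c rho y -> pmod y = pois c rho (v \o crdV k) (crd k y).
Proof. by move=> h; rewrite /pmod asboolT. Qed.

Lemma pmod_out y : ~ odisc k c rho y -> pmod y = v y.
Proof. by move=> h; rewrite /pmod asboolF. Qed.

Let rho0 : 0 < rho. Proof. by case: gk. Qed.

Lemma pmod_circ_cont : circ_cont c rho (v \o crdV k).
Proof.
move=> z hz; have hzr : normc (z - c) <= rho by rewrite hz.
have gi := gk.2 z hzr; have [h1 h2] := crdVK gi.
apply: continuous_comp; first exact: crdV_cont.
by apply: cv; apply: kW; split; rewrite ?h2.
Qed.

Lemma holC_pmod : holC (disc c rho) (poisF c rho (v \o crdV k)).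
Proof. exact: (holC_poisF rho0 pmod_circ_cont). Qed.

Lemma pmod_harm y : odisc k c rho y -> harm1 pmod y.
Proof.
move=> hy; have oD := @open_odisc R X k c rho.
exists (fun y' => poisF c rho (v \o crdV k) (crd k y')); split.
  apply: filterS (near_open oD hy) => y' [h1 h2].
  by have [m dm] := holC_pmod h2; exact: hol1_of_chart h1 dm.
by apply: filterS (near_open oD hy) => y' h; rewrite pmod_in.
Qed.

Lemma pmod_cont y : W y -> {for y, continuous pmod}.
Proof.
move=> Wy; have [hin|hout] := pselect (odisc k c rho y); first exact: harm1_cont (pmod_harm hin).
have [hc|hc] := pselect (cdisc k c rho y); last first.
  apply: rcont_near (cv Wy); apply: filterS (near_notin_cdisc gk hc) => y' h.
  by rewrite pmod_out.
case: hc => h1 h2; have h3 : normc (crd k y - c) = rho.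
  by apply: le_anti; rewrite h2 leNgt /=; apply/negP => h; apply: hout.
apply/rcontP => e e0.
have [d d0 hd] := pois_boundary rho0 pmod_circ_cont h3 e0.
have cvy := (rcontP v y).1 (cv Wy) e e0.
have hn : \forall y' \near y, normc (crd k y' - crd k y) < d := ccont_crd h1 d0.
apply: filterS2 cvy hn => y' a1 a2; rewrite (pmod_out hout) /pmod; case: asboolP => // -[b1 b2].
by have := hd _ b2 a2; rewrite /= crdK.
Qed.

Hypothesis shv : forall y, W y -> sh1 v y.

(** The difference [v - pmod] is subharmonic in the disc and tends to 0 at its boundary. *)
Lemma pmod_ge y : v y <= pmod y.
Proof.
have [hin|hout] := pselect (odisc k c rho y); last by rewrite pmod_out.
have DW : odisc k c rho `<=` W by move=> y' /sub_odisc_cdisc /kW.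
rewrite -subr_le0; have := @max_principle R X Xcompact Xconn (odisc k c rho) (fun y => v y - pmod y) 0.
apply => //.
- exact: open_odisc.
- by move=> e; apply: WT; rewrite -subTset -e.
- move=> y' hy'; apply: continuousB; first exact: cv (DW _ hy').
  exact: pmod_cont (DW _ hy').
- by move=> y' hy'; apply: sh1_subharm; [exact: shv (DW _ hy')|exact: pmod_harm].
move=> y' ny' e e0; have [Wy|nWy] := pselect (W y'); last first.
  have nc : ~ cdisc k c rho y' by move=> /kW.
  by apply: filterS (near_notin_cdisc gk nc) => y'' h /h.
have : {for y', continuous (fun y => v y - pmod y)}.
  by apply: continuousB; [exact: cv|exact: pmod_cont].
move=> /rcontP /(_ e e0); apply: filterS => y'' h _.
move: h; rewrite (pmod_out ny') subrr subr0 add0r => h; apply/ltW; exact: le_lt_trans (ler_norm _) h.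
Qed.

Lemma pmod_sh y : W y -> sh1 pmod y.
Proof.
move=> Wy; have [hin|hout] := pselect (odisc k c rho y); first exact: harm_sh1 (pmod_harm hin).
apply: sh1_touch (shv Wy); last by rewrite pmod_out.
by apply: filterE => y'; exact: pmod_ge.
Qed.

End Modification.

Section Dirichlet.
Variables (k0 : cidx X) (c0 : C) (r0 R0 : R) (Phi : X -> R) (m M : R).
Hypotheses (r00 : 0 < r0) (r0R0 : r0 < R0) (gk0 : good k0 c0 R0).
Definition bdE y := cdom k0 y /\ normc (crd k0 y - c0) = r0.
Hypotheses (cPhi : forall y, bdE y -> {for y, continuous Phi})
  (bPhi : forall y, bdE y -> m <= Phi y <= M).
Definition extE : set X := ~` cdisc k0 c0 r0.
Local Notation Y := extE.

Lemma good_r0 : good k0 c0 r0.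
Proof. by apply: good_le gk0 _ _ => //; exact: ltW. Qed.

Lemma open_extE : open Y.
Proof. exact: closed_openC (closed_cdiscX good_r0). Qed.

Lemma center_in : cdom k0 (crdV k0 c0) /\ crd k0 (crdV k0 c0) = c0.
Proof. by apply: crdVK; apply: gk0.2; rewrite subrr normc0; case: gk0 => /ltW. Qed.

Lemma extE_neq : Y <> setT.
Proof.
move=> e; have : Y (crdV k0 c0) by rewrite e.
have [h1 h2] := center_in; apply; split => //; by rewrite h2 subrr normc0 ltW.
Qed.

Lemma near_notY y : ~ Y y -> bdE y \/ \forall y' \near y, ~ Y y'.
Proof.
move=> /contrapT [h1]; rewrite le_eqVlt => /orP[/eqP h|h]; [by left|right].
apply: filterS (near_open (@open_odisc R X k0 c0 r0) (conj h1 h)) => y' /sub_odisc_cdisc h'.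
by move/(_ h').
Qed.

(** Perron's family for boundary data [Phi]. The bound below by [m] matters: together with [fam_le]
    it bounds all Poisson modifications, which makes their Lipschitz constants uniform. *)
Definition fam (v : X -> R) :=
  [/\ forall y, Y y -> {for y, continuous v}, forall y, Y y -> sh1 v y,
     forall y, Y y -> m <= v y &
     forall y0, bdE y0 -> forall e, 0 < e -> \forall y \near y0, Y y -> v y <= Phi y0 + e].

Lemma fam_le v y : fam v -> Y y -> v y <= M.
Proof.
move=> [h1 h2 h3 h4]; apply: (@max_principle R X Xcompact Xconn) => //.
- exact: open_extE.
- exact: extE_neq.
move=> y' /near_notY[hb|hn] e e0; last by apply: filterS hn => y'' h /h.
apply: filterS (h4 _ hb _ e0) => y'' h /h; move/le_trans; apply; rewrite lerD2r.
by have /andP[] := bPhi hb.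
Qed.

Lemma fam_cst : fam (fun _ => m).
Proof.
split=> //; [by move=> y _; exact: rcont_cst|by move=> y _; apply: harm_sh1; exact: harm1_cst|].
move=> y0 hb e e0; apply: filterE => y _.
by have /andP[h _] := bPhi hb; rewrite (le_trans h) // lerDl ltW.
Qed.

Lemma fam_max u v : fam u -> fam v -> fam (fun y => Num.max (u y) (v y)).
Proof.
move=> [a1 a2 a3 a4] [b1 b2 b3 b4]; split.
- by move=> y hy; apply: continuous_max; [exact: a1|exact: b1].
- by move=> y hy; apply: sh1_max; [exact: a2|exact: b2].
- by move=> y hy; rewrite le_max a3.
- move=> y0 hb e e0; apply: filterS2 (a4 _ hb _ e0) (b4 _ hb _ e0) => y h1 h2 hy.
  by rewrite ge_max h1 // h2.
Qed.

Lemma fam_pmod v k c rho : fam v -> good k c rho -> cdisc k c rho `<=` Y -> fam (pmod v k c rho).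
Proof.
move=> [a1 a2 a3 a4] g kY; have ge := pmod_ge extE_neq a1 g kY a2.
split.
- by move=> y hy; exact: (pmod_cont a1 g kY).
- by move=> y hy; exact: (pmod_sh extE_neq a1 g kY a2).
- by move=> y hy; apply: le_trans (ge y); exact: a3.
- move=> y0 hb e e0.
  have nb : ~ cdisc k c rho y0 by move=> /kY; apply; case: hb => b1 b2; split; rewrite ?b2.
  by apply: filterS2 (near_notin_cdisc g nb) (a4 _ hb _ e0) => y h; rewrite pmod_out.
Qed.

Definition perron y : R := sup [set v y | v in fam].

Lemma perron_has_sup y : Y y -> has_sup [set v y | v in fam].
Proof.
move=> hy; split; first by exists m; exists (fun _ => m) => //; exact: fam_cst.
by exists M => _ [v hv <-]; exact: fam_le.
Qed.

Lemma perron_ge v y : fam v -> Y y -> v y <= perron y.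
Proof. by move=> hv hy; apply: sup_upper_bound (perron_has_sup hy) _ _; exists v. Qed.

Lemma perron_le y (a : R) : Y y -> (forall v, fam v -> v y <= a) -> perron y <= a.
Proof.
move=> hy h; apply: ge_sup; first by case: (perron_has_sup hy).
by move=> _ [v hv <-]; exact: h.
Qed.

Lemma perron_approx y e : Y y -> 0 < e -> exists2 v, fam v & perron y - e < v y.
Proof.
move=> hy e0; have [_ [v hv <-] h] := sup_adherent e0 (perron_has_sup hy).
by exists v.
Qed.

(** On a half-size disc the Poisson modifications of the family are uniformly Lipschitz, and the
    family is directed by maxima; hence its supremum is approximated uniformly by single members. It
    then equals its own Poisson integral on a smaller disc. *)
Lemma perron_harm y : Y y -> harm1 perron y.
Proof.
move=> Yy; have [k [rho [hk g kY]]] := chart_at open_extE Yy.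
set c := crd k y in g kY; have rho0 : 0 < rho by case: g.
pose pt z := crdV k z.
have ptK z : normc (z - c) <= rho -> [/\ cdom k (pt z), crd k (pt z) = z & Y (pt z)].
  move=> hz; have [h1 h2] := crdVK (g.2 z hz); split => //.
  by apply: kY; split; rewrite ?h2.
have r2 : rho / 2 < rho by rewrite ltr_pdivrMr // ltr_pMr //; lra.
have r20 : 0 < rho / 2 by rewrite divr_gt0.
pose B := `|m| + `|M|.
pose P v := poisF c rho (v \o crdV k).
have PE v z : normc (z - c) < rho -> pmod v k c rho (pt z) = re (P v z).
  move=> hz; have [h1 h2 _] := ptK z (ltW hz).
  by rewrite pmod_in ?h2 //; split; rewrite ?h2.
have Phol v : fam v -> holC (disc c rho) (P v).
  by case=> a1 _ _ _; exact: (holC_pmod a1 g kY).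
have PB v z : fam v -> disc c rho z -> `|re (P v z)| <= B.
  move=> fv Dz; rewrite -PE //; have fp := fam_pmod fv g kY.
  have [_ _ hY] := ptK z (ltW Dz).
  have h1 : m <= pmod v k c rho (pt z) by case: fp => _ _ h _; exact: h.
  have h2 := fam_le fp hY; rewrite /B ler_norml.
  have := ler_norm M; have := ler_norm (- m); have := normr_ge0 m; have := normr_ge0 M.
  by rewrite normrN => *; apply/andP; split; lra.
pose L := 16 * B / rho.
have L0 : 0 <= L by rewrite /L /B divr_ge0 ?mulr_ge0 ?addr_ge0 // ltW.
have Plip v z w : fam v -> normc (z - c) <= rho / 2 -> normc (w - c) <= rho / 2 ->
    `|re (P v z) - re (P v w)| <= L * normc (z - w).
  by move=> fv hz hw; apply: (harmonic_lipschitz rho0 (Phol v fv) (fun x => @PB v x fv)).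
have half z : normc (z - c) <= rho / 2 -> normc (z - c) < rho by move=> h; exact: le_lt_trans h r2.
have ulip z w : normc (z - c) <= rho / 2 -> normc (w - c) <= rho / 2 ->
    perron (pt z) <= perron (pt w) + L * normc (z - w).
  move=> hz hw; have [_ _ hYz] := ptK z (ltW (half z hz)); have [_ _ hYw] := ptK w (ltW (half w hw)).
  apply: perron_le => // v fv; have fp := fam_pmod fv g kY.
  have ge : v (pt z) <= pmod v k c rho (pt z).
    by case: fv => a1 a2 _ _; exact: (pmod_ge extE_neq a1 g kY a2).
  apply: le_trans ge _; rewrite PE ?half //.
  have h1 : re (P v w) <= perron (pt w) by rewrite -PE ?half //; exact: perron_ge.
  have := Plip v z w fv hz hw; have := ler_norm (re (P v z) - re (P v w)); lra.
have ulip2 z w : normc (z - c) <= rho / 2 -> normc (w - c) <= rho / 2 ->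
    `|perron (pt z) - perron (pt w)| <= L * normc (z - w).
  move=> hz hw; have := ulip _ _ hz hw; have := ulip _ _ hw hz; rewrite (normcB w z) => h1 h2.
  by rewrite ler_norml; apply/andP; split; lra.
pose K : set C := [set z | normc (z - c) <= rho / 2].
have approx e : 0 < e -> exists2 v, fam v & forall z, K z -> perron (pt z) - e < re (P v z).
  move=> e0; apply: contrapT => nex.
  (* If no member is uniformly close to the supremum, these sets are nonempty. They form a filter
     base, since the maximum of two members has a larger Poisson modification, so they have a
     cluster point in the compact disc. *)
  pose A v : set C := K `&` [set z | re (P v z) <= perron (pt z) - e].
  have An v : fam v -> A v !=set0.
    move=> fv; apply: contrapT => h; apply: nex; exists v => // z Kz.
    by rewrite ltNge; apply/negP => hz; apply: h; exists z.
  have mono u v : fam u -> fam v -> (forall z, normc (z - c) <= rho -> u (pt z) <= v (pt z)) ->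
     forall z, K z -> re (P u z) <= re (P v z).
    move=> fu fv h z Kz; apply: (pois_le rho0).
    - by case: fu => a1 _ _ _; exact: (pmod_circ_cont a1 g kY).
    - by case: fv => a1 _ _ _; exact: (pmod_circ_cont a1 g kY).
    - exact: half.
    - by move=> w hw; apply: h; rewrite hw.
  have PF : ProperFilter (filter_from fam A).
    apply: filter_from_proper; last exact: An.
    apply: filter_from_filter; first by exists (fun _ => m); exact: fam_cst.
    move=> u v fu fv; exists (fun y => Num.max (u y) (v y)); first exact: fam_max.
    move=> z [Kz hz]; split; split => //; apply: le_trans hz; apply: mono => //.
    + exact: fam_max.
    + by move=> w _; rewrite le_max lexx.
    + exact: fam_max.
    + by move=> w _; rewrite le_max lexx orbT.
  have FK : filter_from fam A K by exists (fun _ => m); [exact: fam_cst|move=> z []].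
  have [z [Kz clz]] := compact_cdisc PF FK.
  have [hd1 hd2 hY] := ptK z (ltW (half z Kz)).
  have e3 : 0 < e / 3 by rewrite divr_gt0.
  (* A member close to the supremum at the cluster point is close to it nearby as well, by the
     Lipschitz bounds, which contradicts membership in [A v]. *)
  have [v fv hv] := perron_approx hY e3.
  have ge : v (pt z) <= re (P v z).
    rewrite -PE ?half //.
    by case: fv => a1 a2 _ _; exact: (pmod_ge extE_neq a1 g kY a2).
  have Lp : 0 < L + 1 by lra.
  have nb : nbhs z [set w | normc (w - z) < e / (3 * (L + 1))].
    by apply/nbhs_cplx; exists (e / (3 * (L + 1))); rewrite ?divr_gt0 ?mulr_gt0.
  have FA : filter_from fam A (A v) by exists v.
  have [w [[Kw hw] hwz]] := clz _ _ FA nb.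
  have h1 := ulip w z Kw Kz; have h2 := Plip v z w fv Kz Kw.
  have h3 : L * normc (w - z) < e / 3.
    move: hwz; rewrite /= ltr_pdivlMr ?mulr_gt0 // => h.
    have := normc_ge0 (w - z); have := normc_ge0 (w - z); nra.
  move: h2; rewrite (normcB z w) ler_norml => /andP[_ h2].
  move: hw => /= hw; lra.
have r4 : rho / 4 < rho / 2 by lra.
have r40 : 0 < rho / 4 by lra.
have ucc : circ_cont c (rho / 4) (perron \o crdV k).
  move=> z hz; apply/rcont_cplx => e e0.
  have Lp : 0 < L + 1 by lra.
  exists (Num.min (e / (L + 1)) (rho / 4)); first by rewrite lt_min divr_gt0.
  move=> w; rewrite lt_min => /andP[hw1 hw2].
  have e1 : w - c = (w - z) + (z - c) by ring.
  have h1 : normc (w - c) <= rho / 2.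
    have := le_normcD (w - z) (z - c); rewrite -e1 hz; lra.
  have h2 : normc (z - c) <= rho / 2 by rewrite hz ltW.
  apply: le_lt_trans (ulip2 _ _ h1 h2) _.
  move: hw1; rewrite ltr_pdivlMr // => hw1; have := normc_ge0 (w - z); nra.
(* Sandwich: on the circle the supremum lies between [re (P v)] and [re (P v) + e], and [re (P v)]
   is its own Poisson integral. *)
have upois z : normc (z - c) < rho / 4 -> perron (pt z) = pois c (rho / 4) (perron \o crdV k) z.
  move=> hz; apply/eqP; rewrite -subr_eq0 -normr_eq0; apply/negPn/negP => n0.
  have e0 : 0 < `|perron (pt z) - pois c (rho / 4) (perron \o crdV k) z| / 2.
    by rewrite divr_gt0 // lt_def n0 /=.
  have [v fv hv] := approx _ e0.
  set e := _ / 2 in e0 hv.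
  have le w : normc (w - c) <= rho / 2 -> re (P v w) <= perron (pt w).
    move=> hw; rewrite -PE ?half //; apply: perron_ge; first exact: fam_pmod.
    by have [] := ptK w (ltW (half w hw)).
  have cv : circ_cont c (rho / 4) (fun w => re (P v w)).
    move=> w hw; apply: ccont_Re; apply: holC_cont (Phol v fv) _.
    by rewrite /disc /= hw; lra.
  have h1 : pois c (rho / 4) (fun w => re (P v w)) z <= pois c (rho / 4) (perron \o crdV k) z.
    by apply: pois_le => // w hw; apply: le; rewrite hw ltW.
  have h2 : pois c (rho / 4) (perron \o crdV k) z <= pois c (rho / 4) (fun w => re (P v w) + e) z.
    apply: pois_le => //; first by apply: circ_contD => //; exact: circ_cont_cst.
    move=> w hw; have Kw : K w by rewrite /K /= hw ltW.
    by have := hv w Kw; rewrite /=; lra.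
  have r4r : rho / 4 < rho by lra.
  rewrite poisD // in h2; last exact: circ_cont_cst.
  rewrite pois_cst // (pois_hol r40 r4r (Phol v fv) hz) in h2.
  rewrite (pois_hol r40 r4r (Phol v fv) hz) in h1.
  have Kz : K z by rewrite /K /=; lra.
  have h3 := hv z Kz; have h4 := le z Kz.
  have : `|perron (pt z) - pois c (rho / 4) (perron \o crdV k) z| <= e.
    by rewrite ler_norml; apply/andP; split; lra.
  move: e0; rewrite /e; move: (`|_|) => t t0 t1; lra.
exists (fun y' => poisF c (rho / 4) (perron \o crdV k) (crd k y')).
have nD : \forall y' \near y, odisc k c (rho / 4) y'.
  by apply: near_open; [exact: open_odisc|exact: odisc_center].
split; apply: filterS nD => y' [h1 h2].
  by have [m1 dm] := holC_poisF r40 ucc h2; exact: hol1_of_chart h1 dm.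
by have := upois _ h2; rewrite /pt crdK.
Qed.

Section Barrier.
Variables (y0 : X) (hb0 : bdE y0).
Let z0 := crd k0 y0.
Let nn := (z0 - c0) / r0%:C.
Let a := c0 + (r0 / 2)%:C * nn.
(** A barrier at [z0]. With [a] the midpoint of the centre and [z0], it vanishes on the circle with
    diameter from [a] to [z0] and is positive outside; that circle meets the boundary circle only in
    [z0]. *)
Definition bar z : R := 2 / r0 - re (nn / (z - a)).

Lemma nnE : z0 = c0 + r0%:C * nn.
Proof.
have r0n : r0%:C != 0 :> C by rewrite -normc_gt0 normcR gtr0_norm.
by rewrite /nn mulrC divfK //; ring.
Qed.

Lemma nn1 : normc nn = 1.
Proof. by rewrite /nn normcM normcV (hb0.2 : normc (z0 - c0) = r0) normcR gtr0_norm // divff // gt_eqF. Qed.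

Lemma bar_ne z : r0 <= normc (z - c0) -> z != a.
Proof.
move=> h; apply/eqP => e; move: h; rewrite e /a addrAC subrr add0r normcM nn1 mulr1 normcR gtr0_norm ?divr_gt0 // => h.
have : r0 / 2 < r0 by rewrite ltr_pdivrMr // ltr_pMr // ltrDl ltr01.
by rewrite ltNge h.
Qed.

Lemma re_div_normc (p q : C) : q != 0 -> re (p / q) * normc q ^+ 2 = re p * re q + im p * im q.
Proof.
move=> q0; have e : p = p / q * q by rewrite divfK.
move: (p / q) e => t ->; rewrite ReM ImM sqr_normcE.
move: (re t) (im t) (re q) (im q) => *; ring.
Qed.

Lemma bar_ge z : r0 <= normc (z - c0) -> normc (z - z0) ^+ 2 <= bar z * (r0 * normc (z - a) ^+ 2).
Proof.
move=> h; have zn := bar_ne h.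
have zn' : z - a != 0 by rewrite subr_eq0.
have -> : bar z * (r0 * normc (z - a) ^+ 2) =
    2 * normc (z - a) ^+ 2 - r0 * (re nn * re (z - a) + im nn * im (z - a)).
  rewrite /bar -(re_div_normc nn zn'); field; exact: lt0r_neq0.
have e1 : z - a = (z - z0) + (r0 / 2)%:C * nn.
  rewrite nnE /a; have -> : r0%:C = (r0 / 2)%:C + (r0 / 2)%:C :> C.
    by rewrite -rmorphD /=; congr (_%:C); field.
  ring.
have e2 : z - c0 = (z - z0) + r0%:C * nn by rewrite nnE; ring.
have h2 : r0 ^+ 2 <= normc (z - c0) ^+ 2 by rewrite lerXn2r // nnegrE ?normc_ge0 // ltW.
have n1 : re nn ^+ 2 + im nn ^+ 2 = 1 by rewrite -sqr_normcE nn1 expr1n.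
move: h2; rewrite e1 e2 !sqr_normcE !ReD !ImD !ReMr !ImMr.
move: (re z + re (- z0)) (im z + im (- z0)) (re nn) (im nn) n1 => p q u v n1.
have n2 : r0 ^+ 2 * (u ^+ 2 + v ^+ 2) = r0 ^+ 2 by rewrite n1 mulr1.
by move=> h2; have := sqr_ge0 p; have := sqr_ge0 q; nra.
Qed.

Lemma bar_z0 : bar z0 = 0.
Proof.
rewrite /bar; have -> : z0 - a = (r0 / 2)%:C * nn.
  rewrite nnE /a; have -> : r0%:C = (r0 / 2)%:C + (r0 / 2)%:C :> C.
    by rewrite -rmorphD /=; congr (_%:C); field.
  ring.
have n0 : nn != 0 by rewrite -normc_gt0 nn1.
have -> : nn / ((r0 / 2)%:C * nn) = (2 / r0)%:C.
  have -> : (2 / r0)%:C = (r0 / 2)%:C^-1 :> C by rewrite -fmorphV /= invf_div.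
  by rewrite invfM mulrCA divff // mulr1.
by rewrite /= subrr.
Qed.

Lemma bar_ge0 z : r0 <= normc (z - c0) -> 0 <= bar z.
Proof.
move=> h; have := bar_ge h; have zn := bar_ne h.
have d0 : 0 < normc (z - a) by rewrite normc_gt0 subr_eq0.
have : 0 < r0 * normc (z - a) ^+ 2 by rewrite mulr_gt0 // exprn_gt0.
have := sqr_ge0 (normc (z - z0)) => h1 h2 h3.
by rewrite -(pmulr_lge0 _ h2); exact: le_trans h3.
Qed.

Lemma bar_harm y : cdom k0 y -> r0 <= normc (crd k0 y - c0) -> harm1 (fun y => bar (crd k0 y)) y.
Proof.
move=> hy h; apply: (harm1B (harm1_cst (2 / r0) y)).
have zn : crd k0 y - a != 0 by rewrite subr_eq0 bar_ne.
exists (fun y => nn / (crd k0 y - a)); split; last exact: filterE.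
have c1 : ccont (fun y' => crd k0 y' - a) y by apply: ccontB; [exact: ccont_crd|exact: ccont_cst].
have d0 : 0 < normc (crd k0 y - a) by rewrite normc_gt0.
have := c1 _ d0; have := near_open (cdom_open k0) hy.
apply: filterS2 => y' hy' hn; apply: hol1M; first exact: hol1_cst.
apply: hol1V; last by apply: hol1B; [exact: hol1_crd|exact: hol1_cst].
by apply/eqP => e; move: hn; rewrite e sub0r normcN ltxx.
Qed.

Lemma bar_big (d z : R) w : 0 < d -> r0 <= normc (w - c0) -> normc (w - c0) <= R0 -> d <= normc (w - z0) ->
  d ^+ 2 / (r0 * (2 * R0) ^+ 2) <= bar w.
Proof.
move=> d0 h1 h2 h3; have R00 : 0 < R0 by apply: lt_trans r0R0.
have b0 := bar_ge0 h1; have := bar_ge h1.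
have p0 : 0 < r0 * (2 * R0) ^+ 2 by rewrite mulr_gt0 // exprn_gt0 // mulr_gt0.
rewrite ler_pdivrMr // => hb.
have s1 : d ^+ 2 <= normc (w - z0) ^+ 2 by rewrite lerXn2r // nnegrE ?normc_ge0 // ltW.
apply: le_trans s1 _; apply: le_trans hb _; apply: ler_wpM2l => //.
rewrite ler_pM2l //; apply: lerXn2r; rewrite ?nnegrE ?normc_ge0 //.
  by rewrite mulr_ge0 // ltW.
have e : w - a = (w - c0) + (- ((r0 / 2)%:C * nn)) by rewrite /a; ring.
rewrite e; apply: le_trans (le_normcD _ _) _.
rewrite normcN normcM nn1 mulr1 normcR gtr0_norm ?divr_gt0 //; lra.
Qed.

(** [K] is [M - m] divided by the least value that [bar_big] guarantees at distance [d / 2] from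
    [z0]. The cap [d <= R0 - r0] keeps the disc about [z0] inside the coordinate disc of radius
    [R0], where [bar] is defined. *)
Lemma barrier e : 0 < e -> exists K d, [/\ 0 <= K, 0 < d, d <= R0 - r0,
   forall y, bdE y -> normc (crd k0 y - z0) < d -> `|Phi y - Phi y0| < e &
   forall y, Y y -> odisc k0 c0 R0 y -> d / 2 <= normc (crd k0 y - z0) -> M - m <= K * bar (crd k0 y)].
Proof.
move=> e0; have hn := (rcontP Phi y0).1 (cPhi hb0) e e0.
have [r1 r10 h1] := (near_chart _ hb0.1).1 hn.
pose d := Num.min r1 (R0 - r0); have d0 : 0 < d by rewrite lt_min r10 subr_gt0.
have R00 : 0 < R0 by apply: lt_trans r0R0.
pose q := (d / 2) ^+ 2 / (r0 * (2 * R0) ^+ 2).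
have q0 : 0 < q by rewrite /q divr_gt0 ?exprn_gt0 ?mulr_gt0 ?invr_gt0 // exprn_gt0 // mulr_gt0.
have mM : m <= M by have /andP[] := bPhi hb0; exact: le_trans.
exists ((M - m) / q), d; split => //.
- by rewrite divr_ge0 ?subr_ge0 // ltW.
- by rewrite /d ge_min lexx orbT.
- move=> y [hy1 hy2] hy3; apply: h1; split => //.
  by apply: lt_le_trans hy3 _; rewrite /d ge_min lexx.
- move=> y Yy [h2 h3] h4.
  have h5 : r0 <= normc (crd k0 y - c0).
    by rewrite leNgt; apply/negP => h; apply: Yy; split => //; exact: ltW.
  have := bar_big 0 (_ : 0 < d / 2) h5 (ltW h3) h4; rewrite divr_gt0 // => /(_ isT).
  rewrite -/q => h6; rewrite mulrAC ler_pdivlMr //; apply: ler_wpM2l => //; by rewrite subr_ge0.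
Qed.

Lemma near_far y d : ~ (cdom k0 y /\ normc (crd k0 y - z0) < d) -> 0 < d ->
  \forall y' \near y, odisc k0 c0 R0 y' -> d / 2 <= normc (crd k0 y' - z0).
Proof.
move=> h d0; have [hc|hc] := pselect (cdisc k0 c0 R0 y); last first.
  by apply: filterS (near_notin_cdisc gk0 hc) => y' h' /h'.
case: hc => hc1 hc2; have h1 : d / 2 < normc (crd k0 y - z0).
  by rewrite ltNge; apply/negP => h'; apply: h; split => //; lra.
by apply: filterS (near_crd_gt hc1 h1) => y' [_ /ltW h2].
Qed.

Lemma Y_ge y : Y y -> cdom k0 y -> r0 <= normc (crd k0 y - c0).
Proof. by move=> hY hy; rewrite leNgt; apply/negP => h; apply: hY; split => //; exact: ltW. Qed.

Lemma near_bar_small K e : 0 <= K -> 0 < e -> \forall y \near y0, K * bar (crd k0 y) < e.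
Proof.
move=> K0 e0; have h0 : r0 <= normc (crd k0 y0 - c0) by rewrite hb0.2.
have := harm1_cont (harm1Z K (bar_harm hb0.1 h0)) => /rcontP /(_ _ e0).
apply: filterS => y; rewrite bar_z0 mulr0 subr0; exact: le_lt_trans (ler_norm _).
Qed.

Lemma near_R0 : \forall y \near y0, odisc k0 c0 R0 y.
Proof.
apply: near_open; first exact: open_odisc.
by split; [exact: hb0.1|rewrite hb0.2].
Qed.

(** The maximum principle for [v - K bar] in the annulus: near [z0] the boundary values are
    controlled by the continuity of [Phi], elsewhere [K bar] exceeds the whole range [M - m]. *)
Lemma perron_upper e : 0 < e -> \forall y \near y0, Y y -> perron y < Phi y0 + e.
Proof.
move=> e0; have e2 : 0 < e / 2 by rewrite divr_gt0.
have [K [d [K0 d0 dR h1 h2]]] := barrier e2.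
have /andP[mP PM] := bPhi hb0.
pose W := Y `&` odisc k0 c0 R0.
have oW : open W by apply: openI; [exact: open_extE|exact: open_odisc].
have WT : W <> setT by move=> eW; apply: extE_neq; rewrite -subTset -eW => y [].
have H v : fam v -> forall y, W y -> v y - K * bar (crd k0 y) <= Phi y0 + e / 2.
  move=> fv; have [a1 a2 a3 a4] := fv.
  have hh y : W y -> harm1 (fun y => K * bar (crd k0 y)) y.
    by move=> [Yy [y1 y2]]; apply: harm1Z; apply: bar_harm => //; exact: Y_ge.
  apply: (@max_principle R X Xcompact Xconn W (fun y => v y - K * bar (crd k0 y))) => //.
  - by move=> y Wy; apply: continuousB; [exact: a1 Wy.1|exact: harm1_cont (hh _ Wy)].
  - by move=> y Wy; apply: sh1_subharm; [exact: a2 Wy.1|exact: hh].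
  move=> y nW e1 e10; have [[hy1 hy2]|hf] := pselect (cdom k0 y /\ normc (crd k0 y - z0) < d).
    have hyR : normc (crd k0 y - c0) < R0.
      have -> : crd k0 y - c0 = (crd k0 y - z0) + (z0 - c0) by ring.
      have := le_normcD (crd k0 y - z0) (z0 - c0).
      by rewrite (hb0.2 : normc (z0 - c0) = r0); lra.
    have nY : ~ Y y by move=> hY; apply: nW.
    have [hb|hn] := near_notY nY; last by apply: filterS hn => y' h' [/h'].
    apply: filterS (a4 _ hb _ e10) => y' h' [Yy' [g1 g2]].
    have := h1 _ hb hy2; rewrite ltr_norml => /andP[_ h3].
    have := h' Yy'; have := bar_ge0 (Y_ge Yy' g1); have : 0 <= K * bar (crd k0 y').
      by rewrite mulr_ge0 // bar_ge0 // Y_ge.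
    lra.
  apply: filterS (near_far hf d0) => y' h' [Yy' hO].
  have := h2 _ Yy' hO (h' hO); have := fam_le fv Yy'; lra.
apply: filterS2 near_R0 (near_bar_small K0 e2) => y hO hs hY.
have : perron y <= Phi y0 + e / 2 + K * bar (crd k0 y).
  by apply: perron_le => // v fv; have := H v fv y (conj hY hO); lra.
lra.
Qed.

(** The function [max m (Phi y0 - e/2 - K bar)] equals [m] away from [z0]; continued by [m] it
    belongs to the family. *)
Lemma perron_lower e : 0 < e -> \forall y \near y0, Y y -> Phi y0 - e < perron y.
Proof.
move=> e0; have e2 : 0 < e / 2 by rewrite divr_gt0.
have [K [d [K0 d0 dR h1 h2]]] := barrier e2.
have /andP[mP PM] := bPhi hb0.
pose g y := Phi y0 - e / 2 - K * bar (crd k0 y).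
pose v y := if `[< odisc k0 c0 R0 y >] then Num.max m (g y) else m.
have vin y : odisc k0 c0 R0 y -> v y = Num.max m (g y) by move=> h; rewrite /v asboolT.
have vout y : Y y -> (odisc k0 c0 R0 y -> d / 2 <= normc (crd k0 y - z0)) -> v y = m.
  move=> Yy h; rewrite /v; case: asboolP => // hO; apply: max_l.
  by have := h2 _ Yy hO (h hO); rewrite /g; lra.
have hg y : Y y -> cdom k0 y -> harm1 g y.
  move=> Yy hy; apply: harm1B; first exact: harm1_cst.
  by apply: harm1Z; apply: bar_harm => //; exact: Y_ge.
have dich y : Y y -> (odisc k0 c0 R0 y) \/ \forall y' \near y, v y' = m.
  move=> Yy; have [hO|hO] := pselect (odisc k0 c0 R0 y); [by left|right].
  have hf : ~ (cdom k0 y /\ normc (crd k0 y - z0) < d).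
    move=> [g1 g2]; apply: hO; split => //.
    have -> : crd k0 y - c0 = (crd k0 y - z0) + (z0 - c0) by ring.
    have := le_normcD (crd k0 y - z0) (z0 - c0).
    by rewrite (hb0.2 : normc (z0 - c0) = r0); lra.
  apply: filterS2 (near_far hf d0) (near_open open_extE Yy) => y' h3 h4; exact: vout.
have nv y : odisc k0 c0 R0 y -> \forall y' \near y, Num.max m (g y') = v y'.
  by move=> h; apply: filterS (near_open (@open_odisc R X k0 c0 R0) h) => y' /vin.
have fv : fam v.
  split.
  - move=> y Yy; have [hO|hm] := dich _ Yy.
      apply: rcont_near (nv _ hO) _; apply: continuous_max; first exact: rcont_cst.
      exact: harm1_cont (hg _ Yy hO.1).
    apply: (@rcont_near _ _ (fun _ => m)); last exact: rcont_cst.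
    by apply: filterS hm => y' ->.
  - move=> y Yy; have [hO|hm] := dich _ Yy.
      apply: sh1_near (nv _ hO) _; apply: sh1_max; apply: harm_sh1; first exact: harm1_cst.
      exact: hg Yy hO.1.
    apply: (@sh1_near _ _ (fun _ => m)); last by apply: harm_sh1; exact: harm1_cst.
    by apply: filterS hm => y' ->.
  - by move=> y Yy; rewrite /v; case: ifP => // _; rewrite le_max lexx.
  move=> y1 hb1 e1 e10; have /andP[mP1 _] := bPhi hb1.
  have [hd|hd] := pselect (cdom k0 y1 /\ normc (crd k0 y1 - z0) < d); last first.
    apply: filterS (near_far hd d0) => y' h3 Yy'; rewrite vout //; lra.
  apply: filterE => y' Yy'; have := h1 _ hb1 hd.2; rewrite ltr_norml => /andP[h3 _].
  rewrite /v; case: asboolP => [hO|_]; last by lra.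
  rewrite ge_max; apply/andP; split; first by lra.
  have : 0 <= K * bar (crd k0 y') by rewrite mulr_ge0 // bar_ge0 // Y_ge //; case: hO.
  rewrite /g; lra.
apply: filterS2 near_R0 (near_bar_small K0 e2) => y hO hs hY.
have := perron_ge fv hY; rewrite vin // => h.
have : g y <= perron y by apply: le_trans h; rewrite le_max lexx orbT.
rewrite /g; lra.
Qed.

End Barrier.

Theorem dirichlet : exists u : X -> R, [/\ forall y, Y y -> harm1 u y,
  forall y, Y y -> m <= u y <= M &
  forall y0, bdE y0 -> forall e, 0 < e -> \forall y \near y0, Y y -> `|u y - Phi y0| < e].
Proof.
exists perron; split; first exact: perron_harm.
  move=> y Yy; apply/andP; split; first exact: perron_ge fam_cst Yy.
  by apply: perron_le => // v fv; exact: fam_le.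
move=> y0 hb e e0; apply: filterS2 (perron_upper hb e0) (perron_lower hb e0) => y h1 h2 hY.
rewrite ltr_norml; have := h1 hY; have := h2 hY => *; apply/andP; split; lra.
Qed.

End Dirichlet.
End Perron.

(** * Meromorphic forms with one double pole *)

Section Alternating.
Context {R : realType} {X : riemannSurface R}.
Local Notation C := (Cplx R).
Implicit Types (W N : set X) (k l : cidx X) (y : X) (z w : C).
Hypotheses (Xcompact : compact [set: X]) (Xconn : connected [set: X]).

Lemma open_setC1 (p : X) : open [set y : X | y <> p].
Proof.
apply: closed_openC; apply: accessible_closed_set1; apply: hausdorff_accessible.
exact: carrier_hausdorff.
Qed.

Lemma circle_minmax c rho (phi : C -> R) : 0 < rho -> circ_cont c rho phi ->
  exists zm zM, [/\ normc (zm - c) = rho, normc (zM - c) = rho &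
    forall z, normc (z - c) = rho -> phi zm <= phi z <= phi zM].
Proof.
move=> rho0 cp; pose A : set C := [set z | normc (z - c) = rho].
have A0 : A !=set0.
  by exists (c + rho%:C); rewrite /A /= addrAC subrr add0r normcR gtr0_norm.
have cA : compact A.
  apply: subclosed_compact (@compact_cdisc R c rho) _; last by move=> z; rewrite /A /= => ->.
  have -> : A = (fun z => normc (z - c)) @^-1` [set rho] by [].
  apply: closed_comp; last exact: closed_eq.
  move=> z _; apply: (@ccont_normc _ _ (fun z => z - c)); apply: ccontB; [exact: ccont_id|exact: ccont_cst].
have cw : {within A, continuous phi}.
  by apply: continuous_in_subspaceT => z; rewrite inE => hz; exact: cp.
have [zM hM1 hM2] := @compact_EVT_max C R phi A A0 cA cw.
have [zm hm1 hm2] := @compact_EVT_min C R phi A A0 cA cw.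
exists zm, zM; split; [by move: hm1; rewrite inE|by move: hM1; rewrite inE|].
by move=> z hz; rewrite hM2 ?hm2 // inE.
Qed.

(** Halving the radius contracts the oscillation of the boundary values. In the alternating method
    the inner circle has half the radius of the outer one, so the error shrinks at each round. *)
Lemma pois_osc c rho (phi : C -> R) B z w : 0 < rho -> circ_cont c rho phi ->
  (forall z w, normc (z - c) = rho -> normc (w - c) = rho -> phi z - phi w <= B) ->
  normc (z - c) <= rho / 2 -> normc (w - c) <= rho / 2 ->
  pois c rho phi z - pois c rho phi w <= 2 / 3 * B.
Proof.
move=> rho0 cp hB hz hw; have [zm [zM [h1 h2 h3]]] := circle_minmax rho0 cp.
have hb v : disc c rho v -> phi zm <= re (poisF c rho phi v) <= phi zM.
  move=> Dv; rewrite -(pois_cst rho0 (phi zm) Dv) -(pois_cst rho0 (phi zM) Dv).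
  by apply/andP; split; apply: pois_le => //; try (exact: circ_cont_cst); move=> v' /h3/andP[].
apply: le_trans (harmonic_osc rho0 (holC_poisF rho0 cp) hb hz hw) _.
by rewrite ler_pM2l ?divr_gt0 //; exact: hB.
Qed.

Variables (k0 : cidx X) (c0 : C) (R0 r1 : R).
Hypotheses (r10 : 0 < r1) (r1R0 : r1 < R0) (gk0 : good k0 c0 R0).
Local Notation r0 := (r1 / 2).
Local Notation Y := (extE k0 c0 r0).
Local Notation bd := (bdE k0 c0 r0).
Local Notation pt := (crdV k0).

Let r00 : 0 < r0. Proof. by rewrite divr_gt0. Qed.
Let r0r1 : r0 < r1. Proof. by rewrite ltr_pdivrMr // ltr_pMr //; lra. Qed.
Let r0R0 : r0 < R0. Proof. exact: lt_trans r0r1 r1R0. Qed.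

Lemma ptP z : normc (z - c0) <= r1 -> cdom k0 (pt z) /\ crd k0 (pt z) = z.
Proof. by move=> h; apply: crdVK; apply: gk0.2; apply: le_trans h _; exact: ltW. Qed.

Lemma pt_Y z : normc (z - c0) = r1 -> Y (pt z).
Proof.
move=> h; have h' : normc (z - c0) <= r1 by rewrite h.
have [h1 h2] := ptP h'.
by move=> [_]; rewrite h2 h leNgt r0r1.
Qed.

Definition sing_cont (s : C -> R) := forall z, z != c0 -> {for z, continuous s}.

(** One half of Schwarz's method: [f] is a guess for the regular part on the outer circle, of radius
    [r1]; its Poisson extension plus the singular part [s] gives the data on the inner circle, of
    radius [r1 / 2], for a solution outside that circle. *)
Definition Dsol (s f : C -> R) (u : X -> R) :=
  (forall y, Y y -> harm1 u y) /\
  forall y0, bd y0 -> forall e, 0 < e -> \forall y \near y0, Y y ->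
    `|u y - (pois c0 r1 f (crd k0 y0) + s (crd k0 y0))| < e.

Lemma ne_c0 z : 0 < normc (z - c0) -> z != c0.
Proof. by rewrite normc_gt0 subr_eq0. Qed.

Lemma Dsol_ex s f : sing_cont s -> circ_cont c0 r1 f -> exists u, Dsol s f u.
Proof.
move=> cs cf; pose phi z := pois c0 r1 f z + s z.
have cphi z : normc (z - c0) = r0 -> {for z, continuous phi}.
  move=> hz; apply: continuousD; last by apply: cs; apply: ne_c0; rewrite hz.
  by apply: ccont_Re; apply: holC_cont (holC_poisF r10 cf) _; rewrite /disc /= hz.
have [zm [zM [h1 h2 h3]]] := circle_minmax r00 cphi.
have cPhi y : bd y -> {for y, continuous (fun y => phi (crd k0 y))}.
  by move=> [b1 b2]; apply: rcont_ccomp; [exact: cphi|exact: ccont_crd].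
have bPhi y : bd y -> phi zm <= phi (crd k0 y) <= phi zM by move=> [b1 b2]; exact: h3.
have [u [u1 u2 u3]] := dirichlet Xcompact Xconn r00 r0R0 gk0 cPhi bPhi.
by exists u.
Qed.

Lemma Dsol_le s f u s' f' u' (a : R) : Dsol s f u -> Dsol s' f' u' ->
  (forall z, normc (z - c0) = r0 ->
     (pois c0 r1 f z + s z) - (pois c0 r1 f' z + s' z) <= a) ->
  forall y, Y y -> u y - u' y <= a.
Proof.
move=> [u1 u2] [v1 v2] h.
apply: (@max_principle R X Xcompact Xconn Y (fun y => u y - u' y)).
- by apply: open_extE r0R0 gk0.
- exact: extE_neq r00 gk0.
- by move=> y Yy; apply: continuousB; apply: harm1_cont; [exact: u1|exact: v1].
- by move=> y Yy; apply: harm_sh1; apply: harm1B; [exact: u1|exact: v1].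
move=> y nY e e0; have [hb|hn] := near_notY nY; last first.
  by apply: filterS hn => y' h' /h'.
have e2 : 0 < e / 2 by rewrite divr_gt0.
apply: filterS2 (u2 _ hb _ e2) (v2 _ hb _ e2) => y' a1 a2 Yy'.
have := a1 Yy'; have := a2 Yy'; rewrite !ltr_norml => /andP[b1 b2] /andP[b3 b4].
have := h _ hb.2; lra.
Qed.

(** The two halves match on the outer circle up to a constant. The constant is kept because
    constants are not contracted by the iteration: on a compact surface they reproduce
    themselves. *)
Definition Sol s f u (kap : R) := [/\ circ_cont c0 r1 f, Dsol s f u &
  forall z, normc (z - c0) = r1 -> u (pt z) = f z + s z + kap].

Lemma Sol_lin s f u kap s' f' u' kap' (a b : R) : Sol s f u kap -> Sol s' f' u' kap' ->
  Sol (fun z => a * s z + b * s' z) (fun z => a * f z + b * f' z)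
      (fun y => a * u y + b * u' y) (a * kap + b * kap').
Proof.
move=> [h1 [h2 h3] h4] [g1 [g2 g3] g4]; split.
- by apply: circ_contD; apply: circ_contZ.
- split; first by move=> y Yy; apply: harm1D; apply: harm1Z; [exact: h2|exact: g2].
  move=> y0 hb e e0; pose K := `|a| + `|b| + 1.
  have K0 : 0 < K by rewrite /K; have := normr_ge0 a; have := normr_ge0 b; lra.
  have eK : 0 < e / K by rewrite divr_gt0.
  have hz : normc (crd k0 y0 - c0) < r1 by rewrite hb.2.
  apply: filterS2 (h3 _ hb _ eK) (g3 _ hb _ eK) => y a1 a2 Yy.
  rewrite poisD //; try exact: circ_contZ.
  rewrite !poisZ //; move: (a1 Yy) (a2 Yy).
  set P := pois _ _ _ _; set Q := pois _ _ _ _ => b1 b2.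
  have -> : a * u y + b * u' y - (a * P + b * Q + (a * s (crd k0 y0) + b * s' (crd k0 y0))) =
     a * (u y - (P + s (crd k0 y0))) + b * (u' y - (Q + s' (crd k0 y0))) by ring.
  apply: le_lt_trans (ler_normD _ _) _; rewrite !normrM.
  have c1 : `|a| * `|u y - (P + s (crd k0 y0))| <= `|a| * (e / K) by apply: ler_wpM2l => //; exact: ltW.
  have c2 : `|b| * `|u' y - (Q + s' (crd k0 y0))| <= `|b| * (e / K) by apply: ler_wpM2l => //; exact: ltW.
  have c3 : e = K * (e / K) by rewrite mulrCA divff ?mulr1 // gt_eqF.
  rewrite c3 {1}/K !mulrDl mul1r; apply: (@le_lt_trans _ _ (`|a| * (e / K) + `|b| * (e / K))); first exact: lerD.
  by rewrite ltrDl.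
- by move=> z hz; rewrite h4 // g4 //; ring.
Qed.

Section Iteration.
Variables (s : C -> R) (cs : sing_cont s).

Definition dsol f : X -> R :=
  if pselect (exists u, Dsol s f u) is left h then projT1 (cid h) else (fun _ => 0).

Lemma dsolP f : circ_cont c0 r1 f -> Dsol s f (dsol f).
Proof.
move=> cf; rewrite /dsol; case: pselect => [h|[]]; first exact: projT2 (cid h).
exact: Dsol_ex.
Qed.

Let zs : C := c0 + r1%:C.
Let hzs : normc (zs - c0) = r1.
Proof. by rewrite /zs addrAC subrr add0r normcR gtr0_norm. Qed.

(** The normalization at the base point [zs] of the outer circle removes the constants; modulo
    constants the map is a contraction. *)
Definition step f : C -> R := fun z => dsol f (pt z) - s z - (dsol f (pt zs) - s zs).

Lemma step_cont f : circ_cont c0 r1 f -> circ_cont c0 r1 (step f).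
Proof.
move=> cf z hz; apply: continuousB; last exact: rcont_cst.
apply: continuousB; last by apply: cs; apply: ne_c0; rewrite hz.
have gi : chart_img k0 z by apply: gk0.2; rewrite hz ltW.
apply: continuous_comp; first exact: crdV_cont.
by apply: harm1_cont; apply: (dsolP cf).1; exact: pt_Y.
Qed.

Fixpoint iter_f n : C -> R := if n is n'.+1 then step (iter_f n') else fun _ => 0.

Lemma iter_cont n : circ_cont c0 r1 (iter_f n).
Proof. by elim: n => [|n IH] /=; [exact: circ_cont_cst|exact: step_cont]. Qed.

Lemma iter_zs n : iter_f n zs = 0.
Proof. by case: n => // n; rewrite /= /step; ring. Qed.

Lemma dsol_diff f g a : circ_cont c0 r1 f -> circ_cont c0 r1 g ->
  (forall z, normc (z - c0) = r0 -> pois c0 r1 (fun w => f w - g w) z <= a) ->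
  forall y, Y y -> dsol f y - dsol g y <= a.
Proof.
move=> cf cg h; apply: Dsol_le (dsolP cf) (dsolP cg) _ => z hz.
have hz1 : normc (z - c0) < r1 by rewrite hz.
have := h z hz; rewrite poisD // ?poisN //; last by move=> w hw; apply: continuousN; exact: cg.
set P := pois _ _ _ _; set Q := pois _ _ _ _; lra.
Qed.

Lemma circ_contB f g : circ_cont c0 r1 f -> circ_cont c0 r1 g -> circ_cont c0 r1 (fun w => f w - g w).
Proof. by move=> cf cg w hw; apply: continuousB; [exact: cf|exact: cg]. Qed.

Lemma dsol_osc f g B : circ_cont c0 r1 f -> circ_cont c0 r1 g ->
  (forall z w, normc (z - c0) = r1 -> normc (w - c0) = r1 ->
     (f z - g z) - (f w - g w) <= B) ->
  forall y y', Y y -> Y y' -> (dsol f y - dsol g y) - (dsol f y' - dsol g y') <= 2 / 3 * B.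
Proof.
move=> cf cg h y y' Yy Yy'; have cd := circ_contB cf cg.
have cP : circ_cont c0 r0 (pois c0 r1 (fun w => f w - g w)).
  by move=> z hz; apply: ccont_Re; apply: holC_cont (holC_poisF r10 cd) _; rewrite /disc /= hz.
have [zm [zM [h1 h2 h3]]] := circle_minmax r00 cP.
have a1 : dsol f y - dsol g y <= pois c0 r1 (fun w => f w - g w) zM.
  by apply: dsol_diff => // z /h3/andP[].
have a2 : dsol g y' - dsol f y' <= - pois c0 r1 (fun w => f w - g w) zm.
  apply: dsol_diff => // z hz; have hz1 : normc (z - c0) < r1 by rewrite hz.
  have -> : (fun w => g w - f w) = fun w => - (f w - g w) by apply/funext => w; rewrite opprB.
  by rewrite poisN // lerN2; have /andP[] := h3 z hz.
have := pois_osc r10 cd h (_ : normc (zM - c0) <= r0) (_ : normc (zm - c0) <= r0).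
rewrite h1 h2 => /(_ (lexx _) (lexx _)); lra.
Qed.

Lemma iter_step : exists2 A, 0 <= A & forall n z, normc (z - c0) = r1 ->
  `|iter_f n.+1 z - iter_f n z| <= A * (2 / 3) ^+ n.
Proof.
have [zm [zM [h1 h2 h3]]] := circle_minmax r10 (@iter_cont 1).
pose A := iter_f 1 zM - iter_f 1 zm.
have H n z w : normc (z - c0) = r1 -> normc (w - c0) = r1 ->
    (iter_f n.+1 z - iter_f n z) - (iter_f n.+1 w - iter_f n w) <= A * (2 / 3) ^+ n.
  elim: n z w => [|n IH] z w hz hw.
    rewrite expr0 mulr1 /A; have /andP[_ a1] := h3 z hz; have /andP[a2 _] := h3 w hw.
    by rewrite [iter_f 0]/=; lra.
  have := dsol_osc (@iter_cont n.+1) (@iter_cont n) IH (pt_Y hz) (pt_Y hw).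
  rewrite exprS; have -> : 2 / 3 * (A * (2 / 3) ^+ n) = A * (2 / 3 * (2 / 3) ^+ n) by ring.
  have e v : iter_f n.+2 v - iter_f n.+1 v =
      dsol (iter_f n.+1) (pt v) - dsol (iter_f n) (pt v) - (dsol (iter_f n.+1) (pt zs) - dsol (iter_f n) (pt zs)).
    transitivity (step (iter_f n.+1) v - step (iter_f n) v) => //.
    rewrite /step; ring.
  rewrite !e; lra.
exists A => [|n z hz].
  by have := h3 zM h2; rewrite /A subr_ge0 => /andP[].
have := H n z zs hz hzs; have := H n zs z hzs hz; rewrite !iter_zs subrr subr0 sub0r => a1 a2.
by rewrite ler_norml a2 andbT; lra.
Qed.

Lemma Sol_ex : exists f u kap, Sol s f u kap.
Proof.
have [A A0 hA] := iter_step.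
have q01 : 0 <= (2 / 3 : R) < 1 by apply/andP; split; lra.
pose K := A / (1 - 2 / 3); have K0 : 0 <= K by rewrite /K divr_ge0 //; lra.
have Hl z : exists lm : R, normc (z - c0) = r1 -> forall n, `|lm - iter_f n z| <= K * (2 / 3) ^+ n.
  have [hz|hz] := pselect (normc (z - c0) = r1); last by exists 0.
  have [l hl] := @geometric_limit R (fun n => iter_f n z) A _ q01 (fun n => hA n z hz).
  by exists l.
have [f hf] := choice Hl.
have small e : 0 < e -> exists n, K * (2 / 3) ^+ n < e.
  move=> e0; have lt1 : `|2 / 3 : R| < 1 by rewrite ger0_norm; lra.
  have /cvgrPdist_lt /(_ (e / (K + 1))) := @cvg_expr R _ lt1.
  have e1 : 0 < e / (K + 1) by rewrite divr_gt0 //; lra.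
  move=> /(_ e1) [n _ hn]; exists n; have := hn n (leqnn n).
  rewrite /= sub0r normrN ger0_norm ?exprn_ge0 //; last by lra.
  rewrite ltr_pdivlMr; last by lra.
  have := exprn_ge0 n (_ : 0 <= 2 / 3 :> R); rewrite divr_ge0 // => /(_ isT).
  move: ((2 / 3) ^+ n) => t t0; nra.
(* The limit exists only on the circle, while [circ_cont] speaks of continuity in the plane; it is
   extended along rays. *)
pose rp w : C := c0 + (r1 / normc (w - c0))%:C * (w - c0).
have rp1 z : normc (z - c0) = r1 -> rp z = z.
  by move=> hz; rewrite /rp hz divff ?gt_eqF // mul1r; ring.
have rpC w : w != c0 -> normc (rp w - c0) = r1.
  move=> hw; have h0 : 0 < normc (w - c0) by rewrite normc_gt0 subr_eq0.
  rewrite /rp addrAC subrr add0r normcM normcR gtr0_norm ?divr_gt0 // divfK //; exact: lt0r_neq0.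
have crp z : normc (z - c0) = r1 -> ccont rp z.
  move=> hz; have cn : ccont (fun w => w - c0) z by apply: ccontB; [exact: ccont_id|exact: ccont_cst].
  apply: ccontD; first exact: ccont_cst.
  apply: ccontM => //; apply: ccont_Complex; last exact: rcont_cst.
  apply: continuousM; first exact: rcont_cst.
  apply: continuousV; first by rewrite hz gt_eqF.
  exact: (@ccont_normc _ _ (fun w => w - c0)).
pose F w := f (rp w).
have FE z : normc (z - c0) = r1 -> F z = f z by move=> hz; rewrite /F rp1.
have F1 z n : normc (z - c0) = r1 -> `|F z - iter_f n z| <= K * (2 / 3) ^+ n.
  by move=> hz; rewrite FE //; exact: hf.
have cF : circ_cont c0 r1 F.
  move=> z hz; have cr : {for z, continuous (fun w => 0 : R)} by exact: rcont_cst.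
  apply/rcontP => e e0; have e3 : 0 < e / 3 by rewrite divr_gt0.
  have [n hn] := small _ e3.
  have ci : {for rp z, continuous (iter_f n)} by rewrite rp1 //; exact: iter_cont.
  have := (rcontP _ _).1 (rcont_ccomp ci (crp z hz)) _ e3.
  have nz : \forall w \near z, w != c0.
    have z0 : 0 < normc (z - c0) by rewrite hz.
    have := @ccont_id _ z _ z0; apply: filterS => w hw; apply/eqP => ew.
    by move: hw; rewrite ew normcB ltxx.
  apply: filterS2 nz => w hw h1.
  have h2 := hf _ (rpC w hw) n; have h3 := hf _ (rpC z (ne_c0 (_ : 0 < normc (z - c0)))) n.
  rewrite hz in h3; have {}h3 := h3 r10.
  rewrite /F; move: h1 h2 h3; rewrite !ler_norml !ltr_norml => /andP[a1 a2] /andP[a3 a4] /andP[a5 a6].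
  by apply/andP; split; lra.
have hu := dsolP cF; set u := dsol F in hu.
exists F, u, (u (pt zs) - s zs - F zs); split => // z hz.
apply/eqP; rewrite -subr_eq0 -normr_eq0; apply/negPn/negP => n0.
(* An eighth of the supposed mismatch: the four errors below, each at most [e], add up to at most
   half of it. *)
pose e := `|u (pt z) - (F z + s z + (u (pt zs) - s zs - F zs))| / 8.
have e0 : 0 < e by rewrite divr_gt0 // lt_def n0 /=.
have [n hn] := small _ e0.
have bd1 y : Y y -> u y - dsol (iter_f n) y <= e.
  apply: dsol_diff => //; first exact: iter_cont.
  move=> w hw; have hw1 : normc (w - c0) < r1 by rewrite hw.
  rewrite -(pois_cst r10 e hw1); apply: pois_le => //; [by apply: circ_contB => //; exact: iter_cont|exact: circ_cont_cst|].
  move=> v /(F1 _ n) h; apply: le_trans (ler_norm _) _; apply: le_trans h _; exact: ltW.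
have bd2 y : Y y -> dsol (iter_f n) y - u y <= e.
  apply: dsol_diff => //; first exact: iter_cont.
  move=> w hw; have hw1 : normc (w - c0) < r1 by rewrite hw.
  rewrite -(pois_cst r10 e hw1); apply: pois_le => //; [by apply: circ_contB => //; exact: iter_cont|exact: circ_cont_cst|].
  move=> v /(F1 _ n) h; rewrite -opprB; apply: le_trans (ler_norm _) _; rewrite normrN; apply: le_trans h _; exact: ltW.
have q1 : K * (2 / 3) ^+ n.+1 <= K * (2 / 3) ^+ n.
  apply: ler_wpM2l => //; rewrite exprS ger_pMl ?exprn_gt0 //; lra.
have h1 := F1 z n.+1 hz; have h2 := F1 zs n hzs; rewrite iter_zs subr0 in h2.
have b1 := bd1 _ (pt_Y hz); have b2 := bd2 _ (pt_Y hz); have b3 := bd1 _ (pt_Y hzs); have b4 := bd2 _ (pt_Y hzs).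
rewrite [iter_f n.+1]/= /step in h1.
have : `|u (pt z) - (F z + s z + (u (pt zs) - s zs - F zs))| <= 4 * e.
  move: h1 h2; rewrite !ler_norml => /andP[a1 a2] /andP[a3 a4]; apply/andP; split; lra.
have e8 : `|u (pt z) - (F z + s z + (u (pt zs) - s zs - F zs))| = 8 * e by rewrite /e; move: (`|_|) => t; field.
by rewrite e8; lra.
Qed.

End Iteration.

Definition polar (al : C) z : R := re (al / (z - c0)).

Lemma sing_cont_polar al : sing_cont (polar al).
Proof.
move=> z hz; apply: (@ccont_Re _ _ (fun z => al / (z - c0))); apply: ccontM; first exact: ccont_cst.
by apply: ccontV; [rewrite subr_eq0|apply: ccontB; [exact: ccont_id|exact: ccont_cst]].
Qed.

(** The poles [1] and [i] each give a solution with some constant; a real combination of the two,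
    with a nonzero pole, has constant 0. *)
Lemma Sol_polar : exists al f u, al != 0 /\ Sol (polar al) f u 0.
Proof.
have [f1 [u1 [k1 h1]]] := Sol_ex (@sing_cont_polar 1).
have [e|n1] := eqVneq k1 0.
  by exists 1, f1, u1; rewrite oner_neq0 -e.
have [f2 [u2 [k2 h2]]] := Sol_ex (@sing_cont_polar (Complex 0 1)).
have := Sol_lin k2 (- k1) h1 h2; rewrite mulNr mulrC subrr => h.
exists (Complex k2 (- k1)); do 2 eexists; split.
  by apply/eqP => -[_ /eqP]; rewrite oppr_eq0 (negbTE n1).
have -> : polar (Complex k2 (- k1)) = (fun z => k2 * polar 1 z + - k1 * polar (Complex 0 1) z).
  apply/funext => z; rewrite /polar -!ReMr -ReD; congr complex.Re.
  have -> : Complex k2 (- k1) = k2%:C + (- k1)%:C * Complex 0 1 :> C by apply: Re_Im_eq; rewrite ?ReD ?ImD ?ReMr ?ImMr /=; ring.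
  by rewrite !mulrA mulr1 mulrDl.
exact: h.
Qed.

(** The exterior solution and [re F] plus the pole have the same boundary values on both circles,
    hence agree on the annulus between them and glue to one function. *)
Theorem dipole_harmonic : exists al F (U : X -> R), [/\ al != 0,
  holC (disc c0 r1) F,
  forall y, y <> pt c0 -> harm1 U y &
  forall y, odisc k0 c0 r1 y -> y <> pt c0 -> U y = re (F (crd k0 y) + al / (crd k0 y - c0))].
Proof.
have [al [f [u [al0 [cf [u1 u2] u3]]]]] := Sol_polar.
pose F := poisF c0 r1 f; have hF : holC (disc c0 r1) F := holC_poisF r10 cf.
pose G y := F (crd k0 y) + al / (crd k0 y - c0).
have hG y : odisc k0 c0 r1 y -> y <> pt c0 -> hol1 G y.
  move=> [h1 h2] hp; apply: hol1D; first by have [m dm] := hF _ h2; exact: hol1_of_chart h1 dm.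
  apply: hol1M; first exact: hol1_cst.
  apply: hol1V; last by apply: hol1B; [exact: hol1_crd|exact: hol1_cst].
  by rewrite subr_eq0; apply/eqP => e; apply: hp; rewrite -e crdK.
have c00 : normc (c0 - c0) <= r1 by rewrite subrr normc0 ltW.
have Yp y : Y y -> y <> pt c0.
  have [d1 d2] := ptP c00.
  by move=> + e; apply; rewrite e; split; rewrite // d2 subrr normc0 ltW.
have oO := @open_odisc R X k0 c0 r1.
have oY : open Y by apply: open_extE r0R0 gk0.
have oP : open [set y : X | y <> pt c0].
  exact: open_setC1.
have hV y : odisc k0 c0 r1 y -> y <> pt c0 -> harm1 (fun y => re (G y)) y.
  move=> hO hp; exists G; split; last exact: filterE.
  by apply: filterS2 (near_open oO hO) (near_open oP hp); exact: hG.
pose W := Y `&` odisc k0 c0 r1.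
have bdW y e : ~ W y -> 0 < e -> \forall y' \near y, W y' -> `|u y' - re (G y')| < e.
  move=> nW e0; have e2 : 0 < e / 2 by rewrite divr_gt0.
  have [Yy|nY] := pselect (Y y); last first.
    have [hb|hn] := near_notY nY; last by apply: filterS hn => y' h' [].
    have hO : odisc k0 c0 r1 y by case: hb => b1 b2; split; rewrite ?b2.
    have hp : y <> pt c0.
      move=> e1; have [d1 d2] := ptP c00.
      by have := hb.2; rewrite e1 d2 subrr normc0 => e3; move: r00; rewrite -e3 ltxx.
    have := (rcontP _ _).1 (harm1_cont (hV _ hO hp)) _ e2.
    apply: filterS2 (u2 _ hb _ e2) => y' a1 a2 [Yy' _]; have := a1 Yy'; move: a2.
    rewrite -/F {2}/G ReD -/(polar al _) -/(pois c0 r1 f _) !ltr_norml => /andP[b1 b2] /andP[b3 b4].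
    by apply/andP; split; lra.
  have [hc|hc] := pselect (cdisc k0 c0 r1 y); last first.
    have g1 : good k0 c0 r1 by apply: good_le gk0 _ _ => //; exact: ltW.
    by apply: filterS (near_notin_cdisc g1 hc) => y' h' [_ /h'].
  case: hc => c1 c2; have hz : normc (crd k0 y - c0) = r1.
    apply: le_anti; rewrite c2 leNgt /=; apply/negP => h; exact: nW.
  have e3 : 0 < e / 3 by rewrite divr_gt0.
  have [d d0 hd] := pois_boundary r10 cf hz e3.
  have n1 := (rcontP _ _).1 (harm1_cont (u1 _ Yy)) _ e3.
  have n2 := ccont_crd c1 d0.
  have nc : crd k0 y != c0 by apply: ne_c0; rewrite hz.
  have n3 := (rcontP _ _).1 (rcont_ccomp (@sing_cont_polar al _ nc) (ccont_crd c1)) _ e3.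
  have := u3 _ hz; rewrite crdK // addr0 => uy.
  near=> y' => -[_ [d1 d2]].
  have a1 : `|u y' - u y| < e / 3 by near: y'.
  have a2 : normc (crd k0 y' - crd k0 y) < d by near: y'.
  have a3 : `|polar al (crd k0 y') - polar al (crd k0 y)| < e / 3 by near: y'.
  have := hd _ d2 a2; rewrite /G ReD -/(polar al _) -/(pois c0 r1 f _).
  move: a1 a3; rewrite uy !ltr_norml => /andP[b1 b2] /andP[b3 b4] /andP[b5 b6].
  by apply/andP; split; lra.
have oW : open W by apply: openI.
have WT : W <> setT.
  move=> eW; have WW : W (pt c0) by rewrite eW.
  by case: WW => /Yp.
have cW y : W y -> harm1 u y /\ harm1 (fun y => re (G y)) y.
  by move=> [w1 w2]; split; [exact: u1|apply: hV => //; exact: Yp].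
have eW y : W y -> u y = re (G y).
  move=> Wy; apply/eqP; rewrite eq_le -subr_le0 -[X in _ && X]subr_le0; apply/andP; split.
    apply: (@max_principle R X Xcompact Xconn W (fun y => u y - re (G y))) => //.
    - by move=> y' /cW[a b]; apply: continuousB; exact: harm1_cont.
    - by move=> y' /cW[a b]; apply: harm_sh1; exact: harm1B.
    move=> y' /bdW h e /h; apply: filterS => y'' h' /h' h2; rewrite add0r; exact: ltW (le_lt_trans (ler_norm _) h2).
  apply: (@max_principle R X Xcompact Xconn W (fun y => re (G y) - u y)) => //.
  - by move=> y' /cW[a b]; apply: continuousB; exact: harm1_cont.
  - by move=> y' /cW[a b]; apply: harm_sh1; exact: harm1B.
  move=> y' /bdW h e /h; apply: filterS => y'' h' /h'; rewrite distrC => h2; rewrite add0r; exact: ltW (le_lt_trans (ler_norm _) h2).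
exists al, F, (fun y => if `[< odisc k0 c0 r1 y >] then re (G y) else u y); split => //.
  move=> y hp; have [hO|hO] := pselect (odisc k0 c0 r1 y).
    by apply: harm1_near (hV y hO hp); apply: filterS (near_open oO hO) => y' h; rewrite asboolT.
  have Yy : Y y by move=> [h1 h2]; apply: hO; split => //; exact: le_lt_trans h2 r0r1.
  apply: harm1_near (u1 y Yy); apply: filterS (near_open oY Yy) => y' h; case: asboolP => // h'.
  exact: eW.
by move=> y hO _; rewrite asboolT.
Unshelve. all: by end_near. Qed.

End Alternating.

(** * Differentials of functions and forms attached to harmonic functions *)

Section DifferentialCalculus.
Context {R : realType} {X : riemannSurface R}.
Local Notation C := (Cplx R).
Implicit Types (W N : set X) (k l : cidx X) (y : X) (f g : X -> C).

Lemma dfun_dC f k y m : dC (f \o crdV k) (crd k y) m -> dfun k f y = m.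
Proof. exact: dC_derive1. Qed.

Lemma hol1_dC f k y : cdom k y -> hol1 f y -> dC (f \o crdV k) (crd k y) (dfun k f y).
Proof. by move=> hk /(hol1P _ hk).1[m dm]; rewrite (dfun_dC dm). Qed.

Lemma dfun_near f g k y : cdom k y -> (\forall y' \near y, f y' = g y') -> hol1 f y ->
  dfun k g y = dfun k f y.
Proof.
move=> hk e hf; apply: dfun_dC; apply: dC_near (hol1_dC hk hf); exact: near_crdV hk e.
Qed.

Lemma dfun_cst k y (a : C) : dfun k (fun _ => a) y = 0.
Proof. apply: dfun_dC; exact: dC_cst. Qed.

Lemma dfunB f g k y : cdom k y -> hol1 f y -> hol1 g y ->
  dfun k (fun y => f y - g y) y = dfun k f y - dfun k g y.
Proof. by move=> hk hf hg; apply: dfun_dC; exact: dCB (hol1_dC hk hf) (hol1_dC hk hg). Qed.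

Lemma dfunD f g k y : cdom k y -> hol1 f y -> hol1 g y ->
  dfun k (fun y => f y + g y) y = dfun k f y + dfun k g y.
Proof. by move=> hk hf hg; apply: dfun_dC; exact: dCD (hol1_dC hk hf) (hol1_dC hk hg). Qed.

Lemma dfunM f g k y : cdom k y -> hol1 f y -> hol1 g y ->
  dfun k (fun y => f y * g y) y = dfun k f y * g y + f y * dfun k g y.
Proof.
move=> hk hf hg; apply: dfun_dC; have := dCM (hol1_dC hk hf) (hol1_dC hk hg).
by rewrite /= crdK.
Qed.

Lemma hol1_dcrd k l y : cdom k y -> cdom l y -> dC (crd l \o crdV k) (crd k y) (dcrd k l y).
Proof. by move=> hk hl; exact: hol1_dC hk (hol1_crd hl). Qed.

Lemma dfun_change f k l y : cdom k y -> cdom l y -> hol1 f y ->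
  dfun k f y = dfun l f y * dcrd k l y.
Proof.
move=> hk hl hf; apply: dfun_dC.
have d1 := hol1_dcrd hk hl.
have d2 : dC (f \o crdV l) ((crd l \o crdV k) (crd k y)) (dfun l f y).
  have -> : (crd l \o crdV k) (crd k y) = crd l y by congr (crd l _); exact: crdK.
  exact: hol1_dC.
apply: dC_near (dC_comp d1 d2).
have := near_crdV hk (near_open (cdom_open l) hl); apply: filterS => z hz /=; by rewrite crdK.
Qed.

Lemma hol1_dfun f k y : cdom k y -> (\forall y' \near y, hol1 f y') -> hol1 (dfun k f) y.
Proof.
move=> hk hf; have [r r0 h] := (near_chart _ hk).1 hf.
have oi : open (chart_img k) := @crd_open R X k; have ik : chart_img k (crd k y) by exists y.
have [d d0 hd] := (open_cplx _).1 oi _ ik.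
pose s := Num.min r d; have s0 : 0 < s by rewrite lt_min r0.
have sr : s <= r by rewrite ge_min lexx.
have sd : s <= d by rewrite ge_min lexx orbT.
have hC : holC (disc (crd k y) s) (f \o crdV k).
  apply: holC_chart => [y'' [g1 g2]|z hz].
    by apply: h; split => //; exact: lt_le_trans g2 sr.
  by apply: hd; exact: lt_le_trans hz sd.
have ds : disc (crd k y) s (crd k y) by rewrite /disc /= subrr normc0.
have [m dm] := holC_derive1 (@disc_open R _ _) hC ds.
exact: (hol1_of_chart hk dm).
Qed.

(** The differential of a local holomorphic function with real part [U]. Two such functions differ
    by a constant ([dharmE]), so the choice is harmless and the local differentials form a global
    form. *)
Definition dharm (U : X -> R) k y : C :=
  if pselect (harm1 U y) is left h then dfun k (projT1 (cid h)) y else 0.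

Lemma dharmE U g k y : cdom k y -> (\forall y' \near y, hol1 g y') ->
  (\forall y' \near y, U y' = re (g y')) -> dharm U k y = dfun k g y.
Proof.
move=> hk h1 h2; rewrite /dharm; case: pselect => [h|[]]; last by exists g.
case: (cid h) => g' /= [h1' h2'].
have := @hol1_max _ _ (fun y => g' y - g y) y; move=> H.
have {}H : \forall y' \near y, g' y' - g y' = g' y - g y.
  apply: H; first by apply: filterS2 h1 h1' => y' a b; exact: hol1B.
  have e0 := nbhs_singleton h2; have e0' := nbhs_singleton h2'.
  by apply: filterS2 h2 h2' => y' a b; rewrite !ReB -a -b -e0 -e0' !subrr.
have hg := nbhs_singleton h1; have hg' := nbhs_singleton h1'.
have := dfunB hk hg' hg; rewrite -(dfun_near hk H (hol1B hg' hg)) dfun_cst.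
by move/esym/subr0_eq.
Qed.

Lemma dharm_form U W : open W -> (forall y, W y -> harm1 U y) -> is_form W (dharm U).
Proof.
move=> oW hU; have nearE y g : W y -> (\forall y' \near y, hol1 g y') ->
    (\forall y' \near y, U y' = re (g y')) -> forall k, cdom k y -> \forall y' \near y, dharm U k y' = dfun k g y'.
  move=> Wy h1 h2 k hk; have n1 := nearP_dep.
  have h1' : \forall y' \near y, \forall y'' \near y', hol1 g y'' by exact: near_join.
  have h2' : \forall y' \near y, \forall y'' \near y', U y'' = re (g y'') by exact: near_join.
  by apply: filterS3 h1' h2' (near_open (cdom_open k) hk) => y' a b c; exact: dharmE.
split=> [k|k l y Wy hk hl].
  apply/holP => y [Wy hk]; have [g [h1 h2]] := hU _ Wy.
  apply: hol1_near (hol1_dfun hk h1).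
  by apply: filterS (nearE _ _ Wy h1 h2 _ hk) => y' ->.
have [g [h1 h2]] := hU _ Wy.
rewrite (dharmE hk h1 h2) (dharmE hl h1 h2); apply: dfun_change => //; exact: nbhs_singleton h1.
Qed.

Theorem double_pole_form (Xcompact : compact [set: X]) (Xconn : connected [set: X]) (p : X) :
  exists k N al G w, [/\ coord_nbhd k p N, al != 0, is_form (~` [set p]) w, hol N G &
    forall y, N y -> y <> p -> w k y = al / ccrd k p y ^+ 2 + G y].
Proof.
have [k [R0 [hk g _]]] := chart_at openT (I : [set: X] p).
set c := crd k p in g; have R00 : 0 < R0 by case: g.
have r10 : 0 < R0 / 2 by rewrite divr_gt0.
have r1R : R0 / 2 < R0 by rewrite ltr_pdivrMr // ltr_pMr // ltrDl ltr01.
have [al [F [U [al0 hF hU eU]]]] := dipole_harmonic Xcompact Xconn r10 r1R g.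
have pc : crdV k c = p by rewrite /c crdK.
rewrite pc in hU eU.
have oP : open (~` [set p] : set X).
  exact: open_setC1.
have oO := @open_odisc R X k c (R0 / 2).
(* The polar part [al / (z - c)] of the harmonic function has derivative [- al / (z - c)^2], whence
   the sign. *)
exists k, (odisc k c (R0 / 2)), (- al), (fun y => derive1 F (crd k y)), (dharm U); split.
- split => //; first exact: odisc_center.
  by move=> y [].
- by rewrite oppr_eq0.
- exact: dharm_form.
- apply/holP => y [h1 h2]; have [m dm] := holC_derive1 (@disc_open R _ _) hF h2.
  exact: hol1_of_chart h1 dm.
move=> y [h1 h2] hp.
pose q z := F z + al / (z - c).
have nz : crd k y - c != 0 by rewrite subr_eq0; apply/eqP => e; apply: hp; rewrite -pc -e crdK.
have dq z : disc c (R0 / 2) z -> z - c != 0 -> dC q z (derive1 F z + - al / (z - c) ^+ 2).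
  move=> Dz zc; apply: dCD; first exact: holC_dC hF Dz.
  have d1 : dC (fun v => v - c) z 1 by have := dCB (dC_id z) (dC_cst c z); rewrite subr0.
  apply: dC_eq (dCZ al (@dCV _ (fun v => v - c) _ _ zc d1)) _.
  by rewrite mulNr mul1r mulrN mulNr.
have nO : \forall y' \near y, odisc k c (R0 / 2) y' /\ y' <> p.
  by apply: filterI; [exact: near_open oO _|exact: near_open oP _].
have hq : \forall y' \near y, hol1 (fun y => q (crd k y)) y'.
  apply: filterS nO => y' [[g1 g2] g3]; apply: (hol1_of_chart g1 (dq _ g2 _)).
  by rewrite subr_eq0; apply/eqP => e; apply: g3; rewrite -pc -e crdK.
rewrite (dharmE h1 hq); last by apply: filterS nO => y' [g1 g2]; exact: eU.
rewrite /ccrd -/c addrC; apply: dfun_dC; apply: dC_near (dq _ h2 nz).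
have oi : open (chart_img k) := @crd_open R X k; have ik : chart_img k (crd k y) by exists y.
by have := open_nbhs_nbhs (conj oi ik); apply: filterS => z hz /=; have [_ ->] := crdVK hz.
Qed.

End DifferentialCalculus.

(** * Orders and residues *)

Section LocalTheory.
Context {R : realType} {X : riemannSurface R}.
Local Notation C := (Cplx R).
Implicit Types (W N : set X) (k l : cidx X) (x y : X) (f g h F : X -> C) (w : cidx X -> X -> C).

Lemma hol_chart_disc k x h : cdom k x -> (\forall y \near x, hol1 h y) ->
  exists r, [/\ good k (crd k x) r, holC (disc (crd k x) r) (h \o crdV k) &
    forall y, odisc k (crd k x) r y -> hol1 h y].
Proof.
move=> hk hf; have [r r0 hr] := (near_chart _ hk).1 hf.
have [d [[d0 gd] _]] := chart_disc hk openT (I : [set: X] x).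
pose s := Num.min r d; have s0 : 0 < s by rewrite lt_min r0.
have sr : s <= r by rewrite ge_min lexx.
have sd : s <= d by rewrite ge_min lexx orbT.
have hs y : odisc k (crd k x) s y -> hol1 h y.
  by move=> [h1 h2]; apply: hr; split => //; exact: lt_le_trans h2 sr.
have gs : good k (crd k x) s by split => // z hz; apply: gd; exact: le_trans hz sd.
exists s; split => //; apply: holC_chart => // z hz; apply: gs.2; exact: ltW.
Qed.

Lemma hol1_comp_crd k c r (G : C -> C) y : holC (disc c r) G -> odisc k c r y ->
  hol1 (fun y => G (crd k y)) y.
Proof. by move=> hG [h1 h2]; have [m dm] := hG _ h2; exact: hol1_of_chart h1 dm. Qed.

Lemma near_odisc k x r : cdom k x -> 0 < r -> \forall y \near x, odisc k (crd k x) r y.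
Proof. by move=> hk r0; apply: near_open; [exact: open_odisc|exact: odisc_center]. Qed.

Lemma hol_near_comp k x r (G : C -> C) : cdom k x -> 0 < r -> holC (disc (crd k x) r) G ->
  \forall y \near x, hol1 (fun y => G (crd k y)) y.
Proof. by move=> hk r0 hG; apply: filterS (near_odisc hk r0) => y; exact: hol1_comp_crd. Qed.

Lemma hol_div k x h : cdom k x -> (\forall y \near x, hol1 h y) ->
  exists h1, (\forall y \near x, hol1 h1 y) /\
    \forall y \near x, h y = h x + ccrd k x y * h1 y.
Proof.
move=> hk hf; have [r [[r0 gr] hC _]] := hol_chart_disc hk hf.
pose G := dquot (h \o crdV k) (crd k x).
have hG : holC (disc (crd k x) r) G := holC_dquot (@disc_open R _ _) (disc_center _ r0) hC.
exists (fun y => G (crd k y)); split; first exact: hol_near_comp hG.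
apply: filterS (near_odisc hk r0) => y [h1 h2].
by have := dquotE (h \o crdV k) (crd k x) (crd k y); rewrite /= !crdK.
Qed.

Lemma hol_factor k x h : cdom k x -> (\forall y \near x, hol1 h y) ->
  (\forall y \near x, h y = 0) \/
  exists n g, [/\ \forall y \near x, hol1 g y, g x != 0 & \forall y \near x, h y = ccrd k x y ^+ n * g y].
Proof.
move=> hk hf; have [r [[r0 gr] hC _]] := hol_chart_disc hk hf.
have [hz|[n [g [hg g0 e]]]] := holC_factor r0 hC; [left|right].
  by apply: filterS (near_odisc hk r0) => y [h1 h2]; have := hz _ h2; rewrite /= crdK.
exists n, (fun y => g (crd k y)); split => //; first exact: hol_near_comp hg.
by apply: filterS (near_odisc hk r0) => y [h1 h2]; have := e (crd k y); rewrite /= crdK.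
Qed.

Lemma hol_prim k x h : cdom k x -> (\forall y \near x, hol1 h y) ->
  exists F, (\forall y \near x, hol1 F y) /\ \forall y \near x, dfun k F y = h y.
Proof.
move=> hk hf; have [r [[r0 gr] hC _]] := hol_chart_disc hk hf.
have cf z : disc (crd k x) r z -> ccont (h \o crdV k) z by move=> Dz; exact: holC_cont hC Dz.
have df z : disc (crd k x) r z -> z != crd k x -> exists m, dC (h \o crdV k) z m by move=> Dz _; exact: hC.
have [F dF] := disc_primitive (disc_center _ r0) cf df.
have hF : holC (disc (crd k x) r) F by move=> z Dz; eexists; exact: dF.
exists (fun y => F (crd k y)); split; first exact: hol_near_comp hF.
apply: filterS (near_odisc hk r0) => y [h1 h2]; apply: dfun_dC.
have := dF _ h2; rewrite /= crdK //; apply: dC_near.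
have oi : open (chart_img k) := @crd_open R X k; have ik : chart_img k (crd k y) by exists y.
by have := open_nbhs_nbhs (conj oi ik); apply: filterS => z hz /=; have [_ ->] := crdVK hz.
Qed.

Lemma crd_inj k x y : cdom k x -> cdom k y -> crd k y = crd k x -> y = x.
Proof. by move=> hx hy e; rewrite -(crdK hx) -e crdK. Qed.

Lemma ccrd_neq0 k x y : cdom k x -> cdom k y -> y <> x -> ccrd k x y != 0.
Proof. by move=> hx hy n; rewrite subr_eq0; apply/eqP => /(crd_inj hx hy). Qed.

Lemma ccrd0 k x : ccrd k x x = 0. Proof. exact: subrr. Qed.

Lemma near_cdom k x : cdom k x -> \forall y \near x, cdom k y.
Proof. by move=> h; exact: near_open (cdom_open k) h. Qed.

Lemma hol1_ccrd k x y : cdom k y -> hol1 (ccrd k x) y.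
Proof. by move=> h; apply: hol1B; [exact: hol1_crd|exact: hol1_cst]. Qed.

Lemma near_hol_ccrd k x : cdom k x -> \forall y \near x, hol1 (ccrd k x) y.
Proof. by move=> h; apply: filterS (near_cdom h) => y; exact: hol1_ccrd. Qed.

Lemma dcrd_id k y : cdom k y -> dcrd k k y = 1.
Proof.
move=> hk; apply: dfun_dC; apply: dC_near (dC_id _).
have oi : open (chart_img k) := @crd_open R X k; have ik : chart_img k (crd k y) by exists y.
by have := open_nbhs_nbhs (conj oi ik); apply: filterS => z hz /=; have [_ ->] := crdVK hz.
Qed.

Lemma dcrd_neq0 k l y : cdom k y -> cdom l y -> dcrd k l y != 0.
Proof.
move=> hk hl; have := dfun_change hk hl (hol1_crd hk); rewrite -/(dcrd k k y) dcrd_id // => e.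
by apply/eqP => e0; move: e; rewrite e0 mulr0 => /eqP; rewrite oner_eq0.
Qed.

Lemma dfun_ccrd l k x y : cdom l y -> cdom k y -> dfun l (ccrd k x) y = dcrd l k y.
Proof. by move=> hl hk; rewrite dfunB ?dfun_cst ?subr0 //; [exact: hol1_crd|exact: hol1_cst]. Qed.

Lemma near_neq0 h x : hol1 h x -> h x != 0 -> \forall y \near x, h y != 0.
Proof.
move=> hh n0; have p0 : 0 < normc (h x) by rewrite normc_gt0.
apply: filterS (hol1_cont hh p0) => y hy; apply/eqP => e.
by move: hy; rewrite e sub0r normcN ltxx.
Qed.

Lemma ccrd_unit k l x : cdom k x -> cdom l x -> exists U, [/\ \forall y \near x, hol1 U y,
  \forall y \near x, U y != 0 & \forall y \near x, ccrd k x y = ccrd l x y * U y].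
Proof.
move=> hk hl; have [U [hU e]] := hol_div hl (near_hol_ccrd hk).
have hUx := nbhs_singleton hU.
have e' : \forall y \near x, ccrd l x y * U y = ccrd k x y.
  by apply: filterS e => y ->; rewrite ccrd0 add0r.
have Ux : U x != 0.
  have hcl := hol1_ccrd x hl.
  have := dfun_near hl e' (hol1M hcl hUx).
  rewrite dfunM // ccrd0 mul0r addr0 !dfun_ccrd // dcrd_id // mul1r => <-.
  exact: dcrd_neq0.
exists U; split => //; first exact: near_neq0.
by apply: filterS e' => y ->.
Qed.

(** * Meromorphic functions and residues *)

(** Meromorphic functions are total functions with arbitrary values at their poles, so identities
    between them are stated on punctured neighbourhoods. *)
Definition pnear x (P : X -> Prop) := \forall y \near x, y <> x -> P y.

Lemma pnearW x (P : X -> Prop) : (\forall y \near x, P y) -> pnear x P.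
Proof. by apply: filterS => y h _. Qed.

#[global] Instance pnear_filter x : Filter (pnear x).
Proof.
split; first by apply: pnearW; apply: filterE.
  by rewrite /pnear => P Q h1 h2; apply: filterS2 h1 h2 => y a b n; split; [exact: a|exact: b].
by rewrite /pnear => P Q h; apply: filterS => y a n; apply: h; exact: a.
Qed.

Lemma pnearT x (P : X -> Prop) : (forall y, P y) -> pnear x P.
Proof. by move=> h; apply: pnearW; apply: filterE. Qed.

Lemma pnearI x (P Q : X -> Prop) : pnear x P -> pnear x Q -> pnear x (fun y => P y /\ Q y).
Proof. exact: filterI. Qed.

Lemma pnear_join x (P : X -> Prop) : pnear x P -> pnear x (fun y => \forall y' \near y, P y').
Proof.
move=> h; have h' : \forall y \near x, \forall y' \near y, y' <> x -> P y' by exact: near_join h.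
rewrite /pnear; apply: filterS h' => y hy n; have := near_open (open_setC1 x) n.
by apply: filterS2 hy => y' a /a.
Qed.

Lemma pnear_ccrd k x : cdom k x -> pnear x (fun y => ccrd k x y != 0).
Proof. by move=> hk; apply: filterS (near_cdom hk) => y hy; exact: ccrd_neq0. Qed.

Definition mero1 (f : X -> C) x := exists k h m, [/\ cdom k x, \forall y \near x, hol1 h y &
  pnear x (fun y => f y = h y / ccrd k x y ^+ m)].

Lemma mero1P f l x : cdom l x -> mero1 f x -> exists h m, (\forall y \near x, hol1 h y) /\
  pnear x (fun y => f y = h y / ccrd l x y ^+ m).
Proof.
move=> hl [k [h [m [hk hh e]]]]; have [U [U1 U2 U3]] := ccrd_unit hk hl.
exists (fun y => h y / U y ^+ m), m; split.
  near=> y; apply: hol1M; first by near: y.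
  have hU : hol1 U y by near: y.
  by apply: hol1V; [rewrite expf_neq0 //; near: y|exact: hol1X].
apply: filterS3 e (pnearW U3) (pnear_ccrd hl) => y -> -> n.
by rewrite exprMn invfM mulrA mulrAC.
Unshelve. all: by end_near. Qed.

Lemma mero1_hol f x : (\forall y \near x, hol1 f y) -> mero1 f x.
Proof.
move=> h; have [k hk] := cdom_cover x; exists k, f, 0; split => //.
by apply: pnearT => y; rewrite expr0 divr1.
Qed.

Lemma mero1_near f g x : pnear x (fun y => f y = g y) -> mero1 f x -> mero1 g x.
Proof.
move=> e [k [h [m [hk hh e']]]]; exists k, h, m; split => //.
by apply: filterS2 e e' => y <-.
Qed.

Lemma mero1M f g x : mero1 f x -> mero1 g x -> mero1 (fun y => f y * g y) x.
Proof.
move=> [k [h [m [hk hh e]]]] /(mero1P hk)[h' [m' [hh' e']]].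
exists k, (fun y => h y * h' y), (m + m')%N; split => //.
  by apply: filterS2 hh hh' => y; exact: hol1M.
by apply: filterS2 e e' => y -> ->; rewrite exprD invfM mulrACA.
Qed.

Lemma mero1D f g x : mero1 f x -> mero1 g x -> mero1 (fun y => f y + g y) x.
Proof.
move=> [k [h [m [hk hh e]]]] /(mero1P hk)[h' [m' [hh' e']]].
exists k, (fun y => h y * ccrd k x y ^+ m' + h' y * ccrd k x y ^+ m), (m + m')%N; split => //.
  apply: filterS3 hh hh' (near_hol_ccrd hk) => y a b d.
  by apply: hol1D; apply: hol1M => //; exact: hol1X.
apply: filterS3 e e' (pnear_ccrd hk) => y -> -> n.
by rewrite exprD; field; rewrite !expf_neq0.
Qed.

Lemma mero1_cst (a : C) x : mero1 (fun _ => a) x.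
Proof. by apply: mero1_hol; apply: filterE => y; exact: hol1_cst. Qed.

Lemma mero1Z (a : C) f x : mero1 f x -> mero1 (fun y => a * f y) x.
Proof. by apply: mero1M; exact: mero1_cst. Qed.

Lemma mero1B f g x : mero1 f x -> mero1 g x -> mero1 (fun y => f y - g y) x.
Proof.
move=> hf /(mero1Z (-1)) hg; apply: mero1_near (mero1D hf hg).
by apply: pnearT => y; rewrite mulN1r.
Qed.

Lemma mero1_hol1 f x : mero1 f x -> pnear x (hol1 f).
Proof.
move=> [k [h [m [hk hh e]]]].
have := pnearI (pnearI (pnear_join e) (pnearW hh)) (pnearI (pnear_ccrd hk) (pnearW (near_cdom hk))).
apply: filterS => y [[e' hy] [n hky]]; apply: (@hol1_near _ _ (fun y => h y / ccrd k x y ^+ m)).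
  by apply: filterS e' => y' ->.
apply: hol1M => //; apply: hol1V; first by rewrite expf_neq0.
by apply: hol1X; exact: hol1_ccrd.
Qed.

(* the Laurent normal form; the order is [n - m] *)
Lemma mero1_normal k x f : cdom k x -> mero1 f x -> pnear x (fun y => f y = 0) \/
  exists n m g, [/\ \forall y \near x, hol1 g y, g x != 0 &
    pnear x (fun y => f y = ccrd k x y ^+ n / ccrd k x y ^+ m * g y)].
Proof.
move=> hk /(mero1P hk)[h [m [hh e]]]; have [z|[n [g [hg g0 e']]]] := hol_factor hk hh; [left|right].
  by apply: filterS2 e (pnearW z) => y -> ->; rewrite mul0r.
exists n, m, g; split => //; apply: filterS2 e (pnearW e') => y -> ->.
by rewrite mulrAC.
Qed.

Lemma mero1_dich x f : mero1 f x -> pnear x (fun y => f y = 0) \/ pnear x (fun y => f y != 0).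
Proof.
have [k hk] := cdom_cover x; move=> /(mero1_normal hk)[|[n [m [g [hg g0 e]]]]]; [by left|right].
apply: filterS3 e (pnearW (near_neq0 (nbhs_singleton hg) g0)) (pnear_ccrd hk) => y -> a b.
by rewrite mulf_neq0 // mulf_neq0 ?invr_eq0 // expf_neq0.
Qed.

Lemma mero1V f x : mero1 f x -> mero1 (fun y => (f y)^-1) x.
Proof.
have [k hk] := cdom_cover x; move=> /(mero1_normal hk)[e|[n [m [g [hg g0 e]]]]].
  apply: (@mero1_near (fun _ => 0)); last exact: mero1_cst.
  by apply: filterS e => y ->; rewrite invr0.
exists k, (fun y => ccrd k x y ^+ m / g y), n; split => //.
  near=> y; apply: hol1M; first by apply: hol1X; near: y; exact: near_hol_ccrd.
  apply: hol1V; near: y => //; exact: near_neq0 (nbhs_singleton hg) g0.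
apply: filterS e => y ->; rewrite !invfM invrK mulrC; ring.
Unshelve. all: by end_near. Qed.

Definition formp w x := pnear x (fun y => forall k l, cdom k y -> cdom l y -> w k y = w l y * dcrd k l y).

(** The residue is the coefficient of [dz / z] modulo exact meromorphic forms. In this shape
    additivity and invariance under coordinate changes are formal; only uniqueness needs contour
    integrals. *)
Definition isres w x (rho : C) := exists k F, [/\ cdom k x, mero1 F x &
  pnear x (fun y => w k y = rho / ccrd k x y + dfun k F y)].

(* [dz/z] changes by the exact form [dU/U], [U] a unit, under a change of coordinate *)
Lemma isresP w l x rho : cdom l x -> formp w x -> isres w x rho -> exists F, mero1 F x /\
  pnear x (fun y => w l y = rho / ccrd l x y + dfun l F y).
Proof.
move=> hl fw [k [F [hk mF e]]]; have [U [U1 U2 U3]] := ccrd_unit hk hl.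
have hq : \forall y \near x, hol1 (fun y => rho * (dfun l U y / U y)) y.
  have U1' := near_join U1; near=> y; apply: hol1M; first exact: hol1_cst.
  apply: hol1M; last by apply: hol1V; near: y.
  by apply: hol1_dfun; near: y => //; exact: near_cdom.
have [G [hG eG]] := hol_prim hl hq.
exists (fun y => F y + G y); split; first by apply: mero1D => //; exact: mero1_hol.
have U3' := pnearW (near_join U3).
have c1 := pnearW (near_cdom hk); have c2 := pnearW (near_cdom hl); have {}U1 := pnearW U1; have {}U2 := pnearW U2; have {}U3 := pnearW U3; have {}hG := pnearW hG; have {}eG := pnearW eG; have hF := mero1_hol1 mF.
have d1 := pnear_ccrd hl; have d2 := pnear_ccrd hk.
have N1 := pnearI (pnearI c1 c2) (pnearI U1 U2).
have N2 := pnearI (pnearI hF hG) (pnearI d1 d2).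
have N3 := pnearI (pnearI fw e) (pnearI eG (pnearI U3 U3')).
have := pnearI N1 (pnearI N2 N3); apply: filterS.
move=> y [[[ky ly] [hUy Uy]] [[[hFy hGy] [n1 n2]] [[fy ey] [eGy [eU eUn]]]]].
have eU' : \forall y' \near y, ccrd l x y' * U y' = ccrd k x y'.
  by apply: filterS eUn => y' ->.
have hl1 := hol1_ccrd x ly.
have dU : dcrd l k y = U y + ccrd l x y * dfun l U y.
  rewrite -(dfun_ccrd x ly ky) (dfun_near ly eU' (hol1M hl1 hUy)) dfunM // dfun_ccrd // dcrd_id //.
  by rewrite mul1r.
rewrite (fy l k ly ky) ey mulrDl -(dfun_change ly ky hFy) (dfunD ly hFy hGy) eGy eU dU.
move: (dfun l F y) (dfun l U y) (ccrd l x y) (U y) n1 Uy => p q a b a0 b0.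
by field; rewrite a0 b0.
Unshelve. all: by end_near. Qed.

Lemma isresD w w' x a b : formp w x -> formp w' x -> isres w x a -> isres w' x b ->
  isres (fun k y => w k y + w' k y) x (a + b).
Proof.
move=> f1 f2 [k [F [hk mF e]]] /(isresP hk f2)[G [mG e']].
exists k, (fun y => F y + G y); split; [exact: hk|exact: mero1D|].
have := pnearI (pnearI (pnearW (near_cdom hk)) (pnearI (mero1_hol1 mF) (mero1_hol1 mG))) (pnearI e e').
apply: filterS => y [[ky [hF hG]] [-> ->]]; rewrite (dfunD ky hF hG) mulrDl.
by rewrite addrACA.
Qed.

Lemma isresZ w x (a b : C) : isres w x a -> isres (fun k y => b * w k y) x (b * a).
Proof.
move=> [k [F [hk mF e]]]; exists k, (fun y => b * F y); split; [exact: hk|exact: mero1Z|].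
have := pnearI (pnearI (pnearW (near_cdom hk)) (mero1_hol1 mF)) e.
apply: filterS => y [[ky hF] ->]; rewrite (dfunM ky (hol1_cst b y) hF) dfun_cst mul0r add0r mulrDr.
by rewrite mulrA.
Qed.

Lemma isres_near w w' k x a : cdom k x -> formp w x -> pnear x (fun y => w k y = w' k y) -> isres w x a -> isres w' x a.
Proof.
move=> hk fw e /(isresP hk fw)[F [mF e']]; exists k, F; split => //.
by apply: filterS2 e e' => y <-.
Qed.

Lemma isres_hol w k x : cdom k x -> (\forall y \near x, hol1 (w k) y) -> isres w x 0.
Proof.
move=> hk hw; have [F [hF e]] := hol_prim hk hw.
exists k, F; split => //; first exact: mero1_hol.
by apply: pnearW; apply: filterS e => y ->; rewrite mul0r add0r.
Qed.

End LocalTheory.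

(** * Circle integrals of functions with finitely many poles *)

Section PlanarResidues.
Context {R : realType}.
Local Notation C := (Cplx R).
Implicit Types (a c z : C) (r : R) (f g G P : C -> C).

(* [1 / (2 i pi)] times the integral of [f dz] over a circle *)
Definition CI f c r : C := I01 (fun t => f (circ c r t) * (r%:C * zeta t)).

Definition cont_circle f c r := forall t, ccont f (circ c r t).

Lemma cont01_CI f c r : cont_circle f c r -> cont01 (fun t => f (circ c r t) * (r%:C * zeta t)).
Proof. by move=> h; apply: cont01M; [exact: cont01_circ|exact: cont01_rz]. Qed.

Lemma CID f g c r : cont_circle f c r -> cont_circle g c r ->
  CI (fun z => f z + g z) c r = CI f c r + CI g c r.
Proof.
move=> hf hg; rewrite /CI -I01D; try exact: cont01_CI.
by apply: I01_ext => t _; rewrite mulrDl.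
Qed.

Lemma CI_ext f g c r : (forall t, f (circ c r t) = g (circ c r t)) -> CI f c r = CI g c r.
Proof. by move=> h; apply: I01_ext => t _; rewrite h. Qed.

Lemma CI_hol f c r r' : 0 < r < r' -> holC (disc c r') f -> CI f c r = 0.
Proof.
move=> /andP[r0 rr] hf; have r'0 := lt_trans r0 rr.
have cf z : disc c r' z -> ccont f z by move=> Dz; exact: holC_cont hf Dz.
have df z : disc c r' z -> z != c -> exists m, dC f z m by move=> Dz _; exact: hf.
have [F dF] := disc_primitive (disc_center _ r'0) cf df.
apply: (@circ_prim _ F) => t; [apply: dF|apply: cf]; apply: circ_disc => //; exact: ltW.
Qed.

Lemma CI_inv a c r : normc (a - c) < r -> CI (fun z => (z - a)^-1) c r = 1.
Proof.
move=> h; have r0 : 0 < r by apply: le_lt_trans h; exact: normc_ge0.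
have rr : 0 < r < r + 1 by rewrite r0 /= ltrDl.
have := @cauchy_formula R c (r + 1) (fun _ => 1) r a (holC_cst 1) rr h.
move=> <-; apply: I01_ext => t _; by rewrite mul1r mulrC.
Qed.

(** [P] is required on the whole punctured plane: the polar part at one point can then be subtracted
    without creating singularities at other points. *)
Definition pres f a (rho : C) := exists P G d, [/\ 0 < d, forall z, z != a -> exists m, dC P z m,
  holC (disc a d) G & forall z, disc a d z -> z != a -> f z = rho / (z - a) + derive1 P z + G z].

Lemma open_neq a : open [set z : C | z != a].
Proof.
apply/open_cplx => z /= h; exists (normc (z - a)); first by rewrite normc_gt0 subr_eq0.
by move=> w hw; apply/eqP => e; move: hw; rewrite e normcB ltxx.
Qed.

Lemma disc_residues (s : seq C) (rho : C -> C) f c r r' : uniq s -> 0 < r < r' ->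
  (forall z, disc c r' z -> z \notin s -> exists m, dC f z m) ->
  (forall a, a \in s -> disc c r a) -> (forall a, a \in s -> pres f a (rho a)) ->
  CI f c r = \sum_(a <- s) rho a.
Proof.
elim: s f => [|a s IH] f us rr hf ins hp.
  by rewrite big_nil; apply: CI_hol rr _ => z Dz; exact: hf.
have /andP[r0 rr'] := rr; move: us => /= /andP[nas us].
have as0 : a \in a :: s by rewrite mem_head.
have [P [G [d [d0 hP hG e]]]] := hp a as0.
have hP' : holC [set z | z != a] (derive1 P) by apply: holC_derive1 (@open_neq a) _.
have hI : holC [set z | z != a] (fun z => rho a / (z - a)).
  apply: holCM; first exact: holC_cst.
  by apply: holCV; [apply: holCB; [exact: holC_id|exact: holC_cst]|move=> z; rewrite subr_eq0].
(* The function with its polar part at [a] removed and the gap at [a] filled; it falls under the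
   induction hypothesis for the remaining points. *)
pose f' z := if z == a then G a else f z - rho a / (z - a) - derive1 P z.
have ne z : z != a -> \forall v \near z, v != a.
  by move=> h; have := open_nbhs_nbhs (conj (@open_neq a) h).
have f'E z : z != a -> f' z = f z - rho a / (z - a) - derive1 P z by rewrite /f' => /negbTE ->.
have f'G z : disc a d z -> f' z = G z.
  move=> Dz; rewrite /f'; case: eqVneq => [->//|n]; rewrite e //.
  move: (_ / _) (derive1 P z) (G z) => p q t; ring.
have := IH f' us rr; rewrite big_cons => <- //; last 3 first.
- move=> z Dz zs; have [->|n] := eqVneq z a.
    apply: (holC_near_eq (@disc_open R a d) (disc_center a d0)); last exact: hG _ (disc_center a d0).
    by move=> w Dw; rewrite f'G.
  have zs' : z \notin a :: s by rewrite inE negb_or n.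
  have [m1 d1] := hf z Dz zs'; have [m2 d2] := hI z n; have [m3 d3] := hP' z n.
  eexists; apply: dC_near (dCB (dCB d1 d2) d3).
  by apply: filterS (ne z n) => v /f'E ->.
- by move=> b hb; apply: ins; rewrite inE hb orbT.
- move=> b hb; have nb : b != a by apply: contraNneq nas => <-.
  have hb' : b \in a :: s by rewrite inE hb orbT.
  have [P1 [G1 [d1 [d10 hP1 hG1 e1]]]] := hp b hb'.
  have nn : 0 < normc (b - a) by rewrite normc_gt0 subr_eq0.
  pose q := Num.min d1 (normc (b - a)).
  have q1 : q <= d1 by rewrite ge_min lexx.
  have q2 : q <= normc (b - a) by rewrite ge_min lexx orbT.
  have qa z : disc b q z -> z != a.
    move=> Dz; apply/eqP => ez; move: Dz; rewrite ez /disc /= normcB ltNge => /negP; apply; exact: q2.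
  exists P1, (fun z => G1 z - rho a / (z - a) - derive1 P z), q; split => //.
  + by rewrite lt_min d10.
  + apply: holCB; first apply: holCB.
    * by apply: holC_sub hG1 => z Dz; exact: lt_le_trans Dz q1.
    * by apply: holC_sub hI => z /qa.
    * by apply: holC_sub hP' => z /qa.
  + move=> z Dz nz; rewrite f'E ?qa // e1 //; last exact: lt_le_trans Dz q1.
    move: (rho b / _) (rho a / _) (derive1 P z) (derive1 P1 z) (G1 z) => *; ring.
have Da : disc c r a by exact: ins.
have cne t : circ c r t != a.
  by apply/eqP => ea; move: Da; rewrite -ea /disc /= circ_sub ?ltxx // ltW.
have cI : cont_circle (fun z => rho a / (z - a)) c r by move=> t; exact: holC_cont hI (cne t).
have cP : cont_circle (derive1 P) c r by move=> t; exact: holC_cont hP' (cne t).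
have cs t : circ c r t \notin a :: s.
  apply/negP => /ins; by rewrite /disc /= circ_sub ?ltxx // ltW.
have cf : cont_circle f c r.
  move=> t; have [m] := hf _ (circ_disc c t (ltW r0) rr') (cs t); exact: dC_cont.
have cf' : cont_circle f' c r.
  move=> t; apply: ccont_near (ccontB (ccontB (cf t) (cI t)) (cP t)).
  by apply: filterS (ne _ (cne t)) => v /f'E ->.
have ePI : CI (derive1 P) c r = 0.
  apply: (@circ_prim _ P) => t; last exact: cP.
  by have [m dm] := hP _ (cne t); rewrite (dC_derive1 dm).
have eI : CI (fun z => rho a / (z - a)) c r = rho a.
  transitivity (rho a * CI (fun z => (z - a)^-1) c r); last by rewrite CI_inv ?mulr1.
  rewrite /CI -I01Z; first by apply: I01_ext => t _; rewrite mulrA.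
  apply: (@cont01_CI (fun z => (z - a)^-1)) => t; apply: ccontV; first by rewrite subr_eq0.
  by apply: ccontB; [exact: ccont_id|exact: ccont_cst].
have e2 := CID cI cf'; rewrite eI in e2; rewrite -e2.
have -> : CI f c r = CI (fun z => (rho a / (z - a) + f' z) + derive1 P z) c r.
  apply: CI_ext => t; rewrite f'E //; move: (_ / _) (f _) (derive1 P _) => *; ring.
have cS : cont_circle (fun z => rho a / (z - a) + f' z) c r by move=> t; apply: ccontD; [exact: cI|exact: cf'].
by rewrite (CID cS cP) ePI addr0.
Qed.

Lemma holC_derive1n U f n : open U -> holC U f -> holC U (derive1n n f).
Proof. by move=> oU; elim: n f => [|n IH] f hf //; rewrite derive1nS; apply: holC_derive1 => //; exact: IH. Qed.

(** The recursion for Taylor coefficients when one factor [z - a] is split off; it matches the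
    residues below with the normalization by derivatives and factorials. *)
Lemma derive1n_mul_sub a r f g (b : C) n : 0 < r -> holC (disc a r) g ->
  (forall z, disc a r z -> f z = b + (z - a) * g z) ->
  derive1n n.+1 f a = n.+1%:R * derive1n n g a.
Proof.
move=> r0 hg e; have oD := @disc_open R a r.
have nD z : disc a r z -> \forall v \near z, disc a r v by move=> Dz; exact: open_nbhs_nbhs (conj oD Dz).
have da z : dC (fun v => v - a) z 1 by have := dCB (dC_id z) (dC_cst a z); rewrite subr0.
suff H z : disc a r z -> derive1n n.+1 f z = (z - a) * derive1n n.+1 g z + n.+1%:R * derive1n n g z.
  by rewrite H ?subrr ?mul0r ?add0r //; exact: disc_center.
elim: n z => [|n IH] z Dz.
  apply: dC_derive1; apply: dC_near (_ : dC (fun v => b + (v - a) * g v) z _).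
    by apply: filterS (nD _ Dz) => v /e ->.
  apply: dC_eq (dCD (dC_cst b z) (dCM (da z) (holC_dC hg Dz))) _.
  by rewrite add0r !mul1r addrC.
rewrite derive1nS; apply: dC_derive1.
have h1 := holC_derive1n n.+1 oD hg; have h0 := holC_derive1n n oD hg.
apply: dC_near (_ : dC (fun v => (v - a) * derive1n n.+1 g v + n.+1%:R * derive1n n g v) z _).
  by apply: filterS (nD _ Dz) => v /IH ->.
apply: dC_eq (dCD (dCM (da z) (holC_dC h1 Dz)) (dCZ _ (holC_dC h0 Dz))) _.
rewrite -!derive1nS mul1r [n.+2%:R]mulrS.
move: (derive1n n.+1 g z) (derive1n n.+2 g z) => p q; rewrite addrAC addrC; congr (_ + _).
by rewrite mulrDl mul1r.
Qed.

End PlanarResidues.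

(** * Residues of meromorphic forms *)

Section Residues.
Context {R : realType} {X : riemannSurface R}.
Local Notation C := (Cplx R).
Implicit Types (W N : set X) (k l : cidx X) (x y : X) (f g h F : X -> C) (w : cidx X -> X -> C).

Lemma dC_inv_pow (a z : C) n : z != a ->
  dC (fun v => ((v - a) ^+ n.+1)^-1) z (- n.+1%:R / (z - a) ^+ n.+2).
Proof.
move=> n0; have d1 : dC (fun v => v - a) z 1 by have := dCB (dC_id z) (dC_cst a z); rewrite subr0.
have z0 : z - a != 0 by rewrite subr_eq0.
apply: dC_eq (@dCV _ (fun v => (v - a) ^+ n.+1) _ _ _ (dCX n.+1 d1)) _; first by rewrite expf_neq0.
rewrite /= mulr1; move: (z - a) z0 => u u0.
rewrite [u ^+ n.+2]exprS [u ^+ n.+1]exprS; have : u ^+ n != 0 by rewrite expf_neq0.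
move: (u ^+ n) (n.+1%:R : C) => p q p0; by field; rewrite u0 p0.
Qed.

Lemma dfun_comp_crd k (G : C -> C) y m : cdom k y -> dC G (crd k y) m -> dfun k (fun y => G (crd k y)) y = m.
Proof.
move=> hk dG; apply: dfun_dC; apply: dC_near dG.
have oi : open (chart_img k) := @crd_open R X k; have ik : chart_img k (crd k y) by exists y.
by have := open_nbhs_nbhs (conj oi ik); apply: filterS => z hz /=; have [_ ->] := crdVK hz.
Qed.

Lemma mero1_ccrdV k x m : cdom k x -> mero1 (fun y => (ccrd k x y ^+ m)^-1) x.
Proof.
move=> hk; exists k, (fun _ => 1), m; split => //; first by apply: filterE => y; exact: hol1_cst.
by apply: pnearT => y; rewrite div1r.
Qed.

(** Induction on the pole order: with [h = h x + z h1], the term [h x / z^(m+2)] is exact and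
    [h1 / z^(m+1)] has a pole of smaller order. *)
Lemma pole_exact k x m h : cdom k x -> (\forall y \near x, hol1 h y) -> exists F, mero1 F x /\
  pnear x (fun y => h y / ccrd k x y ^+ m.+1 =
    derive1n m (h \o crdV k) (crd k x) / m`!%:R / ccrd k x y + dfun k F y).
Proof.
move=> hk; elim: m h => [|m IH] h hh; have [h1 [hh1 e]] := hol_div hk hh.
  have [F [hF eF]] := hol_prim hk hh1; exists F; split; first exact: mero1_hol.
  apply: filterS (pnearI (pnearW e) (pnearI (pnearW eF) (pnear_ccrd hk))) => y [-> [-> n]].
  by rewrite /= crdK // divr1 expr1 mulrDl mulrAC divff // mul1r.
have [F [mF eF]] := IH h1 hh1.
(* The power [z^-(m+1)] with coefficient [a] has derivative [h x / z^(m+2)]. *)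
pose a := - (h x / m.+1%:R).
exists (fun y => F y + a * (ccrd k x y ^+ m.+1)^-1); split.
  by apply: mero1D => //; apply: mero1Z; exact: mero1_ccrdV.
have [r1 [[r10 gr1] hC1 hy1]] := hol_chart_disc hk hh1.
have [r2 r20 hr2] := (near_chart _ hk).1 e.
pose r := Num.min r1 r2; have r0 : 0 < r by rewrite lt_min r10.
have rr1 : r <= r1 by rewrite ge_min lexx.
have rr2 : r <= r2 by rewrite ge_min lexx orbT.
have eT : derive1n m.+1 (h \o crdV k) (crd k x) = m.+1%:R * derive1n m (h1 \o crdV k) (crd k x).
  apply: (derive1n_mul_sub (b := h x) _ r0); first by apply: holC_sub hC1 => z Dz; exact: lt_le_trans Dz rr1.
  move=> z Dz; have [g1 g2] := crdVK (gr1 z (ltW (lt_le_trans Dz rr1))).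
  rewrite /= hr2 /ccrd ?g2 //; split; rewrite ?g2 //; exact: lt_le_trans Dz rr2.
rewrite eT factS natrM.
have m0 : m.+1%:R != 0 :> C by rewrite pnatr_eq0.
have f0 : m`!%:R != 0 :> C by rewrite pnatr_eq0 -lt0n fact_gt0.
apply: filterS (pnearI (pnearI (pnearW e) eF) (pnearI (pnearW (near_cdom hk)) (pnearI (pnear_ccrd hk) (mero1_hol1 mF)))).
move=> y [[ey eFy] [ky [n hF]]].
have yx : crd k y != crd k x by rewrite -subr_eq0.
have dq := dC_inv_pow m yx.
have hq : hol1 (fun y => (ccrd k x y ^+ m.+1)^-1) y := hol1_of_chart ky dq.
rewrite (dfunD ky hF (hol1M (hol1_cst a y) hq)) (dfunM ky (hol1_cst a y) hq) dfun_cst mul0r add0r.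
have -> : dfun k (fun y => (ccrd k x y ^+ m.+1)^-1) y = - m.+1%:R / ccrd k x y ^+ m.+2 := dfun_comp_crd ky dq.
rewrite ey; have -> : dfun k F y = h1 y / ccrd k x y ^+ m.+1 -
    derive1n m (h1 \o crdV k) (crd k x) / m`!%:R / ccrd k x y by rewrite eFy addrC addKr.
rewrite /a; move: (derive1n m _ _) (h x) (h1 y) (ccrd k x y) n => p q u v v0.
rewrite [v ^+ m.+2]exprS [v ^+ m.+1]exprS; have : v ^+ m != 0 by rewrite expf_neq0.
move: (m.+1%:R : C) m0 (m`!%:R : C) f0 (v ^+ m) => b b0 d d0 s s0.
by field; rewrite b0 d0 v0 s0.
Qed.

Lemma isres_pole w k x m h : cdom k x -> (\forall y \near x, hol1 h y) ->
  pnear x (fun y => w k y = h y / ccrd k x y ^+ m.+1) ->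
  isres w x (derive1n m (h \o crdV k) (crd k x) / m`!%:R).
Proof.
move=> hk hh e; have [F [mF eF]] := pole_exact m hk hh.
by exists k, F; split => //; apply: filterS (pnearI e eF) => y [-> ->].
Qed.

Lemma has_residue_isres w x rho : has_residue x w rho -> isres w x rho.
Proof.
move=> [k [N [m [h [[oN Nx Nk] hh e ->]]]]]; apply: isres_pole; first exact: Nk.
  by apply: filterS (near_open oN Nx) => y; exact: (holP _ _).1 hh y.
by apply: filterS (near_open oN Nx) => y Ny n; exact: e.
Qed.

Lemma isres_ex w k x : cdom k x -> mero1 (w k) x -> exists rho, isres w x rho.
Proof.
move=> hk /(mero1P hk)[h [m [hh e]]]; eexists.
apply: (@isres_pole w k x m (fun y => h y * ccrd k x y)) => //.
  by apply: filterS2 hh (near_hol_ccrd hk) => y; exact: hol1M.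
apply: filterS (pnearI e (pnear_ccrd hk)) => y [-> n].
move: (h y) (ccrd k x y) n => p q q0; rewrite exprS; have := expf_neq0 m q0.
move: (q ^+ m) => s s0; by field; rewrite q0 s0.
Qed.

(** The point is that the derivative of a meromorphic function is meromorphic, here by an explicit
    quotient rule with one more power in the denominator. *)
Lemma isres_mero w x rho k : cdom k x -> formp w x -> isres w x rho -> mero1 (w k) x.
Proof.
move=> hk fw /(isresP hk fw)[F [mF e]].
have dF : mero1 (dfun k F) x.
  have [h [m [hh eh]]] := mero1P hk mF.
  apply: (@mero1_near _ _ (fun y => (dfun k h y * ccrd k x y - m%:R * h y) / ccrd k x y ^+ m.+1)).
    apply: filterS (pnearI (pnearI (pnear_join eh) (pnearW hh)) (pnearI (pnearW (near_cdom hk)) (pnear_ccrd hk))).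
    move=> y [[ey hy] [ky n]]; have yx : crd k y != crd k x by rewrite -subr_eq0.
    case: m ey {eh} => [|m] ey.
      rewrite (@dfun_near _ _ h) //; last by apply: filterS ey => y' ->; rewrite expr0 divr1.
      by rewrite mul0r subr0 expr1 mulfK.
    have dq := dC_inv_pow m yx.
    have hq : hol1 (fun y => (ccrd k x y ^+ m.+1)^-1) y := hol1_of_chart ky dq.
    have e1 : \forall y' \near y, h y' * (ccrd k x y' ^+ m.+1)^-1 = F y' by apply: filterS ey => y' ->.
    rewrite (dfun_near ky e1 (hol1M hy hq)) (dfunM ky hy hq).
    have -> : dfun k (fun y => (ccrd k x y ^+ m.+1)^-1) y = - m.+1%:R / ccrd k x y ^+ m.+2 := dfun_comp_crd ky dq.
    move: (dfun k h y) (h y) (ccrd k x y) n (m.+1%:R : C) => p q v v0 b.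
    rewrite [v ^+ m.+2]exprS; have : v ^+ m.+1 != 0 by rewrite expf_neq0.
    move: (v ^+ m.+1) => s s0; by field; rewrite v0 s0.
  exists k, (fun y => dfun k h y * ccrd k x y - m%:R * h y), m.+1; split => //.
    have hh' := near_join hh.
    have : \forall y \near x, (hol1 h y /\ \forall y' \near y, hol1 h y') /\ cdom k y.
      by apply: filterI; [exact: filterI|exact: near_cdom].
    apply: filterS => y [[a b] ky]; apply: hol1B.
      by apply: hol1M; [exact: hol1_dfun|exact: hol1_ccrd].
    by apply: hol1M; [exact: hol1_cst|].
  exact: pnearW (filterE _ (fun _ => erefl)).
have m1 : mero1 (fun y => rho / ccrd k x y) x.
  apply: mero1Z; apply: mero1_near (mero1_ccrdV 1 hk).
  by apply: pnearT => y; rewrite expr1.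
by apply: mero1_near (mero1D m1 dF); apply: filterS e => y ->.
Qed.

(** * Logarithmic derivatives *)

Definition dlog (f : X -> C) k y : C := dfun k f y / f y.

Lemma dlog_near f g k y : cdom k y -> (\forall y' \near y, f y' = g y') -> hol1 f y ->
  dlog g k y = dlog f k y.
Proof.
move=> hk e hf; have ev : f y = g y := nbhs_singleton e.
by rewrite /dlog (dfun_near hk e hf) ev.
Qed.

Lemma dlogM f g k y : cdom k y -> hol1 f y -> hol1 g y -> f y != 0 -> g y != 0 ->
  dlog (fun y => f y * g y) k y = dlog f k y + dlog g k y.
Proof.
move=> hk hf hg f0 g0; rewrite /dlog dfunM //.
move: (dfun k f y) (dfun k g y) (f y) (g y) f0 g0 => p q u v u0 v0; by field; rewrite u0 v0.
Qed.

Lemma dlogV f k y : cdom k y -> hol1 f y -> f y != 0 ->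
  dlog (fun y => (f y)^-1) k y = - dlog f k y.
Proof.
move=> hk hf f0; have hV := hol1V f0 hf; have iv0 : (f y)^-1 != 0 by rewrite invr_eq0.
have := dlogM hk hf hV f0 iv0.
have -> : dlog (fun y => f y * (f y)^-1) k y = 0.
  rewrite /dlog (@dfun_near _ _ (fun _ => 1)) ?dfun_cst ?mul0r //; last exact: hol1_cst.
  by apply: filterS (near_neq0 hf f0) => y' n; rewrite divff.
by move/esym/eqP; rewrite addrC addr_eq0 => /eqP.
Qed.

Lemma dlogX f k y n : cdom k y -> hol1 f y -> f y != 0 ->
  dlog (fun y => f y ^+ n) k y = n%:R * dlog f k y.
Proof.
move=> hk hf f0; elim: n => [|n IH].
  by rewrite mul0r /dlog [fun y => _](_ : _ = fun _ => 1) ?dfun_cst ?mul0r //; apply/funext => y'; rewrite expr0.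
have -> : (fun y => f y ^+ n.+1) = (fun y => f y * f y ^+ n) by apply/funext => y'; rewrite exprS.
by rewrite dlogM ?IH ?expf_neq0 //; [rewrite [n.+1%:R]mulrS mulrDl mul1r|exact: hol1X].
Qed.

Lemma isres_dlog f k x n m g : cdom k x -> (\forall y \near x, hol1 g y) -> g x != 0 ->
  pnear x (fun y => f y = ccrd k x y ^+ n / ccrd k x y ^+ m * g y) ->
  isres (fun k y => dlog f k y) x (n%:R - m%:R).
Proof.
move=> hk hg g0 e; have gn := near_neq0 (nbhs_singleton hg) g0.
have hq : \forall y \near x, hol1 (dlog g k) y.
  have hg' := near_join hg.
  have : \forall y \near x, (hol1 g y /\ \forall y' \near y, hol1 g y') /\ (cdom k y /\ g y != 0).
    by apply: filterI; [exact: filterI|apply: filterI => //; exact: near_cdom].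
  apply: filterS => y [[a b] [ky n0]]; apply: hol1M; first exact: hol1_dfun.
  exact: hol1V.
have [F [hF eF]] := hol_prim hk hq.
exists k, F; split => //; first exact: mero1_hol.
apply: filterS (pnearI (pnearI (pnear_join e) (pnearW hg)) (pnearI (pnearI (pnearW (near_cdom hk)) (pnearW eF)) (pnearI (pnearW gn) (pnear_ccrd hk)))).
move=> y [[ey hy] [[ky eFy] [gy n0]]].
have hc := hol1_ccrd x ky.
have hV := hol1V (expf_neq0 m n0) (hol1X m hc).
have hX := hol1X n hc.
have n1 := expf_neq0 n n0; have n2 : (ccrd k x y ^+ m)^-1 != 0 by rewrite invr_eq0 expf_neq0.
have h1 := hol1M hX hV; have h1n : ccrd k x y ^+ n / ccrd k x y ^+ m != 0 by rewrite mulf_neq0.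
have -> : dlog f k y = dlog (fun y => ccrd k x y ^+ n / ccrd k x y ^+ m * g y) k y.
  apply: (dlog_near ky _ (hol1M h1 hy)); by apply: filterS ey => y' ->.
rewrite dlogM // dlogM // dlogV ?expf_neq0 //; last exact: hol1X.
rewrite !dlogX // eFy.
have -> : dlog (ccrd k x) k y = (ccrd k x y)^-1 by rewrite /dlog dfun_ccrd // dcrd_id // div1r.
by rewrite mulrBl.
Qed.

End Residues.

(** * Uniqueness of residues, and sums of residues as circle integrals *)

Section Principal.
Context {R : realType} {X : riemannSurface R}.
Local Notation C := (Cplx R).
Implicit Types (W N : set X) (k l : cidx X) (x y : X) (f g h F : X -> C) (w : cidx X -> X -> C).

Lemma pres_unique (f : C -> C) a (rho rho' : C) : pres f a rho -> pres f a rho' -> rho = rho'.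
Proof.
move=> h h'; have [P [G [d [d0 hP hG e]]]] := h; have [P' [G' [d' [d'0 hP' hG' e']]]] := h'.
have hf z : disc a d z -> z \notin [:: a] -> exists m, dC f z m.
  rewrite inE => Dz n; have oU := @disc_open R a d.
  have oV := @open_neq R a.
  have h1 : holC [set z | z != a] (derive1 P) by apply: holC_derive1 => //.
  have h2 : holC [set z | z != a] (fun z => rho / (z - a)).
    apply: holCM; first exact: holC_cst.
    by apply: holCV; [apply: holCB; [exact: holC_id|exact: holC_cst]|move=> v; rewrite subr_eq0].
  have [m1 d1] := h1 z n; have [m2 d2] := h2 z n; have [m3 d3] := hG z Dz.
  eexists; apply: dC_near (dCD (dCD d2 d1) d3).
  have n1 := open_nbhs_nbhs (conj oU Dz); have n2 : nbhs z [set z | z != a] := open_nbhs_nbhs (conj oV n).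
  by apply: filterS2 n1 n2 => v v1 v2; rewrite -e.
have rr : 0 < d / 2 < d by rewrite divr_gt0 // ltr_pdivrMr // ltr_pMr // ltrDl ltr01.
have ins b : b \in [:: a] -> disc a (d / 2) b.
  by rewrite inE => /eqP ->; apply: disc_center; case/andP: rr.
have := @disc_residues R [:: a] (fun _ => rho) f a (d / 2) d isT rr hf ins.
have := @disc_residues R [:: a] (fun _ => rho') f a (d / 2) d isT rr hf ins.
rewrite !big_seq1 => -> ; last by move=> b; rewrite inE => /eqP ->.
by move=> -> // b; rewrite inE => /eqP ->.
Qed.

(** The polar part is a polynomial in the inverse of the coordinate, so it makes sense on the whole
    punctured plane, as [pres] demands. *)
Lemma pole_principal k x m h : cdom k x -> (\forall y \near x, hol1 h y) ->
  exists (P : C -> C) G, [/\ forall z, z != crd k x -> exists m, dC P z m,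
    \forall y \near x, hol1 G y & pnear x (fun y => h y / ccrd k x y ^+ m = P (crd k y) + G y)].
Proof.
move=> hk; elim: m h => [|m IH] h hh.
  exists (fun _ => 0), h; split => //; first by move=> z _; exists 0; exact: dC_cst.
  by apply: pnearT => y; rewrite expr0 divr1 add0r.
have [h1 [hh1 e]] := hol_div hk hh; have [P [G [hP hG eG]]] := IH h1 hh1.
exists (fun z => h x * ((z - crd k x) ^+ m.+1)^-1 + P z), G; split => //.
  move=> z n; have [m1 d1] := hP z n; eexists; exact: dCD (dCZ (h x) (dC_inv_pow m n)) d1.
apply: filterS (pnearI (pnearW e) (pnearI eG (pnear_ccrd hk))) => y [-> [eGy n]].
rewrite -addrA -eGy mulrDl -/(ccrd k x y); congr (_ + _); rewrite exprS.
have := expf_neq0 m n; move: (ccrd k x y) n (h1 y) => q q0 p; move: (q ^+ m) => s s0.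
by field; rewrite q0 s0.
Qed.

Lemma isres_pres k x w rho : cdom k x -> formp w x -> isres w x rho ->
  pres (w k \o crdV k) (crd k x) rho.
Proof.
move=> hk fw /(isresP hk fw)[F [mF e]].
have [h [m [hh eh]]] := mero1P hk mF.
have [P [G [hP hG eP]]] := pole_principal m hk hh.
have [g [hg eg]] : exists g, (\forall y \near x, hol1 g y) /\ forall y, dfun k G y = g y.
  exists (dfun k G); split => //; have hG' := near_join hG.
  by apply: filterS2 (near_cdom hk) hG' => y a b; exact: hol1_dfun.
have [r1 [[r10 gr1] hC1 _]] := hol_chart_disc hk hg.
have oV := @open_neq R (crd k x).
have eF : pnear x (fun y => w k y = rho / ccrd k x y + derive1 P (crd k y) + g y).
  apply: filterS (pnearI (pnearI e (pnear_join (pnearI eh eP))) (pnearI (pnearI (pnearW hG) (pnear_ccrd hk)) (pnearW (near_cdom hk)))).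
  move=> y [[-> ey] [[hGy n] ky]]; rewrite -addrA; congr (_ + _).
  have n1 : crd k y != crd k x by rewrite -subr_eq0.
  have [q dq] := hP _ n1; have hPy : hol1 (fun y => P (crd k y)) y := hol1_of_chart ky dq.
  have e1 : \forall y' \near y, P (crd k y') + G y' = F y' by apply: filterS ey => y' [-> ->].
  have -> : dfun k F y = dfun k (fun y => P (crd k y)) y + dfun k G y.
    by rewrite (dfun_near ky e1 (hol1D hPy hGy)); exact: dfunD.
  by rewrite eg (dC_derive1 dq) (dfun_comp_crd ky dq).
have [r2 r20 hr2] := (near_chart _ hk).1 eF.
pose r := Num.min r1 r2; have r0 : 0 < r by rewrite lt_min r10.
have rr1 : r <= r1 by rewrite ge_min lexx.
have rr2 : r <= r2 by rewrite ge_min lexx orbT.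
exists P, (g \o crdV k), r; split => //.
  by apply: holC_sub hC1 => z Dz; exact: lt_le_trans Dz rr1.
move=> z Dz nz; have [g1 g2] := crdVK (gr1 z (ltW (lt_le_trans Dz rr1))).
have := hr2 (crdV k z) (conj g1 _); rewrite g2 /= => ->; first by rewrite /ccrd g2.
  exact: lt_le_trans Dz rr2.
by move=> ez; move: nz; rewrite -g2 ez eqxx.
Qed.

Lemma isres_unique w x a b : formp w x -> isres w x a -> isres w x b -> a = b.
Proof.
have [k hk] := cdom_cover x; move=> fw /(isres_pres hk fw) ha /(isres_pres hk fw).
exact: pres_unique ha.
Qed.

Lemma pnear_ex x (P : X -> Prop) : pnear x P -> exists y, y <> x /\ P y.
Proof.
have [k hk] := cdom_cover x; move=> /(near_chart _ hk)[r r0 h].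
have [d [[d0 gd] _]] := chart_disc hk openT (I : [set: X] x).
pose s := Num.min r d / 2; have m0 : 0 < Num.min r d by rewrite lt_min r0.
have s0 : 0 < s by rewrite divr_gt0.
have m1 : Num.min r d <= r by rewrite ge_min lexx.
have m2 : Num.min r d <= d by rewrite ge_min lexx orbT.
have nz : normc (crd k x + s%:C - crd k x) = s by rewrite addrAC subrr add0r normcR gtr0_norm.
have [g1 g2] : cdom k (crdV k (crd k x + s%:C)) /\ crd k (crdV k (crd k x + s%:C)) = crd k x + s%:C.
  by apply: crdVK; apply: gd; rewrite nz /s; lra.
have ny : crdV k (crd k x + s%:C) <> x.
  move=> e; move: nz; rewrite -g2 e subrr normc0 => e1; by rewrite -e1 ltxx in s0.
exists (crdV k (crd k x + s%:C)); split => //; apply: h => //; split => //.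
by rewrite g2 nz /s; lra.
Qed.

Lemma open_notin (s : seq X) : open [set y : X | y \notin s].
Proof.
elim: s => [|a s IH].
  have -> : [set y : X | y \notin [::]] = setT by apply/seteqP; split.
  exact: openT.
rewrite (_ : mkset _ = [set y | y <> a] `&` [set y | y \notin s]); first by apply: openI => //; exact: open_setC1.
apply/seteqP; split => y /=; rewrite inE negb_or; first by move=> /andP[/eqP].
by move=> [/eqP h1 h2]; rewrite h1.
Qed.

Lemma near_notin (s : seq X) x : x \notin s -> \forall y \near x, y \notin s.
Proof. exact: near_open (open_notin s). Qed.

Lemma pnear_notin x (s : seq X) : pnear x (fun y => y \notin s).
Proof.
have h : x \notin [seq y <- s | y != x] by rewrite mem_filter eqxx.
have := near_notin h; apply: filterS => y /= hy n.
by move: hy; rewrite mem_filter; move/eqP: n => ->.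
Qed.

Lemma is_form_formp w (s : seq X) x : is_form (~` [set` s]) w -> formp w x.
Proof.
move=> [_ h]; apply: filterS (pnear_notin x s) => y /negP hy k l hk hl; exact: h.
Qed.

Definition Tot w (s : seq X) (rho : X -> C) :=
  [/\ uniq s, is_form (~` [set` s]) w & forall x, x \in s -> isres w x (rho x)].

Lemma Tot_hol1 w s rho k y : Tot w s rho -> y \notin s -> cdom k y -> hol1 (w k) y.
Proof. by move=> [_ [h _] _] /negP hy hk; have := (holP _ _).1 (h k) y; apply. Qed.

Lemma disc_tot w s rho k c r r' : Tot w s rho -> good k c r' -> 0 < r < r' ->
  (forall y, y \in s -> odisc k c r' y -> odisc k c r y) ->
  CI (w k \o crdV k) c r = \sum_(y <- s | `[< odisc k c r y >]) rho y.
Proof.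
move=> tw gk rr hs; have [us fw hr] := tw; have /andP[r0 rr'] := rr.
pose s' := [seq y <- s | `[< odisc k c r y >]].
have s'P y : y \in s' -> y \in s /\ odisc k c r y by rewrite mem_filter => /andP[/asboolP].
have cK y : y \in s' -> crdV k (crd k y) = y by move=> /s'P[_ [h _]]; rewrite crdK.
have := @disc_residues R (map (crd k) s') (fun z => rho (crdV k z)) (w k \o crdV k) c r r'.
rewrite big_map => ->.
- rewrite -[RHS]big_filter -/s' big_seq [RHS]big_seq; apply: eq_bigr => y hy; by rewrite cK.
- rewrite map_inj_in_uniq ?filter_uniq // => y y' hy hy' e; by rewrite -(cK y) // e cK.
- exact: rr.
- move=> z Dz nz; have [h1 h2] := crdVK (gk.2 z (ltW Dz)).
  have hz : crdV k z \notin s.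
    apply/negP => hin; have Dy : odisc k c r' (crdV k z) by split; rewrite ?h2.
    move/negP: nz; apply; apply/mapP; exists (crdV k z); rewrite ?h2 //.
    by rewrite mem_filter hin andbT; apply/asboolP; exact: hs.
  have [m dm] := (hol1P _ h1).1 (Tot_hol1 tw hz h1).
  by exists m; rewrite h2 in dm.
- by move=> a /mapP[y /s'P[_ [_ h]] ->].
- move=> a /mapP[y hy ->]; rewrite cK //; have [h1 [h2 h3]] := s'P _ hy.
  by apply: isres_pres => //; [exact: is_form_formp fw|exact: hr].
Qed.

(** The discs may contain several poles each, or none. The larger radii [r'] are disjoint, so each
    pole is counted in exactly one disc. *)
Lemma tot_discs w s rho (t : seq X) (k : X -> cidx X) (r r' : X -> R) : Tot w s rho -> uniq t ->
  (forall x, x \in t -> good (k x) (crd (k x) x) (r' x) /\ 0 < r x < r' x) ->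
  (forall x x' y, x \in t -> x' \in t -> odisc (k x) (crd (k x) x) (r' x) y ->
     odisc (k x') (crd (k x') x') (r' x') y -> x = x') ->
  (forall y, y \in s -> exists2 x, x \in t & odisc (k x) (crd (k x) x) (r x) y) ->
  \sum_(y <- s) rho y = \sum_(x <- t) CI (w (k x) \o crdV (k x)) (crd (k x) x) (r x).
Proof.
move=> tw ut hg dj cov.
have sub x y : x \in t -> odisc (k x) (crd (k x) x) (r x) y -> odisc (k x) (crd (k x) x) (r' x) y.
  by move=> /hg[_ /andP[_ h]] [h1 h2]; split => //; exact: lt_trans h2 h.
have -> : \sum_(x <- t) CI (w (k x) \o crdV (k x)) (crd (k x) x) (r x) =
   \sum_(x <- t) \sum_(y <- s | `[< odisc (k x) (crd (k x) x) (r x) y >]) rho y.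
  rewrite big_seq [RHS]big_seq; apply: eq_bigr => x hx; have [h1 h2] := hg x hx.
  apply: (disc_tot tw h1 h2) => y hy hO; have [x' hx' hO'] := cov y hy.
  by have -> : x = x' by apply: (dj _ _ y) => //; exact: sub.
have -> : \sum_(x <- t) \sum_(y <- s | `[< odisc (k x) (crd (k x) x) (r x) y >]) rho y =
    \sum_(x <- t) \sum_(y <- s) (if `[< odisc (k x) (crd (k x) x) (r x) y >] then rho y else 0).
  by apply: eq_bigr => x _; rewrite big_mkcond.
rewrite exchange_big /= big_seq [RHS]big_seq; apply: eq_bigr => y hy.
have [x hx hO] := cov y hy; rewrite (bigD1_seq x) //= asboolT // big_seq_cond big1 ?addr0 //.
move=> x' /andP[hx' nx]; case: asboolP => // hO'; move/eqP: nx; case.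
by apply: (dj _ _ y) => //; exact: sub.
Qed.

Lemma disjoint_nbhds (t : seq X) : uniq t -> exists U : X -> set X,
  (forall x, x \in t -> open (U x) /\ U x x) /\
  forall x x' y, x \in t -> x' \in t -> U x y -> U x' y -> x = x'.
Proof.
elim: t => [|a t IH]; first by exists (fun _ => setT).
move=> /= /andP[nat ut]; have [U [hU dU]] := IH ut.
have hs x : exists V : set X * set X, a <> x -> [/\ open V.1, open V.2, V.1 a, V.2 x & V.1 `&` V.2 = set0].
  have [e|n] := pselect (a = x); first by exists (set0, set0).
  have := @carrier_hausdorff R X; rewrite open_hausdorff => /(_ a x); move/eqP: (n) => n' /(_ n').
  by move=> [[A B] /= [/set_mem a1 /set_mem a2] [a3 a4 /eqP a5]]; exists (A, B).
have [V hV] := choice hs.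
pose W := foldr (fun x (A : set X) => (V x).1 `&` A) setT t.
have WP : open W /\ W a /\ forall x, x \in t -> W `<=` (V x).1.
  rewrite /W; elim: t nat {ut U hU dU IH W} => [|b t IH] /=; first by split; [exact: openT|].
  rewrite inE negb_or => /andP[/eqP nb nt]; have [h1 [h2 h3]] := IH nt; have [v1 v2 v3 v4 v5] := hV b nb.
  split; first exact: openI.
  split; first by split.
  move=> x; rewrite inE => /orP[/eqP ->|/h3 h]; first by move=> y [].
  by move=> y [_ /h].
have na x : x \in t -> a <> x by move=> hx e; move: nat; rewrite e hx.
have [W1 [W2 W3]] := WP.
exists (fun x => if x == a then W else U x `&` (V x).2); split.
  move=> x; rewrite inE; case: eqVneq => [-> //|n /= hx].
  have [u1 u2] := hU x hx; have [v1 v2 v3 v4 v5] := hV x (na x hx).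
  by split; [exact: openI|split].
have key x y : x \in t -> W y -> (V x).2 y -> False.
  move=> hx /(W3 x hx) h1 h2; have [v1 v2 v3 v4 v5] := hV x (na x hx).
  by have : ((V x).1 `&` (V x).2) y by []; rewrite v5.
move=> x x' y; rewrite !inE; case: (eqVneq x a) => [->|n]; case: (eqVneq x' a) => [->|n'] //=.
- by move=> _ hx' Wy [_ /(key _ _ hx' Wy)].
- by move=> hx _ [_ h] /(key _ _ hx) /(_ h).
- by move=> hx hx' [h1 _] [h2 _]; exact: dU h1 h2.
Qed.

(** If infinitely many points satisfied [P], the sets containing all but finitely many of them would
    form a proper filter, and near a cluster point of it [P] could not be isolated. *)
Lemma isolated_finite (Xcompact : compact [set: X]) (P : X -> Prop) :
  (forall x, pnear x (fun y => ~ P y)) -> exists s : seq X, uniq s /\ forall y, P y <-> y \in s.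
Proof.
move=> hP; suff fin : finite_set [set y | P y].
  have /finite_seqP[s es] := fin; exists (undup s); rewrite undup_uniq; split => // y.
  by rewrite mem_undup; change (P y) with ([set y | P y] y); rewrite es.
apply: contrapT => inf.
pose F : set (set X) := [set A | finite_set ([set y | P y] `\` A)].
have FF : ProperFilter F.
  apply: Build_ProperFilter_ex.
    move=> A hA; apply: contrapT => n; apply: inf; apply: sub_finite_set hA => y hy; split => // Ay.
    by apply: n; exists y.
  split.
  - by rewrite /F /= setDT; exact: finite_set0.
  - move=> A B hA hB; rewrite /F /= setDIr; rewrite finite_setU; by split.
  - by move=> A B AB; apply: sub_finite_set => y [h1 h2]; split => // /AB.
have [x [_ cl]] := Xcompact F FF filterT.
have FA : F (~` ([set x] `|` ~` [set y | P y])).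
  rewrite /F /=; apply: (sub_finite_set (B := [set x])); last exact: finite_set1.
  move=> y [hy n]; apply: contrapT => nx; apply: n; case=> // h; exact: h.
have [y [h1 h2]] := cl _ _ FA (hP x).
apply: h1; have [e|n] := pselect (y = x); [by left|right; exact: h2].
Qed.

End Principal.

(** * The residue theorem on a compact surface *)

Section ResidueTheorem.
Context {R : realType} {X : riemannSurface R}.
Local Notation C := (Cplx R).
Implicit Types (W N : set X) (k l : cidx X) (x y : X) (f g h F : X -> C) (w : cidx X -> X -> C).
Hypotheses (Xcompact : compact [set: X]) (Xconn : connected [set: X]).

Lemma dC_sum (I : Type) (s : seq I) (F : I -> C -> C) z : (forall i, exists m, dC (F i) z m) ->
  exists m, dC (fun v => \sum_(i <- s) F i v) z m.
Proof.
move=> h; elim: s => [|a s [m IH]].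
  exists 0; have -> : (fun v => \sum_(i <- [::]) F i v) = (fun _ => 0) by apply/funext => v; rewrite big_nil.
  exact: dC_cst.
have [n dn] := h a; exists (n + m).
have -> : (fun v => \sum_(i <- a :: s) F i v) = (fun v => F a v + \sum_(i <- s) F i v) by apply/funext => v; rewrite big_cons.
exact: dCD.
Qed.

Section Family.
Variables (w : cidx X -> X -> C) (s : seq X) (rho0 : X -> C) (f : X -> C) (P0 : seq X).
Hypotheses (tw : Tot w s rho0) (sP : {subset s <= P0}) (uP : uniq P0)
  (hf : forall y, y \notin P0 -> hol1 f y) (mf : forall x, mero1 f x)
  (nf : forall c x, pnear x (fun y => f y - c != 0)).

Let wc (c : C) k y := w k y / (f y - c).

(** Discs about the points of [t] are fixed once and for all. For every [c] that [f] avoids on the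
    compact complement [K], all poles of [w / (f - c)] lie in these discs, and the total residue is
    a sum of Cauchy transforms in [c]. *)
Lemma contour_rep (t : seq X) : uniq t -> {subset P0 <= t} ->
  exists (K : set X) (g F : X -> R -> C), [/\ compact K, forall y, K y -> y \notin t,
    forall x, x \in t -> [/\ cont01 (g x), cont01 (F x) & forall tau, exists y, K y /\ F x tau = f y] &
    forall c u rho, (forall y, K y -> f y <> c) -> Tot (wc c) u rho ->
      (forall y, y \in u -> y \in P0 \/ f y = c) ->
      \sum_(y <- u) rho y = \sum_(x <- t) I01 (fun tau => g x tau / (F x tau - c))].
Proof.
move=> ut Pt; have [U [hU dU]] := disjoint_nbhds ut.
have Hk x : exists p : cidx X * R, x \in t ->
    [/\ cdom p.1 x, good p.1 (crd p.1 x) p.2 & cdisc p.1 (crd p.1 x) p.2 `<=` U x].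
  have [k hk] := cdom_cover x; case ht : (x \in t); last by exists (k, 0).
  have [oU Ux] := hU x ht; have [r [h1 h2]] := chart_disc hk oU Ux.
  by exists (k, r).
have [p hp] := choice Hk; pose k x := (p x).1; pose r' x := (p x).2; pose r x := r' x / 2.
have r0 x : x \in t -> 0 < r x < r' x.
  by move=> /hp[_ [h _] _]; rewrite /r divr_gt0 //= ltr_pdivrMr // ltr_pMr // ltrDl ltr01.
pose O x := odisc (k x) (crd (k x) x) (r x).
pose K := ~` (\bigcup_(x in [set` t]) O x).
have KP y : K y <-> forall x, x \in t -> ~ O x y.
  by split=> [h x hx hO|h [x hx hO]]; [apply: h; exists x|exact: h hx hO].
have cK : compact K.
  apply: subclosed_compact Xcompact _ => //; apply: open_closedC; apply: bigcup_open => x _; exact: open_odisc.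
have Kt y : K y -> y \notin t.
  move=> /KP h; apply/negP => hy; apply: (h y hy); apply: odisc_center; first by case: (hp y hy).
  by case/andP: (r0 y hy).
pose pt x tau := crdV (k x) (circ (crd (k x) x) (r x) tau).
have ptP x tau : x \in t -> cdom (k x) (pt x tau) /\ crd (k x) (pt x tau) = circ (crd (k x) x) (r x) tau.
  move=> hx; have [h1 [_ h2] h3] := hp x hx; have /andP[a b] := r0 x hx.
  by apply: crdVK; apply: h2; rewrite circ_sub ltW.
have ptK x tau : x \in t -> K (pt x tau).
  move=> hx; have [g1 g2] := ptP x tau hx; apply/KP => x' hx' hO; have [h1 h2 h3] := hp x hx.
  have /andP[a b] := r0 x hx; have /andP[a' b'] := r0 x' hx'; have [h1' h2' h3'] := hp x' hx'.
  have Ux : U x (pt x tau) by apply: h3; split => //; rewrite g2 circ_sub ltW.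
  have Ux' : U x' (pt x tau) by apply: h3'; case: hO => o1 o2; split => //; exact: ltW (lt_trans o2 b').
  have e := dU _ _ _ hx hx' Ux Ux'; rewrite -e in hO; case: hO => _.
  by rewrite g2 circ_sub ?ltxx // ltW.
have ptF x tau (h : X -> C) : x \in t -> hol1 h (pt x tau) -> ccont (h \o crdV (k x)) (circ (crd (k x) x) (r x) tau).
  move=> hx hh; have [g1 g2] := ptP x tau hx; rewrite -g2.
  by have [m dm] := (hol1P _ g1).1 hh; exact: dC_cont dm.
have notP y : K y -> y \notin P0 by move=> /Kt; apply: contra; exact: Pt.
have nots y : K y -> y \notin s by move=> /notP; apply: contra; exact: sP.
exists K, (fun x tau => w (k x) (pt x tau) * ((r x)%:C * zeta tau)), (fun x tau => f (pt x tau)); split => //.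
- move=> x hx; split.
  + apply: cont01M; last exact: cont01_rz.
    move=> tau _; apply: (ccont_comp (f := w (k x) \o crdV (k x))); last exact: ccont_circ.
    apply: ptF => //; apply: Tot_hol1 tw (nots _ (ptK x tau hx)) _; exact: (ptP x tau hx).1.
  + move=> tau _; apply: (ccont_comp (f := f \o crdV (k x))); last exact: ccont_circ.
    by apply: ptF => //; apply: hf; exact: notP (ptK x tau hx).
  + by move=> tau; exists (pt x tau); split => //; exact: ptK.
- move=> c u rho nK tu hu.
  rewrite (tot_discs (t := t) (k := k) (r := r) (r' := r') tu) //.
  + rewrite big_seq [RHS]big_seq; apply: eq_bigr => x hx; apply: I01_ext => tau _.
    by rewrite /= /wc /pt mulrAC.
  + by move=> x hx; split; [case: (hp x hx)|exact: r0].
  + move=> x x' y hx hx' [a1 a2] [b1 b2]; apply: (dU _ _ y hx hx').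
      by case: (hp x hx) => _ _; apply; split => //; exact: ltW.
    by case: (hp x' hx') => _ _; apply; split => //; exact: ltW.
  + move=> y hy; have nKy : ~ K y.
      move=> Ky; case: (hu y hy) => [hP|e]; last exact: nK Ky e.
      by move: (notP _ Ky); rewrite hP.
    by move/contrapT: nKy => [x hx hO]; exists x.
Qed.

Lemma wc_Tot c : exists u rho, Tot (wc c) u rho /\ (forall y, y \in u <-> (y \in P0 \/ f y = c)).
Proof.
have [u [uu hu]] : exists u : seq X, uniq u /\ forall y, (y \in P0 \/ f y = c) <-> y \in u.
  apply: isolated_finite => // x.
  apply: filterS (pnearI (pnear_notin x P0) (nf c x)) => y [/negP h1 h2] [//|e].
  by move: h2; rewrite e subrr eqxx.
have Hr x : exists a, x \in u -> isres (wc c) x a.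
  have [k hk] := cdom_cover x; have [us fw hr] := tw.
  have mw : mero1 (w k) x.
    case hx : (x \in s); first exact: isres_mero hk (is_form_formp x fw) (hr x hx).
    apply: mero1_hol; have hxs : x \notin s by rewrite hx.
    have : \forall y \near x, y \notin s /\ cdom k y.
      by apply: filterI; [exact: near_notin hxs|exact: near_cdom].
    by apply: filterS => y [h1 h2]; exact: Tot_hol1 tw h1 h2.
  have mwc : mero1 (wc c k) x.
    by apply: mero1M => //; apply: mero1V; apply: mero1B; [exact: mf|exact: mero1_cst].
  by have [a ha] := isres_ex hk mwc; exists a.
have [rho hrho] := choice Hr; exists u, rho; split; last by move=> y; split; move/hu.
split => //; have [us fw hr] := tw; split.
  move=> k; apply/holP => y [nu hk].
  have nP : y \notin P0 by apply/negP => h; apply: nu; apply/hu; left.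
  have nfc : f y - c != 0 by rewrite subr_eq0; apply/eqP => e; apply: nu; apply/hu; right.
  apply: hol1M; first by apply: Tot_hol1 tw _ hk; apply: contra nP; exact: sP.
  by apply: hol1V => //; apply: hol1B; [exact: hf|exact: hol1_cst].
move=> k l y nu hk hl; have nP : y \notin P0 by apply/negP => h; apply: nu; apply/hu; left.
have ns : (~` [set` s]) y by move=> /sP; rewrite (negbTE nP).
by rewrite /wc (fw.2 k l y ns hk hl) mulrAC.
Qed.

(** The total residue [T c] of [w / (f - c)] is an entire function of [c] that tends to 0 at
    infinity, hence is 0 by the maximum modulus principle. *)
Lemma Tot_family_eq0 c u rho : Tot (wc c) u rho -> (forall y, y \in u -> y \in P0 \/ f y = c) ->
  \sum_(y <- u) rho y = 0.
Proof.
have HT c' : exists a, exists u rho, [/\ Tot (wc c') u rho, (forall y, y \in u <-> (y \in P0 \/ f y = c')) &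
   a = \sum_(y <- u) rho y].
  by have [u1 [rho1 [h1 h2]]] := wc_Tot c'; exists (\sum_(y <- u1) rho1 y), u1, rho1.
have [T hT] := choice HT.
have contK (K : set X) (c' : C) : (forall y, K y -> y \notin P0) ->
    {within K, continuous (fun y => normc (f y - c'))}.
  move=> hK; apply: continuous_in_subspaceT => y; rewrite inE => Ky.
  apply: (@ccont_normc _ _ (fun y => f y - c')); apply: hol1_cont; apply: hol1B; last exact: hol1_cst.
  by apply: hf; exact: hK.
(* The discs are placed about [P0] and the fibre of [f] over [c0]. On their complement [f] stays at
   distance [d] from [c0], so the same discs serve all [c] within [d] of [c0]. *)
have rep_near c0 : exists (t : seq X) (K : set X) (g F : X -> R -> C) (d : R), [/\ 0 < d, forall y, K y -> d <= normc (f y - c0),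
    forall x, x \in t -> [/\ cont01 (g x), cont01 (F x) & forall tau, exists y, K y /\ F x tau = f y] &
    forall c u rho, normc (c - c0) < d -> Tot (wc c) u rho ->
      (forall y, y \in u -> y \in P0 \/ f y = c) ->
      \sum_(y <- u) rho y = \sum_(x <- t) I01 (fun tau => g x tau / (F x tau - c))].
  have [t [rho' [[ut _ _] ht _]]] := hT c0 .
  have Pt : {subset P0 <= t} by move=> y hy; apply/ht; left.
  have [K [g [F [cK Kt hgF hrep]]]] := contour_rep ut Pt.
  have KP y : K y -> y \notin P0 by move=> /Kt; apply: contra; exact: Pt.
  have [d d0 hd] : exists2 d, 0 < d & forall y, K y -> d <= normc (f y - c0).
    have [[y1 K1]|nK] := pselect (K !=set0); last by exists 1 => // y Ky; case: nK; exists y.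
    have [y0 hy0 hmin] := @compact_EVT_min X R _ K (ex_intro _ y1 K1) cK (contK K c0 KP).
    rewrite inE in hy0; exists (normc (f y0 - c0)).
      by rewrite normc_gt0 subr_eq0; apply/eqP => e; move: (Kt _ hy0); move/negP; apply; apply/ht; right.
    by move=> y Ky; apply: hmin; rewrite inE.
  exists t, K, g, F, d; split => //.
  move=> c' u' rho1 hc; apply: hrep => y Ky e.
  by have := hd y Ky; rewrite e leNgt hc.
have holT : forall z, exists m, dC T z m.
  move=> c0; have [t [K [g [F [d [d0 hd hgF hrep]]]]]] := rep_near c0.
  have [m dm] : exists m, dC (fun v => \sum_(x <- t) (if x \in t then I01 (fun tau => g x tau / (F x tau - v)) else 0)) c0 m.
    apply: dC_sum => x; case hx : (x \in t); last by exists 0; exact: dC_cst.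
    have [h1 h2 h3] := hgF x hx.
    have far tau : in01 tau -> d <= normc (F x tau - c0) by move=> _; have [y [Ky ->]] := h3 tau; exact: hd.
    by eexists; exact: cauchy_transform_dC h1 h2 d0 far.
  exists m; apply: dC_near dm; apply/near_disc; exists d => // v hv.
  have [u' [rho' [h1 h2 ->]]] := hT v.
  rewrite (hrep v u' rho' hv h1); last by move=> y /h2.
  by rewrite big_seq [RHS]big_seq; apply: eq_bigr => x ->.
(* For large [c] discs about [P0] alone suffice: off these discs [f] is bounded by some [M], and the
   Cauchy transforms decay as [1 / (normc c - M)]. *)
have Tsmall e : 0 < e -> exists2 M, 0 < M & forall c', M < normc c' -> normc (T c') <= e.
  move=> e0; have [K [g [F [cK Kt hgF hrep]]]] := contour_rep uP (fun y hy => hy).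
  have [M M0 hM] : exists2 M, 0 <= M & forall y, K y -> normc (f y) <= M.
    have [[y1 K1]|nK] := pselect (K !=set0); last by exists 0 => // y Ky; case: nK; exists y.
    have [y0 hy0 hmax] := @compact_EVT_max X R _ K (ex_intro _ y1 K1) cK (contK K 0 Kt).
    exists (normc (f y0 - 0)); first exact: normc_ge0.
    by move=> y Ky; rewrite -[f y]subr0; apply: hmax; rewrite inE.
  have [B B0 hB] : exists2 B, 0 <= B & forall c', M < normc c' ->
      normc (\sum_(x <- P0) I01 (fun tau => g x tau / (F x tau - c'))) <= B / (normc c' - M).
    elim: (P0) hgF => [|x l IH] hgF.
      by exists 0 => // c' _; rewrite big_nil mul0r normc0.
    have [B B0 hB] := IH (fun x' hx' => hgF x' (mem_behead (s := x :: l) hx')).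
    have [h1 h2 h3] := hgF x (mem_head _ _).
    have [b b0 hb] := cont01_normc_bound h1.
    exists (b + B); first by rewrite addr_ge0 // ltW.
    move=> c' hc; rewrite big_cons mulrDl; apply: le_trans (le_normcD _ _) _; apply: lerD; last exact: hB.
    have c0 : 0 < normc c' - M by rewrite subr_gt0.
    have far tau : normc c' - M <= normc (F x tau - c').
      have [y [Ky ->]] := h3 tau; have := hM y Ky; have := le_normcB (f y) (f y - c').
      by rewrite subKr; lra.
    have n0 tau : F x tau - c' != 0 by rewrite -normc_gt0; exact: lt_le_trans (far tau).
    apply: I01_norm.
      apply: cont01M => // tau ht; apply: ccontV => //; apply: ccontB; [exact: h2|exact: ccont_cst].
    move=> tau ht; rewrite normcM normcV; apply: ler_pM; rewrite ?normc_ge0 ?invr_ge0 ?normc_ge0 ?hb //.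
    by rewrite lef_pV2 // posrE normc_gt0.
  exists (M + (B + 1) / e); first by rewrite ltr_wpDl // divr_gt0 // ltr_wpDl.
  move=> c' hc; have [u' [rho' [h1 h2 ->]]] := hT c'.
  have q0 : 0 < (B + 1) / e by rewrite divr_gt0 // ltr_wpDl.
  have Mc : M < normc c' by lra.
  rewrite (hrep c' u' rho' _ h1); last 2 first.
  - by move=> y /hM + e1; rewrite e1 leNgt Mc.
  - by move=> y /h2.
  apply: le_trans (hB c' Mc) _; rewrite ler_pdivrMr ?subr_gt0 //.
  have : (B + 1) / e < normc c' - M by lra.
  rewrite ltr_pdivrMr // mulrC => h3; lra.
have T0 c' : T c' = 0.
  apply/eqP; rewrite -normc_eq0 eq_le normc_ge0 andbT; apply/ler_addgt0Pl => e e0; rewrite addr0.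
  have [M M0 hM] := Tsmall e e0.
  pose q := M + normc c' + 1; have q0 : 0 < q by rewrite /q; have := normc_ge0 c'; lra.
  have qq : 0 < q < q + 1 by rewrite q0 /= ltrDl.
  have hD : holC (disc 0 (q + 1)) T by move=> z _; exact: holT.
  apply: (max_modulus qq hD); last by rewrite subr0 /q; lra.
  by move=> v; rewrite subr0 => hv; apply: hM; rewrite hv /q; have := normc_ge0 c'; lra.
move=> tu hu; have [t [K [g [F [d [d0 hd hgF hrep]]]]]] := rep_near c.
have cc : normc (c - c) < d by rewrite subrr normc0.
have [u' [rho' [h1 h2 e]]] := hT c.
rewrite (hrep c u rho cc tu hu) -(hrep c u' rho' cc h1); last by move=> y /h2.
by rewrite -e T0.
Qed.

End Family.

Lemma Tot_extend w s rho (t : seq X) : Tot w s rho -> uniq t -> {subset s <= t} ->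
  exists rho', Tot w t rho' /\ \sum_(x <- t) rho' x = \sum_(x <- s) rho x.
Proof.
move=> tw ut st; have [us fw hr] := tw.
exists (fun x => if x \in s then rho x else 0); split.
  split => //.
    split; first by move=> k; apply/holP => y [h1 h2]; apply: Tot_hol1 tw _ h2; apply/negP => /st.
    by move=> k l y hy; apply: fw.2 => /st.
  move=> x hx; case: ifP => hs; first exact: hr.
  have [k hk] := cdom_cover x; apply: (isres_hol hk).
  have hxs : x \notin s by rewrite hs.
  have : \forall y \near x, y \notin s /\ cdom k y.
    by apply: filterI; [exact: near_notin hxs|exact: near_cdom].
  by apply: filterS => y [h1 h2]; exact: Tot_hol1 tw h1 h2.
rewrite -big_mkcond -big_filter; apply: perm_big; apply: uniq_perm => //; first by rewrite filter_uniq.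
by move=> x; rewrite mem_filter; case: (boolP (x \in s)) => //= /st ->.
Qed.

(** The identity theorem: the points near which the form vanishes make up an open and closed set. *)
Lemma mero_identity w : (forall x, formp w x) -> (forall k x, cdom k x -> mero1 (w k) x) ->
  (forall x, pnear x (fun y => forall k, cdom k y -> w k y = 0)) \/
  (forall x k, cdom k x -> pnear x (fun y => w k y != 0)).
Proof.
move=> fw mw; pose A := [set x | pnear x (fun y => forall k, cdom k y -> w k y = 0)].
have dich x k : cdom k x -> A x \/ pnear x (fun y => w k y != 0).
  move=> hk; have [h|h] := mero1_dich (mw k x hk); [left|by right].
  apply: filterS (pnearI (pnearI h (fw x)) (pnearW (near_cdom hk))) => y [[e fy] ky] l ly.
  by rewrite (fy l k ly ky) e mul0r.
have oA : open A.
  rewrite openE => x Ax; have h : \forall y \near x, y <> x -> \forall y' \near y, forall k, cdom k y' -> w k y' = 0 := pnear_join Ax.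
  have : \forall y \near x, A y.
    apply: filterS h => y hy; have [->//|n] := pselect (y = x).
    exact: pnearW (hy n).
  by [].
have cA : closed A.
  move=> x cl; have [k hk] := cdom_cover x; have [//|h] := dich x k hk.
  have nb : \forall y \near x, (y <> x -> \forall y' \near y, w k y' != 0) /\ cdom k y.
    by apply: filterI; [exact: pnear_join h|exact: near_cdom].
  have [y' [Ay' [hy' ky']]] := cl _ nb.
  have [<-//|n'] := pselect (y' = x).
  have := pnearI (pnearI Ay' (pnearW (hy' n'))) (pnearW (near_cdom ky')).
  move=> /pnear_ex[v [_ [[v1 v2] v3]]]; by move: v2; rewrite v1 // eqxx.
have [[x Ax]|nA] := pselect (A !=set0); [left|right].
  have e := clopen_setT Xconn cA oA (ex_intro _ x Ax).
  by move=> y; have : A y by rewrite e.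
by move=> x k hk; have [Ax|//] := dich x k hk; case: nA; exists x.
Qed.

Lemma exists_other (p : X) : exists q : X, q <> p.
Proof. by have [q [h _]] := pnear_ex (pnearW (filterE _ (fun _ : X => I)) : pnear p (fun _ => True)); exists q. Qed.

(** The last clause says that [w] does not agree near [p] with anything holomorphic; it will make
    quotients of such forms nonconstant. *)
Lemma form_pole_mero w p k (al : C) G N : coord_nbhd k p N -> al != 0 -> is_form (~` [set p]) w ->
  hol N G -> (forall y, N y -> y <> p -> w k y = al / ccrd k p y ^+ 2 + G y) ->
  (forall x, formp w x) /\ (forall l x, cdom l x -> mero1 (w l) x) /\
  forall h, (\forall y \near p, hol1 h y) -> ~ pnear p (fun y => w k y - h y = 0).
Proof.
move=> [oN Np Nk] al0 fw hG e; have kp := Nk p Np.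
have tw : is_form (~` [set` [:: p]]) w.
  have -> : [set` [:: p]] = [set p] by apply/seteqP; split => y /=; rewrite inE => /eqP.
  exact: fw.
have fwx x : formp w x := is_form_formp x tw.
have nG : \forall y \near p, hol1 G y by apply: filterS (near_open oN Np) => y; exact: (holP _ _).1 hG y.
have rp : isres w p (derive1n 1 ((fun y => al + G y * ccrd k p y ^+ 2) \o crdV k) (crd k p) / 1`!%:R).
  apply: isres_pole => //.
    apply: filterS2 nG (near_cdom kp) => y a b; apply: hol1D; first exact: hol1_cst.
    by apply: hol1M => //; apply: hol1X; exact: hol1_ccrd.
  apply: filterS (pnearI (pnearW (near_open oN Np)) (pnear_ccrd kp)) => y.
  move=> [Ny n]; rewrite e //; last by move=> ey; move: n; rewrite ey ccrd0 eqxx.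
  by move: (ccrd k p y) n (G y) => q q0 g; field.
split => //; split.
  move=> l x hl; have [ex|n] := pselect (x = p).
    by rewrite ex in hl *; exact: isres_mero hl (fwx p) rp.
  apply: mero1_hol; apply: filterS2 (near_open (open_setC1 p) n) (near_cdom hl) => y a b.
  by have := (holP _ _).1 (fw.1 l) y; apply.
move=> h hh e0.
pose q y := al + (G y - h y) * ccrd k p y ^+ 2.
have hq : \forall y \near p, hol1 q y.
  apply: filterS3 nG hh (near_cdom kp) => y a b c; apply: hol1D; first exact: hol1_cst.
  by apply: hol1M; [exact: hol1B|apply: hol1X; exact: hol1_ccrd].
have q0 : q p != 0 by rewrite /q ccrd0 expr0n /= mulr0 addr0.
have := pnearI (pnearI e0 (pnearW (near_neq0 (nbhs_singleton hq) q0))) (pnearI (pnearW (near_open oN Np)) (pnear_ccrd kp)).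
move=> /pnear_ex[y [ny [[e1 e2] [Ny n]]]]; move: e2; rewrite /q.
have e3 := e y Ny ny; move: e1; rewrite e3 => e1.
have -> : al + (G y - h y) * ccrd k p y ^+ 2 = (al / ccrd k p y ^+ 2 + G y - h y) * ccrd k p y ^+ 2.
  by move: (ccrd k p y) n (G y) (h y) => v v0 a b; field.
by rewrite e1 mul0r eqxx.
Qed.

Theorem residue_theorem w s rho : Tot w s rho -> \sum_(x <- s) rho x = 0.
Proof.
case: s => [|p s0] tw; first by rewrite big_nil.
have [q qp] := exists_other p; set s := p :: s0 in tw *.
have [k1 [N1 [a1 [G1 [al [c1 n1 f1 h1 e1]]]]]] := double_pole_form Xcompact Xconn p.
have [k2 [N2 [a2 [G2 [be [c2 n2 f2 h2 e2]]]]]] := double_pole_form Xcompact Xconn q.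
have [fal [mal pal]] := form_pole_mero c1 n1 f1 h1 e1.
have [fbe [mbe pbe]] := form_pole_mero c2 n2 f2 h2 e2.
have [_ N2q k2q] := c2; have [_ N1p k1p] := c1; have {}k2q := k2q q N2q; have {}k1p := k1p p N1p.
have holb k y : y <> q -> cdom k y -> hol1 (be k) y.
  by move=> n hk; have := (holP _ _).1 (f2.1 k) y; apply.
have hola k y : y <> p -> cdom k y -> hol1 (al k) y.
  by move=> n hk; have := (holP _ _).1 (f1.1 k) y; apply.
have bne x k : cdom k x -> pnear x (fun y => be k y != 0).
  have [h|h] := mero_identity fbe mbe; last exact: h.
  case: (pbe (fun _ => 0)); first by apply: filterE => y; exact: hol1_cst.
  apply: filterS (pnearI (h q) (pnearW (near_cdom k2q))) => y [a b]; by rewrite a // subr0.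
(* The quotient of two forms is a function, independent of the chart chosen at each point. It equals
   no constant [c], since [al = c be] would make [al] holomorphic at [p]. *)
pose f y := al (projT1 (cid (cdom_cover y))) y / be (projT1 (cid (cdom_cover y))) y.
have fE k y : cdom k y -> y <> p -> y <> q -> f y = al k y / be k y.
  move=> hk np nq; rewrite /f; case: cid => l /= hl.
  rewrite (f1.2 l k y np hl hk) (f2.2 l k y nq hl hk) invfM mulrACA divff ?mulr1 //.
  exact: dcrd_neq0.
have fn x k : cdom k x -> pnear x (fun y => f y = al k y / be k y).
  move=> hk; apply: filterS (pnearI (pnear_notin x [:: p; q]) (pnearW (near_cdom hk))) => y [hy ky].
  by move: hy; rewrite !inE negb_or => /andP[/eqP np /eqP nq]; exact: fE.
have [Z [uZ hZ]] : exists Z : seq X, uniq Z /\ forall y, (exists k, cdom k y /\ be k y = 0) <-> y \in Z.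
  apply: isolated_finite => // x; have [k hk] := cdom_cover x.
  apply: filterS (pnearI (pnearI (bne x k hk) (fbe x)) (pnearW (near_cdom hk))) => y [[a b] ky] [l [ly e]].
  by move: a; rewrite (b k l ky ly) e mul0r eqxx.
(* All points where [f] or [w] may fail to be holomorphic: the poles of [w], the two double poles
   and the zeros of [be]. *)
pose P0 := undup (s ++ p :: q :: Z).
have sP : {subset s <= P0} by move=> y hy; rewrite mem_undup mem_cat hy.
have uP : uniq P0 by exact: undup_uniq.
have hf y : y \notin P0 -> hol1 f y.
  rewrite mem_undup mem_cat !inE !negb_or => /andP[_ /and3P[/eqP np /eqP nq nz]].
  have [k hk] := cdom_cover y.
  have b0 : be k y != 0 by apply/eqP => e; move/negP: nz; apply; apply/hZ; exists k.
  apply: (@hol1_near _ _ (fun y => al k y / be k y)).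
    apply: filterS3 (near_open (open_setC1 p) np) (near_open (open_setC1 q) nq) (near_cdom hk) => y' a b c.
    by rewrite (fE k).
  apply: hol1M; first exact: hola.
  by apply: hol1V => //; exact: holb.
have mf x : mero1 f x.
  have [k hk] := cdom_cover x; apply: (@mero1_near _ _ (fun y => al k y / be k y)).
    by apply: filterS (fn x k hk) => y ->.
  by apply: mero1M; [exact: mal|apply: mero1V; exact: mbe].
have nf c x : pnear x (fun y => f y - c != 0).
  have [k hk] := cdom_cover x.
  have fg x' : formp (fun k y => al k y - c * be k y) x'.
    apply: filterS (pnearI (fal x') (fbe x')) => y [a b] k' l' hk' hl'.
    by rewrite (a k' l' hk' hl') (b k' l' hk' hl') mulrBl mulrA.
  have mg k' x' : cdom k' x' -> mero1 (fun y => al k' y - c * be k' y) x'.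
    by move=> hk'; apply: mero1B; [exact: mal|apply: mero1Z; exact: mbe].
  have [h|h] := mero_identity fg mg.
    case: (pal (fun y => c * be k1 y)).
      apply: filterS2 (near_open (open_setC1 q) (fun e => qp (esym e))) (near_cdom k1p) => y a b.
      by apply: hol1M; [exact: hol1_cst|exact: holb].
    by apply: filterS (pnearI (h p) (pnearW (near_cdom k1p))) => y [a b]; exact: a.
  apply: filterS (pnearI (pnearI (fn x k hk) (h x k hk)) (bne x k hk)) => y [[-> a] b].
  move: a; apply: contra => /eqP e; apply/eqP.
  have -> : al k y - c * be k y = (al k y / be k y - c) * be k y by rewrite mulrBl divfK.
  by rewrite e mul0r.
(* Multiplying by [f] beforehand makes [w] itself the member of the family [w' / (f - c)] at
   [c = 0]. *)
pose w' k y := f y * w k y.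
have [us fw hr] := tw; have [rho2 [tw2 es]] := Tot_extend tw uP sP.
have mw k x : cdom k x -> mero1 (w k) x.
  move=> hk; case hx : (x \in s); first exact: isres_mero hk (is_form_formp x fw) (hr x hx).
  apply: mero1_hol; have hxs : x \notin s by rewrite hx.
  have : \forall y \near x, y \notin s /\ cdom k y.
    by apply: filterI; [exact: near_notin hxs|exact: near_cdom].
  by apply: filterS => y [g1 g2]; exact: Tot_hol1 tw g1 g2.
have Hr x : exists a, isres w' x a.
  have [k hk] := cdom_cover x; have mwc : mero1 (w' k) x by apply: mero1M => //; exact: mw.
  exact: isres_ex hk mwc.
have [rho' hrho'] := choice Hr.
have tw' : Tot w' P0 rho'.
  split => //; split.
    move=> k; apply/holP => y [/negP nu hk]; apply: hol1M; first exact: hf.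
    by apply: Tot_hol1 tw _ hk; apply: contra nu; exact: sP.
  move=> k l y /negP nu hk hl; have ns : (~` [set` s]) y by move=> /sP; rewrite (negbTE nu).
  by rewrite /w' (fw.2 k l y ns hk hl) mulrA.
have [u [rhou [tu hu]]] := @wc_Tot w' P0 rho' f P0 tw' (fun y hy => hy) hf mf nf 0.
have e0 := @Tot_family_eq0 w' P0 rho' f P0 tw' (fun y hy => hy) uP hf mf nf 0 u rhou tu (fun y => (hu y).1).
have Pu : {subset P0 <= u} by move=> y hy; apply/hu; left.
have [uu _ hru] := tu; have [rho3 [[_ fw3 tw3] es3]] := Tot_extend tw2 uu Pu.
transitivity (\sum_(y <- u) rhou y); last exact: e0.
rewrite -es -es3 big_seq [RHS]big_seq; apply: eq_bigr => x hx.
have fx : formp w x := is_form_formp x fw.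
apply: (isres_unique fx (tw3 x hx)); have [k hk] := cdom_cover x.
apply: (isres_near hk _ _ (hru x hx)); first by case: tu => _ fu _; exact: is_form_formp x fu.
apply: filterS (nf 0 x) => y; rewrite subr0 /w' => n; by rewrite mulrAC divff // mul1r.
Qed.

End ResidueTheorem.

(** * Orders of vanishing *)

Section Orders.
Context {R : realType} {X : riemannSurface R}.
Local Notation C := (Cplx R).
Implicit Types (W N : set X) (k l : cidx X) (p x y : X) (f g h : X -> C) (u v : int).

(** The order at [p] is at least [u]; the value at [p] itself is irrelevant. Working with lower
    bounds includes the zero function and keeps sums and products simple. *)
Definition ordge p u f := exists k h, [/\ cdom k p, \forall y \near p, hol1 h y &
  pnear p (fun y => f y = ccrd k p y ^ u * h y)].

Lemma near_hol_exprz k p u : cdom k p -> 0 <= u -> \forall y \near p, hol1 (fun y => ccrd k p y ^ u) y.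
Proof. by move=> hk; case: u => // n _; apply: filterS (near_hol_ccrd hk) => y; exact: hol1X. Qed.

Lemma hol1_exprz k p u y : cdom k y -> ccrd k p y != 0 -> hol1 (fun y => ccrd k p y ^ u) y.
Proof.
move=> hk n; have h := hol1_ccrd p hk; case: u => m; first exact: hol1X.
by apply: hol1V; [rewrite expf_neq0|exact: hol1X].
Qed.

Lemma ordgeP l p u f : cdom l p -> ordge p u f -> exists h, (\forall y \near p, hol1 h y) /\
  pnear p (fun y => f y = ccrd l p y ^ u * h y).
Proof.
move=> hl [k [h [hk hh e]]]; have [U [U1 U2 U3]] := ccrd_unit hk hl.
exists (fun y => U y ^ u * h y); split.
  apply: filterS3 U1 U2 hh => y a b c; apply: hol1M => //.
  by case: (u) => m; [exact: hol1X|apply: hol1V; [rewrite expf_neq0|exact: hol1X]].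
by apply: filterS (pnearI e (pnearW U3)) => y [-> ->]; rewrite expfzMl mulrA.
Qed.

Lemma ordge_near p u f g : pnear p (fun y => f y = g y) -> ordge p u f -> ordge p u g.
Proof.
move=> e [k [h [hk hh e']]]; exists k, h; split => //.
by apply: filterS (pnearI e e') => y [<-].
Qed.

Lemma ordge_le p u v f : u <= v -> ordge p v f -> ordge p u f.
Proof.
move=> uv [k [h [hk hh e]]]; exists k, (fun y => ccrd k p y ^ (v - u) * h y); split => //.
  have vu : 0 <= v - u by rewrite subr_ge0.
  by apply: filterS2 (near_hol_exprz hk vu) hh => y; exact: hol1M.
by apply: filterS (pnearI e (pnear_ccrd hk)) => y [-> n]; rewrite mulrA -expfzDr // addrC subrK.
Qed.

Lemma ordgeM p u v f g : ordge p u f -> ordge p v g -> ordge p (u + v) (fun y => f y * g y).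
Proof.
move=> [k [h [hk hh e]]] /(ordgeP hk)[h' [hh' e']]; exists k, (fun y => h y * h' y); split => //.
  by apply: filterS2 hh hh' => y; exact: hol1M.
apply: filterS (pnearI (pnearI e e') (pnear_ccrd hk)) => y [[-> ->] n].
by rewrite expfzDr // mulrACA.
Qed.

Lemma ordgeD p u f g : ordge p u f -> ordge p u g -> ordge p u (fun y => f y + g y).
Proof.
move=> [k [h [hk hh e]]] /(ordgeP hk)[h' [hh' e']]; exists k, (fun y => h y + h' y); split => //.
  by apply: filterS2 hh hh' => y; exact: hol1D.
by apply: filterS (pnearI e e') => y [-> ->]; rewrite mulrDr.
Qed.

Lemma ordge_zero p u f : pnear p (fun y => f y = 0) -> ordge p u f.
Proof.
move=> e; have [k hk] := cdom_cover p; exists k, (fun _ => 0); split => //.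
  by apply: filterE => y; exact: hol1_cst.
by apply: filterS e => y ->; rewrite mulr0.
Qed.

Lemma ordge_sum (I : Type) (s : seq I) (P : pred I) (F : I -> X -> C) p u : (forall i, P i -> ordge p u (F i)) ->
  ordge p u (fun y => \sum_(i <- s | P i) F i y).
Proof.
move=> hF; elim: s => [|a s IH].
  by apply: ordge_zero; apply: pnearT => y; rewrite big_nil.
case hP : (P a).
  apply: ordge_near (ordgeD (hF a hP) IH).
  by apply: pnearT => y; rewrite big_cons hP.
by apply: ordge_near IH; apply: pnearT => y; rewrite big_cons hP.
Qed.

Lemma ordge_hol p f : (\forall y \near p, hol1 f y) -> ordge p 0 f.
Proof.
move=> hf; have [k hk] := cdom_cover p; exists k, f; split => //.
by apply: pnearT => y; rewrite expr0z mul1r.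
Qed.

Lemma ordge_cst p (a : C) : ordge p 0 (fun _ => a).
Proof. by apply: ordge_hol; apply: filterE => y; exact: hol1_cst. Qed.

Lemma ordgeZ p u f (a : C) : ordge p u f -> ordge p u (fun y => a * f y).
Proof. by move=> h; have := ordgeM (ordge_cst p a) h; rewrite add0r. Qed.

Lemma ordge_hol0 p f : (\forall y \near p, hol1 f y) -> f p = 0 -> ordge p 1 f.
Proof.
move=> hf f0; have [k hk] := cdom_cover p; have [h [hh e]] := hol_div hk hf.
exists k, h; split => //; apply: pnearW; apply: filterS e => y ->.
by rewrite f0 add0r expr1z.
Qed.

Lemma ordge_ccrd k p u : cdom k p -> ordge p u (fun y => ccrd k p y ^ u).
Proof.
move=> hk; exists k, (fun _ => 1); split => //; first by apply: filterE => y; exact: hol1_cst.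
by apply: pnearT => y; rewrite mulr1.
Qed.

Lemma ordge_mero p u f : ordge p u f -> mero1 f p.
Proof.
move=> [k [h [hk hh e]]]; apply: mero1_near (_ : mero1 (fun y => ccrd k p y ^ u * h y) p); first by apply: filterS e => y ->.
apply: mero1M; last exact: mero1_hol.
case: (u) => m; last exact: mero1_ccrdV.
by apply: mero1_hol; apply: filterS (near_hol_ccrd hk) => y; exact: hol1X.
Qed.

(** A larger bound would write [g] as a positive power of the coordinate times a holomorphic
    function, against [g p != 0]. *)
Lemma ordge_max k p u v f g : cdom k p -> (\forall y \near p, hol1 g y) -> g p != 0 ->
  pnear p (fun y => f y = ccrd k p y ^ u * g y) -> ordge p v f -> v <= u.
Proof.
move=> hk hg g0 e /(ordgeP hk)[h [hh e']]; rewrite leNgt; apply/negP => uv.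
pose q y := g y - ccrd k p y ^ (v - u) * h y.
have hq : \forall y \near p, hol1 q y.
  have vu : 0 <= v - u by rewrite subr_ge0 ltW.
  by apply: filterS3 (near_hol_exprz hk vu) hh hg => y a b d; apply: hol1B => //; exact: hol1M.
have q0 : q p != 0.
  have : v - u != 0 by rewrite subr_eq0 gt_eqF.
  by rewrite /q ccrd0 exp0rz => /negbTE ->; rewrite mul0r subr0.
have := pnearI (pnearI e e') (pnearI (pnearW (near_neq0 (nbhs_singleton hq) q0)) (pnear_ccrd hk)).
move=> /pnear_ex[y [_ [[e1 e2] [qn n]]]]; move/eqP: qn; apply; rewrite /q.
have nu : ccrd k p y ^ u != 0 by rewrite expfz_neq0.
apply: (mulfI nu); rewrite mulr0 mulrBr -e1 e2 mulrA -expfzDr // [u + _]addrC subrK.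
exact: subrr.
Qed.

End Orders.

Section FiniteSums.

Lemma sum_supp (T : eqType) (V : zmodType) (q r : seq T) (F : T -> V) : uniq q -> uniq r -> {subset q <= r} ->
  (forall y, y \notin q -> F y = 0) -> \sum_(y <- r) F y = \sum_(y <- q) F y.
Proof.
move=> uq ur sq F0; rewrite (bigID (mem q)) /= [X in _ + X]big1 ?addr0; last by move=> y; exact: F0.
rewrite -big_filter; apply: perm_big; apply: uniq_perm => //; first exact: filter_uniq.
by move=> y; rewrite mem_filter; case: (boolP (y \in q)) => // hy; rewrite (sq y hy).
Qed.

Lemma sum_delta (T : eqType) (V : zmodType) (r : seq T) (p : T) (v : V) : uniq r -> p \in r ->
  \sum_(y <- r) (if p == y then v else 0) = v.
Proof.
move=> ur pr; rewrite (bigD1_seq p) //= eqxx big1 ?addr0 // => y.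
by rewrite eq_sym => /negbTE ->.
Qed.

End FiniteSums.

(** * Degrees of divisors of functions *)

Section Divisors.
Context {R : realType} {X : riemannSurface R}.
Local Notation C := (Cplx R).
Implicit Types (W N : set X) (k l : cidx X) (p x y : X) (f g h : X -> C) (u v d : int) (w : cidx X -> X -> C) (s t : seq X).
Hypotheses (Xcompact : compact [set: X]) (Xconn : connected [set: X]).

Lemma formp_local W w s x : open W -> W x -> is_form (W `\` [set` s]) w -> formp w x.
Proof.
move=> oW Wx [_ h]; apply: filterS (pnearI (pnearW (near_open oW Wx)) (pnear_notin x s)) => y [Wy ns] k l ky ly.
by apply: h => //; split => //; apply/negP.
Qed.

Lemma ordgeX p u f q : ordge p u f -> ordge p (q%:Z * u) (fun y => f y ^+ q).
Proof.
move=> hf; elim: q => [|q IH].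
  by rewrite mul0r; apply: ordge_near (ordge_cst p 1); apply: pnearT => y; rewrite expr0.
have -> : q.+1%:Z * u = u + q%:Z * u by rewrite -addn1 PoszD mulrDl mul1r addrC.
by apply: ordge_near (ordgeM hf IH); apply: pnearT => y; rewrite exprS.
Qed.

Lemma mero_unit k x f : cdom k x -> mero1 f x -> pnear x (fun y => f y != 0) ->
  exists d g, [/\ \forall y \near x, hol1 g y, g x != 0 &
    pnear x (fun y => f y = ccrd k x y ^ d * g y)] /\ isres (fun k y => dlog f k y) x d%:~R.
Proof.
move=> hk mf nf; have [z|[n [m [g [hg g0 e]]]]] := mero1_normal hk mf.
  by have [y [_ [h1 /eqP h2]]] := pnear_ex (pnearI z nf).
exists (n%:Z - m%:Z), g; split; last first.
  by have := isres_dlog hk hg g0 e; rewrite intrB -!pmulrn.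
split=> //; apply: filterS (pnearI e (pnear_ccrd hk)) => y [-> z0].
by rewrite expfzDr // -exprnN -!exprnP.
Qed.

Lemma mero_order f x : mero1 f x -> pnear x (fun y => f y != 0) ->
  exists d, [/\ isres (fun k y => dlog f k y) x d%:~R, ordge x d f & forall v, ordge x v f -> v <= d].
Proof.
move=> mf nf; have [k hk] := cdom_cover x; have [d [g [[hg g0 e] hr]]] := mero_unit hk mf nf.
exists d; split=> //; first by exists k, g.
by move=> v hv; exact: ordge_max hk hg g0 e hv.
Qed.

Lemma ordge_inv x f d : mero1 f x -> pnear x (fun y => f y != 0) -> (forall v, ordge x v f -> v <= d) ->
  ordge x (- d) (fun y => (f y)^-1).
Proof.
move=> mf nf hd; have [k hk] := cdom_cover x; have [u [g [[hg g0 e] _]]] := mero_unit hk mf nf.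
have ud : u <= d by apply: hd; exists k, g.
have gh : hol1 g x := nbhs_singleton hg.
apply: (@ordge_le _ _ _ _ (- u)); first by rewrite lerN2.
exists k, (fun y => (g y)^-1); split=> //.
  by apply: filterS2 hg (near_neq0 gh g0) => y h1 h2; exact: hol1V.
by apply: filterS (pnearI e (pnear_ccrd hk)) => y [-> z0]; rewrite invfM invr_expz.
Qed.

Lemma ordge0_isres w k x : cdom k x -> ordge x 0 (w k) -> isres w x 0.
Proof.
move=> hk h; have [g [hg e]] := ordgeP hk h; have [F [hF dF]] := hol_prim hk hg.
exists k, F; split=> //; first exact: mero1_hol.
by apply: filterS (pnearI e (pnearW dF)) => y [-> ->]; rewrite expr0z mul1r mul0r add0r.
Qed.

Lemma hol_order0 f x : (\forall y \near x, hol1 f y) -> f x != 0 -> forall v, ordge x v f -> v <= 0.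
Proof.
move=> hf f0 v; have [k hk] := cdom_cover x; apply: ordge_max hk hf f0 _.
by apply: pnearT => y; rewrite expr0z mul1r.
Qed.

Lemma dlog_change f k l y : cdom k y -> cdom l y -> hol1 f y -> dlog f k y = dlog f l y * dcrd k l y.
Proof. by move=> ky ly hf; rewrite /dlog (dfun_change ky ly hf) mulrAC. Qed.

(** The residue theorem for the logarithmic derivative, whose residues are the orders. *)
Lemma degree_zero f : (forall x, mero1 f x) -> (forall x, pnear x (fun y => f y != 0)) ->
  exists s (d : X -> int), [/\ uniq s, \sum_(y <- s) d y = 0, forall y, y \notin s -> d y = 0,
    forall y, ordge y (d y) f & forall y v, ordge y v f -> v <= d y].
Proof.
move=> mf nf; have [d hd] := choice (fun x => mero_order (mf x) (nf x)).
pose bad y := ~ ((\forall y' \near y, hol1 f y') /\ f y != 0).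
have hbad x : pnear x (fun y => ~ bad y).
  apply: filterS (pnearI (pnear_join (mero1_hol1 (mf x))) (nf x)) => y [h1 h2] h; exact: h.
have [s [us hs]] := isolated_finite Xcompact hbad.
have good y : y \notin s -> (\forall y' \near y, hol1 f y') /\ f y != 0.
  by move=> /negP ns; apply: contrapT => h; apply: ns; apply/hs.
have d0 y : y \notin s -> d y = 0.
  move=> /good[h1 h2]; have [_ o1 o2] := hd y; apply/eqP; rewrite eq_le (hol_order0 h1 h2 o1).
  by apply: o2; exact: ordge_hol.
have T : Tot (fun k y => dlog f k y) s (fun y => (d y)%:~R).
  split=> //; last by move=> x _; case: (hd x).
  split=> [k|k l y ns ky ly].
    apply/holP => y [/negP ns ky]; have [h1 h2] := good y ns.
    by apply: hol1M; [exact: hol1_dfun|apply: hol1V => //; exact: nbhs_singleton].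
  by apply: dlog_change => //; have [h1 _] := good y (introN idP ns); exact: nbhs_singleton h1.
have := residue_theorem Xcompact Xconn T; rewrite -(rmorph_sum (intmul (1 : C))) /= => /eqP.
rewrite intr_eq0 => /eqP e.
by exists s, d; split => // y; case: (hd y).
Qed.

(** True orders sum to 0. Lower bounds with nonnegative sum leave no slack, so each of them is the
    true order. All arguments by degree take this form. *)
Lemma exact_orders f t (N : X -> int) : (forall x, pnear x (fun y => f y != 0)) -> uniq t ->
  (forall y, ordge y (N y) f) -> (forall y, y \notin t -> N y = 0) -> 0 <= \sum_(y <- t) N y ->
  \sum_(y <- t) N y = 0 /\ forall y v, ordge y v f -> v <= N y.
Proof.
move=> nf ut hN N0 sN; have mf x : mero1 f x by exact: ordge_mero (hN x).
have [s [d [us sd d0 od hd]]] := degree_zero mf nf.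
pose r := undup (s ++ t).
have ur : uniq r by exact: undup_uniq.
have sdr : \sum_(y <- r) d y = 0.
  by rewrite (sum_supp us ur _ d0) // => y hy; rewrite mem_undup mem_cat hy.
have sNr : \sum_(y <- r) N y = \sum_(y <- t) N y.
  by apply: (sum_supp ut ur _ N0) => y hy; rewrite mem_undup mem_cat hy orbT.
have ge y : 0 <= d y - N y by rewrite subr_ge0; exact: hd.
have s0 : \sum_(y <- r) (d y - N y) = 0.
  apply/eqP; rewrite eq_le sumr_ge0 ?andbT => [|y _]; last exact: ge.
  by rewrite sumrB sdr sub0r sNr oppr_le0.
have eqN y : d y = N y.
  have [yr|yr] := boolP (y \in r); last first.
    move: yr; rewrite mem_undup mem_cat negb_or => /andP[h1 h2]; by rewrite d0 ?N0.
  move: s0 => /eqP; rewrite psumr_eq0 => [/allP/(_ y yr)|z _]; last exact: ge.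
  by rewrite implyTb subr_eq0 => /eqP.
split; last by move=> y v /hd; rewrite eqN.
by rewrite -sNr -[RHS]sdr; apply: eq_bigr => y _; rewrite eqN.
Qed.

Lemma removable_const f s : (forall y, y \notin s -> hol1 f y) -> (forall y, y \in s -> ordge y 0 f) ->
  exists a : C, forall y, y \notin s -> f y = a.
Proof.
move=> hf hs.
have H y : exists g : X -> C, y \in s -> (\forall y' \near y, hol1 g y') /\ pnear y (fun y' => f y' = g y').
  have [ys|] := boolP (y \in s); last by exists f.
  have [k hk] := cdom_cover y; have [g [hg e]] := ordgeP hk (hs y ys).
  by exists g => _; split=> //; apply: filterS e => y' ->; rewrite expr0z mul1r.
have [g hg] := choice H.
pose F y := if y \in s then g y y else f y.
have hF y : hol1 F y.
  have [ys|ys] := boolP (y \in s).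
    have [h1 h2] := hg y ys.
    apply: hol1_near (nbhs_singleton h1).
    have := pnearI h2 (pnear_notin y s); rewrite /pnear; apply: filterS => y' h.
    rewrite /F; case: ifPn => [ys'|ys'].
      by have [->//|/eqP ne] := eqVneq y' y; have [_ /negP] := h ne.
    have ne : y' <> y by move=> e; rewrite e ys in ys'.
    by have [-> _] := h ne.
  apply: hol1_near (hf y ys); have o := open_notin s.
  by apply: filterS (near_open o ys) => y' h; rewrite /F (negbTE h).
have [[y0 h0]|h] := pselect (exists y, y \notin s); last by exists 0 => y hy; case: h; exists y.
exists (f y0) => y hy; have := hol_constant Xcompact Xconn hF y y0.
by rewrite /F (negbTE hy) (negbTE h0).
Qed.

End Divisors.

(** * The reference form *)

Section Reference.
Context {R : realType} {X : riemannSurface R}.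
Local Notation C := (Cplx R).
Hypotheses (Xcompact : compact [set: X]) (Xconn : connected [set: X]).

(* a meromorphic form, not identically zero, whose divisor is bounded below by [e] *)
Definition is_ref (tp : seq X) (e : X -> int) (ref : cidx X -> X -> C) :=
  [/\ uniq tp, is_form (~` [set` tp]) ref, forall y k, cdom k y -> pnear y (fun y' => ref k y' != 0),
    forall y k, cdom k y -> ordge y (e y) (ref k) & forall y, y \notin tp -> e y = 0].

Lemma is_form_nonzero (w : cidx X -> X -> C) : is_form setT w -> (exists k y, cdom k y /\ w k y != 0) ->
  is_ref [::] (fun=> 0) w.
Proof.
move=> [hw1 hw2] [k0 [y0 [ky0 w0]]].
have hol k y : cdom k y -> \forall y' \near y, hol1 (w k) y'.
  by move=> ky; apply: filterS (near_cdom ky) => y' ky'; exact: (holP _ _).1 (hw1 k) y' (conj I ky').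
have fw x : formp w x.
  by apply: pnearT => y k l ky ly; exact: hw2.
split=> //.
- split=> [k|k l y _ ky ly]; last exact: hw2.
  by apply/holP => y [_ ky]; exact: (holP _ _).1 (hw1 k) y (conj I ky).
- have [z|nz] := mero_identity Xconn fw (fun k x kx => mero1_hol (hol k x kx)); last by move=> y k; exact: nz.
  have h0 := near_neq0 (nbhs_singleton (hol k0 y0 ky0)) w0.
  have [y [_ [[h1 h2] /eqP h3]]] := pnear_ex (pnearI (pnearI (z y0) (pnearW (near_cdom ky0))) (pnearW h0)).
  by case: h3; exact: h1.
- by move=> y k ky; apply: ordge_hol; exact: hol.
Qed.

(** The inequality reads [deg ref + 2 n / 3 >= 0]. A nonzero holomorphic form satisfies it with
    bounds 0; otherwise the form with one double pole has degree bound -2, and [n >= 3] suffices. *)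
Lemma ref_exists (p : X) n : (1 <= n)%N -> (has_genus X 0 -> (3 <= n)%N) ->
  exists tp e ref, is_ref tp e ref /\ 0 <= 3 * \sum_(y <- tp) e y + 2 * n%:Z.
Proof.
move=> n1 n3; have [[w [fw nz]]|none] := pselect (exists w : cidx X -> X -> C, is_form setT w /\ exists k y, cdom k y /\ w k y != 0).
  by exists [::], (fun=> 0), w; split; [exact: is_form_nonzero|rewrite big_nil; lia].
(* Without nonzero holomorphic forms the empty family is a basis. *)
have g0 : has_genus X 0.
  exists (fun _ _ _ => 0); split=> [[]//|v fv].
  exists [ffun _ => 0]; split=> [k y ky|u _]; last by apply/ffunP => -[].
  rewrite big_ord0; apply: contrapT => /eqP nz; apply: none; exists v; split=> //.
  by exists k, y.
have {}n3 := n3 g0.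
have [k [N [al [G [w [[oN Np Nk] al0 fw hG ew]]]]]] := double_pole_form Xcompact Xconn p.
have [fw1 [mw nw]] := form_pole_mero (And3 oN Np Nk : coord_nbhd k p N) al0 fw hG ew.
have kp := Nk p Np.
have sp : [set` [:: p]] = [set p] by apply/seteqP; split => y /=; rewrite inE => /eqP.
pose e y : int := if y == p then -2 else 0.
exists [:: p], e, w; split; last first.
  by rewrite big_seq1 /e eqxx; lia.
split=> //.
- by rewrite sp.
- have [z|nz] := mero_identity Xconn fw1 (fun k x kx => mw k x kx); last by move=> y l; exact: nz.
  case: (nw (fun=> 0) (filterE _ (fun y => hol1_cst 0 y))).
  by apply: filterS (pnearI (z p) (pnearW (near_cdom kp))) => y [h1 h2]; rewrite h1 // subr0.
- move=> y l ly; rewrite /e; case: eqVneq => [ey|/eqP ne]; last first.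
    apply: ordge_hol; apply: filterS2 (near_cdom ly) (near_open (open_setC1 (X := X) p) ne) => y' ly' ne'.
    exact: (holP _ _).1 (fw.1 l) y' (conj ne' ly').
  rewrite ey in ly *.
  have hd : ordge p 0 (dcrd l k).
    apply: ordge_hol; apply: filterS2 (near_cdom ly) (near_cdom kp) => y' ly' ky'.
    apply: hol1_dfun => //; apply: filterS (near_cdom ky') => y2; exact: hol1_crd.
  have h2 : ordge p (-2) (w k).
    exists k, (fun y => al + ccrd k p y ^+ 2 * G y); split=> //.
      apply: filterS2 (near_open oN Np) (near_cdom kp) => y' Ny' ky'.
      apply: hol1D; first exact: hol1_cst.
      by apply: hol1M; [apply: hol1X; exact: hol1_ccrd|exact: (holP _ _).1 hG y' Ny'].
    have hN : pnear p (fun y' => y' <> p) by rewrite /pnear; apply: filterE.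
    apply: filterS (pnearI hN (pnearI (pnear_ccrd kp) (pnearW (near_open oN Np)))) => y' [ne [z0 Ny']].
    rewrite ew // (_ : ccrd k p y' ^ (-2) = (ccrd k p y' ^+ 2)^-1) //.
    have z2 : ccrd k p y' ^+ 2 != 0 by rewrite expf_neq0.
    by rewrite mulrDr mulKf // mulrC.
  apply: ordge_near (ordgeM h2 hd).
  have hN : pnear p (fun y' => y' <> p) by rewrite /pnear; apply: filterE.
  apply: filterS (pnearI hN (pnearW (filterI (near_cdom kp) (near_cdom ly)))) => y' [ne [ky' ly']].
  by rewrite (fw.2 l k y').
- by move=> y; rewrite inE /e => /negbTE ->.
Qed.

End Reference.

(** * Splittings of the cocycle and the extension class *)

Section ExtensionClass.
Context {R : realType} {X : riemannSurface R} (L : lineBundle X).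
Local Notation C := (Cplx R).
Hypotheses (Xcompact : compact [set: X]) (Xconn : connected [set: X]).
Context (kappa : bidx L -> cidx X -> X -> C) (xi : bidx L -> bidx L -> X -> C).

Lemma near_bdom (a : bidx L) y : bdom a y -> \forall y' \near y, bdom a y'.
Proof. exact: near_open (bdom_open a). Qed.

(* A family of local meromorphic forms splitting the cocycle [z * xi] computes [z]
   as its sum of residues, because its difference with [z * mu] is a global form. *)
Lemma ext_residue (kappa_iso : is_theta_iso kappa) (xi_class : has_ext_class kappa xi 1) (Phi : bidx L -> cidx X -> X -> C) (t : seq X) (rho : X -> C) (z : C) : uniq t ->
  (forall a, is_form (bdom a `\` [set` t]) (Phi a)) ->
  (forall a y, y \in t -> bdom a y -> isres (Phi a) y (rho y)) ->
  (forall a a' k y, y \notin t -> bdom a y -> bdom a' y -> cdom k y ->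
     Phi a' k y - Phi a k y = z * (xi a a' y * kappa a k y)) ->
  \sum_(y <- t) rho y = z.
Proof.
move=> ut fP rP dP; have [q [p [rh [mu [pinj fmu rmu dmu srh]]]]] := xi_class.
pose ps := [seq p j | j <- enum 'I_q].
have psP y : range p y <-> y \in ps.
  split=> [[j _ <-]|/mapP[j _ ->]]; last by exists j.
  by apply: map_f; rewrite mem_enum.
have pset : range p = [set` ps] by apply/seteqP; split => y /psP.
pose s := undup (t ++ ps).
have [fr hfr] := choice (fun y => bdom_cover L y).
(* Frames are picked point by point; off [s] the cocycle terms cancel and the result does not depend
   on the frame ([OmE]), so it is a global form. *)
pose Om k y : C := Phi (fr y) k y - z * mu (fr y) k y.
have OmE a k y : y \notin s -> bdom a y -> cdom k y -> Om k y = Phi a k y - z * mu a k y.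
  rewrite mem_undup mem_cat negb_or => /andP[nt np] ha ky.
  have h1 := dP a (fr y) k y nt ha (hfr y) ky.
  have np' : ~ range p y by move=> /psP; apply/negP.
  have h2 := dmu a (fr y) k y ha (hfr y) ky np'.
  rewrite /Om; move: h1; rewrite -h2.
  move: (Phi (fr y) k y) (Phi a k y) (mu (fr y) k y) (mu a k y) => A B M M' e.
  have -> : A = B + z * (M - M') by rewrite -e addrC subrK.
  by ring.
have nt y : y \notin s -> y \notin t by rewrite mem_undup mem_cat negb_or => /andP[].
have np y : y \notin s -> y \notin ps by rewrite mem_undup mem_cat negb_or => /andP[].
have fO : is_form (~` [set` s]) Om.
  split=> [k|k l y /negP ns ky ly].
    apply/holP => y [/negP ns ky].
    have ha := hfr y; apply: (@hol1_near _ _ (fun y' => Phi (fr y) k y' - z * mu (fr y) k y')).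
      by apply: filterS3 (near_notin ns) (near_bdom ha) (near_cdom ky) => y' h1 h2 h3; rewrite (OmE (fr y)).
    apply: hol1B; first by apply: ((holP _ _).1 ((fP (fr y)).1 k) y); split=> //; split=> //; apply/negP; exact: nt.
    apply: hol1M; first exact: hol1_cst.
    apply: ((holP _ _).1 ((fmu (fr y)).1 k) y); split=> //; split=> //; rewrite pset; apply/negP; exact: np.
  have d1 : (bdom (fr y) `\` [set` t]) y by split; [exact: hfr|apply/negP; exact: nt].
  have d2 : (bdom (fr y) `\` range p) y by split; [exact: hfr|rewrite pset; apply/negP; exact: np].
  have [_ h1] := fP (fr y); have [_ h2] := fmu (fr y).
  by rewrite /Om (h1 k l y d1 ky ly) (h2 k l y d2 ky ly) mulrBl mulrA.
pose r1 y : C := if y \in t then rho y else 0.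
pose r2 y : C := \sum_(j < q) (if p j == y then rh j else 0).
have Phr a y k : bdom a y -> cdom k y -> isres (Phi a) y (r1 y).
  move=> ha ky; rewrite /r1; case: ifPn => yt; first exact: rP.
  apply: (isres_hol (k := k) ky).
  apply: filterS3 (near_notin yt) (near_bdom ha) (near_cdom ky) => y' h1 h2 h3.
  by apply: ((holP _ _).1 ((fP a).1 k) y'); split=> //; split=> //; apply/negP.
have mur a y k : bdom a y -> cdom k y -> isres (mu a) y (r2 y).
  move=> ha ky; have [[j _ ej]|nr] := pselect (range p y).
    have -> : r2 y = rh j.
      rewrite /r2 (bigD1 j) //= ej eqxx big1 ?addr0 // => j' nj; case: eqP => // e.
      by case/eqP: nj; apply: pinj; rewrite ej.
    by rewrite -ej; apply: has_residue_isres; apply: rmu; rewrite ej.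
  have -> : r2 y = 0.
    by rewrite /r2 big1 // => j _; case: eqP => // e; case: nr; exists j.
  apply: (isres_hol (k := k) ky).
  have ns : y \notin ps by apply/negP => /psP.
  apply: filterS3 (near_notin ns) (near_bdom ha) (near_cdom ky) => y' h1 h2 h3.
  by apply: ((holP _ _).1 ((fmu a).1 k) y'); split=> //; split=> //; rewrite pset; apply/negP.
have T : Tot Om s (fun y => r1 y - z * r2 y).
  split; [exact: undup_uniq|exact: fO|move=> y ys].
  have [a ha] := bdom_cover L y; have [k ky] := cdom_cover y.
  have fp1 : formp (Phi a) y := formp_local (bdom_open a) ha (fP a).
  have fp2 : formp (mu a) y by apply: (formp_local (s := ps) (bdom_open a) ha); rewrite -pset; exact: fmu.
  have fp3 : formp (fun k y => - z * mu a k y) y.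
    by apply: filterS fp2 => y' h k' l' h1 h2; rewrite (h k' l' h1 h2) mulrA.
  have := isresD fp1 fp3 (Phr a y k ha ky) (isresZ (- z) (mur a y k ha ky)).
  have fp4 : formp (fun k y => Phi a k y + - z * mu a k y) y.
    apply: filterS (pnearI fp1 fp3) => y' [g1 g2] k' l' h1 h2.
    by rewrite (g1 k' l' h1 h2) (g2 k' l' h1 h2) mulrDl.
  rewrite mulNr; apply: (isres_near (k := k)) => //.
  apply: filterS (pnearI (pnear_notin y s) (pnearW (filterI (near_bdom ha) (near_cdom ky)))) => y' [g1 [g2 g3]].
  by rewrite (OmE a) // mulNr.
have := residue_theorem Xcompact Xconn T; rewrite sumrB => /eqP; rewrite subr_eq0 => /eqP.
have -> : \sum_(y <- s) r1 y = \sum_(y <- t) rho y.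
  rewrite (bigID (mem t)) /= [X in _ + X]big1 ?addr0; last by move=> y h; rewrite /r1 (negbTE h).
  rewrite -big_filter (perm_big t).
    by rewrite big_seq [RHS]big_seq; apply: eq_bigr => y yt; rewrite /r1 yt.
  apply: uniq_perm => //; first by rewrite filter_uniq // undup_uniq.
  by move=> y; rewrite mem_filter mem_undup mem_cat; case: (y \in t).
move=> ->; rewrite -mulr_sumr.
have -> : \sum_(y <- s) r2 y = 1.
  rewrite exchange_big -srh; apply: eq_bigr => j _.
  have pj : p j \in s by rewrite mem_undup mem_cat (psP _).1 ?orbT //; exists j.
  rewrite (bigD1_seq (p j)) ?undup_uniq //= eqxx big1 ?addr0 // => y.
  by rewrite eq_sym => /negbTE ->.
exact: mulr1.
Qed.

End ExtensionClass.

(** * Binary forms and the symmetric powers of the extension *)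

Section BinaryForms.
Context {R : realType}.
Local Notation C := (Cplx R).
Local Notation Sym := (mpoly 2 C).
Local Notation ve := (@var_e R).
Local Notation vf := (@var_f R).

Definition bmon (m b : nat) := Multinom [tuple (m - b)%N; b].

Lemma bmon0 m b : bmon m b (0%R : 'I_2) = (m - b)%N. Proof. by rewrite multinomE. Qed.
Lemma bmon1 m b : bmon m b (1%R : 'I_2) = b. Proof. by rewrite multinomE. Qed.

Lemma mdeg2 (mm : multinom 2) : mdeg mm = (mm (0%R : 'I_2) + mm (1%R : 'I_2))%N.
Proof. by rewrite mdegE big_ord_recl big_ord1; congr (_ + mm _)%N; apply/val_inj. Qed.

Lemma mm2P (mm mm' : multinom 2) : mm (0%R : 'I_2) = mm' (0%R : 'I_2) -> mm (1%R : 'I_2) = mm' (1%R : 'I_2) -> mm = mm'.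
Proof.
move=> h0 h1; apply/mnmP => i; case: i => [[|[|//]] hi].
  by rewrite (_ : Ordinal hi = 0) //; apply/val_inj.
by rewrite (_ : Ordinal hi = 1) //; apply/val_inj.
Qed.

Lemma bmonP m (mm : multinom 2) b : mdeg mm = m -> (mm == bmon m b) = (mm (1%R : 'I_2) == b).
Proof.
rewrite mdeg2 => e; apply/eqP/eqP => [->|h]; first exact: bmon1.
by apply: mm2P; rewrite ?bmon0 ?bmon1 // -e h addnK.
Qed.

(* dehomogenization: [e |-> 1], [f |-> 'X] *)
Definition dh (p : Sym) : {poly C} := mmap (@polyC C) (fun i : 'I_2 => if i == 0 then 1 else 'X) p.

Lemma dhD p q : dh (p + q) = dh p + dh q. Proof. exact: mmapD. Qed.
Lemma dh0 : dh 0 = 0. Proof. exact: mmap0. Qed.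
Lemma dhZ c p : dh (c *: p) = c%:P * dh p. Proof. exact: mmapZ. Qed.
Lemma dhM p q : dh (p * q) = dh p * dh q.
Proof. exact: (rmorphM (mmap (@polyC C) (fun i : 'I_2 => if i == 0 then 1 else 'X))). Qed.
Lemma dh_sum (I : Type) (s : seq I) (F : I -> Sym) : dh (\sum_(i <- s) F i) = \sum_(i <- s) dh (F i).
Proof. exact: (raddf_sum (mmap (@polyC C) (fun i : 'I_2 => if i == 0 then 1 else 'X))). Qed.
Lemma dh_pow p n : dh (p ^+ n) = dh p ^+ n.
Proof. exact: (rmorphXn (mmap (@polyC C) (fun i : 'I_2 => if i == 0 then 1 else 'X))). Qed.

Lemma dhX mm : dh (mpolyX C mm) = 'X^(mm (1%R : 'I_2)).
Proof.
rewrite /dh mmapX /mmap1 big_ord_recl big_ord1 /= expr1n mul1r.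
by congr ('X^(mm _)); apply/val_inj.
Qed.

Lemma dh_e : dh ve = 1. Proof. by rewrite dhX mnm1E. Qed.
Lemma dh_f : dh vf = 'X. Proof. by rewrite dhX mnm1E expr1. Qed.

Lemma coef_dh m p b : p \is ishomog1 m mdeg -> (dh p)`_b = mcoeff (bmon m b) p.
Proof.
move=> /dhomogP hp; rewrite [p in LHS]mpolyE [p in RHS]mpolyE dh_sum coef_sum raddf_sum /=.
rewrite big_seq [RHS]big_seq; apply: eq_bigr => mm /hp hm.
by rewrite dhZ dhX coefCM coefXn mcoeffZ mcoeffX (bmonP _ hm) eq_sym.
Qed.

Lemma coef_dh_big m p b : p \is ishomog1 m mdeg -> (m < b)%N -> (dh p)`_b = 0.
Proof.
move=> hp hb; rewrite (coef_dh _ hp); apply: (dhomog_nemf_coeff hp).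
by rewrite /= mdeg2 bmon0 bmon1 neq_ltn; apply/orP; right; apply: leq_trans hb _; exact: leq_addl.
Qed.

Lemma dh_inj m p q : p \is ishomog1 m mdeg -> q \is ishomog1 m mdeg -> dh p = dh q -> p = q.
Proof.
move=> hp hq e; apply/mpolyP => mm; have [hm|hm] := eqVneq (mdeg mm) m; last first.
  by rewrite (dhomog_nemf_coeff hp hm) (dhomog_nemf_coeff hq hm).
have -> : mm = bmon m (mm (1%R : 'I_2)) by apply/eqP; rewrite bmonP.
by rewrite -(coef_dh _ hp) -(coef_dh _ hq) e.
Qed.

(** Homogenization, the inverse of [dh] in degree [m]. Identities between forms are checked on
    one-variable polynomials through [dh_inj]. *)
Definition hm m (P : {poly C}) : Sym := \sum_(b < m.+1) P`_b *: mpolyX C (bmon m b).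

Lemma bmon_homog m (b : 'I_m.+1) : mpolyX C (bmon m b) \is ishomog1 m mdeg.
Proof. by rewrite dhomogX /= mdeg2 bmon0 bmon1 subnK // -ltnS. Qed.

Lemma hm_homog m (P : {poly C}) : hm m P \is ishomog1 m mdeg.
Proof. by apply: rpred_sum => b _; apply: rpredZ; exact: bmon_homog. Qed.

Lemma dh_hm m (P : {poly C}) : (size P <= m.+1)%N -> dh (hm m P) = P.
Proof.
move=> sP; rewrite /hm dh_sum; under eq_bigr do rewrite dhZ dhX bmon1.
apply/polyP => i; rewrite coef_sum; have [hi|hi] := ltnP i m.+1; last first.
  rewrite big1 => [|b _]; first by rewrite nth_default // (leq_trans sP).
  rewrite coefCM coefXn; case: eqVneq => [e|_]; last by rewrite mulr0.
  by move: hi; rewrite e leqNgt ltn_ord.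
rewrite (bigD1 (Ordinal hi)) //= coefCM coefXn eqxx mulr1 big1 ?addr0 // => b nb.
rewrite coefCM coefXn; case: eqVneq => [e|_]; last by rewrite mulr0.
by move/eqP: nb; case; apply/val_inj; rewrite /= e.
Qed.

Lemma size_dh m p : p \is ishomog1 m mdeg -> (size (dh p) <= m.+1)%N.
Proof. by move=> hp; apply/leq_sizeP => b hb; exact: coef_dh_big hp hb. Qed.

Lemma hm_dh m p : p \is ishomog1 m mdeg -> hm m (dh p) = p.
Proof.
move=> hp; apply: (@dh_inj m) => //; first exact: hm_homog.
by rewrite dh_hm // size_dh.
Qed.

Lemma homog_pow m i p q : (i <= m)%N -> p \is ishomog1 1 mdeg -> q \is ishomog1 1 mdeg ->
  p ^+ (m - i) * q ^+ i \is @ishomog1 2 C m mdeg.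
Proof.
move=> hi hp hq; rewrite -{2}(subnK hi); apply: dhomogM.
  by rewrite -[X in ishomog1 X](mul1n (m - i)%N); exact: dhomogMn.
by rewrite -[X in ishomog1 X](mul1n i); exact: dhomogMn.
Qed.

Lemma ve_homog : ve \is ishomog1 1 mdeg. Proof. by rewrite dhomogX /= mdeg1. Qed.
Lemma vf_homog : vf \is ishomog1 1 mdeg. Proof. by rewrite dhomogX /= mdeg1. Qed.

Lemma bmonE m b : (b <= m)%N -> mpolyX C (bmon m b) = ve ^+ (m - b) * vf ^+ b.
Proof.
move=> hb; apply: (@dh_inj m); first by rewrite dhomogX /= mdeg2 bmon0 bmon1 subnK.
  exact: homog_pow ve_homog vf_homog.
by rewrite dhX bmon1 dhM !dh_pow dh_e dh_f expr1n mul1r.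
Qed.

End BinaryForms.

(** * Change of frame in the symmetric powers *)

Section Gluing.
Context {R : realType} {X : riemannSurface R} (L : lineBundle X).
Context (xi : bidx L -> bidx L -> X -> Cplx R).
Local Notation C := (Cplx R).
Local Notation Sym := (mpoly 2 C).
Local Notation ve := (@var_e R).
Local Notation vf := (@var_f R).
Local Notation glu := Defs.glue.
Implicit Types (a b : bidx L) (y : X) (p q : Sym).

Lemma glueD a b y p q : glu xi a b y (p + q) = glu xi a b y p + glu xi a b y q.
Proof. exact: comp_mpolyD. Qed.
Lemma glueZ a b y c p : glu xi a b y (c *: p) = c *: glu xi a b y p.
Proof. exact: comp_mpolyZ. Qed.
Lemma glue0 a b y : glu xi a b y 0 = 0.
Proof. exact: comp_mpoly0. Qed.
Lemma glueM a b y p q : glu xi a b y (p * q) = glu xi a b y p * glu xi a b y q.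
Proof.
exact: (rmorphM (comp_mpoly [tuple ltr a b y *: ve; (ltr a b y)^-1 *: (vf + xi a b y *: ve)])).
Qed.
Lemma glue_pow a b y p n : glu xi a b y (p ^+ n) = glu xi a b y p ^+ n.
Proof.
exact: (rmorphXn (comp_mpoly [tuple ltr a b y *: ve; (ltr a b y)^-1 *: (vf + xi a b y *: ve)])).
Qed.
Lemma glue_sum a b y (I : Type) (s : seq I) (F : I -> Sym) :
  glu xi a b y (\sum_(i <- s) F i) = \sum_(i <- s) glu xi a b y (F i).
Proof.
exact: (raddf_sum (comp_mpoly [tuple ltr a b y *: ve; (ltr a b y)^-1 *: (vf + xi a b y *: ve)])).
Qed.
Lemma glue_e a b y : glu xi a b y ve = ltr a b y *: ve.
Proof. by rewrite /Defs.glue comp_mpolyXU. Qed.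
Lemma glue_f a b y : glu xi a b y vf = (ltr a b y)^-1 *: (vf + xi a b y *: ve).
Proof. by rewrite /Defs.glue comp_mpolyXU. Qed.

Lemma glue_hm a b y m (P : {poly C}) : glu xi a b y (hm m P) =
  \sum_(i < m.+1) P`_i *: (glu xi a b y ve ^+ (m - i) * glu xi a b y vf ^+ i).
Proof. by rewrite /hm glue_sum; apply: eq_bigr => i _; rewrite glueZ bmonE ?glueM ?glue_pow // -ltnS. Qed.

(** After dehomogenization the change of frame is triangular: [f^i] becomes a scalar times
    [('X + xi)^i]. *)
Lemma dh_glue a b y m p : p \is ishomog1 m mdeg -> dh (glu xi a b y p) =
  \sum_(i < m.+1) ((dh p)`_i * (ltr a b y ^+ (m - i) / ltr a b y ^+ i))%:P * ('X + (xi a b y)%:P) ^+ i.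
Proof.
move=> hp; rewrite -{1}(hm_dh hp) glue_hm dh_sum; apply: eq_bigr => i _.
rewrite dhZ dhM !dh_pow glue_e glue_f !dhZ dhD dhZ dh_e dh_f !mulr1 exprMn.
by rewrite -!rmorphXn exprVn !polyCM !mulrA.
Qed.

Lemma glue_homog a b y m p : p \is ishomog1 m mdeg -> glu xi a b y p \is ishomog1 m mdeg.
Proof.
move=> hp; rewrite -(hm_dh hp) glue_hm; apply: rpred_sum => i _; apply: rpredZ.
have hi : (i <= m)%N by rewrite -ltnS.
apply: homog_pow => //; first by rewrite glue_e; apply: rpredZ; exact: ve_homog.
rewrite glue_f; apply: rpredZ; apply: rpredD; first exact: vf_homog.
by apply: rpredZ; exact: ve_homog.
Qed.

Hypothesis xi_cocycle : is_cocycle xi.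

Lemma glue_cocycle a b c y m p : p \is ishomog1 m mdeg -> bdom a y -> bdom b y -> bdom c y ->
  glu xi a b y (glu xi b c y p) = glu xi a c y p.
Proof.
move=> hp ha hb hc; have [_ hx] := xi_cocycle.
have ee : glu xi a b y (glu xi b c y ve) = glu xi a c y ve.
  by rewrite !glue_e glueZ glue_e scalerA mulrC ltr_cocycle.
have n1 := ltr_neq0 ha hb; have n2 := ltr_neq0 hb hc.
have ef : glu xi a b y (glu xi b c y vf) = glu xi a c y vf.
  rewrite !glue_f glueZ glueD glueZ glue_e glue_f (hx a b c y ha hb hc) -(ltr_cocycle ha hb hc).
  rewrite invfM mulrC -scalerA; congr (_ *: _); rewrite !scalerDr !scalerA.
  rewrite -addrA -scalerDl; congr (_ + _ *: _).
  by move: (ltr a b y) (xi a b y) (xi b c y) n1 => g u v g0; field.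
rewrite -(hm_dh hp) glue_hm [RHS]glue_hm glue_sum; apply: eq_bigr => i _.
rewrite (glueZ a b y); congr (_ *: _); rewrite (glueM a b y); congr (_ * _).
  by rewrite -ee; exact: glue_pow.
by rewrite -ef; exact: glue_pow.
Qed.

Lemma ltr_id a y : bdom a y -> ltr a a y = 1.
Proof.
move=> ha; have := ltr_cocycle ha ha ha; have n := ltr_neq0 ha ha.
by move/(congr1 (fun z => z / ltr a a y)); rewrite mulfK // divff.
Qed.

Lemma xi_id a y : bdom a y -> xi a a y = 0.
Proof.
move=> ha; have [_ hx] := xi_cocycle; have := hx a a a y ha ha ha.
by rewrite ltr_id // expr1n mul1r => /eqP; rewrite -subr_eq subrr eq_sym => /eqP.
Qed.

Lemma glue_id a y m p : p \is ishomog1 m mdeg -> bdom a y -> glu xi a a y p = p.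
Proof.
move=> hp ha; apply: (@dh_inj _ m) => //; first exact: glue_homog.
rewrite (dh_glue a a y hp) ltr_id // xi_id // addr0.
under eq_bigr do rewrite !expr1n divr1 mulr1.
rewrite -{2}(dh_hm (size_dh hp)) /hm dh_sum; apply: eq_bigr => i _.
by rewrite dhZ dhX bmon1.
Qed.

End Gluing.

(** * Parabolic connections *)

Section Coefficients.
Context {R : realType}.
Local Notation C := (Cplx R).

Lemma sum_one (F : nat -> C) m p : (p <= m)%N -> (forall l, (l <= m)%N -> l != p -> F l = 0) ->
  \sum_(l < m.+1) F l = F p.
Proof.
move=> hp h; rewrite (bigD1 (Ordinal (hp : (p < m.+1)%N))) //= big1 ?addr0 // => l nl.
by apply: h; [rewrite -ltnS|apply: contra nl => /eqP e; apply/eqP/val_inj].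
Qed.

Lemma sum_two (F : nat -> C) m p : (p <= m)%N -> ((m < p.+1)%N -> F p.+1 = 0) ->
  (forall l, (l <= m)%N -> l != p -> l != p.+1 -> F l = 0) ->
  \sum_(l < m.+1) F l = F p + F p.+1.
Proof.
move=> hp hm h; rewrite (bigD1 (Ordinal (hp : (p < m.+1)%N))) //=; congr (_ + _).
have [hm'|hp1] := ltnP m p.+1.
  rewrite hm // big1 // => l nl; apply: h; first by rewrite -ltnS.
    by apply: contra nl => /eqP e; apply/eqP/val_inj.
  by rewrite neq_ltn (leq_trans (ltn_ord l) hm').
rewrite (bigD1 (Ordinal (hp1 : (p.+1 < m.+1)%N))) /=; last by rewrite -val_eqE /= neq_ltn ltnSn orbT.
rewrite big1 ?addr0 // => l /andP[n1 n2].
apply: h; first by rewrite -ltnS.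
  by apply: contra n1 => /eqP e; apply/eqP/val_inj.
by apply: contra n2 => /eqP e; apply/eqP/val_inj.
Qed.

Lemma coef_Xadd_gt (z : C) l i : (l < i)%N -> (('X + z%:P) ^+ l : {poly C})`_i = 0.
Proof.
move=> h; rewrite nth_default //; apply: leq_trans (size_poly_exp_leq _ _) _.
by rewrite size_XaddC /= mul1n.
Qed.

Lemma coef_Xadd_eq (z : C) l : (('X + z%:P) ^+ l : {poly C})`_l = 1.
Proof.
elim: l => [|l IH]; first by rewrite expr0 coef1.
by rewrite exprS mulrDl coefD coefXM coefCM IH coef_Xadd_gt // mulr0 addr0.
Qed.

Lemma coef_Xadd_pred (z : C) l : (('X + z%:P) ^+ l.+1 : {poly C})`_l = l.+1%:R * z.
Proof.
elim: l => [|l IH]; first by rewrite expr1 coefD coefX coefC /= add0r mul1r.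
rewrite exprS mulrDl coefD coefXM coefCM IH coef_Xadd_eq mulr1.
by rewrite -[in RHS]natr1 mulrDl mul1r.
Qed.

End Coefficients.

(** * The filtered sheaves in terms of orders of coefficients *)

Section ParabolicConnection.
Context {R : realType} {X : riemannSurface R} (L : lineBundle X).
Context (xi : bidx L -> bidx L -> X -> Cplx R) (xi_cocycle : is_cocycle xi).
Context (n : nat) (x : 'I_n -> X) (x_inj : injective x) (c : 'I_n -> R) (c_gt1 : forall i, 1 < c i).
Local Notation C := (Cplx R).
Local Notation Sym := (mpoly 2 C).
Local Notation glu := Defs.glue.
Local Notation S := (range x).
Implicit Types (a : bidx L) (b m : nat) (k l : cidx X) (y : X) (W N : set X) (t : R) (s e : sec L) (P : X -> {poly C}).

Lemma rangeP y : S y <-> y \in [seq x i | i <- enum 'I_n].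
Proof.
split=> [[i _ <-]|/mapP[i _ ->]]; last by exists i.
by apply: map_f; rewrite mem_enum.
Qed.

Lemma open_notS : open (~` S).
Proof.
have -> : ~` S = [set y | y \notin [seq x i | i <- enum 'I_n]].
  apply/seteqP; split => y h; first by apply/negP => /rangeP.
  by move=> /rangeP; apply/negP.
exact: open_notin.
Qed.

Lemma pnear_notS p : pnear p (fun y => ~ S y).
Proof. by apply: filterS (pnear_notin p [seq x i | i <- enum 'I_n]) => y /negP h /rangeP. Qed.

Lemma openD_S W : open W -> open (W `\` S).
Proof. by move=> oW; rewrite setDE; apply: openI => //; exact: open_notS. Qed.

(** The weight at [x_i] of [e^(m-b) (z f)^b], with [z] a local coordinate: [e] has the weight of
    [E], and [z f] spans the line. It is not reduced modulo 1. *)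
Definition wt i m b : R := (m%:R * c i + b%:R) / (2 * c i + 1).
(** The least order at [x_i] of the coefficient of [e^(m-b) f^b] in a section of filtration level
    [t]. The summand [b] is there because the generator is [z f], not [f]. *)
Definition NN i m b t : int := Num.ceil (t - wt i m b) + b%:Z.

Lemma den_gt0 i : 0 < 2 * c i + 1. Proof. by have := c_gt1 i; lra. Qed.

Lemma wtD i m m' b b' : wt i m b + wt i m' b' = wt i (m + m') (b + b').
Proof. by rewrite /wt -mulrDl !natrD; congr (_ / _); ring. Qed.

Lemma ceilD_ge (u v : R) : Num.ceil (u + v) <= Num.ceil u + Num.ceil v.
Proof. by rewrite ceil_le_int intrD lerD ?ceil_ge. Qed.

Lemma NND i m m' b b' u v : NN i (m + m') (b + b') (u + v) <= NN i m b u + NN i m' b' v.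
Proof.
rewrite /NN -wtD PoszD addrACA lerD2r.
have -> : u + v - (wt i m b + wt i m' b') = (u - wt i m b) + (v - wt i m' b') by ring.
exact: ceilD_ge.
Qed.

Lemma hol1_coef_dh m W s a b y : is_sec xi m W s -> open W -> W y -> bdom a y ->
  hol1 (fun y => (dh (s a y))`_b) y.
Proof.
move=> [h1 h2 _] oW Wy ha; have := (holP _ _).1 (h2 a (bmon m b)) y (conj Wy ha).
apply: hol1_near; apply: filterS2 (near_open oW Wy) (near_bdom ha) => y' Wy' ha'.
by rewrite (coef_dh _ (h1 a y' Wy' ha')).
Qed.

Lemma is_secI m W s : open W -> (forall a y, W y -> bdom a y -> s a y \is ishomog1 m mdeg) ->
  (forall a b y, W y -> bdom a y -> hol1 (fun y => (dh (s a y))`_b) y) ->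
  (forall a a' y, W y -> bdom a y -> bdom a' y -> s a y = glu xi a a' y (s a' y)) -> is_sec xi m W s.
Proof.
move=> oW h1 h2 h3; split => // a mon; apply/holP => y [Wy ha].
have nW : \forall y' \near y, W y' /\ bdom a y' by apply: filterI; [exact: near_open oW Wy|exact: near_bdom ha].
have [hm|hm] := eqVneq (mdeg mon) m; last first.
  apply: hol1_near (hol1_cst 0 y); apply: filterS nW => y' [W' a'].
  by rewrite (dhomog_nemf_coeff (h1 a y' W' a') hm).
have -> : mon = bmon m (mon (1%R : 'I_2)) by apply/eqP; rewrite bmonP.
apply: hol1_near (h2 a (mon (1%R : 'I_2)) y Wy ha); apply: filterS nW => y' [W' a'].
by rewrite (coef_dh _ (h1 a y' W' a')).
Qed.

Lemma is_sec_sub m W W' s : W' `<=` W -> is_sec xi m W s -> is_sec xi m W' s.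
Proof.
move=> sW [h1 h2 h3]; split.
- by move=> a y /sW; exact: h1.
- by move=> a mon; apply/holP => y [/sW Wy ha]; exact: (holP _ _).1 (h2 a mon) y (conj Wy ha).
- by move=> a b y /sW; exact: h3.
Qed.

Lemma is_sec_local m W s : open W -> (forall y, W y -> exists N s', [/\ open N, N y, is_sec xi m N s' & seq_on N s s']) ->
  is_sec xi m W s.
Proof.
move=> oW h; apply: is_secI => // [a y Wy ha|a b y Wy ha|a b y Wy ha hb]; have [N [s' [oN Ny hs e]]] := h y Wy.
- by rewrite (e a y Ny ha); case: hs => h1 _ _; exact: h1.
- apply: hol1_near (hol1_coef_dh b hs oN Ny ha).
  by apply: filterS2 (near_open oN Ny) (near_bdom ha) => y' N' a'; rewrite e.
- by rewrite (e a y Ny ha) (e b y Ny hb); case: hs => _ _ h3; exact: h3.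
Qed.

Lemma is_sec_eq m W s s' : open W -> seq_on W s s' -> is_sec xi m W s' -> is_sec xi m W s.
Proof. by move=> oW e hs; apply: is_sec_local => // y Wy; exists W, s'. Qed.

Lemma is_sec_add m W s s' : is_sec xi m W s -> is_sec xi m W s' -> is_sec xi m W (addsec s s').
Proof.
move=> [h1 h2 h3] [g1 g2 g3]; split.
- by move=> a y Wy ha; apply: rpredD; [exact: h1|exact: g1].
- move=> a mon; apply/holP => y hy; apply: hol1_near (hol1D ((holP _ _).1 (h2 a mon) y hy) ((holP _ _).1 (g2 a mon) y hy)).
  by apply: filterE => y'; rewrite /addsec mcoeffD.
- by move=> a b y Wy ha hb; rewrite /addsec (h3 a b) // (g3 a b) // glueD.
Qed.

Lemma is_sec_scale m W f s : hol W f -> is_sec xi m W s -> is_sec xi m W (scalesec f s).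
Proof.
move=> hf [h1 h2 h3]; split.
- by move=> a y Wy ha; apply: rpredZ; exact: h1.
- move=> a mon; apply/holP => y hy; apply: hol1_near (hol1M ((holP _ _).1 hf y hy.1) ((holP _ _).1 (h2 a mon) y hy)).
  by apply: filterE => y'; rewrite /scalesec mcoeffZ.
- by move=> a b y Wy ha hb; rewrite /scalesec (h3 a b) // glueZ.
Qed.

Lemma is_sec0 m W : is_sec xi m W (@zerosec R X L).
Proof.
split.
- by move=> a y _ _; exact: dhomog0.
- move=> a mon; apply/holP => y _; apply: hol1_near (hol1_cst 0 y).
  by apply: filterE => y'; rewrite mcoeff0.
- by move=> a b y _ _ _; rewrite /zerosec glue0.
Qed.

Lemma is_sec_mul m m' W s s' : is_sec xi m W s -> is_sec xi m' W s' -> open W ->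
  is_sec xi (m + m') W (fun a y => s a y * s' a y).
Proof.
move=> hs hs' oW; have [h1 h2 h3] := hs; have [g1 g2 g3] := hs'.
apply: is_secI; first exact: oW.
- by move=> a y Wy ha; apply: dhomogM; [exact: h1|exact: g1].
- move=> a b y Wy ha.
  have : hol1 (fun y => \sum_(i < b.+1) (dh (s a y))`_i * (dh (s' a y))`_(b - i)) y.
    by apply: hol1_sum => i; apply: hol1M; [exact: hol1_coef_dh hs oW Wy ha|exact: hol1_coef_dh hs' oW Wy ha].
  by apply: hol1_near; apply: filterE => y'; rewrite dhM coefM.
- by move=> a b y Wy ha hb; rewrite (h3 a b) // (g3 a b) // glueM.
Qed.

(* the section whose components in the frame [a0] are the coefficients of [P] *)
Definition sec_of m a0 P : sec L := fun a y => glu xi a a0 y (hm m (P y)).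

Lemma sec_ofE m a0 P y : bdom a0 y -> sec_of m a0 P a0 y = hm m (P y).
Proof. by move=> h; rewrite /sec_of (glue_id xi_cocycle (hm_homog m _) h). Qed.

Lemma hol1_pow_coef (f : X -> C) i j y : hol1 f y -> hol1 (fun y => (('X + (f y)%:P) ^+ i : {poly C})`_j) y.
Proof.
move=> hf; elim: i j => [|i IH] j.
  by apply: hol1_near (hol1_cst (1 : {poly C})`_j y); apply: filterE => y'; rewrite expr0.
have : hol1 (fun y => (if j is j'.+1 then (('X + (f y)%:P) ^+ i : {poly C})`_j' else 0) + f y * (('X + (f y)%:P) ^+ i : {poly C})`_j) y.
  apply: hol1D; last exact: hol1M.
  by case: (j) => [|j']; [exact: hol1_cst|exact: IH].
apply: hol1_near; apply: filterE => y'; rewrite exprS mulrDl coefD coefXM coefCM.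
by case: (j).
Qed.

Lemma sec_of_is_sec m a0 P W : open W -> W `<=` bdom a0 -> (forall b y, W y -> hol1 (fun y => (P y)`_b) y) ->
  is_sec xi m W (sec_of m a0 P).
Proof.
move=> oW W0 hP; apply: is_secI; first exact: oW.
- by move=> a y Wy ha; apply: glue_homog; exact: hm_homog.
- move=> a b y Wy ha; have h0 := W0 y Wy.
  have hg : hol1 (ltr a a0) y := (holP _ _).1 (@ltr_hol _ _ L a a0) y (conj ha h0).
  have hx : hol1 (xi a a0) y := (holP _ _).1 (xi_cocycle.1 a a0) y (conj ha h0).
  have g0 := ltr_neq0 ha h0.
  have hh i : hol1 (fun y => (dh (hm m (P y)))`_i) y.
    have [hi|hi] := leqP i m.
      apply: hol1_near (hP i y Wy); apply: filterE => y'; rewrite (coef_dh _ (hm_homog m _)) /hm raddf_sum /=.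
      rewrite (bigD1 (Ordinal (hi : (i < m.+1)%N))) //= mcoeffZ mcoeffX eqxx mulr1 big1 ?addr0 // => j nj.
      rewrite mcoeffZ mcoeffX; case: eqVneq => [e|_]; last by rewrite mulr0.
      by move/eqP: nj; case; apply/val_inj; rewrite /= -(bmon1 m j) e bmon1.
    apply: hol1_near (hol1_cst 0 y); apply: filterE => y'.
    by rewrite (coef_dh_big (hm_homog m _) hi).
  have : hol1 (fun y => \sum_(i < m.+1) (dh (hm m (P y)))`_i * (ltr a a0 y ^+ (m - i) / ltr a a0 y ^+ i) * (('X + (xi a a0 y)%:P) ^+ i : {poly C})`_b) y.
    apply: hol1_sum => i; apply: hol1M; last exact: hol1_pow_coef.
    apply: hol1M => //; apply: hol1M; first exact: hol1X.
    by apply: hol1V; [rewrite expf_neq0|exact: hol1X].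
  apply: hol1_near; apply: filterE => y'; rewrite (dh_glue xi a a0 y' (hm_homog m _)) coef_sum.
  by apply: eq_bigr => i _; rewrite coefCM.
- move=> a b y Wy ha hb; rewrite /sec_of (glue_cocycle xi_cocycle (hm_homog m _)) //; exact: W0.
Qed.

Lemma sec_frame m W s a0 a y : is_sec xi m W s -> W y -> bdom a y -> bdom a0 y ->
  s a y = sec_of m a0 (fun y => dh (s a0 y)) a y.
Proof.
by move=> [h1 _ h3] Wy ha h0; rewrite /sec_of hm_dh; [exact: h3|exact: h1].
Qed.

Lemma sec_of_eq m a0 P P' a y : P y = P' y -> sec_of m a0 P a y = sec_of m a0 P' a y.
Proof. by rewrite /sec_of => ->. Qed.

Lemma sec_of_mul m m' a0 P P' a y : (size (P y) <= m.+1)%N -> (size (P' y) <= m'.+1)%N ->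
  sec_of m a0 P a y * sec_of m' a0 P' a y = sec_of (m + m') a0 (fun y => P y * P' y) a y.
Proof.
move=> h1 h2; rewrite /sec_of -glueM; congr (glu xi a a0 y _).
apply: (@dh_inj _ (m + m')); [by apply: dhomogM; exact: hm_homog|exact: hm_homog|].
rewrite dhM !dh_hm //; apply: leq_trans (size_polyMleq _ _) _.
by rewrite -ltnS; case: (size (P y)) h1 => [|p] h1; case: (size (P' y)) h2 => [|q] h2 /=; lia.
Qed.

Lemma sec_of_add m a0 P P' a y : sec_of m a0 P a y + sec_of m a0 P' a y = sec_of m a0 (fun y => P y + P' y) a y.
Proof.
rewrite /sec_of -glueD; congr (glu xi a a0 y _); rewrite /hm -big_split; apply: eq_bigr => i _.
by rewrite /= coefD scalerDl.
Qed.

Lemma sec_of_scale m a0 P (f : X -> C) a y : f y *: sec_of m a0 P a y = sec_of m a0 (fun y => (f y)%:P * P y) a y.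
Proof.
rewrite /sec_of -glueZ; congr (glu xi a a0 y _); rewrite /hm scaler_sumr; apply: eq_bigr => i _.
by rewrite scalerA coefCM.
Qed.

(** The explicit form of the filtered sheaves: [d] bounds the degree in [f], which selects the
    subsheaf, and the coefficients have prescribed orders in every frame. *)
Definition chiv m d t W s := [/\ is_sec xi m (W `\` S) s,
  forall a y b, (W `\` S) y -> bdom a y -> (d < b)%N -> (dh (s a y))`_b = 0 &
  forall i, W (x i) -> forall a, bdom a (x i) -> forall b, ordge (x i) (NN i m b t) (fun y => (dh (s a y))`_b)].

Lemma near_W_S W p : open W -> W p -> pnear p (W `\` S).
Proof. by move=> oW Wp; apply: filterS (pnearI (pnearW (near_open oW Wp)) (pnear_notS p)). Qed.

Lemma is_sec_sum m W q (F : 'I_q -> sec L) : open W -> (forall j, is_sec xi m W (F j)) ->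
  is_sec xi m W (fun a y => \sum_(j < q) F j a y).
Proof.
move=> oW h; apply: is_secI; first exact: oW.
- by move=> a y Wy ha; apply: rpred_sum => j _; case: (h j) => h1 _ _; exact: h1.
- move=> a b y Wy ha; have : hol1 (fun y => \sum_(j < q) (dh (F j a y))`_b) y.
    by apply: hol1_sum => j; exact: hol1_coef_dh (h j) oW Wy ha.
  by apply: hol1_near; apply: filterE => y'; rewrite dh_sum coef_sum.
- move=> a a' y Wy ha ha'; rewrite glue_sum; apply: eq_bigr => j _.
  by case: (h j) => _ _ h3; exact: h3.
Qed.

(** Products of sections respect the orders because ceilings are subadditive ([NND]); sums of
    products then cause no loss. *)
Lemma chiv_mul (P Q : fshf L) m d m' d' : (forall u N p, open N -> P u N p -> chiv m d u N p) ->
  (forall u N p, open N -> Q u N p -> chiv m' d' u N p) ->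
  forall t W s, open W -> par_mul x P Q t W s -> chiv (m + m') (d + d') t W s.
Proof.
move=> hP hQ t W s oW h.
have loc y : W y -> exists N q (F G : 'I_q -> sec L) (u v : 'I_q -> R), [/\ open N, N y, N `<=` W,
   forall j, [/\ u j + v j = t, chiv m d (u j) N (F j) & chiv m' d' (v j) N (G j)] &
   seq_on (N `\` S) s (fun a y' => \sum_(j < q) F j a y' * G j a y')].
  move=> Wy; have [N [oN Ny NW [q [u [v [F [G [hj e]]]]]]]] := h y Wy.
  exists N, q, F, G, u, v; split => // j; have [h1 h2 h3] := hj j; split => //; [exact: hP|exact: hQ].
have coefE N q (F G : 'I_q -> sec L) a y b : seq_on (N `\` S) s (fun a y' => \sum_(j < q) F j a y' * G j a y') ->
    (N `\` S) y -> bdom a y ->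
    (dh (s a y))`_b = \sum_(j < q) \sum_(i < b.+1) (dh (F j a y))`_i * (dh (G j a y))`_(b - i).
  move=> e Ny ha; rewrite (e a y Ny ha) dh_sum coef_sum; apply: eq_bigr => j _.
  by rewrite dhM coefM.
split.
- apply: is_sec_local; first exact: openD_S.
  move=> y [Wy nS]; have [N [q [F [G [u [v [oN Ny NW hj e]]]]]]] := loc y Wy.
  exists (N `\` S), (fun a y' => \sum_(j < q) F j a y' * G j a y'); split => //.
    exact: openD_S.
  apply: is_sec_sum; first exact: openD_S.
  move=> j; have [_ [f1 _ _] [g1 _ _]] := hj j; apply: is_sec_mul => //; exact: openD_S.
- move=> a y b [Wy nS] ha hb; have [N [q [F [G [u [v [oN Ny NW hj e]]]]]]] := loc y Wy.
  rewrite (coefE N q F G a y b e (conj Ny nS) ha) big1 // => j _; rewrite big1 // => i _.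
  have [_ [_ f2 _] [_ g2 _]] := hj j.
  have [hi|hi] := ltnP d i; first by rewrite f2 // mul0r.
  rewrite [X in _ * X]g2 ?mulr0 //; lia.
- move=> i Wi a ha b; have [N [q [F [G [u [v [oN Ny NW hj e]]]]]]] := loc _ Wi.
  apply: (@ordge_near _ _ _ _ (fun y => \sum_(j < q) \sum_(i < b.+1) (dh (F j a y))`_i * (dh (G j a y))`_(b - i))).
    apply: filterS (pnearI (near_W_S oN Ny) (pnearW (near_bdom ha))) => y [Ny' ha'].
    by rewrite (coefE N q F G a y b e Ny' ha').
  apply: ordge_sum => j _; apply: ordge_sum => i0 _.
  have [<- [_ _ f3] [_ _ g3]] := hj j.
  have hb : (i0 <= b)%N by rewrite -ltnS.
  apply: ordge_le (ordgeM (f3 i Ny a ha i0) (g3 i Ny a ha (b - i0)%N)).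
  by rewrite -{1}(subnKC hb); exact: NND.
Qed.

Lemma p0E p : p \is @ishomog1 2 C 1 mdeg -> p0 p = (dh p)`_1.
Proof.
move=> hp; rewrite (coef_dh _ hp) /p0; congr (mcoeff _ _).
by apply: mm2P; rewrite ?bmon0 ?bmon1 mnm1E.
Qed.

Lemma ceil_frac t (w : R) : Num.ceil (t - w) = Num.ceil (t - (Num.floor t)%:~R - w) + Num.floor t.
Proof.
have -> : t - w = (t - (Num.floor t)%:~R - w) + (Num.floor t)%:~R by ring.
by rewrite ceilDrz ?intrKceil // intr_int.
Qed.

Lemma frac_itv t : 0 <= t - (Num.floor t)%:~R < 1.
Proof. by have := floor_itv t; rewrite intrD => /andP[h1 h2]; apply/andP; split; lra. Qed.

Lemma ceil01 (v : R) : 0 < v <= 1 -> Num.ceil v = 1.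
Proof. by move=> /andP[h1 h2]; apply/eqP; rewrite ceil_eq subrr h1. Qed.

Lemma ceilN10 (v : R) : -1 < v <= 0 -> Num.ceil v = 0.
Proof. by move=> /andP[h1 h2]; apply/eqP; rewrite ceil_eq sub0r intrN h1. Qed.

Lemma wt10 i : wt i 1 0 = weight_total c i.
Proof. by rewrite /wt /weight_total mul1r addr0. Qed.
Lemma wt11 i : wt i 1 1 = weight_line c i.
Proof. by rewrite /wt /weight_line mul1r. Qed.

Lemma weight_bounds i : 0 < weight_total c i /\ weight_total c i < weight_line c i /\ weight_line c i < 1.
Proof.
have d0 := den_gt0 i; have ci := c_gt1 i; rewrite /weight_total /weight_line; split.
  by rewrite divr_gt0 //; lra.
by split; [rewrite ltr_pM2r ?invr_gt0 //|rewrite ltr_pdivrMr //]; lra.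
Qed.

Lemma Eshf_ord N e i a : open N -> N (x i) -> bdom a (x i) -> Eshf xi x N e ->
  ordge (x i) 0 (fun y => (dh (e a y))`_0) /\ ordge (x i) 1 (fun y => (dh (e a y))`_1).
Proof.
move=> oN Ni ha [he hp].
have hol b : \forall y \near x i, hol1 (fun y => (dh (e a y))`_b) y.
  by apply: filterS2 (near_open oN Ni) (near_bdom ha) => y Ny ay; exact: hol1_coef_dh he oN Ny ay.
split; first exact: ordge_hol.
apply: ordge_hol0 => //; rewrite -p0E; last by case: he => h1 _ _; exact: h1.
by apply: hp => //; exists i.
Qed.

Lemma coef_addsec s s' a y b : (dh (addsec s s' a y))`_b = (dh (s a y))`_b + (dh (s' a y))`_b.
Proof. by rewrite /addsec dhD coefD. Qed.
Lemma coef_scalesec f s a y b : (dh (scalesec f s a y))`_b = f y * (dh (s a y))`_b.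
Proof. by rewrite /scalesec dhZ coefCM. Qed.

(** Equality in the fibre is equality modulo the coordinate times a section, so orders up to one
    more than the generic bound [u] transfer. *)
Lemma fib_eq_ord (G : shf L) i e e' a b u : (forall N v, open N -> N (x i) -> G N v -> ordge (x i) u (fun y => (dh (v a y))`_b)) ->
  bdom a (x i) -> fib_eq x G (x i) e e' -> ordge (x i) (1 + u) (fun y => (dh (e' a y))`_b) ->
  ordge (x i) (1 + u) (fun y => (dh (e a y))`_b).
Proof.
move=> hG ha [k [N [v [[oN Ni Nk] Gv es]]]] he'.
apply: (@ordge_near _ _ _ _ (fun y => (dh (e' a y))`_b + ccrd k (x i) y * (dh (v a y))`_b)).
  apply: filterS (pnearI (near_W_S oN Ni) (pnearW (near_bdom ha))) => y [Ny ay].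
  by rewrite (es a y Ny ay) coef_addsec coef_scalesec.
apply: ordgeD => //; apply: ordgeM; last exact: hG oN Ni Gv.
by have := ordge_ccrd 1 (Nk _ Ni); apply: ordge_near; apply: pnearT => y; rewrite expr1z.
Qed.

Lemma chiv_big m t W s i a b : open W -> W (x i) -> bdom a (x i) -> is_sec xi m (W `\` S) s -> (m < b)%N ->
  ordge (x i) (NN i m b t) (fun y => (dh (s a y))`_b).
Proof.
move=> oW Wi ha [h1 _ _] hb; apply: ordge_zero.
apply: filterS (pnearI (near_W_S oW Wi) (pnearW (near_bdom ha))) => y [Wy ay].
by apply: coef_dh_big (h1 a y Wy ay) hb.
Qed.

Lemma E_par_chiv t W s : open W -> E_par xi x c t W s -> chiv 1 1 t W s.
Proof.
move=> oW [hs hi]; split => //.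
  by move=> a y b Wy ha hb; case: hs => h1 _ _; exact: coef_dh_big (h1 a y Wy ha) hb.
move=> i Wi a ha b; have [hb|hb] := ltnP 1 b; first exact: chiv_big oW Wi ha hs hb.
have [k [N [e [[oN Ni Nk] NW Ee cond es]]]] := hi i Wi.
have kx := Nk _ Ni.
have [e0 e1] := Eshf_ord oN Ni ha Ee.
have [w0 [w01 w1]] := weight_bounds i; have := frac_itv t; set tau := t - _ => /andP[t0 t1].
(* Dividing by the power [floor t] of the coordinate reduces to [0 <= tau < 1]; there the three
   cases of the filtration correspond to the values 0 and 1 of the two ceilings. *)
suff H : ordge (x i) (Num.ceil (tau - wt i 1 b) + b%:Z) (fun y => (dh (e a y))`_b).
  rewrite /NN ceil_frac -/tau addrAC addrC.
  apply: ordge_near (ordgeM (ordge_ccrd (Num.floor t) kx) H).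
  apply: filterS (pnearI (near_W_S oN Ni) (pnearW (near_bdom ha))) => y [Ny ay].
  by rewrite (es a y Ny ay) coef_scalesec.
have Eord0 N' v : open N' -> N' (x i) -> Eshf xi x N' v -> ordge (x i) 0 (fun y => (dh (v a y))`_0).
  by move=> oN' Ni' Ev; case: (Eshf_ord oN' Ni' ha Ev).
have Eord1 N' v : open N' -> N' (x i) -> Eshf xi x N' v -> ordge (x i) 1 (fun y => (dh (v a y))`_1).
  by move=> oN' Ni' Ev; case: (Eshf_ord oN' Ni' ha Ev).
move: cond; rewrite -/tau; case: ifPn => [c1 _|].
  case: b hb => [|[|//]] _; rewrite ?wt10 ?wt11.
    by rewrite (@ceilN10 (tau - weight_total c i)) //; apply/andP; split; lra.
  by rewrite (@ceilN10 (tau - weight_line c i)) //; apply/andP; split; lra.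
rewrite -ltNge => c1; case: ifPn => [c2 [N' [u [oN' Ni' hu u0 fe]]]|].
  have hu0 b' : ordge (x i) 1 (fun y => (dh (u a y))`_b').
    apply: ordge_hol0; last by rewrite u0 ?dh0 ?coef0 //; exists i.
    by apply: filterS2 (near_open oN' Ni') (near_bdom ha) => y Ny ay; exact: hol1_coef_dh hu oN' Ny ay.
  case: b hb => [|[|//]] _; rewrite ?wt10 ?wt11.
    rewrite (@ceil01 (tau - weight_total c i)) ?addr0; last by apply/andP; split; lra.
    by have := fib_eq_ord Eord0 ha fe; rewrite addr0; apply.
  by rewrite (@ceilN10 (tau - weight_line c i)) //; apply/andP; split; lra.
rewrite -ltNge => c2 fe; have z0 b' u : ordge (x i) u (fun y => (dh (@zerosec R X L a y))`_b').
  by apply: ordge_zero; apply: pnearT => y; rewrite dh0 coef0.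
case: b hb => [|[|//]] _; rewrite ?wt10 ?wt11.
  rewrite (@ceil01 (tau - weight_total c i)) ?addr0; last by apply/andP; split; lra.
  by have := fib_eq_ord Eord0 ha fe; rewrite addr0; apply.
rewrite (@ceil01 (tau - weight_line c i)); last by apply/andP; split; lra.
exact: fib_eq_ord Eord1 ha fe (z0 _ _).
Qed.

Lemma O_par_chiv t W s : open W -> O_par xi x t W s -> chiv 0 0 t W s.
Proof.
move=> oW [hs hi]; split => //.
  by move=> a y b Wy ha hb; case: hs => h1 _ _; exact: coef_dh_big (h1 a y Wy ha) hb.
move=> i Wi a ha b; have [hb|hb] := ltnP 0 b; first exact: chiv_big oW Wi ha hs hb.
have {hb}-> : b = 0 by lia.
have [k [N [e [[oN Ni Nk] NW Ee cond es]]]] := hi i Wi.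
have kx := Nk _ Ni.
have Oord N' v : open N' -> N' (x i) -> is_sec xi 0 N' v -> ordge (x i) 0 (fun y => (dh (v a y))`_0).
  move=> oN' Ni' hv; apply: ordge_hol.
  by apply: filterS2 (near_open oN' Ni') (near_bdom ha) => y Ny ay; exact: hol1_coef_dh hv oN' Ny ay.
have := frac_itv t; set tau := t - _ => /andP[t0 t1].
have w00 : wt i 0 0 = 0 by rewrite /wt mul0r addr0 mul0r.
suff H : ordge (x i) (Num.ceil tau) (fun y => (dh (e a y))`_0).
  have -> : NN i 0 0 t = Num.floor t + Num.ceil tau by rewrite /NN ceil_frac -/tau w00 !subr0 addrC.
  apply: ordge_near (ordgeM (ordge_ccrd (Num.floor t) kx) H).
  apply: filterS (pnearI (near_W_S oN Ni) (pnearW (near_bdom ha))) => y [Ny ay].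
  by rewrite (es a y Ny ay) coef_scalesec.
move: cond; rewrite -/tau; case: ifPn => [c1 _|].
  by rewrite (@ceilN10 tau); [exact: Oord Ee|apply/andP; split; lra].
rewrite -ltNge => c1 fe; rewrite (@ceil01 tau); last by apply/andP; split; lra.
have := fib_eq_ord Oord ha fe; rewrite addr0; apply.
by apply: ordge_zero; apply: pnearT => y; rewrite dh0 coef0.
Qed.

Lemma L_par_chiv t W s : open W -> L_par xi x c t W s -> chiv 1 0 t W s.
Proof.
move=> oW [hE h0]; have [h1 h2 h3] := E_par_chiv oW hE; split => //.
move=> a y b Wy ha hb; have [hb1|hb1] := ltnP 1 b; first exact: h2.
have -> : b = 1 by lia.
by rewrite -p0E; [exact: h0|case: h1 => g _ _; exact: g].
Qed.

Lemma SymE_chiv m t W s : open W -> SymE_par xi x c m t W s -> chiv m m t W s.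
Proof.
elim: m t W s => [|m IH] t W s oW; first exact: O_par_chiv.
rewrite -(add1n m) => h; apply: (chiv_mul (P := E_par xi x c) (Q := SymE_par xi x c m)) => //.
by move=> u N p oN; exact: E_par_chiv.
Qed.

Lemma L_pow_chiv m t W s : open W -> L_par_pow xi x c m t W s -> chiv m 0 t W s.
Proof.
elim: m t W s => [|m IH] t W s oW; first exact: O_par_chiv.
move=> h; change (chiv (1 + m) (0 + 0) t W s); apply: (chiv_mul (P := L_par xi x c) (Q := L_par_pow xi x c m)) => //.
by move=> u N p oN; exact: L_par_chiv.
Qed.

Lemma F_par_chiv r j t W s : (0 < j <= r)%N -> open W -> F_par xi x c r j t W s -> chiv r.-1 j.-1 t W s.
Proof.
move=> hj oW h; have -> : r.-1 = (j.-1 + (r - j))%N by lia.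
rewrite -[X in chiv _ X](addn0 j.-1).
apply: (chiv_mul (P := SymE_par xi x c j.-1) (Q := L_par_pow xi x c (r - j))) => //.
  by move=> u N p oN; exact: SymE_chiv.
by move=> u N p oN; exact: L_pow_chiv.
Qed.

(** The same conditions tested in a single frame at each [x_i]. This is what constructions provide;
    the passage to all frames goes through the sheaf: [chiw] implies membership, which implies
    [chiv]. *)
Definition chiw m d t W s := [/\ is_sec xi m (W `\` S) s,
  forall a y b, (W `\` S) y -> bdom a y -> (d < b)%N -> (dh (s a y))`_b = 0 &
  forall i, W (x i) -> exists a, bdom a (x i) /\ forall b, (b <= d)%N -> ordge (x i) (NN i m b t) (fun y => (dh (s a y))`_b)].

Lemma small_nbhd W y a : open W -> W y -> bdom a y ->
  exists N, [/\ open N, N y, N `<=` W, N `<=` bdom a & forall y', N y' -> S y' -> y' = y].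
Proof.
move=> oW Wy ha.
have h : \forall y' \near y, [/\ W y', bdom a y' & y' <> y -> ~ S y'].
  apply: filterS3 (near_open oW Wy) (near_bdom ha) (pnear_notS y) => y' h1 h2 h3.
  by split.
move: h; rewrite -nbhs_nearE nbhsE => -[N [oN Ny] hN]; exists N; split => // y' /hN[h1 h2 h3] //.
by move=> hS; apply: contrapT => ne; exact: (h3 ne hS).
Qed.

Lemma hol1_exprz_ge0 k p u y : cdom k y -> 0 <= u -> hol1 (fun y => ccrd k p y ^ u) y.
Proof. by move=> hk; case: u => // q _; apply: hol1X; exact: hol1_ccrd. Qed.

Lemma p0_sec_of a0 P a y : bdom a0 y -> bdom a y -> (P y)`_1 = 0 -> (size (P y) <= 2)%N -> p0 (sec_of 1 a0 P a y) = 0.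
Proof.
move=> h0 ha e sP; rewrite p0E; last by apply: glue_homog; exact: hm_homog.
rewrite (dh_glue xi a a0 y (hm_homog 1 _)) dh_hm // !big_ord_recl big_ord0 /= e mul0r polyC0 mul0r !addr0.
by rewrite expr0 mulr1 coefC.
Qed.

Lemma sec_of0 m a0 P a y : P y = 0 -> sec_of m a0 P a y = 0.
Proof.
move=> e; rewrite /sec_of e; have -> : hm m (0 : {poly C}) = 0.
  by rewrite /hm big1 // => i _; rewrite coef0 scale0r.
exact: glue0.
Qed.

Lemma coef2 (u v : C) b : (u%:P + v%:P * 'X)`_b = if b == 0%N then u else if b == 1%N then v else 0.
Proof. by rewrite coefD coefC coefMX coefC; case: b => [|[|b]] //=; rewrite ?addr0 ?add0r. Qed.

Lemma size2 (u v : C) : (size (u%:P + v%:P * 'X)%R <= 2)%N.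
Proof. by apply/leq_sizeP => b hb; rewrite coef2; case: b hb => [|[|]]. Qed.

Lemma exprz_pred (z : C) (u : int) : z != 0 -> z * z ^ (u - 1) = z ^ u.
Proof. by move=> z0; rewrite -{1}[z]expr1z -expfzDr // addrC subrK. Qed.

Definition pick2 (T : Type) (u v : T) (i : 'I_2) := if i == 0 then u else v.

Lemma sum_pick2 (s1 s2 s3 s4 : sec L) a y :
  \sum_(j < 2) pick2 s1 s2 j a y * pick2 s3 s4 j a y = s1 a y * s3 a y + s2 a y * s4 a y.
Proof. by rewrite big_ord_recl big_ord1. Qed.

Lemma scalesec_sec_of m a0 P (f : X -> C) a y :
  scalesec f (sec_of m a0 P) a y = sec_of m a0 (fun y => (f y)%:P * P y) a y.
Proof. exact: sec_of_scale. Qed.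

Lemma local_form W s i a t (m : nat) (A : nat -> int) : open W -> W (x i) -> bdom a (x i) -> is_sec xi m (W `\` S) s ->
  (forall b, (b <= m)%N -> ordge (x i) (A b + Num.floor t) (fun y => (dh (s a y))`_b)) ->
  exists k N (h : nat -> X -> C), [/\ coord_nbhd k (x i) N, N `<=` W /\ N `<=` bdom a, forall y, N y -> S y -> y = x i,
    forall b y, (b <= m)%N -> N y -> hol1 (h b) y &
    forall b y, (b <= m)%N -> (N `\` S) y -> (dh (s a y))`_b = ccrd k (x i) y ^ Num.floor t * (ccrd k (x i) y ^ A b * h b y)].
Proof.
move=> oW Wi ha hs hord; have [k hk] := cdom_cover (x i).
have Hh b : exists h : X -> C, (b <= m)%N -> (\forall y \near x i, hol1 h y) /\
    pnear (x i) (fun y => (dh (s a y))`_b = ccrd k (x i) y ^ (A b + Num.floor t) * h y).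
  have [hb|hb] := leqP b m; last by exists (fun _ => 0).
  by have [h hh] := ordgeP hk (hord b hb); exists h.
have [h hh] := choice Hh.
have [N0 [oN0 N0x N0W N0a N0S]] := small_nbhd oW Wi ha.
have nb : \forall y \near x i, [/\ N0 y, cdom k y, (forall b : 'I_m.+1, hol1 (h b) y) &
    y <> x i -> forall b : 'I_m.+1, (dh (s a y))`_b = ccrd k (x i) y ^ (A b + Num.floor t) * h b y].
  have n1 : \forall y \near x i, forall b : 'I_m.+1, hol1 (h b) y.
    by apply: filter_forall => b; case: (hh b (ltn_ord b : (b <= m)%N)).
  have n2 : pnear (x i) (fun y => forall b : 'I_m.+1, (dh (s a y))`_b = ccrd k (x i) y ^ (A b + Num.floor t) * h b y).
    have : \forall y \near x i, forall b : 'I_m.+1, y <> x i -> (dh (s a y))`_b = ccrd k (x i) y ^ (A b + Num.floor t) * h b y.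
      by apply: filter_forall => b; case: (hh b (ltn_ord b : (b <= m)%N)).
    by apply: filterS => y hy ne b; exact: hy.
  apply: filterS3 (filterI (near_open oN0 N0x) (near_cdom hk)) n1 n2 => y [h1 h2] h3 h4; by split.
move: nb; rewrite -nbhs_nearE nbhsE => -[N [oN Nx] hN]; exists k, N, h; split.
- by split => // y /hN[].
- by split=> y /hN[h1 _ _ _]; [exact: N0W|exact: N0a].
- by move=> y /hN[h1 _ _ _]; exact: N0S.
- move=> b y hb /hN[_ _ h3 _]; exact: (h3 (Ordinal (hb : (b < m.+1)%N))).
- move=> b y hb [/hN[_ hky _ h4] nS].
  have ny : y <> x i by move=> e; apply: nS; exists i.
  rewrite (h4 ny (Ordinal (hb : (b < m.+1)%N))) /= addrC expfzDr ?mulrA //.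
  exact: ccrd_neq0.
Qed.

(** After removal of the power [floor t] of the coordinate, the section with coefficients
    [z^(A b) h b] is the required section of [E]; the filtration conditions are read off from the
    signs of [A 0], [A 1] and [A 1 - 1]. *)
Lemma chiw_E t W s : open W -> chiw 1 1 t W s -> E_par xi x c t W s.
Proof.
move=> oW [hs hv hi]; split => // i Wi; have [a [ha hord]] := hi i Wi.
have [w0 [w01 w1]] := weight_bounds i; have := frac_itv t; set tau := t - _ => /andP[t0 t1].
pose A b : int := Num.ceil (tau - wt i 1 b) + b%:Z.
have hA b : (b <= 1)%N -> ordge (x i) (A b + Num.floor t) (fun y => (dh (s a y))`_b).
  by move=> hb; have := hord b hb; rewrite /NN ceil_frac -/tau addrAC.
have [k [N [h [[oN Nx Nk] [NW Na] NS hh es]]]] := local_form oW Wi ha hs hA.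
have kx := Nk _ Nx.
pose P (B0 B1 : int) y : {poly C} := (ccrd k (x i) y ^ B0 * h 0%N y)%:P + (ccrd k (x i) y ^ B1 * h 1%N y)%:P * 'X.
have hP B0 B1 : 0 <= B0 -> 0 <= B1 -> is_sec xi 1 N (sec_of 1 a (P B0 B1)).
  move=> p0 p1; apply: sec_of_is_sec => // b y Ny.
  have h0 : hol1 (fun y => ccrd k (x i) y ^ B0 * h 0%N y) y.
    by apply: hol1M; [apply: hol1_exprz_ge0 => //; exact: Nk|exact: hh].
  have h1 : hol1 (fun y => ccrd k (x i) y ^ B1 * h 1%N y) y.
    by apply: hol1M; [apply: hol1_exprz_ge0 => //; exact: Nk|exact: hh].
  case: b => [|[|b]].
  - by apply: hol1_near h0; apply: filterE => y'; rewrite coef2.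
  - by apply: hol1_near h1; apply: filterE => y'; rewrite coef2.
  - by apply: hol1_near (hol1_cst 0 y); apply: filterE => y'; rewrite coef2.
have z0 (B : int) (z : C) : 0 < B -> ccrd k (x i) (x i) ^ B * z = 0.
  by move=> B0; rewrite ccrd0 exp0rz gt_eqF // mul0r.
have hE B0 B1 : 0 <= B0 -> 0 < B1 -> Eshf xi x N (sec_of 1 a (P B0 B1)).
  move=> p0 p1; split; first by apply: hP => //; exact: ltW.
  move=> a' y Ny ha' Sy; have ey := NS y Ny Sy; apply: p0_sec_of => //; [exact: Na| |exact: size2].
  by rewrite coef2 /= ey z0.
have A0 : 0 <= A 0%N by rewrite /A addr0 ceil_ge0 wt10; lra.
have A1 : 0 < A 1%N.
  rewrite /A wt11; have : 0 <= Num.ceil (tau - weight_line c i) by rewrite ceil_ge0; lra.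
  lia.
exists k, N, (sec_of 1 a (P (A 0%N) (A 1%N))); split; [by split|exact: NW|exact: hE| |].
- rewrite -/tau; case: ifPn => // c1; rewrite -ltNge in c1; have A0' : 0 < A 0%N by rewrite /A addr0 ceil_gt0 wt10; lra.
  case: ifPn => c2.
    (* Both exponents are positive, so the section vanishes at [x_i] as a section of the unmodified
       extension: it serves itself as the witness for the line. *)
    exists N, (sec_of 1 a (P (A 0%N) (A 1%N))); split; [exact: oN|exact: Nx|exact: hP _ _ A0 (ltW A1)| |].
      move=> a' y Ny ha' Sy; apply: sec_of0; rewrite (NS y Ny Sy) /P !z0 // polyC0 mul0r addr0; by [].
    exists k, N, (@zerosec R X L); split; [by split| |].
      by split; [exact: is_sec0|move=> a' y _ _ _; rewrite /p0 mcoeff0].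
    by move=> a' y _ _; rewrite /addsec /scalesec /zerosec scaler0 addr0.
  rewrite -ltNge in c2.
  have A1' : 0 < A 1%N - 1 by rewrite /A wt11 addrK ceil_gt0; lra.
  (* Lowering both exponents by one leaves a section of [E]; the original section is the coordinate
     times it, hence zero in the fibre. *)
  exists k, N, (sec_of 1 a (P (A 0%N - 1) (A 1%N - 1))); split; [by split| |].
    by apply: hE; [lia|exact: A1'].
  move=> a' y [Ny nS] ha'; rewrite /addsec /scalesec /zerosec add0r sec_of_scale; apply: sec_of_eq.
  have nz : ccrd k (x i) y != 0 by apply: ccrd_neq0 => //; [exact: Nk|move=> e; apply: nS; exists i].
  rewrite /P mulrDr mulrA -!polyCM !mulrA.
  by rewrite !exprz_pred.
- move=> a' y [Ny nS] ha'.
  have Wy : (W `\` S) y by split => //; exact: NW.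
  rewrite (sec_frame hs Wy ha' (Na _ Ny)) scalesec_sec_of; apply: sec_of_eq.
  apply/polyP => b; rewrite /P mulrDr mulrA -!polyCM coef2.
  case: b => [|[|b]] /=; [exact: es|exact: es|].
  by apply: coef_dh_big (_ : s a y \is ishomog1 1 mdeg) _ => //; case: hs => g _ _; apply: g => //; exact: Na.
Qed.

Lemma chiw_O t W s : open W -> chiw 0 0 t W s -> O_par xi x t W s.
Proof.
move=> oW [hs hv hi]; split => // i Wi; have [a [ha hord]] := hi i Wi.
have := frac_itv t; set tau := t - _ => /andP[t0 t1].
have w00 : wt i 0 0 = 0 by rewrite /wt mul0r addr0 mul0r.
pose A b : int := Num.ceil tau.
have hA b : (b <= 0)%N -> ordge (x i) (A b + Num.floor t) (fun y => (dh (s a y))`_b).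
  rewrite leqn0 => /eqP ->; have := hord 0%N (leqnn _); rewrite /NN ceil_frac -/tau w00 !subr0; exact.
have [k [N [h [[oN Nx Nk] [NW Na] NS hh es]]]] := local_form oW Wi ha hs hA.
pose P (B0 : int) y : {poly C} := (ccrd k (x i) y ^ B0 * h 0%N y)%:P.
have hP B0 : 0 <= B0 -> is_sec xi 0 N (sec_of 0 a (P B0)).
  move=> p0; apply: sec_of_is_sec => // b y Ny.
  have h0 : hol1 (fun y => ccrd k (x i) y ^ B0 * h 0%N y) y.
    by apply: hol1M; [apply: hol1_exprz_ge0 => //; exact: Nk|exact: hh].
  case: b => [|b].
  - by apply: hol1_near h0; apply: filterE => y'; rewrite coefC.
  - by apply: hol1_near (hol1_cst 0 y); apply: filterE => y'; rewrite coefC.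
have A0 : 0 <= A 0%N by rewrite /A ceil_ge0; lra.
exists k, N, (sec_of 0 a (P (A 0%N))); split; [by split|exact: NW|exact: hP| |].
- rewrite -/tau; case: ifPn => // c1; rewrite -ltNge in c1; have A0' : 0 < A 0%N by rewrite /A ceil_gt0.
  exists k, N, (sec_of 0 a (P (A 0%N - 1))); split; [by split| |].
    by apply: hP; lia.
  move=> a' y [Ny nS] ha'; rewrite /addsec /scalesec /zerosec add0r sec_of_scale; apply: sec_of_eq.
  have nz : ccrd k (x i) y != 0 by apply: ccrd_neq0 => //; [exact: Nk|exact: Nk|move=> e; apply: nS; exists i].
  rewrite /P -!polyCM !mulrA.
  by rewrite exprz_pred.
- move=> a' y [Ny nS] ha'.
  have Wy : (W `\` S) y by split => //; exact: NW.
  rewrite (sec_frame hs Wy ha' (Na _ Ny)) scalesec_sec_of; apply: sec_of_eq.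
  apply/polyP => b; rewrite /P -!polyCM coefC.
  case: b => [|b] /=; [exact: es|].
  by apply: coef_dh_big (_ : s a y \is ishomog1 0 mdeg) _ => //; case: hs => g _ _; apply: g => //; exact: Na.
Qed.

Lemma coef_sec_of m a0 P y b : bdom a0 y -> (size (P y) <= m.+1)%N -> (dh (sec_of m a0 P a0 y))`_b = (P y)`_b.
Proof. by move=> h0 sP; rewrite sec_ofE // dh_hm. Qed.

Lemma sec_of_coef_sub m a0 P d a y b : bdom a0 y -> bdom a y -> (size (P y) <= d.+1)%N -> (d <= m)%N -> (d < b)%N ->
  (dh (sec_of m a0 P a y))`_b = 0.
Proof.
move=> h0 ha sP dm hb; rewrite (dh_glue xi a a0 y (hm_homog m _)) dh_hm; last exact: leq_trans sP _.
rewrite coef_sum big1 // => i _; rewrite coefCM; have [hi|hi] := ltnP d i.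
  by rewrite (nth_default 0 (leq_trans sP hi)) !mul0r.
rewrite [X in _ * X]nth_default ?mulr0 //; apply: leq_trans (size_poly_exp_leq _ _) _.
rewrite size_XaddC /= mul1n; lia.
Qed.

Lemma chiw_sec_of m d t N a0 P y0 : open N -> N `<=` bdom a0 -> (forall y, N y -> S y -> y = y0) -> (d <= m)%N ->
  (forall b y, (N `\` S) y -> hol1 (fun y => (P y)`_b) y) ->
  (forall y, (size (P y) <= d.+1)%N) ->
  (forall i, y0 = x i -> N (x i) -> forall b, (b <= d)%N -> ordge (x i) (NN i m b t) (fun y => (P y)`_b)) ->
  chiw m d t N (sec_of m a0 P).
Proof.
move=> oN Na NS dm hP sP ho; split.
- by apply: sec_of_is_sec => //; [exact: openD_S|move=> y [/Na]].
- move=> a y b [Ny _] ha hb; apply: sec_of_coef_sub dm hb => //; exact: Na.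
- move=> i Ni; exists a0; split; first exact: Na.
  move=> b hb; have e : x i = y0 by apply: NS => //; exists i.
  apply: ordge_near (ho i (esym e) Ni b hb).
  apply: pnearW; apply: filterS (near_open oN Ni) => y Ny; rewrite coef_sec_of //; first exact: Na.
  by apply: leq_trans (sP y) _.
Qed.

Lemma chiw_frame m d t W s y : chiw m d t W s -> W y -> exists a, bdom a y /\
  forall i, y = x i -> forall b, (b <= d)%N -> ordge (x i) (NN i m b t) (fun y => (dh (s a y))`_b).
Proof.
move=> [_ _ hi] Wy; have [[i e]|h] := pselect (exists i, y = x i).
  have Wi : W (x i) by rewrite -e.
  have [a [ha ho]] := hi i Wi; exists a; split; first by rewrite e.
  move=> i' e' b hb; have ei : i = i' by apply: x_inj; rewrite -e -e'.
  by rewrite -ei; exact: ho.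
by have [a ha] := bdom_cover L y; exists a; split => // i e; case: h; exists i.
Qed.

(** A single number serves all points: the value attached to [y] if [y] is one of the [x_i], and 0
    otherwise. Only injectivity of [x] is at stake. *)
Lemma pick_weight (f : 'I_n -> R) y : exists u, forall i, y = x i -> u = f i.
Proof.
have [[i e]|h] := pselect (exists i, y = x i); last by exists 0 => i e; case: h; exists i.
by exists (f i) => i' e'; congr f; apply: x_inj; rewrite -e -e'.
Qed.

Lemma chiw_mono N a0 y0 (u : R) : open N -> N `<=` bdom a0 -> (forall y, N y -> S y -> y = y0) ->
  (forall i, y0 = x i -> u = wt i 1 0) -> L_par xi x c u N (sec_of 1 a0 (fun _ => 1)).
Proof.
move=> oN Na NS hu.
have h : chiw 1 0 u N (sec_of 1 a0 (fun _ => 1)).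
  apply: (chiw_sec_of (y0 := y0) oN Na NS (leq0n _)); first by move=> b y _; exact: hol1_cst.
    by move=> y; rewrite size_poly1.
  move=> i e Ni b; rewrite leqn0 => /eqP ->; rewrite (hu i e) /NN subrr ceil0.
  exact: ordge_cst.
have h1 : chiw 1 1 u N (sec_of 1 a0 (fun _ => 1)).
  apply: (chiw_sec_of (y0 := y0) oN Na NS (leqnn _)); first by move=> b y _; exact: hol1_cst.
    by move=> y; rewrite size_poly1.
  move=> i e Ni [|[|b]] //= _; first by rewrite (hu i e) /NN subrr ceil0; exact: ordge_cst.
  by apply: ordge_zero; apply: pnearT => y; rewrite coef1.
split; first exact: chiw_E oN h1.
move=> a y Ny ha; rewrite p0E; last by apply: glue_homog; exact: hm_homog.
by case: h => _ h2 _; exact: h2.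
Qed.

(** The frame [f] is only a meromorphic section of [E]: at a parabolic point it is [1 / z] times the
    generator of the line, so its level is the weight of the line minus 1. *)
Lemma chiw_f N a0 y0 (u : R) : open N -> N `<=` bdom a0 -> (forall y, N y -> S y -> y = y0) ->
  (forall i, y0 = x i -> u = wt i 1 1 - 1) -> E_par xi x c u N (sec_of 1 a0 (fun _ => 'X)).
Proof.
move=> oN Na NS hu; apply: chiw_E; first exact: oN.
apply: (chiw_sec_of (y0 := y0) oN Na NS (leqnn _)); first by move=> b y _; exact: hol1_cst.
  by move=> y; rewrite size_polyX.
move=> i e Ni [|[|b]] //= _; first by apply: ordge_zero; apply: pnearT => y; rewrite coefX.
rewrite (hu i e) /NN; have -> : wt i 1 1 - 1 - wt i 1 1 = -1 by ring.
have -> : Num.ceil (- 1 : R) + 1%N = 0 by rewrite ceilN ?ceil1 //; rewrite int_num1.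
exact: ordge_cst.
Qed.

Lemma chiw_local m d t W s y a N : chiw m d t W s -> N `<=` W -> N `<=` bdom a ->
  forall b y', (N `\` S) y' -> open W -> hol1 (fun y => (dh (s a y))`_b) y'.
Proof.
move=> [hs _ _] NW Na b y' [Ny nS] oW; apply: hol1_coef_dh hs _ _ _; [exact: openD_S|split => //; exact: NW|exact: Na].
Qed.

(** A form of degree [m + 1] is [e] times its part of degree at most [m] in [f], plus [f] times its
    top term. Placing [e] and [f] exactly at their own weights makes the ceilings add up without
    loss. *)
Lemma chiw_SymE m t W s : open W -> chiw m m t W s -> SymE_par xi x c m t W s.
Proof.
elim: m t W s => [|m IH] t W s oW; first exact: chiw_O.
move=> hw y Wy; have [a [ha ho]] := chiw_frame hw Wy.
have [N [oN Ny NW Na NS]] := small_nbhd oW Wy ha.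
have [u1 hu1] := pick_weight (fun i => wt i 1 0) y.
have [u2 hu2] := pick_weight (fun i => wt i 1 1 - 1) y.
have [hs hv _] := hw.
have hol b y' : (N `\` S) y' -> hol1 (fun y => (dh (s a y))`_b) y' by move=> h; exact: chiw_local hw NW Na _ _ h oW.
(* [Q0] is the cofactor of [e], and [Q1], a single monomial, is the cofactor of [f]. *)
pose Q0 y' : {poly C} := take_poly m.+1 (dh (s a y')).
pose Q1 y' : {poly C} := ((dh (s a y'))`_m.+1)%:P * 'X^m.
have h0 : SymE_par xi x c m (t - u1) N (sec_of m a Q0).
  apply: IH; first exact: oN.
  apply: (chiw_sec_of (y0 := y) oN Na NS (leqnn _)).
  - move=> b y' hy; have [hb|hb] := ltnP b m.+1.
      by apply: hol1_near (hol b y' hy); apply: filterE => y''; rewrite coef_take_poly hb.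
    by apply: hol1_near (hol1_cst 0 y'); apply: filterE => y''; rewrite coef_take_poly ltnNge hb.
  - by move=> y'; exact: size_take_poly.
  - move=> i e Ni b hb; have := ho i e b (leqW hb).
    have -> : NN i m b (t - u1) = NN i m.+1 b t.
      by rewrite /NN (hu1 i e) -addrA -opprD wtD.
    by apply: ordge_near; apply: pnearT => y'; rewrite coef_take_poly ltnS hb.
have h1 : SymE_par xi x c m (t - u2) N (sec_of m a Q1).
  apply: IH; first exact: oN.
  apply: (chiw_sec_of (y0 := y) oN Na NS (leqnn _)).
  - move=> b y' hy; have := hol1M (hol m.+1 y' hy) (hol1_cst ((b == m)%:R) y').
    by apply: hol1_near; apply: filterE => y''; rewrite coefCM coefXn.
  - move=> y'; apply: leq_trans (size_polyMleq _ _) _; rewrite size_polyXn size_polyC.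
    by case: (_ != 0).
  - move=> i e Ni b hb; have [eb|nb] := eqVneq b m; last first.
      by apply: ordge_zero; apply: pnearT => y'; rewrite coefCM coefXn (negbTE nb) mulr0.
    have := ho i e m.+1 (leqnn _); rewrite eb.
    have -> : NN i m m (t - u2) = NN i m.+1 m.+1 t.
      rewrite /NN (hu2 i e) -[wt i m.+1 m.+1](wtD i 1 m 1 m).
      have -> : t - (wt i 1 1 - 1) - wt i m m = (t - (wt i 1 1 + wt i m m)) + 1 by ring.
      by rewrite ceilDrz ?int_num1 // ceil1 -addrA -PoszD add1n.
    by apply: ordge_near; apply: pnearT => y'; rewrite coefCM coefXn eqxx mulr1.
have e0 := (chiw_mono oN Na NS hu1).1; have e1 := chiw_f oN Na NS hu2.
exists N; split; [exact: oN|exact: Ny|exact: NW|]; exists 2%N, (pick2 u1 u2), (pick2 (t - u1) (t - u2)),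
  (pick2 (sec_of 1 a (fun _ => 1)) (sec_of 1 a (fun _ => 'X))), (pick2 (sec_of m a Q0) (sec_of m a Q1)); split.
  by move=> j; rewrite /pick2; case: (j == 0); split; rewrite ?(addrC u1) ?(addrC u2) ?subrK; [|exact: e0|exact: h0| |exact: e1|exact: h1].
move=> a' y' [Ny' nS] ha'; rewrite sum_pick2.
have Wy' : (W `\` S) y' by split => //; exact: NW.
have sQ1 : (size (Q1 y') <= m.+1)%N.
  by apply: leq_trans (size_polyMleq _ _) _; rewrite size_polyXn size_polyC; case: (_ != 0).
have sQ0 : (size (Q0 y') <= m.+1)%N by apply: size_take_poly.
rewrite (sec_frame hs Wy' ha' (Na _ Ny')).
have s1 : (size (1 : {poly C})%R <= 2)%N by rewrite size_poly1.
have s2 : (size ('X : {poly C})%R <= 2)%N by rewrite size_polyX.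
have E0 := sec_of_mul a a' (P := fun=> 1) (P' := Q0) (m := 1) s1 sQ0.
have E1 := sec_of_mul a a' (P := fun=> 'X) (P' := Q1) (m := 1) s2 sQ1.
refine (etrans _ (esym (f_equal2 (fun p q => p + q) E0 E1))).
rewrite sec_of_add; apply: sec_of_eq; apply/polyP => b; rewrite mul1r coefD coef_take_poly /Q1.
rewrite mulrCA -exprS coefCM coefXn; case: ltnP => hb.
  by rewrite (_ : (b == m.+1) = false) ?mulr0 ?addr0 //; apply/negbTE; rewrite neq_ltn hb.
rewrite add0r; case: eqVneq => [->|nb]; first by rewrite mulr1.
have [h1' _ _] := hs.
rewrite mulr0; apply: coef_dh_big (h1' a y' Wy' (Na _ Ny')) _; lia.
Qed.

Lemma chiw_L m t W s : open W -> chiw m 0 t W s -> L_par_pow xi x c m t W s.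
Proof.
elim: m t W s => [|m IH] t W s oW; first exact: chiw_O.
move=> hw y Wy; have [a [ha ho]] := chiw_frame hw Wy.
have [N [oN Ny NW Na NS]] := small_nbhd oW Wy ha.
have [u1 hu1] := pick_weight (fun i => wt i 1 0) y.
have [hs hv _] := hw.
have hol b y' : (N `\` S) y' -> hol1 (fun y => (dh (s a y))`_b) y' by move=> h; exact: chiw_local hw NW Na _ _ h oW.
pose Q0 y' : {poly C} := ((dh (s a y'))`_0)%:P.
have h0 : L_par_pow xi x c m (t - u1) N (sec_of m a Q0).
  apply: IH; first exact: oN.
  apply: (chiw_sec_of (y0 := y) oN Na NS (leq0n _)).
  - move=> b y' hy; have := hol1M (hol 0%N y' hy) (hol1_cst ((b == 0%N)%:R) y').
    by apply: hol1_near; apply: filterE => y''; rewrite coefC; case: eqP; rewrite ?mulr1 ?mulr0.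
  - by move=> y'; rewrite size_polyC; case: (_ != 0).
  - move=> i e Ni b hb; have := ho i e b hb.
    have -> : NN i m b (t - u1) = NN i m.+1 b t.
      by rewrite /NN (hu1 i e) -addrA -opprD wtD.
    by move: hb; rewrite leqn0 => /eqP ->; apply: ordge_near; apply: pnearT => y'; rewrite coefC.
have e0 := chiw_mono oN Na NS hu1.
exists N; split; [exact: oN|exact: Ny|exact: NW|]; exists 1%N, (fun _ => u1), (fun _ => t - u1), (fun _ => sec_of 1 a (fun _ => 1)), (fun _ => sec_of m a Q0); split.
  by move=> j; split; [rewrite addrC subrK|exact: e0|exact: h0].
move=> a' y' [Ny' nS] ha'; rewrite big_ord1.
have Wy' : (W `\` S) y' by split => //; exact: NW.
rewrite (sec_frame hs Wy' ha' (Na _ Ny')) sec_of_mul; [|by rewrite size_poly1|by rewrite size_polyC; case: (_ != 0)].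
apply: sec_of_eq; rewrite mul1r; apply/polyP => b; rewrite coefC; case: eqP => [->//|/eqP hb].
by apply: hv => //; [exact: Na|rewrite lt0n].
Qed.

(** Degree less than [j] in [f] means divisibility by [e^(r-j)]; this power is placed at its own
    weight and the cofactor is treated by [chiw_SymE]. *)
Lemma chiw_F r j t W s : (0 < j <= r)%N -> open W -> chiw r.-1 j.-1 t W s -> F_par xi x c r j t W s.
Proof.
move=> hj oW hw y Wy; have [a [ha ho]] := chiw_frame hw Wy.
have [N [oN Ny NW Na NS]] := small_nbhd oW Wy ha.
have [u1 hu1] := pick_weight (fun i => wt i (r - j) 0) y.
have [hs hv _] := hw.
have hol b y' : (N `\` S) y' -> hol1 (fun y => (dh (s a y))`_b) y' by move=> h; exact: chiw_local hw NW Na _ _ h oW.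
have er : r.-1 = (j.-1 + (r - j))%N by lia.
pose Q0 y' : {poly C} := take_poly j (dh (s a y')).
have sQ y' : (size (Q0 y') <= j.-1.+1)%N by rewrite prednK; [exact: size_take_poly|lia].
have h0 : SymE_par xi x c j.-1 (t - u1) N (sec_of j.-1 a Q0).
  apply: chiw_SymE; first exact: oN.
  apply: (chiw_sec_of (y0 := y) oN Na NS (leqnn _)).
  - move=> b y' hy; have [hb|hb] := ltnP b j.
      by apply: hol1_near (hol b y' hy); apply: filterE => y''; rewrite coef_take_poly hb.
    by apply: hol1_near (hol1_cst 0 y'); apply: filterE => y''; rewrite coef_take_poly ltnNge hb.
  - exact: sQ.
  - move=> i e Ni b hb; have := ho i e b hb.
    have -> : NN i j.-1 b (t - u1) = NN i r.-1 b t.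
      by rewrite /NN (hu1 i e) -addrA -opprD wtD add0n addnC -er.
    by apply: ordge_near; apply: pnearT => y'; rewrite coef_take_poly (_ : (b < j)%N) //; lia.
have e0 : L_par_pow xi x c (r - j) u1 N (sec_of (r - j) a (fun _ => 1)).
  apply: chiw_L; first exact: oN.
  apply: (chiw_sec_of (y0 := y) oN Na NS (leq0n _)); first by move=> b y' _; exact: hol1_cst.
    by move=> y'; rewrite size_poly1.
  move=> i e Ni b; rewrite leqn0 => /eqP ->; rewrite (hu1 i e) /NN subrr ceil0.
  exact: ordge_cst.
exists N; split; [exact: oN|exact: Ny|exact: NW|]; exists 1%N, (fun _ => t - u1), (fun _ => u1), (fun _ => sec_of j.-1 a Q0), (fun _ => sec_of (r - j) a (fun _ => 1)); split.
  by move=> _; split; [rewrite subrK|exact: h0|exact: e0].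
move=> a' y' [Ny' nS] ha'; rewrite big_ord1.
have Wy' : (W `\` S) y' by split => //; exact: NW.
rewrite (sec_frame hs Wy' ha' (Na _ Ny')) sec_of_mul; [|exact: sQ|by rewrite size_poly1].
rewrite {1}er; apply: sec_of_eq; rewrite mulr1; apply/polyP => b; rewrite coef_take_poly; case: ltnP => // hb.
by apply: hv => //; [exact: Na|lia].
Qed.

(** * The connection matrix and the residue condition *)

Context (m : nat) (D : set X -> sec L -> cidx X -> sec L).
Local Notation G := (SymE_par xi x c m).
Context (D_par : is_par_connection x G D).

Lemma chiv_chiw d q t W s : chiv q d t W s -> chiw q d t W s.
Proof.
move=> [h1 h2 h3]; split; [exact: h1|exact: h2|].
move=> i Wi; have [a ha] := bdom_cover L (x i); exists a; split; first exact: ha.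
by move=> b _; exact: h3.
Qed.

Lemma symP t W s : open W -> G t W s <-> chiv m m t W s.
Proof.
move=> oW; split; first exact: SymE_chiv.
by move=> h; apply: chiw_SymE => //; exact: chiv_chiw.
Qed.

Lemma sym_free t W s : open W -> (forall y, W y -> ~ S y) -> is_sec xi m W s -> G t W s.
Proof.
move=> oW WS hs; apply/symP => //; have sW : W `\` S `<=` W by move=> y [].
split; first exact: is_sec_sub sW hs.
- by move=> a y b [Wy _] ha; apply: coef_dh_big; case: hs => h1 _ _; exact: h1.
- by move=> i /WS; case; exists i.
Qed.

Definition Vb a b : sec L := sec_of m a (fun _ => 'X^b).

Lemma Vb_sec a b W : open W -> W `<=` bdom a -> is_sec xi m W (Vb a b).
Proof. by move=> oW Wa; apply: sec_of_is_sec => // q y _; exact: hol1_cst. Qed.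

(** The matrix of [D] in the frame [e^(m-b) f^b]: row [b'], column [b], coefficient of [dz_k]. It is
    computed off [S], because at the points of [S] the frame sections need not belong to the level 0
    sheaf. *)
Definition AA a (b' b : nat) k y : C := (dh (D (bdom a `\` S) (Vb a b) k a y))`_b'.

Lemma open_U a : open (bdom a `\` S). Proof. by apply: openD_S; exact: bdom_open. Qed.

Lemma hm_Xn b : (b <= m)%N -> hm m ('X^b : {poly C}) = mpolyX C (bmon m b).
Proof.
move=> hb; apply: (@dh_inj _ m); [exact: hm_homog|exact: (bmon_homog (Ordinal (hb : (b < m.+1)%N)))|].
by rewrite dh_hm ?size_polyXn // dhX bmon1.
Qed.

Lemma sec_of_sum a P a' y : sec_of m a P a' y = \sum_(b < m.+1) (P y)`_b *: Vb a b a' y.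
Proof.
rewrite /sec_of {1}/hm glue_sum; apply: eq_bigr => b _.
by rewrite glueZ /Vb /sec_of hm_Xn // -ltnS.
Qed.

Definition comb a (f : nat -> X -> C) (q : nat) : sec L := fun a' y => \sum_(b < q) f b y *: Vb a b a' y.

(** Additivity, Leibniz rule and locality of [D] hold only up to irrelevant values off [S], so the
    combination is built one term at a time, with membership in the sheaf carried along. *)
Lemma D_comb a W (f : nat -> X -> C) q : open W -> W `<=` bdom a `\` S -> (q <= m.+1)%N ->
  (forall b, hol W (f b)) ->
  G 0 W (comb a f q) /\ forall k a' y, W y -> cdom k y -> bdom a' y -> D W (comb a f q) k a' y =
    \sum_(b < q) (f b y *: D W (Vb a b) k a' y + dfun k (f b) y *: Vb a b a' y).
Proof.
move=> oW WU + hf; have [[_ Dloc Dadd Dleib] _] := D_par.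
have Wa : W `<=` bdom a by move=> y /WU[].
have WS y : W y -> ~ S y by move=> /WU[].
have hV b : is_sec xi m W (Vb a b) by exact: Vb_sec.
have hS b : is_sec xi m W (scalesec (f b) (Vb a b)) by exact: is_sec_scale.
elim: q => [_|q IH hq].
  have hT : is_sec xi m W (comb a f 0).
    by apply: is_sec_eq (is_sec0 m W) => // a' y _ _; rewrite /comb big_ord0.
  have GT := sym_free 0 oW WS hT; split=> [|k a' y Wy ky ha']; first exact: GT.
  have h0 : hol W (fun _ : X => 0 : C) by apply/holP => y' _; exact: hol1_cst.
  have G0 := sym_free 0 oW WS (hV 0%N).
  have e0 : seq_on (W `\` S) (comb a f 0) (scalesec (fun _ : X => 0) (Vb a 0)).
    by move=> a1 y1 _ _; rewrite /comb big_ord0 /scalesec scale0r.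
  have Gs := sym_free 0 oW WS (is_sec_scale h0 (hV 0%N)).
  have nS := WS y Wy.
  have -> := Dloc W W _ _ oW oW (fun _ h => h) GT Gs e0 k a' y (conj (conj Wy ky) nS) ha'.
  have -> := Dleib W _ _ oW h0 G0 k a' y (conj (conj Wy ky) nS) ha'.
  by rewrite big_ord0 /addsec /scalesec dfun_cst !scale0r addr0.
have [GT hT] := IH (ltnW hq).
have Gs := sym_free 0 oW WS (hS q).
have GV := sym_free 0 oW WS (hV q).
have eT : seq_on (W `\` S) (comb a f q.+1) (addsec (comb a f q) (scalesec (f q) (Vb a q))).
  by move=> a1 y1 _ _; rewrite /comb big_ord_recr.
have sT0 : is_sec xi m W (comb a f q).
  have [h _ _] := (symP 0 (comb a f q) oW).1 GT; apply: is_sec_sub h => y Wy; split; [exact: Wy|exact: WS].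
have sA := is_sec_add sT0 (hS q); have GA := sym_free 0 oW WS sA.
have GT' : G 0 W (comb a f q.+1).
  apply: (sym_free 0 oW WS); apply: is_sec_eq oW _ sA => a1 y1 Wy1 ha1; apply: eT ha1; split; [exact: Wy1|exact: WS].
split=> [|k a' y Wy ky ha']; first exact: GT'.
have hy : (W `&` cdom k `\` S) y by split; [split|exact: WS].
have -> := Dloc W W _ _ oW oW (fun _ h => h) GT' GA eT k a' y hy ha'.
have -> := Dadd W _ _ oW GT Gs k a' y hy ha'.
rewrite /addsec (hT k a' y Wy ky ha') big_ord_recr /=; congr (_ + _).
exact: Dleib W _ _ oW (hf q) GV k a' y hy ha'.
Qed.

Lemma D_expand W s a b' k y : open W -> G 0 W s -> (W `\` S) y -> bdom a y -> cdom k y -> (b' <= m)%N ->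
  (dh (D W s k a y))`_b' = dfun k (fun y => (dh (s a y))`_b') y + \sum_(b < m.+1) (dh (s a y))`_b * AA a b' b k y.
Proof.
move=> oW Gs [Wy nS] ha hk hb; have [hs _ _] := (symP 0 s oW).1 Gs.
have [[_ Dloc _ _] _] := D_par.
pose W' := (W `&` bdom a) `\` S.
have oW' : open W' by apply: openD_S; apply: openI => //; exact: bdom_open.
have W'U : W' `<=` bdom a `\` S by move=> y' [[]].
have W'W : W' `<=` W by move=> y' [[]].
have W'S y' : W' y' -> ~ S y' by case.
have hf b : hol W' (fun y => (dh (s a y))`_b).
  apply/holP => y' [[W1 a1] n1]; exact: hol1_coef_dh hs (openD_S oW) (conj W1 n1) a1.
have [GT hT] := D_comb oW' W'U (leqnn _) hf.
pose f b y := (dh (s a y))`_b.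
have eT : seq_on (W' `\` S) s (comb a f m.+1).
  move=> a' y' [[[W1 a1] n1] _] ha'.
  by rewrite (sec_frame hs (conj W1 n1) ha' a1) sec_of_sum.
have hy : (W' `&` cdom k `\` S) y by [].
have -> := Dloc W W' s _ oW oW' W'W Gs GT eT k a y hy ha; rewrite (hT k a y hy.1.1 hk ha).
rewrite dh_sum coef_sum.
have E (b : 'I_m.+1) : (dh ((dh (s a y))`_b *: D W' (Vb a b) k a y + dfun k (fun y => (dh (s a y))`_b) y *: Vb a b a y))`_b' =
   (dh (s a y))`_b * AA a b' b k y + (if b == b' :> nat then dfun k (fun y => (dh (s a y))`_b) y else 0).
  rewrite dhD coefD !dhZ !coefCM; congr (_ * _ + _).
    rewrite /AA.
    have GU := sym_free 0 (open_U a) (fun y h => h.2) (Vb_sec b (open_U a) (fun y h => h.1)).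
    have G' := sym_free 0 oW' W'S (Vb_sec b oW' (fun y h => h.1.2)).
    by rewrite (Dloc _ W' (Vb a b) (Vb a b) (open_U a) oW' W'U GU G' (fun _ _ _ _ => erefl) k a y hy ha).
  rewrite /Vb coef_sec_of //; last by rewrite size_polyXn.
  by rewrite coefXn eq_sym; case: eqP => _; rewrite ?mulr1 ?mulr0.
rewrite (eq_bigr _ (fun (b : 'I_m.+1) _ => E b)) big_split /= addrC; congr (_ + _).
rewrite (bigD1 (Ordinal (hb : (b' < m.+1)%N))) //= eqxx big1 ?addr0 // => b nb.
by case: eqP => // e; move/eqP: nb; case; apply/val_inj.
Qed.

Lemma D_sec W s k y : open W -> G 0 W s -> (W `\` S) y -> cdom k y ->
  exists N, [/\ coord_nbhd k y N, N `<=` W & is_sec xi m (N `\` S) (D W s k)].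
Proof.
move=> oW Gs [Wy nS] ky; have [[Dform _ _ _] _] := D_par.
have [_ h2] := Dform W s oW Gs; have [N [hN NW hG _]] := h2 k y Wy ky.
by exists N; split=> //; have [h _ _] := (symP 0 _ (let: And3 o _ _ := hN in o)).1 (hG nS).
Qed.

Lemma V_sym a b t : G t (bdom a `\` S) (Vb a b).
Proof. exact: (sym_free t (open_U a) (fun y h => h.2) (Vb_sec b (open_U a) (fun y h => h.1))). Qed.

Lemma AA_form a b' b : is_form (bdom a `\` S) (AA a b' b).
Proof.
have oU := open_U a; split=> [k|k l y Uy ky ly].
  apply/holP => y [Uy ky].
  have [N [[oN Ny Nk] NU hs]] := D_sec oU (V_sym a b 0) (conj Uy Uy.2) ky.
  exact: hol1_coef_dh hs (openD_S oN) (conj Ny Uy.2) Uy.1.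
have [[Dform _ _ _] _] := D_par; have [h1 _] := Dform _ _ oU (V_sym a b 0).
rewrite /AA (h1 k l a y (conj (conj (conj Uy ky) ly) Uy.2) Uy.1) /scalesec dhZ coefCM mulrC.
by [].
Qed.

Lemma AA_big a b' b k y : (m < b')%N -> (bdom a `\` S) y -> cdom k y -> AA a b' b k y = 0.
Proof.
move=> hb Uy ky; have [N [[oN Ny Nk] NU [h1 _ _]]] := D_sec (open_U a) (V_sym a b 0) (conj Uy Uy.2) ky.
by apply: coef_dh_big hb; apply: h1; [split => //; exact: Uy.2|exact: Uy.1].
Qed.

(** The ambiguity of the fibre is a coordinate times a section of level 0. Its orders are at least
    [1 + NN i m b 0], which is no less than [NN i m b t] as long as [t <= 1]. *)
Lemma in_fib_ord i t v a b : in_fib x G (x i) t v -> bdom a (x i) -> t <= 1 ->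
  ordge (x i) (NN i m b t) (fun y => (dh (v a y))`_b).
Proof.
move=> [N [u [oN Ni Gu [k [N' [w [[oN' Ni' Nk] Gw ew]]]]]]] ha t1.
have [_ _ hu] := (symP t u oN).1 Gu; have [_ _ hw] := (symP 0 w oN').1 Gw.
apply: (@ordge_near _ _ _ _ (fun y => (dh (u a y))`_b + ccrd k (x i) y * (dh (w a y))`_b)).
  apply: filterS (pnearI (near_W_S oN' Ni') (pnearW (near_bdom ha))) => y [Ny ay].
  by rewrite (ew a y Ny ay) coef_addsec coef_scalesec.
apply: ordgeD; first exact: hu.
have le : NN i m b t <= 1 + NN i m b 0.
  rewrite /NN addrA lerD2r sub0r.
  have -> : (1 : int) = Num.ceil (1 : R) by rewrite ceil1.
  by apply: le_trans (ceilD_ge _ _); apply: le_ceil; lra.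
apply: ordge_le le _; apply: ordgeM; last exact: hw.
by have := ordge_ccrd 1 (Nk _ Ni'); apply: ordge_near; apply: pnearT => y; rewrite expr1z.
Qed.

Lemma dfun_exprz k p u y : cdom k y -> ccrd k p y != 0 ->
  dfun k (fun y => ccrd k p y ^ u) y = u%:~R * ccrd k p y ^ u / ccrd k p y.
Proof.
move=> ky z0; have hc := hol1_ccrd p ky.
have d1 : dlog (ccrd k p) k y = (ccrd k p y)^-1.
  by rewrite /dlog dfun_ccrd // dcrd_id // div1r.
have E (f : C) : f != 0 -> forall g : X -> C, g y = f -> dfun k g y = dlog g k y * f.
  by move=> f0 g e; rewrite /dlog e divfK.
case: u => q.
  have q0 : ccrd k p y ^+ q != 0 by rewrite expf_neq0.
  rewrite (E _ q0 (fun y => ccrd k p y ^ q)) //.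
  have := dlogX q ky hc z0; rewrite d1 => ->.
  by move: (ccrd k p y) => z; rewrite mulrAC.
have q0 : ccrd k p y ^+ q.+1 != 0 by rewrite expf_neq0.
have q1 : (ccrd k p y ^+ q.+1)^-1 != 0 by rewrite invr_eq0.
rewrite (E _ q1 (fun y => ccrd k p y ^ Negz q)) //.
have := dlogV ky (hol1X q.+1 hc) q0; rewrite (dlogX q.+1 ky hc z0) d1 => ->.
have -> : (Negz q)%:~R = - q.+1%:R :> C by rewrite NegzE mulrNz.
change (ccrd k p y ^ Negz q) with (ccrd k p y ^+ q.+1)^-1.
by move: (ccrd k p y) => z; rewrite !mulNr mulrAC.
Qed.

Lemma frac_floor (w : R) : 0 <= w - (Num.floor w)%:~R < 1.
Proof. exact: frac_itv. Qed.

(* the local section [z^N V_b] generates the part of weight [wt i m b] modulo 1 *)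
Lemma test_section i a k b : bdom a (x i) -> cdom k (x i) -> (b <= m)%N ->
  let w := wt i m b in let al := w - (Num.floor w)%:~R in let Nb := b%:Z - Num.floor w in
  exists N (v : sec L) t, [/\ open N /\ N (x i), al < t <= 1, G 0 N v,
    forall y, (N `\` S) y -> [/\ cdom k y, bdom a y &
      forall b', (dh (v a y))`_b' = if b' == b then ccrd k (x i) y ^ Nb else 0] &
    in_fib x G (x i) t (addsec (residue D N k (x i) v) (scalesec (fun=> - al%:C) v))].
Proof.
move=> ha hk hb w al Nb.
have [N [oN Ni Nk Na NS]] := small_nbhd (cdom_open (r := X) k) hk ha.
pose P y : {poly C} := (ccrd k (x i) y ^ Nb)%:P * 'X^b.
have cP y b' : (P y)`_b' = if b' == b then ccrd k (x i) y ^ Nb else 0.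
  by rewrite coefCM coefXn; case: eqP => _; rewrite ?mulr1 ?mulr0.
have sP y : (size (P y) <= m.+1)%N.
  by apply/leq_sizeP => b' hb'; rewrite cP; case: eqP => // e; move: hb'; rewrite e leqNgt ltnS hb.
pose v := sec_of m a P.
have Gv t : NN i m b t <= Nb -> G t N v.
  move=> ht; apply: chiw_SymE; [exact: oN|]; apply: (chiw_sec_of (y0 := x i) oN Na NS (leqnn _)).
  - move=> b' y [Ny nS]; have z0 : ccrd k (x i) y != 0.
      by apply: ccrd_neq0 => //; [exact: Nk|move=> e; apply: nS; exists i].
    have : hol1 (fun y => if b' == b then ccrd k (x i) y ^ Nb else 0) y.
      by case: eqP => _; [apply: hol1_exprz => //; exact: Nk|exact: hol1_cst].
    by apply: hol1_near; apply: filterE => y'; rewrite cP.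
  - exact: sP.
  - move=> i' e Ni' b' hb'; rewrite -(x_inj e).
    apply: (@ordge_near _ _ _ _ (fun y => if b' == b then ccrd k (x i) y ^ Nb else 0)).
      by apply: pnearT => y'; rewrite cP.
    case: eqP => [->|_]; first by apply: ordge_le ht _; exact: ordge_ccrd.
    by apply: ordge_zero; apply: pnearW; apply: filterE.
have N0 : NN i m b 0 = Nb.
  have e0 : Num.ceil (0 - w) = - Num.floor w by rewrite sub0r ceilNfloor opprK.
  by rewrite /NN -/w e0; exact: addrC.
have eal : Num.ceil (al - w) = - Num.floor w by rewrite /al addrAC subrr sub0r -intrN intrKceil.
have Nal : NN i m b al = Nb.
  by rewrite /NN -/w eal; exact: addrC.
have vE y : (N `\` S) y -> [/\ cdom k y, bdom a y &
      forall b', (dh (v a y))`_b' = if b' == b then ccrd k (x i) y ^ Nb else 0].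
  move=> [Ny nS]; split=> [||b']; [exact: Nk|exact: Na|].
  by rewrite /v coef_sec_of //; exact: Na.
have al01 := frac_floor w.
have G0 : G 0 N v by apply: Gv; rewrite N0.
have vfib : in_fib x G (x i) al v.
  exists N, v; split; [exact: oN|exact: Ni|by apply: Gv; rewrite Nal|].
  exists k, N, (@zerosec R X L); split; first by split.
    apply/symP => //; split; first exact: is_sec0.
    - by move=> a' y b' _ _ _; rewrite dh0 coef0.
    - by move=> i' _ a' _ b'; apply: ordge_zero; apply: pnearT => y; rewrite dh0 coef0.
  by move=> a' y _ _; rewrite /addsec /scalesec /zerosec scaler0 addr0.
(* [ceil (t - w)] has the same value at [t = 0] and [t = al] and increases immediately after [al];
   so [v], of order exactly [Nb], belongs to level [al] and to no later one. *)
have wal : is_weight x G (x i) al.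
  split; first exact: al01.
  exists N, v; split; [exact: oN|exact: Ni|exact: G0|exact: vfib|].
  move=> t /andP[t0 t1] /in_fib_ord => /(_ a b ha t1) h.
  have ex : pnear (x i) (fun y => (dh (v a y))`_b = ccrd k (x i) y ^ Nb * 1).
    apply: filterS (near_W_S oN Ni) => y /vE[_ _ ->].
    by rewrite eqxx mulr1.
  have := ordge_max hk _ _ ex h => /(_ _ (oner_neq0 _)) le.
  have {}le : NN i m b t <= Nb by apply: le; apply: filterE => y; exact: hol1_cst.
  move: le; rewrite leNgt => /negP; apply.
  by rewrite -Nal /NN ltrD2r -/w eal ceil_gt_int intrN; move: t0; rewrite /al; lra.
have [_ hD] := D_par; have [_ [t [ht hf]]] := hD i al wal N k v oN Ni hk G0 vfib.
by exists N, v, t; split.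
Qed.

(** The residue condition applied to [v = z^Nb V_b]. Its residue minus [al] lies in a strictly later
    step; dividing its coefficients by [z^Nb] leaves [z AA] plus the scalar [Nb - al] on the
    diagonal. *)
Lemma residue_ord i a k b : bdom a (x i) -> cdom k (x i) -> (b <= m)%N ->
  let w := wt i m b in let al := w - (Num.floor w)%:~R in let Nb := b%:Z - Num.floor w in
  exists t, al < t <= 1 /\ forall b', (b' <= m)%N -> ordge (x i) (NN i m b' t - Nb)
    (fun y => ccrd k (x i) y * AA a b' b k y + (if b' == b then Nb%:~R - al%:C else 0)).
Proof.
move=> ha hk hb w al Nb; have [N [v [t [[oN Ni] ht Gv vE hf]]]] := test_section ha hk hb.
rewrite -/w in vE hf; rewrite -/al -/Nb in vE hf ht.
exists t; split=> [|b' hb']; first exact: ht.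
have := ordgeM (ordge_ccrd (- Nb) hk) (in_fib_ord b' hf ha (andP ht).2).
rewrite addrC; apply: ordge_near.
apply: filterS (near_W_S oN Ni) => y Ny; have [ky ay hv] := vE y Ny.
have z0 : ccrd k (x i) y != 0 by apply: (ccrd_neq0 hk ky) => e; apply: Ny.2; exists i.
rewrite coef_addsec !coef_scalesec (D_expand oN Gv Ny ay ky hb') hv.
have nE : \forall y' \near y, (if b' == b then ccrd k (x i) y' ^ Nb else 0) = (dh (v a y'))`_b'.
  by apply: filterS (near_open (openD_S oN) Ny) => y' /vE[_ _ ->].
have hz := hol1_exprz Nb ky z0.
have -> : dfun k (fun y => (dh (v a y))`_b') y =
   if b' == b then Nb%:~R * ccrd k (x i) y ^ Nb / ccrd k (x i) y else 0.
  case: eqP nE => _ nE.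
    by rewrite (dfun_near ky nE hz) dfun_exprz.
  by rewrite (dfun_near ky nE (hol1_cst 0 y)) dfun_cst.
have -> : \sum_(b0 < m.+1) (dh (v a y))`_b0 * AA a b' b0 k y = ccrd k (x i) y ^ Nb * AA a b' b k y.
  rewrite (bigD1 (Ordinal (hb : (b < m.+1)%N))) //= hv eqxx big1 ?addr0 // => b0 nb.
  rewrite hv; case: eqP => e; last by rewrite mul0r.
  by move/eqP: nb; case; apply/val_inj.
have zN : ccrd k (x i) y ^ (- Nb) * ccrd k (x i) y ^ Nb = 1 by rewrite -expfzDr // addNr expr0z.
move: (ccrd k (x i) y ^ (- Nb)) (ccrd k (x i) y ^ Nb) (ccrd k (x i) y) (AA a b' b k y) z0 zN => p q z A z0 pq.
case: eqP => _; last by rewrite mulr0 addr0 add0r -[RHS]mul1r -pq; ring.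
rewrite -[RHS]mul1r -pq; move: (Nb%:~R : C) (al%:C) => u u'; by field.
Qed.

(** A logarithmic form would allow one pole more. That unit is regained because the residue
    condition places the image in a strictly later step of the filtration. *)
Lemma AA_ord i a k b b' : bdom a (x i) -> cdom k (x i) -> (b < b' <= m)%N ->
  ordge (x i) ((b' - b)%N%:Z - Num.ceil ((b' - b)%N%:R / (2 * c i + 1))) (AA a b' b k).
Proof.
move=> ha hk /andP[bb' hb'].
have hb : (b <= m)%N by exact: leq_trans (ltnW bb') hb'.
have [t [/andP[t0 t1] h]] := residue_ord ha hk hb; have := h b' hb'.
rewrite (gtn_eqF bb') => h'.
have := ordgeM (ordge_ccrd (-1) hk) h'; set v := (_ + _) => h2.
have le : (b' - b)%N%:Z - Num.ceil ((b' - b)%N%:R / (2 * c i + 1)) <= v.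
  rewrite /v /NN; set w := wt i m b in t0 *.
  have -> : wt i m b' = w + (b' - b)%N%:R / (2 * c i + 1).
    by rewrite /w /wt natrB ?(ltnW bb') // -mulrDl; congr (_ / _); ring.
  set ka := (b' - b)%N%:R / (2 * c i + 1).
  (* The strict inequality comes from [t > al = w - floor w]. *)
  have H : - Num.floor w - Num.ceil ka < Num.ceil (t - (w + ka)).
    rewrite ceil_gt_int intrD !intrN; have := ceil_ge ka; move: t0; lra.
  have e : b'%:Z = b%:Z + (b' - b)%N%:Z by rewrite -PoszD subnKC // ltnW.
  move: H; rewrite e; move: (Num.floor w) (Num.ceil ka) (Num.ceil (t - (w + ka))) => f g h0; lia.
apply: ordge_le le _; move: h2; apply: ordge_near.
apply: filterS (pnear_ccrd hk) => y z0; rewrite addr0 mulrA.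
have -> : ccrd k (x i) y ^ (-1) * ccrd k (x i) y = 1 by rewrite exprN1 mulVf.
by rewrite mul1r.
Qed.

(** On the diagonal [z AA + Nb - al] vanishes at [x_i], so the residue is [al - Nb = w - b], in
    which the integer part of the weight has disappeared. *)
Lemma AA_diag i a b : bdom a (x i) -> (b <= m)%N -> isres (AA a b b) (x i) (wt i m b - b%:R)%:C.
Proof.
move=> ha hb; have [k hk] := cdom_cover (x i).
have [t [/andP[t0 t1] h]] := residue_ord ha hk hb; have := h b hb.
rewrite eqxx; set w := wt i m b in t0 *; set u := (_ - _ : int) => hu.
have u1 : 1 <= u.
  rewrite /u /NN -/w; have : - Num.floor w < Num.ceil (t - w) by rewrite ceil_gt_int intrN; lra.
  by move: (Num.floor w) (Num.ceil (t - w)) => f g; lia.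
have [g [hg eg]] := ordgeP hk (ordge_le u1 hu).
have [F [hF dF]] := hol_prim hk hg.
exists k, F; split; [exact: hk|exact: mero1_hol|].
apply: filterS (pnearI eg (pnearI (pnear_ccrd hk) (pnearW dF))) => y [e [z0 ->]].
move: e; rewrite expr1z /= => e.
have eC : (w - b%:R)%:C = (w - (Num.floor w)%:~R)%:C - (b%:Z - Num.floor w)%:~R :> C.
  rewrite intrB !rmorphB /= !rmorph_int rmorph_nat -pmulrn; move: ((Num.floor w)%:~R : C) (w%:C : C) (b%:R : C) => p q r; ring.
rewrite eC; move: e z0; move: (_%:~R : C) ((w - (Num.floor w)%:~R)%:C : C) (ccrd k (x i) y) (AA a b b k y) (g y) => p q z A G0 e z0.
have -> : A = (z * A) / z by rewrite mulrC mulKf.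
have -> : z * A = z * G0 - (p - q) by rewrite -e addrK.
by field.
Qed.

(** * Change of frame for the connection matrix *)

Definition gc a a' b y : C := ltr a a' y ^+ (m - b) / ltr a a' y ^+ b.
(** The matrix of the change of frame: [cc a a' b i] is the coefficient on the monomial of index [i]
    of frame [a] of the monomial of index [b] of frame [a']. It is triangular, with diagonal [gc],
    and next to it [xi] enters linearly. *)
Definition cc a a' b (i : nat) y : C := gc a a' b y * (('X + (xi a a' y)%:P) ^+ b : {poly C})`_i.

Lemma cc_gt a a' b i y : (b < i)%N -> cc a a' b i y = 0.
Proof. by move=> h; rewrite /cc coef_Xadd_gt // mulr0. Qed.

Lemma cc_eq a a' b y : cc a a' b b y = gc a a' b y.
Proof. by rewrite /cc coef_Xadd_eq mulr1. Qed.

Lemma cc_pred a a' b y : cc a a' b.+1 b y = gc a a' b.+1 y * (b.+1%:R * xi a a' y).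
Proof. by rewrite /cc coef_Xadd_pred. Qed.

Lemma coef_glue a a' y p i : p \is ishomog1 m mdeg ->
  (dh (glu xi a a' y p))`_i = \sum_(l < m.+1) (dh p)`_l * cc a a' l i y.
Proof.
move=> hp; rewrite (dh_glue xi a a' y hp) coef_sum; apply: eq_bigr => l _.
by rewrite coefCM /cc /gc -mulrA.
Qed.

Lemma coef_Vb a a' b i y : (b <= m)%N -> (dh (Vb a' b a y))`_i = cc a a' b i y.
Proof.
move=> hb; rewrite /Vb /sec_of (coef_glue a a' y i (hm_homog m _)) dh_hm ?size_polyXn //.
rewrite (@sum_one _ (fun l : nat => ('X^b : {poly C})`_l * cc a a' l i y) m b hb); first by rewrite coefXn eqxx mul1r.
by move=> l _ hl; rewrite coefXn (negbTE hl) mul0r.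
Qed.

(** Two expansions of [D] applied to one frame section, computed in its own frame and in the other
    one. *)
Lemma gauge_raw a a' b i k y : (b <= m)%N -> (i <= m)%N -> bdom a y -> bdom a' y -> ~ S y -> cdom k y ->
  \sum_(l < m.+1) AA a' l b k y * cc a a' l i y =
  dfun k (cc a a' b i) y + \sum_(l < m.+1) cc a a' b l y * AA a i l k y.
Proof.
move=> hb hi ha ha' nS ky; have oU := open_U a'; have GV := V_sym a' b 0.
have Uy : ((bdom a' `\` S) `\` S) y by [].
have := D_expand oU GV Uy ha ky hi.
have [N [[oN Ny Nk] NU [h1 _ h3]]] := D_sec oU GV Uy ky.
have E : (dh (D (bdom a' `\` S) (Vb a' b) k a y))`_i = \sum_(l < m.+1) AA a' l b k y * cc a a' l i y.
  by have := coef_glue a a' y i (h1 a' y (conj Ny nS) ha'); have -> := h3 a a' y (conj Ny nS) ha ha'.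
move=> E2; refine (etrans (esym E) (etrans E2 (f_equal2 (fun p q => p + q) _ _))).
  by apply: (f_equal (fun f => dfun k f y)); apply: funext => y'; exact: coef_Vb.
by apply: eq_bigr => l _; rewrite coef_Vb.
Qed.

Definition Van K := forall a b b' k y, (b' <= m)%N -> (b + K < b')%N -> (bdom a `\` S) y -> cdom k y -> AA a b' b k y = 0.

Lemma dfun0 k y (f : X -> C) : (forall y, f y = 0) -> dfun k f y = 0.
Proof. by move=> h; rewrite (funext h) dfun_cst. Qed.

Lemma gc_shift a a' b K y : (b + K <= m)%N -> bdom a y -> bdom a' y -> gc a a' b y = gc a a' (b + K) y * ltr a a' y ^+ (2 * K).
Proof.
move=> h ha ha'; have g0 := ltr_neq0 ha ha'; rewrite /gc.
have -> : (m - b = (m - (b + K)) + K)%N by lia.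
rewrite mul2n -addnn !exprD.
have := expf_neq0 b g0; have := expf_neq0 K g0.
by move: (ltr a a' y ^+ b) (ltr a a' y ^+ K) (ltr a a' y ^+ (m - (b + K))) => p q r q0 p0; field; rewrite q0 p0.
Qed.

Lemma gc_neq0 a a' b y : bdom a y -> bdom a' y -> gc a a' b y != 0.
Proof. by move=> ha ha'; have g0 := ltr_neq0 ha ha'; rewrite /gc mulf_neq0 ?invr_eq0 ?expf_neq0. Qed.

(** On the extreme diagonal only the diagonal entries of the change of frame survive: the others are
    cut off by its triangularity or by [Van K]. *)
Lemma gauge_top K a a' b k y : Van K -> (0 < K)%N -> (b + K <= m)%N -> bdom a y -> bdom a' y -> ~ S y -> cdom k y ->
  AA a' (b + K) b k y = ltr a a' y ^+ (2 * K) * AA a (b + K) b k y.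
Proof.
move=> vK K0 hb ha ha' nS ky; have hb' : (b <= m)%N by lia.
have := gauge_raw hb' hb ha ha' nS ky.
rewrite (dfun0 _ _ (fun y => cc_gt a a' y _)); last by lia.
rewrite add0r (@sum_one _ (fun l : nat => AA a' l b k y * cc a a' l (b + K) y) m (b + K) hb); last first.
  move=> l hl nl; have [h|h] := ltnP l (b + K); first by rewrite cc_gt // mulr0.
  by rewrite (vK a' b l k y hl) ?mul0r //; lia.
rewrite (@sum_one _ (fun l : nat => cc a a' b l y * AA a (b + K) l k y) m b hb'); last first.
  move=> l hl nl; have [h|h] := ltnP b l; first by rewrite cc_gt // mul0r.
  by rewrite (vK a l (b + K)%N k y hb) ?mulr0 //; lia.
rewrite !cc_eq (gc_shift hb ha ha') mulrC -mulrA.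
exact: mulfI (gc_neq0 _ ha ha') _ _.
Qed.

Lemma dlog_gc a a' b k y : (b <= m)%N -> bdom a y -> bdom a' y -> cdom k y ->
  dfun k (gc a a' b) y = gc a a' b y * ((m%:R - 2 * b%:R) * dlog (ltr a a') k y).
Proof.
move=> hb ha ha' ky; have g0 := ltr_neq0 ha ha'.
have hg : hol1 (ltr a a') y := (holP _ _).1 (@ltr_hol _ _ L a a') y (conj ha ha').
have e0 q : ltr a a' y ^+ q != 0 by rewrite expf_neq0.
have -> : dfun k (gc a a' b) y = gc a a' b y * dlog (gc a a' b) k y.
  by rewrite /dlog mulrC divfK // gc_neq0.
congr (_ * _); rewrite /gc (dlogM ky (hol1X _ hg) (hol1V (e0 b) (hol1X _ hg)) (e0 _)) ?invr_eq0 ?e0 //.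
rewrite (dlogV ky (hol1X b hg) (e0 b)) !(dlogX _ ky hg g0) natrB //.
by move: (dlog _ _ _) => z; ring.
Qed.

(** One diagonal further in, two terms survive on each side, and the term linear in [xi] appears.
    Only for [K = 1], where the entry is diagonal, does the derivative of the transition function
    contribute. *)
Lemma gauge_sub K a a' b q k y : Van K -> (0 < K)%N -> (b + K = q.+1)%N -> (q <= m)%N -> bdom a y -> bdom a' y -> ~ S y -> cdom k y ->
  AA a' q b k y = ltr a a' y ^+ (2 * K.-1) *
    (AA a q b k y + xi a a' y * (b%:R * AA a q b.-1 k y - q.+1%:R * AA a q.+1 b k y)) +
    (if K == 1%N then (m%:R - 2 * b%:R) * dlog (ltr a a') k y else 0).
Proof.
move=> vK K1 eq hq ha ha' nS ky.
have hb' : (b <= m)%N by lia.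
have Ua : (bdom a `\` S) y by []. have Ua' : (bdom a' `\` S) y by [].
have := gauge_raw hb' hq ha ha' nS ky.
rewrite (@sum_two _ (fun l : nat => AA a' l b k y * cc a a' l q y) m q hq); last first.
  move=> l hl n1 n2; have [h|h] := ltnP l q; first by rewrite cc_gt // mulr0.
  by rewrite (vK a' b l k y hl) ?mul0r //; lia.
  by move=> h; rewrite (AA_big) // mul0r.
(* For [b = 0] the index [b.-1] is a default, harmless because of the factor [b%:R]. *)
have -> : \sum_(l < m.+1) cc a a' b l y * AA a q l k y = gc a a' b y * (AA a q b k y + b%:R * xi a a' y * AA a q b.-1 k y).
  case: b eq hb' => [|b] eq hb'.
    rewrite (@sum_one _ (fun l : nat => cc a a' 0 l y * AA a q l k y) m 0%N (leq0n _)); last first.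
      by move=> l hl nl; rewrite cc_gt ?mul0r // lt0n.
    by rewrite cc_eq !mul0r addr0.
  rewrite (@sum_two _ (fun l : nat => cc a a' b.+1 l y * AA a q l k y) m b (ltnW hb')); last first.
    move=> l hl n1 n2; have [h|h] := ltnP b.+1 l; first by rewrite cc_gt // mul0r.
    by rewrite (vK a l q k y hq) ?mulr0 //; lia.
    by move=> h; lia.
  rewrite cc_eq cc_pred (_ : b.+1.-1 = b) //.
  by move: (gc a a' b.+1 y) (AA a q b k y) (AA a q b.+1 k y) (xi a a' y) (b.+1%:R : C) => g A B z u; ring.
have -> : AA a' q.+1 b k y * cc a a' q.+1 q y = gc a a' b y * (q.+1%:R * xi a a' y * AA a q.+1 b k y).
  have [h|h] := ltnP m q.+1; first by rewrite !(AA_big) // mul0r !mulr0.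
  have hbK : (b + K <= m)%N by lia.
  have := gauge_top vK K1 hbK ha ha' nS ky; rewrite eq => ->.
  rewrite cc_pred (gc_shift hbK ha ha') eq.
  by move: (gc a a' q.+1 y) (ltr a a' y ^+ (2 * K)) (AA a q.+1 b k y) (xi a a' y) (q.+1%:R : C) => g A B z u; ring.
rewrite cc_eq => E.
have gq := gc_neq0 q ha ha'.
have sh : gc a a' b y = gc a a' q y * ltr a a' y ^+ (2 * K.-1).
  have hh : (b + K.-1 <= m)%N by lia.
  by have := gc_shift hh ha ha'; have -> : (b + K.-1 = q)%N by lia.
apply: (mulIf gq); rewrite mulrDl -[LHS](addrK (gc a a' b y * (q.+1%:R * xi a a' y * AA a q.+1 b k y))) E.
have -> : dfun k (cc a a' b q) y = (if K == 1%N then (m%:R - 2 * b%:R) * dlog (ltr a a') k y else 0) * gc a a' q y.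
  case: eqP => [K1'|K1'].
    have <- : b = q by lia.
    have -> : cc a a' b b = gc a a' b by apply: funext => y'; exact: cc_eq.
    by rewrite dlog_gc // mulrC.
  by rewrite mul0r; apply: dfun0 => y'; apply: cc_gt; lia.
rewrite sh; move: (gc a a' q y) (ltr a a' y ^+ (2 * K.-1)) (AA a q.+1 b k y) (AA a q b.-1 k y) (AA a q b k y) (xi a a' y) (q.+1%:R : C) (b%:R : C) => g A B z u u1 u2 u3.
by case: (K == 1%N); [move: (_ * dlog _ _ _) => u4|]; ring.
Qed.

(** * Vanishing of the entries far from the diagonal *)

Hypotheses (Xcompact : compact [set: X]) (Xconn : connected [set: X]).
Context (kappa : bidx L -> cidx X -> X -> C) (kappa_iso : is_theta_iso kappa) (xi_class : has_ext_class kappa xi 1).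
Context (tp : seq X) (e : X -> int) (ref : cidx X -> X -> C) (href : is_ref tp e ref).
Context (he : 0 <= 3 * \sum_(y <- tp) e y + 2 * n%:Z) (n1 : (1 <= n)%N).

Definition xs : seq X := [seq x i | i <- enum 'I_n].

Lemma xsP y : S y <-> y \in xs. Proof. exact: rangeP. Qed.
Lemma xsN y : y \notin xs -> ~ S y. Proof. by move=> /negP h /xsP. Qed.
Lemma setS : S = [set` xs]. Proof. by apply/seteqP; split => y /xsP. Qed.
Lemma uniq_xs : uniq xs. Proof. by rewrite map_inj_uniq // enum_uniq. Qed.
Lemma mem_xs i : x i \in xs. Proof. by apply: map_f; rewrite mem_enum. Qed.

Lemma kappa_change a k l y : bdom a y -> cdom k y -> cdom l y -> kappa a k y = kappa a l y * dcrd k l y.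
Proof. by case: kappa_iso => h _ _; exact: (h a).2. Qed.
Lemma kappa_neq0 a k y : bdom a y -> cdom k y -> kappa a k y != 0.
Proof. by case: kappa_iso => _ h _; exact: h. Qed.
Lemma kappa_glue a a' k y : bdom a y -> bdom a' y -> cdom k y -> kappa a' k y = ltr a a' y ^+ 2 * kappa a k y.
Proof. by case: kappa_iso => _ _ h; exact: h. Qed.
Lemma kappa_hol a k y : bdom a y -> cdom k y -> hol1 (kappa a k) y.
Proof. by case: kappa_iso => h _ _ ha hk; exact: ((holP _ _).1 ((h a).1 k) y (conj ha hk)). Qed.
Lemma near_kappa a k y : bdom a y -> cdom k y -> \forall y' \near y, hol1 (kappa a k) y'.
Proof. by move=> ha hk; apply: filterS2 (near_bdom ha) (near_cdom hk) => y' h1 h2; exact: kappa_hol. Qed.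

Lemma AA_change a b' b k l y : bdom a y -> y \notin xs -> cdom k y -> cdom l y -> AA a b' b k y = AA a b' b l y * dcrd k l y.
Proof.
move=> ha ns ky ly; have [_ h] := AA_form a b' b.
exact: h (conj ha (xsN ns)) ky ly.
Qed.
Lemma AA_hol a b' b k y : bdom a y -> y \notin xs -> cdom k y -> hol1 (AA a b' b k) y.
Proof.
move=> ha ns ky; have [h _] := AA_form a b' b.
exact: ((holP _ _).1 (h k) y (conj (conj ha (xsN ns)) ky)).
Qed.

Lemma near_frame (T : seq X) a k y : bdom a y -> cdom k y -> pnear y (fun y' => [/\ bdom a y', cdom k y', y' \notin xs & y' \notin T]).
Proof.
move=> ha hk; apply: filterS (pnearI (pnearI (pnearW (near_bdom ha)) (pnearW (near_cdom hk)))
  (pnearI (pnear_notin y xs) (pnear_notin y T))) => y' [[h1 h2] [h3 h4]]; by split.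
Qed.

(** Frames and charts are chosen point by point; the values on [T] are arbitrary. *)
Lemma globalize (T : seq X) (Phi : bidx L -> cidx X -> X -> C) :
  (forall a a' k k' y, y \notin T -> bdom a y -> bdom a' y -> cdom k y -> cdom k' y -> Phi a k y = Phi a' k' y) ->
  exists F : X -> C, forall a k y, y \notin T -> bdom a y -> cdom k y -> F y = Phi a k y.
Proof.
move=> h; have [fr hfr] := choice (fun y => bdom_cover L y); have [ch hch] := choice (fun y => @cdom_cover R X y).
by exists (fun y => Phi (fr y) (ch y) y) => a k y ns ha hk; exact: h.
Qed.

Definition nu i (K : nat) : int := K%:Z - Num.ceil (K%:R / (2 * c i + 1)).

(** Since [2 c_i + 1 > 3], the ceiling is less than [(K + 1) / 3 + 1]; for integers this is the
    stated bound. It is the source of the constant 2/3. *)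
Lemma nu_ge i K : 2 * (K.+1%:Z - 1) <= 3 * nu i K.+1.
Proof.
have ci := c_gt1 i; have d0 := den_gt0 i.
have h : K.+1%:R / (2 * c i + 1) <= K.+1%:R / 3 :> R.
  by rewrite ler_pM2l ?ltr0n // lef_pV2 ?posrE //; lra.
have : (Num.ceil (K.+1%:R / (2 * c i + 1)))%:~R < K.+1%:R / 3 + 1 :> R.
  by have := ceilB1_lt (K.+1%:R / (2 * c i + 1)); rewrite intrB; lra.
rewrite /nu; move: (Num.ceil _) => z hz.
have : (3 * z)%:~R < (K.+1%:Z + 3)%:~R :> R by rewrite intrM intrD -!pmulrn; lra.
rewrite ltr_int; lia.
Qed.

(** In the extreme case [(K + 1) / 3] is an integer, and it already bounds the ceiling for [K + 1].
    This makes the quotient by [BB] free of poles at [x_i]. *)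
Lemma nu_pred i K : 3 * nu i K.+2 = 2 * (K.+2%:Z - 1) -> nu i K.+2 <= nu i K.+1.
Proof.
have ci := c_gt1 i; have d0 := den_gt0 i.
rewrite /nu; set z := Num.ceil (K.+2%:R / _); set z' := Num.ceil (K.+1%:R / _) => h.
have hj : 3 * (z - 1) = K.+1%:Z by lia.
suff : z' <= z - 1 by lia.
rewrite /z' ceil_le_int ler_pdivrMr //.
have -> : K.+1%:R = 3 * (z - 1)%:~R :> R by rewrite -[3]/(3%:~R) -intrM hj.
by rewrite mulrC ler_wpM2l //; [rewrite ler0z; lia|lra].
Qed.

Section Step.
Context (K b q : nat) (vK : Van K.+2) (eq : (b + K.+2 = q.+1)%N) (hq : (q <= m)%N).

(** The factor of [xi] in [gauge_sub] for the entry [(q, b)]. The distance called K in the overview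
    is [K.+2] here, and [q = b + K + 1]. *)
Definition BB a k y : C := b%:R * AA a q b.-1 k y - q.+1%:R * AA a q.+1 b k y.

Lemma BB_change a k l y : bdom a y -> y \notin xs -> cdom k y -> cdom l y -> BB a k y = BB a l y * dcrd k l y.
Proof.
by move=> ha ns ky ly; rewrite /BB !(AA_change _ _ ha ns ky ly) mulrBl !mulrA.
Qed.

Lemma BB_hol a k y : bdom a y -> y \notin xs -> cdom k y -> hol1 (BB a k) y.
Proof.
move=> ha ns ky; apply: hol1B; apply: hol1M; [exact: hol1_cst|exact: AA_hol|exact: hol1_cst|exact: AA_hol].
Qed.

Lemma BB_glue a a' k y : bdom a y -> bdom a' y -> y \notin xs -> cdom k y ->
  BB a' k y = ltr a a' y ^+ (2 * K.+2) * BB a k y.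
Proof.
move=> ha ha' ns ky; have nS := xsN ns.
have -> : BB a' k y = b%:R * (ltr a a' y ^+ (2 * K.+2) * AA a q b.-1 k y) - q.+1%:R * (ltr a a' y ^+ (2 * K.+2) * AA a q.+1 b k y).
  rewrite /BB; apply: (f_equal2 (fun p r : C => p - r)).
    case: b eq => [|b'] eq'; first by rewrite !mul0r.
    have e1 : (b' + K.+2 = q)%N by lia.
    have hb1 : (b' + K.+2 <= m)%N by lia.
    by have := gauge_top vK isT hb1 ha ha' nS ky; rewrite e1 => ->.
  apply: (f_equal (fun p : C => q.+1%:R * p)).
  have [hm|hm] := ltnP m q.+1.
    rewrite (AA_big b hm (conj ha' nS) ky).
    by rewrite (AA_big b hm (conj ha nS) ky) mulr0.
  have hb1 : (b + K.+2 <= m)%N by rewrite eq.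
  by have := gauge_top vK isT hb1 ha ha' nS ky; rewrite eq => ->.
rewrite /BB; move: (ltr a a' y ^+ _) (AA a q b.-1 k y) (AA a q.+1 b k y) => g A B; ring.
Qed.

Lemma BB_ord i a k : bdom a (x i) -> cdom k (x i) -> ordge (x i) (nu i K.+2) (BB a k).
Proof.
move=> ha hk.
have h1 : ordge (x i) (nu i K.+2) (fun y => b%:R * AA a q b.-1 k y).
  case: b eq => [|b'] eq'.
    by apply: ordge_zero; apply: pnearT => y; rewrite mul0r.
  have hb : (b' < q <= m)%N by apply/andP; split; [lia|exact: hq].
  have := AA_ord ha hk hb.
  have -> : (q - b' = K.+2)%N by lia.
  exact: ordgeZ.
have h2 : ordge (x i) (nu i K.+2) (fun y => (- q.+1%:R) * AA a q.+1 b k y).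
  have [hm|hm] := ltnP m q.+1.
    apply: ordge_zero; apply: filterS (near_frame [::] ha hk) => y [h1' h2' h3 _].
    by rewrite (AA_big b hm (conj h1' (xsN h3)) h2') mulr0.
  have hb : (b < q.+1 <= m)%N by apply/andP; split; [lia|exact: hm].
  have := AA_ord ha hk hb.
  have -> : (q.+1 - b = K.+2)%N by lia.
  exact: ordgeZ.
apply: ordge_near (ordgeD h1 h2); apply: pnearT => y.
by rewrite /BB mulNr.
Qed.

(* its degree rules out zeros of [BB] off [S] *)
Lemma BB_global : exists F : X -> C, forall a k y, y \notin xs ++ tp -> bdom a y -> cdom k y ->
  F y = BB a k y * ref k y ^+ K.+1 / kappa a k y ^+ K.+2.
Proof.
apply: globalize => a a' k k' y; rewrite mem_cat negb_or => /andP[ns nt] ha ha' ky ky'.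
have [_ [_ hr] _ _ _] := href; have nt' : (~` [set` tp]) y by apply/negP.
rewrite (BB_glue ha ha' ns ky') (kappa_glue ha ha' ky').
rewrite (BB_change ha ns ky ky') (hr k k' y nt' ky ky') (kappa_change ha ky ky').
have g0 := ltr_neq0 ha ha'; have k0 := kappa_neq0 ha ky'; have d0 := dcrd_neq0 ky ky'.
move: (ltr a a' y) (kappa a k' y) (dcrd k k' y) (BB a k' y) (ref k' y) g0 k0 d0 => g ka d B r g0 k0 d0.
have -> : (g ^+ 2 * ka) ^+ K.+2 = g ^+ (2 * K.+2) * ka ^+ K.+2 by rewrite exprMn exprM.
rewrite [(r * d) ^+ _]exprMn [(ka * d) ^+ _]exprMn [d ^+ K.+2]exprS.
have := expf_neq0 (2 * K.+2) g0; have := expf_neq0 K.+2 k0; have := expf_neq0 K.+1 d0.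
move: (g ^+ (2 * K.+2)) (ka ^+ K.+2) (d ^+ K.+1) (r ^+ K.+1) => g1 ka1 d1 r1 hd hk hg.
by field; rewrite d0 hd hk hg.
Qed.

Lemma BB_zero a k y : bdom a y -> y \notin xs -> cdom k y -> BB a k y = 0.
Proof.
move=> ha0 ns0 ky0; apply: contrapT => /eqP nz.
have [F FE] := BB_global; have [ut [hr1 hr2] hr0 hre e0] := href.
have ord_F a1 k1 y1 v : bdom a1 y1 -> cdom k1 y1 -> ordge y1 v (BB a1 k1) -> ordge y1 (v + K.+1%:Z * e y1) F.
  move=> ha1 hk1 hv.
  have hi : ordge y1 0 (fun y => (kappa a1 k1 y ^+ K.+2)^-1).
    apply: ordge_hol; apply: filterS2 (near_bdom ha1) (near_cdom hk1) => y' h1 h2.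
    by apply: hol1V; [rewrite expf_neq0 // kappa_neq0|apply: hol1X; exact: kappa_hol].
  have := ordgeM (ordgeM hv (ordgeX K.+1 (hre y1 k1 hk1))) hi; rewrite addr0.
  apply: ordge_near; apply: filterS (near_frame tp ha1 hk1) => y' [h1 h2 h3 h4].
  by rewrite (FE a1 k1) // mem_cat negb_or h3.
(* Lower bounds for the orders of [F]: those of the reference form, with multiplicity [K + 1], and
   at the points of [S] those of [BB]; [kappa] has neither zeros nor poles. *)
pose N y1 : int := K.+1%:Z * e y1 + \sum_i (if x i == y1 then nu i K.+2 else 0).
have N_notS y1 : y1 \notin xs -> N y1 = K.+1%:Z * e y1.
  move=> ns; rewrite /N big1 ?addr0 // => i _; case: eqP => // ei.
  by rewrite -ei mem_xs in ns.
have N_S i : N (x i) = nu i K.+2 + K.+1%:Z * e (x i).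
  rewrite /N addrC (bigD1 i) //= eqxx big1 ?addr0 // => i' ni.
  by case: eqP => // /x_inj ei; rewrite ei eqxx in ni.
have hN y1 : ordge y1 (N y1) F.
  have [a1 ha1] := bdom_cover L y1; have [k1 hk1] := cdom_cover y1.
  have [ys|ys] := boolP (y1 \in xs).
    have [i _ ei] := (xsP y1).2 ys; rewrite -ei in ha1 hk1 *; rewrite N_S.
    exact: (ord_F _ _ _ _ ha1 hk1 (BB_ord ha1 hk1)).
  rewrite N_notS // -[X in ordge _ X]add0r; apply: (ord_F _ _ _ _ ha1 hk1); apply: ordge_hol.
  apply: filterS3 (near_bdom ha1) (near_cdom hk1) (near_notin ys) => y' h1 h2 h3.
  exact: BB_hol.
(* The identity theorem is available for forms, so [F] is multiplied by the reference form. *)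
pose w k1 y1 : C := F y1 * ref k1 y1.
have fw y1 : formp w y1.
  apply: filterS (pnear_notin y1 tp) => y' nt k1 l1 h1 h2; rewrite /w (hr2 k1 l1 y') ?mulrA //.
  by apply/negP.
have mw k1 y1 : cdom k1 y1 -> mero1 (w k1) y1.
  by move=> h; apply: mero1M; [exact: ordge_mero (hN y1)|exact: ordge_mero (hre y1 k1 h)].
have nF y1 : pnear y1 (fun y => F y != 0).
  have [z|nz1] := mero_identity Xconn fw mw; last first.
    have [k1 hk1] := cdom_cover y1; apply: filterS (nz1 y1 k1 hk1) => y'.
    by rewrite /w mulf_eq0 negb_or => /andP[].
  have hB := near_neq0 (BB_hol ha0 ns0 ky0) nz.
  have [y' [_ [[z1 r1] [b1 [h1 h2 h3 h4]]]]] := pnear_ex (pnearI (pnearI (z y) (hr0 y k ky0)) (pnearI (pnearW hB) (near_frame tp ha0 ky0))).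
  have := z1 k h2; rewrite /w (FE a k) // ?mem_cat ?negb_or ?h3 // => /eqP.
  by rewrite !mulf_eq0 invr_eq0 !expf_eq0 (negbTE r1) (negbTE b1) (negbTE (kappa_neq0 h1 h2)).
pose t := undup (xs ++ tp).
have ut' : uniq t by exact: undup_uniq.
have N0 y1 : y1 \notin t -> N y1 = 0.
  rewrite mem_undup mem_cat negb_or => /andP[h1 h2]; by rewrite N_notS // e0 // mulr0.
have sumN : \sum_(y1 <- t) N y1 = K.+1%:Z * \sum_(y1 <- tp) e y1 + \sum_i nu i K.+2.
  rewrite big_split /= -mulr_sumr (sum_supp ut ut' _ e0); last by move=> y1 h; rewrite mem_undup mem_cat h orbT.
  congr (_ + _); rewrite exchange_big /=; apply: eq_bigr => i _; apply: sum_delta ut' _.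
  by rewrite mem_undup mem_cat mem_xs.
have sum_nu : 2 * K.+1%:Z * n%:Z <= 3 * \sum_i nu i K.+2.
  rewrite mulr_sumr; apply: le_trans (ler_sum _ (fun i _ => nu_ge i K.+1)).
  by rewrite sumr_const card_ord -mulr_natr natz; lia.
have hs : 0 <= \sum_(y1 <- t) N y1.
  rewrite sumN; move: sum_nu he; move: (\sum_i _) (\sum_(y1 <- tp) _) => A E; nia.
have [sN0 exN] := exact_orders Xcompact Xconn nF ut' hN N0 hs.
(* The total degree is 0, so there is no slack in [nu_ge] either, at any point of [S]. *)
have nu_eq i : 3 * nu i K.+2 = 2 * (K.+2%:Z - 1).
  have s0 : \sum_i (3 * nu i K.+2 - 2 * (K.+2%:Z - 1)) = 0.
    apply/eqP; rewrite eq_le sumr_ge0 ?andbT => [|i' _]; last by rewrite subr_ge0 nu_ge.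
    rewrite sumrB -mulr_sumr sumr_const card_ord -mulr_natr natz.
    move: sN0 he; rewrite sumN; move: (\sum_i _) (\sum_(y1 <- tp) _) => A E; nia.
  move: s0 => /eqP; rewrite psumr_eq0 => [/allP/(_ i (mem_index_enum i))|i' _]; last by rewrite subr_ge0 nu_ge.
  by rewrite implyTb subr_eq0 => /eqP.
have BB_neq0 a1 k1 y1 : bdom a1 y1 -> y1 \notin xs -> cdom k1 y1 -> BB a1 k1 y1 != 0.
  move=> ha1 ns1 hk1; apply/eqP => z.
  have : ordge y1 1 (BB a1 k1).
    apply: ordge_hol0 z.
    apply: filterS3 (near_bdom ha1) (near_cdom hk1) (near_notin ns1) => y' h1 h2 h3.
    exact: BB_hol.
  by move=> /(ord_F a1 k1 y1 1 ha1 hk1)/exN; rewrite N_notS //; lia.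
(* By [gauge_sub] and the scaling of [BB] and [kappa], these forms split the cocycle [xi]; being
   without residues, they contradict [ext_residue]. *)
pose th a1 k1 y1 : C := kappa a1 k1 y1 * AA a1 q b k1 y1 / BB a1 k1 y1.
have hb : (b < q)%N by lia.
have qb : (q - b = K.+1)%N by lia.
have := ext_residue Xcompact Xconn kappa_iso xi_class (Phi := th) (t := xs) (rho := fun=> 0) (z := 1) uniq_xs.
rewrite big1_eq => H; suff : (0 : C) = 1 by move/eqP; rewrite eq_sym oner_eq0.
apply: H.
- move=> a1; split=> [k1|k1 l1 y1 [ha1 /negP ns1] ky1 ly1].
    apply/holP => y1 [[ha1 /negP ns1] ky1].
    apply: hol1M; last by apply: hol1V; [exact: BB_neq0|exact: BB_hol].
    by apply: hol1M; [exact: kappa_hol|exact: AA_hol].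
  rewrite /th (kappa_change ha1 ky1 ly1) (AA_change q b ha1 ns1 ky1 ly1) (BB_change ha1 ns1 ky1 ly1).
  have d0 := dcrd_neq0 ky1 ly1; have B0 := BB_neq0 a1 l1 y1 ha1 ns1 ly1.
  move: (dcrd k1 l1 y1) (kappa a1 l1 y1) (AA a1 q b l1 y1) (BB a1 l1 y1) d0 B0 => d ka A B d0 B0.
  by field; rewrite d0 B0.
- move=> a1 y1 ys ha1; have [i _ ei] := (xsP y1).2 ys; rewrite -ei in ha1 *.
  have [k1 hk1] := cdom_cover (x i); apply: (ordge0_isres hk1).
  have nB : pnear (x i) (fun y => BB a1 k1 y != 0).
    by apply: filterS (near_frame [::] ha1 hk1) => y' [h1 h2 h3 _]; exact: BB_neq0.
  have oI : ordge (x i) (- nu i K.+2) (fun y => (BB a1 k1 y)^-1).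
    apply: ordge_inv => //; first exact: ordge_mero (BB_ord ha1 hk1).
    by move=> v /(ord_F a1 k1 (x i) v ha1 hk1)/exN; rewrite N_S; lia.
  have hbq : (b < q <= m)%N by rewrite hb.
  (* At [x_i] the numerator has order at least [nu i K.+1] and [BB] has order exactly [nu i K.+2];
     [nu_pred] compares the two. *)
  have oA := AA_ord ha1 hk1 hbq; rewrite qb in oA.
  apply: ordge_le (ordgeM (ordgeM (ordge_hol (near_kappa ha1 hk1)) oA) oI).
  by have := nu_pred (nu_eq i); rewrite /nu; lia.
- move=> a1 a2 k1 y1 ns1 ha1 ha2 hk1; rewrite mul1r /th.
  have -> := gauge_sub vK isT eq hq ha1 ha2 (xsN ns1) hk1.
  rewrite (BB_glue ha1 ha2 ns1 hk1) (kappa_glue ha1 ha2 hk1) addr0 -/(BB a1 k1 y1).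
  have g0 := ltr_neq0 ha1 ha2; have B0 := BB_neq0 a1 k1 y1 ha1 ns1 hk1.
  have -> : ltr a1 a2 y1 ^+ (2 * K.+2) = ltr a1 a2 y1 ^+ 2 * ltr a1 a2 y1 ^+ (2 * K.+2.-1).
    by rewrite -exprD; congr (_ ^+ _); lia.
  have := expf_neq0 (2 * K.+2.-1) g0; have := expf_neq0 2 g0.
  move: (ltr a1 a2 y1 ^+ 2) (ltr a1 a2 y1 ^+ _) (kappa a1 k1 y1) (AA a1 q b k1 y1) (BB a1 k1 y1) (xi a1 a2 y1) B0 => g g' ka A B z B0 gg0 gg1.
  by field; rewrite B0 gg0 gg1.
Qed.

End Step.

(** Induction along the diagonal: [BB] for index [b] involves the entry of index [b] and the
    preceding one, which is already zero, or absent for [b = 0]. *)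
Lemma Van_step K : Van K.+2 -> Van K.+1.
Proof.
move=> vK a b b' k y hb' hK Uy ky; have [h|h] := ltnP (b + K.+2) b'; first exact: vK a b b' k y hb' h Uy ky.
have {h hK} eb : b' = (b + K.+2)%N by lia.
have ns : y \notin xs by apply/negP => /xsP; exact: Uy.2.
rewrite {b'}eb in hb' *.
elim: b hb' => [|b IH] hb.
  have e1 : (0 + K.+2 = K.+1.+1)%N by [].
  have hq : (K.+1 <= m)%N by lia.
  have := BB_zero vK e1 hq Uy.1 ns ky; rewrite /BB mul0r sub0r => /eqP.
  by rewrite oppr_eq0 mulf_eq0 pnatr_eq0 /= => /eqP.
have e1 : (b.+1 + K.+2 = (b + K.+2).+1)%N by [].
have hq : (b + K.+2 <= m)%N by lia.
have := BB_zero vK e1 hq Uy.1 ns ky; rewrite /BB IH // mulr0 sub0r => /eqP.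
by rewrite oppr_eq0 mulf_eq0 pnatr_eq0 /= => /eqP.
Qed.

(** Descending induction from the distance [m + 1], at which the matrix has no entries. *)
Lemma Van1 : Van 1.
Proof.
have h q : forall K, (K.+1 + q = m.+1)%N -> Van K.+1.
  elim: q => [|q IH] K hK.
    by move=> a b b' k y h1 h2; lia.
  by apply: Van_step; apply: IH; lia.
by apply: (h m).
Qed.

(** * The entries next to the diagonal *)

Lemma nu1 i : nu i 1 = 0.
Proof.
have ci := c_gt1 i; have d0 := den_gt0 i; rewrite /nu ceil01 // divr_gt0 //=.
by rewrite ler_pdivrMr //; lra.
Qed.

(** At distance 1 the order bound is [nu i 1 = 0], so the quotient by [kappa] has no poles at [S]
    and extends to a holomorphic function on the compact surface. *)
Lemma u_const b : exists u : C, forall a k y, bdom a y -> y \notin xs -> cdom k y -> AA a b.+1 b k y = u * kappa a k y.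
Proof.
have [hm|hm] := ltnP m b.+1.
  exists 0 => a k y ha ns ky; rewrite mul0r.
  exact: (AA_big b hm (conj ha (xsN ns)) ky).
have hb1 : (b + 1 <= m)%N by rewrite addn1.
have [F FE] : exists F : X -> C, forall a k y, y \notin xs -> bdom a y -> cdom k y -> F y = AA a b.+1 b k y / kappa a k y.
  apply: globalize => a a' k k' y ns ha ha' ky ky'.
  have := gauge_top Van1 isT hb1 ha ha' (xsN ns) ky'; rewrite addn1 muln1 => ->.
  rewrite (kappa_glue ha ha' ky') (kappa_change ha ky ky').
  rewrite (AA_change _ _ ha ns ky ky').
  have g0 := ltr_neq0 ha ha'; have k0 := kappa_neq0 ha ky'; have d0 := dcrd_neq0 ky ky'.
  move: (ltr a a' y) (kappa a k' y) (dcrd k k' y) (AA a b.+1 b k' y) g0 k0 d0 => g ka d A g0 k0 d0.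
  by field; rewrite d0 k0 g0.
have hF y : y \notin xs -> hol1 F y.
  move=> ns; have [a ha] := bdom_cover L y; have [k hk] := cdom_cover y.
  have h : hol1 (fun y => AA a b.+1 b k y / kappa a k y) y.
    apply: hol1M; first exact: (AA_hol).
    by apply: hol1V; [exact: kappa_neq0|exact: kappa_hol].
  apply: hol1_near h.
  by apply: filterS3 (near_bdom ha) (near_cdom hk) (near_notin ns) => y' h1 h2 h3; rewrite (FE a k).
have oF y : y \in xs -> ordge y 0 F.
  move=> ys; have [i _ ei] := (xsP y).2 ys; rewrite -ei {ys}.
  have [a ha] := bdom_cover L (x i); have [k hk] := cdom_cover (x i).
  have hbm : (b < b.+1 <= m)%N by rewrite ltnSn.
  have oA := AA_ord ha hk hbm.
  rewrite subSnn in oA; have hn := nu1 i; rewrite /nu in hn; rewrite hn in oA.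
  have oK : ordge (x i) 0 (fun y => (kappa a k y)^-1).
    apply: ordge_hol; apply: filterS2 (near_bdom ha) (near_cdom hk) => y' h1 h2.
    by apply: hol1V; [exact: kappa_neq0|exact: kappa_hol].
  have := ordgeM oA oK; rewrite addr0; apply: ordge_near.
  by apply: filterS (near_frame [::] ha hk) => y' [h1 h2 h3 _]; rewrite (FE a k).
have [u hu] := removable_const Xcompact Xconn hF oF.
exists u => a k y ha ns ky; rewrite -(hu y ns) (FE a k y ns ha ky) divfK //.
exact: kappa_neq0.
Qed.

(** The component of the reference form in one chart depends on the chart, and its [dlog] is not a
    form. Dividing by [kappa] gives a function [Q a] attached to the frame alone; [kappa] being a
    unit, the orders [d] are unchanged. *)
Lemma ref_order : exists (s : seq X) (d : X -> int) (Q : bidx L -> X -> C),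
  [/\ uniq s /\ {subset tp <= s}, forall y, y \notin s -> d y = 0, forall y, e y <= d y,
    forall a k y, y \notin tp -> bdom a y -> cdom k y -> Q a y = ref k y / kappa a k y &
    (forall a y, bdom a y -> isres (fun k y => dlog (Q a) k y) y (d y)%:~R) /\
    forall a y, y \notin s -> bdom a y -> (\forall y' \near y, hol1 (Q a) y') /\ Q a y != 0].
Proof.
have [ut [hr1 hr2] hr0 hre e0] := href.
have [ch hch] := choice (fun y => @cdom_cover R X y).
have hmer k y : cdom k y -> mero1 (ref k) y by move=> hk; exact: ordge_mero (hre y k hk).
have [d hd] := choice (fun y => mero_order (hmer _ y (hch y)) (hr0 y _ (hch y))).
pose Q a y := ref (ch y) y / kappa a (ch y) y.
have QE a k y : y \notin tp -> bdom a y -> cdom k y -> Q a y = ref k y / kappa a k y.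
  move=> nt ha hk; rewrite /Q (kappa_change ha (hch y) hk) (hr2 (ch y) k y) //; last by apply/negP.
  have d0 := dcrd_neq0 (hch y) hk; have k0 := kappa_neq0 ha hk.
  move: (dcrd _ _ _) (kappa a k y) (ref k y) d0 k0 => z ka r z0 k0.
  by field; rewrite z0 k0.
have ref_hol k y : y \notin tp -> cdom k y -> \forall y' \near y, hol1 (ref k) y'.
  move=> nt hk; apply: filterS2 (near_notin nt) (near_cdom hk) => y' h1 h2.
  by apply: ((holP _ _).1 (hr1 k) y'); split=> //; apply/negP.
pose bad y := ~ (y \notin tp /\ ref (ch y) y != 0).
have hbad y : pnear y (fun y' => ~ bad y').
  have [k hk] := cdom_cover y.
  apply: filterS (pnearI (hr0 y k hk) (pnearI (pnearW (near_cdom hk)) (pnear_notin y tp))) => y' [r0 [h1 h2]]; apply; split=> //.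
  move: r0; rewrite (hr2 k (ch y') y') //; last by apply/negP.
  by rewrite mulf_eq0 negb_or => /andP[].
have [s [us hs]] := isolated_finite Xcompact hbad.
have good y : y \notin s -> y \notin tp /\ ref (ch y) y != 0.
  by move=> /negP ns; apply: contrapT => h; apply: ns; apply/hs.
have ge y : e y <= d y by have [_ _ h] := hd y; apply: h; exact: hre.
have d0 y : y \notin s -> d y = 0.
  move=> /good[nt r0]; have [_ o1 _] := hd y; apply/eqP; rewrite eq_le -{2}(e0 y nt) ge andbT.
  exact: hol_order0 (ref_hol _ _ nt (hch y)) r0 _ o1.
have ik a k y : bdom a y -> cdom k y -> \forall y' \near y, hol1 (fun y => (kappa a k y)^-1) y'.
  move=> ha hk; apply: filterS2 (near_bdom ha) (near_cdom hk) => y' h1 h2.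
  by apply: hol1V; [exact: kappa_neq0|exact: kappa_hol].
exists s, d, Q; split.
- split=> // y yt; apply: contrapT => /negP /good[h _]; by rewrite yt in h.
- exact: d0.
- exact: ge.
- exact: QE.
split=> [a y ha|a y ns ha].
  pose k := ch y; have hk : cdom k y := hch y.
  have eQ : pnear y (fun y => ref k y * (kappa a k y)^-1 = Q a y).
    by apply: filterS (near_frame tp ha hk) => y' [h1 h2 h3 h4]; rewrite (QE a k).
  have eR : pnear y (fun y => Q a y * kappa a k y = ref k y).
    by apply: filterS (near_frame tp ha hk) => y' [h1 h2 h3 h4]; rewrite (QE a k) // divfK // kappa_neq0.
  have ordQ v : ordge y v (ref k) -> ordge y v (Q a).
    by move=> h; have := ordgeM h (ordge_hol (ik a k y ha hk)); rewrite addr0; exact: ordge_near.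
  have ordR v : ordge y v (Q a) -> ordge y v (ref k).
    by move=> h; have := ordgeM h (ordge_hol (near_kappa ha hk)); rewrite addr0; exact: ordge_near.
  have nQ : pnear y (fun y => Q a y != 0).
    by apply: filterS (pnearI (hr0 y k hk) (pnearI eQ (near_frame tp ha hk))) => y' [r0 [<- [h1 h2 _ _]]];
       rewrite mulf_neq0 // invr_eq0 kappa_neq0.
  have [_ o1 o2] := hd y.
  have [d' [r1 q1 q2]] := mero_order (ordge_mero (ordQ _ o1)) nQ.
  have -> : d y = d' by apply/eqP; rewrite eq_le (q2 _ (ordQ _ o1)) (o2 _ (ordR _ q1)).
  exact: r1.
have [nt r0] := good y ns; have hk := hch y; split; last first.
  by rewrite (QE a (ch y)) // mulf_neq0 // invr_eq0 kappa_neq0.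
have h : \forall y' \near y, hol1 (fun y0 => ref (ch y) y0 / kappa a (ch y) y0) y'.
  by apply: filterS2 (ref_hol _ _ nt hk) (ik a _ y ha hk) => y' h1 h2; exact: hol1M.
have o : \forall y' \near y, \forall y2 \near y', ref (ch y) y2 / kappa a (ch y) y2 = Q a y2.
  apply: filterS3 (near_notin nt) (near_bdom ha) (near_cdom hk) => y' h1 h2 h3.
  by apply: filterS3 (near_notin h1) (near_bdom h2) (near_cdom h3) => y2 g1 g2 g3; rewrite (QE a (ch y)).
by apply: filterS2 h o => y' h1 h2; exact: hol1_near h2 h1.
Qed.

(** Each [2 c_i / (2 c_i + 1)] exceeds 2/3 and there is at least one point, while the degree of the
    reference form is at least [- 2 n / 3]. *)
Lemma slope_gt0 (T : int) : \sum_(y <- tp) e y <= T ->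
  0 < \sum_i 2 * c i / (2 * c i + 1) + T%:~R.
Proof.
move=> hT.
have h : \sum_(i < n) (2 / 3 : R) < \sum_i 2 * c i / (2 * c i + 1).
  rewrite -subr_gt0 -sumrB.
  have p i : 0 < 2 * c i / (2 * c i + 1) - 2 / 3.
    have ci := c_gt1 i; have d0 := den_gt0 i.
    rewrite subr_gt0 ltr_pdivlMr //; lra.
  rewrite (bigD1 (Ordinal n1)) //= ltr_pwDl ?p //.
  by apply: sumr_ge0 => i _; exact: ltW.
move: h; have -> : \sum_(i < n) (2 / 3 : R) = n%:R * (2 / 3) by rewrite sumr_const card_ord; exact: esym (mulr_natl _ _).
have : (0 : R) <= (3 * T + 2 * n%:Z)%:~R by rewrite ler0z; lia.
rewrite intrD !intrM -pmulrn; move: (\sum_i _) (T%:~R : R) (n%:R : R) => A B N; lra.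
Qed.

Context (u : nat -> C) (uE : forall b a k y, bdom a y -> y \notin xs -> cdom k y -> AA a b.+1 b k y = u b * kappa a k y).

(** A second use of [ext_residue], on the diagonal: the entries [AA a b b], corrected by a
    logarithmic derivative, split a multiple of [xi], and that multiple is read off from their
    residues. *)
Lemma beta_val : exists2 De : R, 0 < De & forall b, (b <= m)%N ->
  2 * (b%:R * u b.-1 - b.+1%:R * u b) = (m%:R - 2 * b%:R) * De%:C.
Proof.
have [s [d [Q [[us sub] d0 ge QE [resQ holQ]]]]] := ref_order.
pose t := undup (xs ++ s).
have ut : uniq t by exact: undup_uniq.
have tP y : y \notin t -> y \notin xs /\ y \notin s.
  by rewrite mem_undup mem_cat negb_or => /andP.
have st : {subset s <= t} by move=> y h; rewrite mem_undup mem_cat h orbT.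
have [utp _ _ _ e0] := href.
exists (\sum_i 2 * c i / (2 * c i + 1) + (\sum_(y <- t) d y)%:~R).
  apply: slope_gt0; rewrite -(sum_supp utp ut _ e0); last by move=> y /sub/st.
  by apply: ler_sum => y _; exact: ge.
move=> b hb.
(* [Q a] is [ltr a a' ^+ 2] times [Q a'], so its [dlog] absorbs the [dlog] of the transition
   function in [gauge_sub]; the square explains the factor 2 before [AA]. *)
pose Phi a k y : C := 2 * AA a b b k y + (m%:R - 2 * b%:R) * dlog (Q a) k y.
pose rA y : C := \sum_i (if x i == y then (wt i m b - b%:R)%:C else 0).
have hA a : is_form (bdom a `\` [set` xs]) (AA a b b).
  by rewrite -setS; exact: (AA_form).
have resA a y : bdom a y -> isres (AA a b b) y (rA y).
  move=> ha; have [ys|ys] := boolP (y \in xs).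
    have [i _ ei] := (xsP y).2 ys; rewrite -ei in ha *.
    have -> : rA (x i) = (wt i m b - b%:R)%:C.
      rewrite /rA (bigD1 i) //= eqxx big1 ?addr0 // => i' ni.
      by case: eqP => // /x_inj e1; rewrite e1 eqxx in ni.
    exact: (AA_diag).
  have -> : rA y = 0.
    by rewrite /rA big1 // => i _; case: eqP => // e1; rewrite -e1 mem_xs in ys.
  have [k hk] := cdom_cover y; apply: (isres_hol hk).
  apply: filterS3 (near_bdom ha) (near_cdom hk) (near_notin ys) => y' h1 h2 h3.
  exact: (AA_hol).
have fQ a : is_form (bdom a `\` [set` s]) (fun k y => dlog (Q a) k y).
  split=> [k|k l y [ha /negP ns] ky ly].
    apply/holP => y [[ha /negP ns] ky]; have [h1 h2] := holQ a y ns ha.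
    by apply: hol1M; [exact: hol1_dfun|apply: hol1V; [exact: h2|exact: nbhs_singleton h1]].
  by apply: dlog_change => //; have [h1 _] := holQ a y ns ha; exact: nbhs_singleton h1.
have := ext_residue Xcompact Xconn kappa_iso xi_class (Phi := Phi) (t := t)
  (rho := fun y => 2 * rA y + (m%:R - 2 * b%:R) * (d y)%:~R) (z := 2 * (b%:R * u b.-1 - b.+1%:R * u b)) ut.
move=> H; rewrite -H {H}.
- rewrite big_split /= -!mulr_sumr -(rmorph_sum (intmul (1 : C))) /=.
  have -> : \sum_(y <- t) rA y = \sum_i (wt i m b - b%:R)%:C.
    rewrite exchange_big /=; apply: eq_bigr => i _; apply: (sum_delta _ ut).
    by rewrite mem_undup mem_cat mem_xs.
  (* The identity [wt i m b - b = c_i (m - 2 b) / (2 c_i + 1)] exhibits the common factor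
     [m - 2 b]. *)
  have -> : 2 * (\sum_i (wt i m b - b%:R)%:C) = (m%:R - 2 * b%:R) * (\sum_i 2 * c i / (2 * c i + 1))%:C :> C.
    have hR : 2 * (\sum_i (wt i m b - b%:R)) = (m%:R - 2 * b%:R) * (\sum_i 2 * c i / (2 * c i + 1)).
      rewrite !mulr_sumr; apply: eq_bigr => i _.
      have dn : 2 * c i + 1 != 0 by rewrite gt_eqF // (den_gt0).
      by rewrite /wt; field.
    have := f_equal (real_complex R) hR; rewrite rmorphM rmorph_nat rmorph_sum /= => ->.
    by rewrite rmorphM rmorphB rmorphM !rmorph_nat.
  by rewrite rmorphD /= rmorph_int mulrDr.
- move=> a; split=> [k|k l y [ha /negP /tP[nx ns]] ky ly].
    apply/holP => y [[ha /negP /tP[nx ns]] ky].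
    apply: hol1D; apply: hol1M; [exact: hol1_cst| |exact: hol1_cst|].
      exact: (AA_hol).
    apply: ((holP _ _).1 ((fQ a).1 k) y); split=> //; split=> //; exact/negP.
  rewrite /Phi (AA_change _ _ ha nx ky ly).
  have [_ h2] := fQ a; rewrite (h2 k l y) //; last by split=> //; exact/negP.
  move: (dlog _ _ _) (AA a b b l y) (dcrd k l y) => z1 z2 z3; ring.
- move=> a y yt ha.
  have f1 : formp (AA a b b) y := formp_local (bdom_open a) ha (hA a).
  have f2 : formp (fun k y => dlog (Q a) k y) y := formp_local (bdom_open a) ha (fQ a).
  have f1' : formp (fun k y => 2 * AA a b b k y) y.
    by apply: filterS f1 => y' h k' l' h1 h2; rewrite (h k' l' h1 h2) mulrA.
  have f2' : formp (fun k y => (m%:R - 2 * b%:R) * dlog (Q a) k y) y.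
    by apply: filterS f2 => y' h k' l' h1 h2; rewrite (h k' l' h1 h2) mulrA.
  exact: isresD f1' f2' (isresZ 2 (resA a y ha)) (isresZ _ (resQ a y ha)).
- move=> a a' k y /tP[nx ns] ha ha' ky; rewrite /Phi.
  have eq1 : (b + 1 = b.+1)%N by rewrite addn1.
  have -> := gauge_sub Van1 isT eq1 hb ha ha' (xsN nx) ky.
  rewrite expr0 mul1r eqxx (uE b ha nx ky).
  have -> : b%:R * AA a b b.-1 k y = b%:R * u b.-1 * kappa a k y.
    by case: (b) => [|b']; [rewrite !mul0r|rewrite (uE b' ha nx ky) mulrA].
  have hg : hol1 (ltr a a') y := (holP _ _).1 (@ltr_hol _ _ L a a') y (conj ha ha').
  have g0 := ltr_neq0 ha ha'.
  have [hQ' Q0'] := holQ a' y ns ha'.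
  have -> : dlog (Q a) k y = dlog (Q a') k y + 2 * dlog (ltr a a') k y.
    rewrite -(dlogX 2 ky hg g0) -(dlogM ky (nbhs_singleton hQ') (hol1X 2 hg) Q0' (expf_neq0 2 g0)).
    apply: dlog_near => //; last by apply: hol1M; [exact: nbhs_singleton hQ'|exact: hol1X].
    have nt : y \notin tp by apply/negP => /sub; apply/negP.
    apply: filterS3 (filterI (near_bdom ha) (near_bdom ha')) (near_cdom ky) (near_notin nt) => y' [h1 h1'] h2 h3.
    rewrite (QE a k) // (QE a' k) // (kappa_glue h1 h1' h2).
    have k0 := kappa_neq0 h1 h2; have gg := ltr_neq0 h1 h1'.
    move: (ltr a a' y') (kappa a k y') (ref k y') k0 gg => g ka r k0 gg; by field; rewrite k0 gg.
  move: (dlog (Q a') k y) (dlog (ltr a a') k y) (AA a b b k y) (xi a a' y) (kappa a k y) (u b) (u b.-1) => z1 z2 z3 z4 z5 z6 z7; ring.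
Qed.

(** The relations telescope: [(b + 1) u_b] is [- De / 2] times the sum of [m - 2 l] for [l <= b],
    which is [(b + 1) (m - b)]. *)
Lemma u_val : exists2 De : R, 0 < De & forall b, (b <= m)%N -> u b = - ((m%:R - b%:R) * De%:C) / 2.
Proof.
have [De De0 h] := beta_val; exists De => //.
have two : (2 : C) != 0 by rewrite pnatr_eq0.
elim=> [|b IH] hb.
  have := h 0%N hb; rewrite mul0r mulr0 sub0r subr0 mul1r => e1.
  by rewrite -e1; move: (u 0%N) => v; field.
have := h b.+1 hb; rewrite /= IH ?(ltnW hb) // => e1.
have n0 : (b.+2%:R : C) != 0 by rewrite pnatr_eq0.
apply: (mulfI n0); apply: (mulfI two).
move: e1; rewrite -![b.+2%:R]natr1 -![b.+1%:R]natr1; move: (u b.+1) (De%:C) (m%:R : C) (b%:R : C) => v z p q e1.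
have -> : 2 * ((q + 1 + 1) * v) = 2 * ((q + 1) * (- ((p - q) * z) / 2)) - (p - 2 * (q + 1)) * z.
  by rewrite -e1; ring.
by field.
Qed.

End ParabolicConnection.

(** * The second fundamental forms *)

Section SecondFundamentalForm.
Context {R : realType} {X : riemannSurface R} (L : lineBundle X).
Local Notation C := (Cplx R).
Context (kappa : bidx L -> cidx X -> X -> Cplx R).
Context (xi : bidx L -> bidx L -> X -> Cplx R) (xi_cocycle : is_cocycle xi).
Context (n : nat) (x : 'I_n -> X) (x_inj : injective x) (c : 'I_n -> R) (c_gt1 : forall i, 1 < c i).
Local Notation S := (range x).
Local Notation xs := (xs x).
Context (r : nat).
Local Notation m := r.-1.
Context (D : set X -> sec L -> cidx X -> sec L) (D_par : is_par_connection x (SymE_par xi x c m) D).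
Local Notation AA := (AA xi x m D).
Context (vK : Van xi x m D 1).
Context (u : nat -> C) (uE : forall b a k y, bdom a y -> y \notin xs -> cdom k y -> AA a b.+1 b k y = u b * kappa a k y).
Context (j : nat) (j_bounds : (1 <= j <= r.-1)%N).

Lemma F_sym t W (s : sec L) : open W -> chiv xi x c m j.-1 t W s -> SymE_par xi x c m t W s.
Proof.
move=> oW [h1 h2 h3]; apply/(symP xi_cocycle x_inj c_gt1) => //; split; [exact: h1| |exact: h3].
by move=> a y b Wy ha hb; apply: h2 => //; lia.
Qed.

(** For a section of degree less than [j] in [f], the coefficients from index [j] on vanish, and so
    do their derivatives; by [Van] only the entry [(j, j-1)] of the matrix contributes. *)
Lemma D_coef W s a b k y : open W -> chiv xi x c m j.-1 0 W s -> (W `\` S) y -> bdom a y -> cdom k y ->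
  (j <= b <= m)%N -> (dh (D W s k a y))`_b =
  if b == j then u j.-1 * kappa a k y * (dh (s a y))`_(j.-1) else 0.
Proof.
move=> oW hs Wy ha hk /andP[jb bm]; have Gs := F_sym oW hs; have [h1 h2 _] := hs.
rewrite (D_expand xi_cocycle x_inj c_gt1 D_par oW Gs Wy ha hk bm).
have -> : dfun k (fun y => (dh (s a y))`_b) y = 0.
  have z : \forall y' \near y, (0 : C) = (dh (s a y'))`_b.
    apply: filterS2 (near_open (openD_S x oW) Wy) (near_bdom ha) => y' g1 g2.
    by rewrite h2 //; lia.
  by rewrite (dfun_near hk z (hol1_cst 0 y)) dfun_cst.
have hj : (j.-1 <= m)%N by lia.
have Uy : (bdom a `\` S) y by split; [exact: ha|exact: Wy.2].
rewrite add0r (@sum_one _ (fun q : nat => (dh (s a y))`_q * AA a b q k y) m j.-1 hj).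
  case: eqP => [->|/eqP nb].
    have ns : y \notin xs by apply/negP => /xsP; exact: Wy.2.
    have := uE j.-1 ha ns hk; have -> : j.-1.+1 = j by lia.
    by move=> ->; rewrite mulrC.
  rewrite (vK bm _ Uy hk) ?mulr0 //.
  by move: nb; lia.
move=> q hq nq; have [hjq|hjq] := ltnP j.-1 q; first by rewrite h2 // mul0r.
by rewrite (vK bm _ Uy hk) ?mulr0 //; move: nq; lia.
Qed.

Lemma gr_coef i (s : sec L) a y : (0 < i <= r)%N -> s a y \is ishomog1 m mdeg -> gr r i s a y = (dh (s a y))`_(i.-1).
Proof.
move=> hi hs; rewrite (coef_dh _ hs) /gr; congr (mcoeff _ _); rewrite /bmon.
by have -> : (m - i.-1 = r - i)%N by lia.
Qed.

(** Griffiths transversality comes out of the vanishing of the matrix beyond distance 1; the order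
    conditions are inherited from [D] being logarithmic on the whole symmetric power. *)
Lemma second_form W s : open W -> F_par xi x c r j 0 W s ->
  is_logform x (F_par xi x c r j.+1 0) W (D W s) /\
  forall k a y, (W `\` S) y -> cdom k y -> bdom a y ->
    gr r j.+1 (D W s k) a y = u j.-1 * kappa a k y * gr r j s a y.
Proof.
move=> oW Fs; have hj : (0 < j <= r)%N by lia.
have hj1 : (0 < j.+1 <= r)%N by lia.
have hs := F_par_chiv c_gt1 hj oW Fs; have Gs := F_sym oW hs.
have [[Dform _ _ _] _] := D_par; have [L1 L2] := Dform W s oW Gs.
have [s1 _ _] := hs; have [hom _ _] := s1.
have homD k a y : (W `\` S) y -> cdom k y -> bdom a y -> D W s k a y \is ishomog1 m mdeg.
  move=> Wy hk ha; have [N [[oN Ny Nk] NW [g1 _ _]]] := D_sec xi_cocycle x_inj c_gt1 D_par oW Gs Wy hk.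
  by apply: g1 => //; split=> //; exact: Wy.2.
have big k a y b : (W `\` S) y -> cdom k y -> bdom a y -> (j < b)%N -> (dh (D W s k a y))`_b = 0.
  move=> Wy hk ha hb; have [bm|bm] := leqP b m; last exact: coef_dh_big (homD k a y Wy hk ha) bm.
  have hjb : (j <= b <= m)%N by rewrite ltnW.
  by rewrite (D_coef oW hs Wy ha hk hjb) gtn_eqF.
have FN N e : open N -> SymE_par xi x c m 0 N e ->
   (forall a y b, (N `\` S) y -> bdom a y -> (j < b)%N -> (dh (e a y))`_b = 0) -> F_par xi x c r j.+1 0 N e.
  move=> oN Ge hb; have [g1 _ g3] := (symP xi_cocycle x_inj c_gt1 m 0 e oN).1 Ge.
  apply: (chiw_F xi_cocycle x_inj c_gt1 hj1 oN); apply: chiv_chiw; split; [exact: g1|exact: hb|exact: g3].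
split.
  split; first exact: L1.
  move=> k y Wy hk; have [N [hN NW n1 n2]] := L2 k y Wy hk; have [oN Ny Nk] := hN.
  exists N; split; [exact: hN|exact: NW| |].
    move=> nS; apply: (FN N _ oN (n1 nS)) => a y' b [Ny' nS'] ha hb.
    by apply: big ha hb; [split; [exact: NW|]|exact: Nk].
  move=> yS; apply: (FN N _ oN (n2 yS)) => a y' b [Ny' nS'] ha hb.
  rewrite coef_scalesec big ?mulr0 //; [by split; [exact: NW|]|exact: Nk].
move=> k a y Wy hk ha; rewrite (gr_coef hj1 (homD k a y Wy hk ha)) (gr_coef hj (hom a y Wy ha)).
have hjj : (j <= j <= m)%N by lia.
by rewrite (D_coef oW hs Wy ha hk hjj) eqxx.
Qed.

(** A section whose leading coefficient is 1: it determines the second fundamental form at every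
    point off [S]. *)
Lemma test_F a : F_par xi x c r j 0 (bdom a `\` S) (Vb xi m a j.-1).
Proof.
have hj : (0 < j <= r)%N by lia.
have oU := open_U x a; apply: (chiw_F xi_cocycle x_inj c_gt1 hj oU); split.
- by apply: Vb_sec => //; [exact: openD_S|move=> y [[]]].
- move=> a' y b [[ha _] nS] ha' hb; apply: (sec_of_coef_sub _ ha ha' _ _ hb); first by rewrite size_polyXn.
  by lia.
- by move=> i [_ h]; case: h; exists i.
Qed.

End SecondFundamentalForm.

Theorem corollary4p4 (R : realType) (X : riemannSurface R)
  (Xcompact : compact [set: X]) (Xconnected : connected [set: X])
  (n : nat) (x : 'I_n -> X) (x_inj : injective x) (n_ge1 : (1 <= n)%N)
  (n_ge3 : has_genus X 0 -> (3 <= n)%N)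
  (c : 'I_n -> R) (c_gt1 : forall i, 1 < c i)
  (L : lineBundle X) (kappa : bidx L -> cidx X -> X -> Cplx R)
  (kappa_iso : is_theta_iso kappa)
  (xi : bidx L -> bidx L -> X -> Cplx R) (xi_cocycle : is_cocycle xi)
  (xi_class : has_ext_class kappa xi 1)
  (r : nat) (r_ge2 : (2 <= r)%N)
  (D : set X -> sec L -> cidx X -> sec L)
  (D_par : is_par_connection x (SymE_par xi x c r.-1) D)
  (j : nat) (j_bounds : (1 <= j <= r.-1)%N) :
  exists lambda : Cplx R, lambda != 0 /\
    forall h : X -> Cplx R,
      is_second_fundamental_form xi x c kappa r D j h <->
      (forall y, h y = lambda).
Proof.
have [tp [e [ref [href he]]]] := ref_exists Xcompact Xconnected (x (Ordinal n_ge1)) n_ge1 n_ge3.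
have vK := Van1 xi_cocycle x_inj c_gt1 D_par Xcompact Xconnected kappa_iso xi_class href he n_ge1.
have [u uE] := choice (u_const xi_cocycle x_inj c_gt1 D_par Xcompact Xconnected kappa_iso xi_class href he n_ge1).
have [De De0 hu] := u_val xi_cocycle x_inj c_gt1 D_par Xcompact Xconnected kappa_iso xi_class href he n_ge1 uE.
have hj1 : (j.-1 <= r.-1)%N by lia.
exists (u j.-1); split.
  (* The value is [- (m - (j - 1)) De / 2], and [j - 1 < m]. *)
  rewrite hu // mulf_neq0 ?invr_eq0 ?pnatr_eq0 // oppr_eq0 mulf_neq0 //.
    by rewrite subr_eq0 eqr_nat; lia.
  by rewrite (inj_eq (@complexI R)) gt_eqF.
have second := second_form xi_cocycle x_inj c_gt1 D_par vK uE j_bounds.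
move=> h; split=> [[hh hF]|hE]; last first.
  split=> [|W s oW Fs].
    apply/holP => y _; apply: hol1_near (hol1_cst (u j.-1) y).
    by apply: filterE => y'; rewrite hE.
  have [h1 h2] := second W s oW Fs; split=> [|k a y Wy hk ha]; first exact: h1.
  by rewrite hE; exact: h2.
have offS y : ~ range x y -> h y = u j.-1.
  move=> nS; have [a ha] := bdom_cover L y; have [k hk] := cdom_cover y.
  have Fs := test_F xi_cocycle x_inj c_gt1 j_bounds (a := a); have oU := open_U x a.
  have Uy : ((bdom a `\` range x) `\` range x) y by [].
  have [_ e1] := hF _ _ oU Fs; have [_ e2] := second _ _ oU Fs.
  have := e1 k a y Uy hk ha; rewrite (e2 k a y Uy hk ha).
  have -> : gr r j (Vb xi r.-1 a j.-1) a y = 1.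
    have hjr : (0 < j <= r)%N by lia.
    have [hom _ _] := Vb_sec xi_cocycle r.-1 j.-1 (bdom_open a) (fun y (h : bdom a y) => h).
    rewrite (gr_coef j_bounds hjr (hom a y ha ha)) /Vb coef_sec_of ?size_polyXn //.
    by rewrite coefXn eqxx.
  by rewrite !mulr1 => /(mulIf (kappa_neq0 kappa_iso ha hk)).
have hol1h y : hol1 h y by exact: ((holP _ _).1 hh y I).
(* The values are known only off [S]; a holomorphic function on the compact surface is constant, so
   one such point is enough. *)
move=> y; have [y1 [_ nS]] := pnear_ex (pnear_notS x y).
by have -> := hol_constant Xcompact Xconnected hol1h y y1; exact: offS.
Qed.
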